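(* There is a $5.437$-approximation algorithm for SC-G on perfect graphs.
   Context: SC-G (sum coloring with group completion times): given an undirected graph $G = (V,E)$, assign each vertex $v$ a positive integer color $C_v$ such that adjacent vertices receive different colors. A family $\mathcal{S}$ of vertex groups with weights $w_S > 0$ is given, $C_S := \max_{v \in S} C_v$, and the objective is to minimize $\sum_S w_S C_S$. A graph is perfect if for every induced subgraph the chromatic number equals the size of a largest clique. An $\alpha$-approximation algorithm runs in polynomial time and outputs a solution of cost at most $\alpha$ times the optimum. *)

(* Defs.v *)
From Corelib Require Import BinNums.
From HB Require Import structures.
From mathcomp Require Import all_boot all_order all_algebra.
Set Implicit Arguments.
Unset Strict Implicit.
Unset Printing Implicit Defensive.
Import Order.TTheory GRing.Theory Num.Theory.
Local Open Scope ring_scope.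

(** * Perfect graphs *)

Record sgraph := SGraph {
  vertex :> finType;
  adj : rel vertex;
  adj_sym : symmetric adj;
  adj_irr : irreflexive adj }.

Definition induced (G : sgraph) (A : {set G}) : sgraph :=
  @SGraph {x : G | x \in A} (fun u v => adj (val u) (val v))
    (fun u v => adj_sym (val u) (val v)) (fun u => adj_irr (val u)).

Definition colorable (G : sgraph) (k : nat) : bool :=
  [exists f : {ffun G -> 'I_k},
     [forall u, forall v, adj u v ==> (f u != f v)]].

Lemma colorable_card (G : sgraph) : exists k, colorable G k.
Proof.
exists #|G|; apply/existsP; exists [ffun u => enum_rank u].
apply/forallP => u; apply/forallP => v; apply/implyP => uv.
rewrite !ffunE (inj_eq enum_rank_inj).
by apply: contraTneq uv => ->; rewrite adj_irr.
Qed.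

Definition chromatic_number (G : sgraph) : nat := ex_minn (colorable_card G).

Definition clique (G : sgraph) (K : {set G}) : bool :=
  [forall u in K, forall v in K, (u != v) ==> adj u v].

Definition clique_number (G : sgraph) : nat :=
  \max_(K : {set G} | clique K) #|K|.

Definition perfect (G : sgraph) : Prop :=
  forall A : {set G}, chromatic_number (induced A) = clique_number (induced A).

(** * Sum coloring with group completion times *)

(* Weights are rational so that instances have a finite encoding.  The groups
   form a list: two groups with the same vertex set are allowed. *)
Record instance := Instance {
  nvert : nat;
  edge : rel 'I_nvert;
  edge_sym : symmetric edge;
  edge_irr : irreflexive edge;
  groups : seq ({set 'I_nvert} * rat);
  groups_wf : all (fun g => (g.1 != set0) && (0 < g.2)) groups }.

Definition graph (I : instance) : sgraph := SGraph (@edge_sym I) (@edge_irr I).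

Definition coloring (I : instance) : Type := {ffun 'I_(nvert I) -> nat}.

Definition feasible (I : instance) (C : coloring I) : Prop :=
  (forall v, (0 < C v)%N) /\ (forall u v, edge u v -> C u != C v).

Definition completion (I : instance) (C : coloring I)
  (S : {set 'I_(nvert I)}) : nat := \max_(v in S) C v.

Definition cost (I : instance) (C : coloring I) : rat :=
  \sum_(g <- groups I) g.2 * (completion C g.1)%:R.

Definition optimal (I : instance) (C : coloring I) : Prop :=
  feasible C /\ (forall C' : coloring I, feasible C' -> cost C <= cost C').

(** * Deterministic multitape Turing machines *)

Inductive direction := Left | Right | Stay.

Section Turing.
Variable symbol : finType.

(* A cell holds the blank [None], an input letter, or a work symbol of [W]. *)
Definition cell (W : finType) : finType := option (symbol + W)%type.

Record machine := Machine {
  state : finType;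
  work : finType;
  extra_tapes : nat;
  start : state;
  halted : pred state;
  delta : state -> {ffun 'I_extra_tapes.+1 -> cell work} ->
          state * {ffun 'I_extra_tapes.+1 -> cell work * direction} }.

(* A two-way infinite tape: the cells left of the head (nearest first), the
   scanned cell, the cells right of the head; all further cells are blank. *)
Record tape (W : finType) := Tape {
  before : seq (cell W);
  scanned : cell W;
  after : seq (cell W) }.

Definition write_move (W : finType) (t : tape W) (a : cell W * direction) :
    tape W :=
  match a.2 with
  | Left => Tape (behead (before t)) (head None (before t)) (a.1 :: after t)
  | Right => Tape (a.1 :: before t) (head None (after t)) (behead (after t))
  | Stay => Tape (before t) a.1 (after t)
  end.

Definition input_tape (W : finType) (x : seq symbol) : tape W :=
  let s := [seq Some (inl a) | a <- x] in
  Tape [::] (head None s) (behead s).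

Fixpoint leading_word (W : finType) (s : seq (cell W)) : seq symbol :=
  if s is Some (inl a) :: s' then a :: leading_word s' else [::].

(* The longest word over the input alphabet that starts at the head. *)
Definition output_word (W : finType) (t : tape W) : seq symbol :=
  leading_word (scanned t :: after t).

Record config (M : machine) := Config {
  control : state M;
  tapes : 'I_(extra_tapes M).+1 -> tape (work M) }.

Definition initial (M : machine) (x : seq symbol) : config M :=
  Config (start M)
    (fun i => input_tape (work M) (if i == ord0 then x else [::])).

Definition step (M : machine) (c : config M) : config M :=
  if halted (control c) then c else
  let a := delta (control c) [ffun i => scanned (tapes c i)] in
  Config a.1 (fun i => write_move (tapes c i) (a.2 i)).

(* [M], started with [x] on tape 0, halts within [t] steps with [y] on tape 0. *)
Definition outputs_within (M : machine) (x : seq symbol) (t : nat)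
    (y : seq symbol) : Prop :=
  let c := iter t (@step M) (initial M x) in
  halted (control c) /\ output_word (tapes c ord0) = y.

End Turing.

(** * Encodings *)

(* [Some b] is the bit [b], [None] is the separator. *)
Definition letter : finType := option bool.

(* Binary digits, least significant first; 0 has no digit. *)
Fixpoint pos_bits (p : positive) : seq bool :=
  match p with
  | xH => [:: true]
  | xO p' => false :: pos_bits p'
  | xI p' => true :: pos_bits p'
  end.

Definition bits (n : nat) : seq bool :=
  if bin_of_nat n is Npos p then pos_bits p else [::].

(* Every number is followed by a separator. *)
Definition encode_nats (s : seq nat) : seq letter :=
  flatten [seq rcons [seq Some b | b <- bits n] None | n <- s].

(* The number of vertices, the adjacency matrix by rows, the number of groups,
   then for each group its characteristic vector and its weight as a reduced
   fraction. *)
Definition instance_nats (I : instance) : seq nat :=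
  let V := enum 'I_(nvert I) in
  let group_nats (g : {set 'I_(nvert I)} * rat) : seq nat :=
    [seq nat_of_bool (v \in g.1) | v <- V]
    ++ [:: `|numq g.2|%N; `|denq g.2|%N] in
  nvert I :: [seq nat_of_bool (edge u v) | u <- V, v <- V]
  ++ size (groups I) :: flatten [seq group_nats g | g <- groups I].

Definition encode_instance (I : instance) : seq letter :=
  encode_nats (instance_nats I).

Definition encode_coloring (I : instance) (C : coloring I) : seq letter :=
  encode_nats [seq C v | v <- enum 'I_(nvert I)].

(** * Approximation algorithms *)

Definition approximation_algorithm (P : instance -> Prop) (alpha : rat)
    (M : machine letter) : Prop :=
  exists p : {poly nat}, forall I : instance, P I ->
  exists C Copt : coloring I,
    [/\ outputs_within M (encode_instance I) p.[size (encode_instance I)]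
          (encode_coloring C),
        feasible C, optimal Copt & cost C <= alpha * cost Copt].

(* Main.v *)
From HB Require Import structures.
Require Import Defs.
From mathcomp Require Import all_boot all_order all_algebra.
From mathcomp Require Import zify ring lra.
Set Implicit Arguments.
Unset Strict Implicit.
Unset Printing Implicit Defensive.
Import Order.TTheory GRing.Theory Num.Theory.

(** In a proper colouring the colours on a clique of size k are distinct positive integers, so they
    sum to at least k(k+1)/2. A relaxed colouring that obeys these clique inequalities therefore has
    a value of at least (k+1)/2 on every clique of size k. The proof works with vectors y that keep
    only this consequence: up to a factor near 1, y_v is at least half of one plus the clique number
    of the vertices u with y_u <= y_v, while the weighted sum of the group maxima of y is at most
    about the optimum.

    Put x = 2y and cut the positive line at the points e^(i+U) for a uniform shift U in [0,1). The
    clique number of each block is at most the upper end of the block, and on a perfect graph that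
    many colours suffice. Colour the blocks one after another with fresh colours. If t is the upper
    end of the block of v, the colour of v is at most t + t/e + t/e^2 + ... = t e/(e-1), and t/x_v
    has mean e-1 over the shift. The mean of this bound is e x_v = 2e y_v; the bound is monotone in
    x_v, hence valid for the maximum over a group, and 2e < 5.437. The development replaces e by
    (1+1/J)^J and tries all J shifts ([cand_bound], [offset_sum], [best_bound]). It loses a factor 1
    + 1/ee in the constraints on y, in the value of y, and in rounding the weights
    ([rounding_transfer]); [approximation_ratio] takes J = 2^17 and ee = 10^6.

    The algorithmic tools rest on Lovász's theory of perfect graphs. By the weak perfect graph
    theorem ([good_compl]) the maximum weight of a stable set equals the least number of cliques
    that cover the weights, and a semidefinite relaxation lies between the two ([theta_testP]).
    Deciding the relaxation gives maximum weight stable sets ([mwsP]), then a stable set that meets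
    all maximum cliques of a vertex set ([hitP]), and so optimal colourings of the blocks
    ([colorP]).

    The semidefinite problem and the search for y ([lp_XP]) are both solved by perceptron steps: a
    violated inequality is added to an integral current point, and the squared distance to a scaled
    hidden solution, a nonnegative integer, drops by at least 1 ([potential_iter]). The inequalities
    are relaxed by slacks chosen so that polynomially many steps suffice once the group weights are
    rounded to small integers. A direction in which a matrix is negative is found by power iteration
    ([power_violation]).

    Running time is handled by a class [PT] of polynomial-time functions on tree-encoded data. It is
    closed under composition, pairing, case distinction and iterations whose intermediate values
    stay polynomially large ([PT_iter]), and each of its functions on words runs on a multitape
    Turing machine ([PT_machine]). *)

(** * Structured programs on four stacks and their compilation to a Turing machine *)

Definition sym : finType := (letter + bool)%type.
Definition store : Type := (seq sym * seq sym * seq sym * seq sym)%type.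

Definition get (k : nat) (s : store) : seq sym :=
  let: (a, b, c, d) := s in
  match k with 0 => a | 1 => b | 2 => c | _ => d end.
Definition put (k : nat) (w : seq sym) (s : store) : store :=
  let: (a, b, c, d) := s in
  match k with
  | 0 => (w, b, c, d) | 1 => (a, w, c, d) | 2 => (a, b, w, d) | _ => (a, b, c, w)
  end.

Inductive op := Push of nat & sym | Pop of nat | Move of bool & nat & nat.

(* [Move b i j] pushes the top of [i] on [j], and pops it from [i] if [b]. *)
Definition effect (o : op) (s : store) : store :=
  match o with
  | Push k a => put k (a :: get k s) s
  | Pop k => put k (behead (get k s)) s
  | Move b i j =>
    if minn i 3 == minn j 3 then s else
    if get i s is a :: w then put j (a :: get j s) (if b then put i w s else s)
    else s
  end.

Inductive instr := Op of op | Br of nat & pred (option sym) & nat.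

(** An out-of-range target goes to 0, which is where [inord] sends it in the machine. *)
Definition clip (n t : nat) := if t <= n then t else 0.

Definition astep (code : seq instr) (c : nat * store) : nat * store :=
  if size code <= c.1 then c else
  match nth (Op (Pop 0)) code c.1 with
  | Op o => (c.1.+1, effect o c.2)
  | Br k P t =>
    (if P (ohead (get k c.2)) then c.1.+1 else clip (size code) t, c.2)
  end.

Inductive prog :=
  | Do of op
  | Seq of prog & prog
  | If of nat & pred (option sym) & prog & prog
  | While of nat & pred (option sym) & prog.

(** The number is the exact cost in instructions: a conditional that takes its first branch also
    pays for the jump over the second, and each round of a loop for the jump back. *)
Inductive exec : prog -> store -> nat -> store -> Prop :=
  | ExDo o s : exec (Do o) s 1 (effect o s)
  | ExSeq p q s1 n s2 m s3 :
      exec p s1 n s2 -> exec q s2 m s3 -> exec (Seq p q) s1 (n + m) s3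
  | ExIfT k (P : pred (option sym)) p q s n s' : P (ohead (get k s)) ->
      exec p s n s' -> exec (If k P p q) s n.+2 s'
  | ExIfF k (P : pred (option sym)) p q s n s' : ~~ P (ohead (get k s)) ->
      exec q s n s' -> exec (If k P p q) s n.+1 s'
  | ExWhileT k (P : pred (option sym)) p s1 n s2 m s3 : P (ohead (get k s1)) ->
      exec p s1 n s2 -> exec (While k P p) s2 m s3 ->
      exec (While k P p) s1 (n + m).+2 s3
  | ExWhileF k (P : pred (option sym)) p s : ~~ P (ohead (get k s)) ->
      exec (While k P p) s 1 s.

(** Jump targets are absolute, [off] being the address of the first instruction; a branch on
    [xpred0] is an unconditional jump. *)
Fixpoint compile (p : prog) (off : nat) : seq instr :=
  match p with
  | Do o => [:: Op o]
  | Seq p q => let a := compile p off in a ++ compile q (off + size a)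
  | If k P p q =>
    let a := compile p off.+1 in
    let b := compile q (off + size a).+2 in
    Br k P (off + size a).+2 :: a ++ Br k xpred0 (off + size a + size b).+2 :: b
  | While k P p =>
    let a := compile p off.+1 in
    Br k P (off + size a).+2 :: a ++ [:: Br k xpred0 off]
  end.

Lemma clipE n t : t <= n -> clip n t = t.
Proof. by rewrite /clip => ->. Qed.

Lemma astep_nth pre i post s :
  astep (pre ++ i :: post) (size pre, s) =
  match i with
  | Op o => ((size pre).+1, effect o s)
  | Br k P t => (if P (ohead (get k s)) then (size pre).+1
                 else clip (size (pre ++ i :: post)) t, s)
  end.
Proof.
rewrite /astep /= {1}size_cat /= leqNgt -addSnnS leq_addr /=.
by rewrite nth_cat ltnn subnn /=.
Qed.

(** Induction on the execution. The surrounding code is arbitrary, so that the induction hypothesis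
    for a subprogram applies in place. *)
Lemma compileP p s n s' : exec p s n s' -> forall pre post,
  iter n (astep (pre ++ compile p (size pre) ++ post)) (size pre, s) =
  (size pre + size (compile p (size pre)), s').
Proof.
elim=> {p s n s'}.
- by move=> o s pre post; rewrite /= astep_nth addn1.
- move=> p q s1 n s2 m s3 _ IHp _ IHq pre post /=; rewrite addnC iterD.
  rewrite -catA IHp -[size pre + size _]size_cat catA IHq.
  by rewrite !size_cat addnA.
- move=> k P p q s n s' Ps _ IH pre post; rewrite [compile _ _]/= -/compile.
  set a := compile p _; set b := compile q _.
  rewrite iterS iterSr.
  have -> : pre ++ (Br k P (size pre + size a).+2 :: a ++ Br k xpred0 (size pre + size a + size b).+2 :: b) ++ post
    = rcons pre (Br k P (size pre + size a).+2) ++ a ++ (Br k xpred0 (size pre + size a + size b).+2 :: b) ++ post.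
    by rewrite cat_rcons /= -catA.
  have E : astep (rcons pre (Br k P (size pre + size a).+2) ++ a ++ (Br k xpred0 (size pre + size a + size b).+2 :: b) ++ post) (size pre, s) = (size (rcons pre (Br k P (size pre + size a).+2)), s).
    by rewrite cat_rcons astep_nth Ps size_rcons.
  rewrite E.
  have := IH (rcons pre (Br k P (size pre + size a).+2)) ((Br k xpred0 (size pre + size a + size b).+2 :: b) ++ post).
  rewrite size_rcons => -> /=.
  rewrite catA -[_ + size _]/(_) -/a.
  have -> : (size pre).+1 + size a = size (rcons pre (Br k P (size pre + size a).+2) ++ a) by rewrite size_cat size_rcons.
  rewrite astep_nth /= clipE; first by rewrite size_cat /= ; congr pair; lia.
  by rewrite !size_cat !size_rcons /= !size_cat; lia.
- move=> k P p q s n s' Ps _ IH pre post; rewrite [compile _ _]/= -/compile.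
  set a := compile p _; set b := compile q _.
  rewrite iterSr.
  have -> : pre ++ (Br k P (size pre + size a).+2 :: a ++ Br k xpred0 (size pre + size a + size b).+2 :: b) ++ post
    = (rcons pre (Br k P (size pre + size a).+2) ++ a ++ [:: Br k xpred0 (size pre + size a + size b).+2]) ++ b ++ post.
    by rewrite cat_rcons /= -!catA /= -!catA.
  set pre' := rcons pre _ ++ _.
  have sz : size pre' = (size pre + size a).+2 by rewrite /pre' !size_cat size_rcons /=; lia.
  have E : astep (pre' ++ b ++ post) (size pre, s) = (size pre', s).
    rewrite /pre' cat_rcons -catA /= astep_nth (negbTE Ps) clipE.
      by congr pair; rewrite !size_cat /= !size_cat /=; lia.
    by rewrite !size_cat /= !size_cat /=; lia.
  rewrite E.
  have := IH pre' post; rewrite sz -/b => ->.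
  by rewrite /= size_cat /=; congr pair; lia.
- move=> k P p s1 n s2 m s3 Ps _ IHp _ IHw pre post; rewrite [compile _ _]/= -/compile.
  rewrite addnC -addnS -addSn iterD (iterSr m) (iterSr n).
  have := IHw pre post; rewrite /=.
  set a := compile p _.
  have -> : pre ++ (Br k P (size pre + size a).+2 :: a ++ [:: Br k xpred0 (size pre)]) ++ post
    = rcons pre (Br k P (size pre + size a).+2) ++ a ++ (Br k xpred0 (size pre) :: post).
    by rewrite cat_rcons /= -catA.
  set code := _ ++ _ => IH.
  have E : astep code (size pre, s1) = (size (rcons pre (Br k P (size pre + size a).+2)), s1).
    by rewrite /code cat_rcons astep_nth Ps size_rcons.
  rewrite E.
  have := IHp (rcons pre (Br k P (size pre + size a).+2)) (Br k xpred0 (size pre) :: post).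
  rewrite size_rcons -/a -/code => ->.
  have -> : astep code ((size pre).+1 + size a, s2) = (size pre, s2).
    rewrite /code catA.
    have -> : (size pre).+1 + size a = size (rcons pre (Br k P (size pre + size a).+2) ++ a) by rewrite size_cat size_rcons.
    rewrite astep_nth /= clipE //.
    by rewrite !size_cat !size_rcons /=; lia.
  exact: IH.
- move=> k P p s Ps pre post /=.
  rewrite -cat1s -!catA /= astep_nth (negbTE Ps) /= clipE; last first.
    by rewrite !size_cat /= size_cat /=; lia.
  by rewrite size_cat /=; congr pair; lia.
Qed.

Lemma write_scan (W : finType) (t : tape letter W) a d :
  d = Stay -> scanned (write_move t (a, d)) = a.
Proof. by move=> ->. Qed.

Section Machine.
Variable code : seq instr.

Definition tix (k : nat) : 'I_4 := inord (minn k 3).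
(** The flag asks for a move to the left in the first half of an instruction; the pair is what the
    second half writes and where it moves. *)
Definition act (a : {ffun 'I_4 -> option sym}) (o : op) (i : 'I_4) :
    bool * (option sym * direction) :=
  match o with
  | Push k x => if i == tix k then (true, (Some x, Stay)) else (false, (a i, Stay))
  | Pop k => (false, if i == tix k then (None, Right) else (a i, Stay))
  | Move b k l =>
    if (tix k == tix l) || ~~ a (tix k) then (false, (a i, Stay)) else
    if i == tix l then (true, (a (tix k), Stay)) else
    (false, if b && (i == tix k) then (None, Right) else (a i, Stay))
  end.

(* Every instruction takes two steps, since pushing needs a move to the left
   followed by a write. *)
Definition mdelta (q : 'I_(size code).+1 * bool)
    (a : {ffun 'I_4 -> cell letter bool}) :
    ('I_(size code).+1 * bool) * {ffun 'I_4 -> cell letter bool * direction} :=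
  match nth (Op (Pop 0)) code q.1, q.2 with
  | Op o, false => ((q.1, true), [ffun i => (a i, if (act a o i).1 then Left else Stay)])
  | Op o, true => ((inord (q.1).+1, false), [ffun i => (act a o i).2])
  | Br _ _ _, false => ((q.1, true), [ffun i => (a i, Stay)])
  | Br k P t, true =>
    ((inord (if P (a (tix k)) then (q.1).+1 else t), false), [ffun i => (a i, Stay)])
  end.

Definition tmachine : machine letter :=
  @Machine letter _ bool 3 (ord0, false) (fun q => q.1 == size code :> nat) mdelta.

(** The top of the stack is under the head. The cells on the left of the head are arbitrary, because
    a push overwrites the cell it moves to; the trailing blanks make popping an empty stack
    harmless. *)
Definition holds (t : tape letter bool) (s : seq sym) : Prop :=
  exists j, scanned t :: after t = [seq Some x | x <- s] ++ nseq j None.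

Definition sim (c : config tmachine) (a : nat * store) : Prop :=
  [/\ a.1 <= size code, control c = (inord a.1, false)
    & forall i : 'I_4, holds (tapes c i) (get i a.2)].

Lemma holds_top t s : holds t s -> scanned t = ohead s.
Proof.
case=> j; case: s => [|x s] /=; last by case=> ->.
by case: j => [|j] //= [-> _].
Qed.

Lemma holds_pop t s : holds t s -> holds (write_move t (None, Right)) (behead s).
Proof.
case=> j; rewrite /holds /=; case: s => [|x s] /=.
  case: j => //= j [_ ->]; case: j => [|j]; first by exists 1.
  by exists j.+1.
case=> _ ->; case: s => [|y s] /=; last by exists j.
by case: j => [|j]; [exists 1 | exists j.+1].
Qed.

Lemma holds_push t s x y : holds t s ->
  holds (write_move (write_move t (scanned t, Left)) (Some x, y)) (x :: s) \/ y <> Stay.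
Proof.
case: y; [by right|by right|left]; case: H => j E; exists j => /=.
by rewrite -E.
Qed.

Lemma tix_eq k l : (tix k == tix l) = (minn k 3 == minn l 3).
Proof. by rewrite -val_eqE /= !inordK // ltnS geq_minr. Qed.

Lemma tixE (i : 'I_4) k : (i == tix k) = (i == minn k 3 :> nat).
Proof. by rewrite -val_eqE /= inordK // ltnS geq_minr. Qed.

Lemma get_tix k s : get (tix k) s = get k s.
Proof.
rewrite /= inordK ?ltnS ?geq_minr //; case: s => [[[a b] c] d].
by case: k => [|[|[|[|k]]]].
Qed.

Lemma get_put (i : 'I_4) k w s :
  get i (put k w s) = if i == tix k then w else get i s.
Proof.
rewrite tixE; case: s => [[[a b] c] d].
by case: i => [[|[|[|[|i]]]]] //= _; case: k => [|[|[|[|k]]]].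
Qed.

Lemma write_stay (t : tape letter bool) : write_move t (scanned t, Stay) = t.
Proof. by case: t. Qed.

Lemma sim_step c a : sim c a -> sim (step (step c)) (astep code a).
Proof.
case=> le_a Ec Hc; case: (ltnP a.1 (size code)) => lt_a; last first.
  have E : a.1 = size code by apply/eqP; rewrite eqn_leq le_a.
  have H : step c = c by rewrite /step Ec /= inordK E // eqxx.
  by rewrite /astep lt_a H H.
have S1 : forall i, scanned (tapes c i) = ohead (get i a.2) by move=> i; exact: holds_top.
have V : (inord a.1 : 'I_(size code).+1) = a.1 :> nat by rewrite inordK.
have H1 : halted (control c) = false by rewrite Ec /= V ltn_eqF.
rewrite /astep leqNgt lt_a /=.
rewrite {2}/step H1 Ec /= /mdelta /= V.
case Ei: (nth _ _ _) => [o|k P t] /=.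
  rewrite /step /= V ltn_eqF //= /mdelta /= V Ei /=.
  set A := [ffun i => scanned (tapes c i)].
  have A0 i : A i = ohead (get i a.2) by rewrite ffunE.
  set A' := [ffun i => scanned (write_move _ _)].
  (* Only a tape that receives a push has moved, so on all other tapes the second half reads the
     same symbols as the first and makes the same decision. *)
  have A'0 i : ~~ (act A o i).1 -> A' i = A i.
    by move=> /negbTE H; rewrite /A' ffunE ffunE H write_scan // A0 -S1 /A ffunE.
  split=> //= i; rewrite !ffunE !S1.
  case: o Ei A' A'0 => [k x|k|b k l] Ei A' A'0 /=.
  - rewrite get_put; case: eqP => [->|/eqP ne] /=.
      rewrite -S1; case: (holds_push x Stay (Hc (tix k))) => //.
      by rewrite /holds /= get_tix.
    by rewrite A'0 /= ?(negbTE ne) // A0 -S1 !write_stay.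
  - rewrite get_put; case: eqP => [->|/eqP ne] /=.
      by rewrite -S1 write_stay -get_tix; apply: holds_pop.
    by rewrite A'0 // A0 -S1 !write_stay.
  - rewrite A0 get_tix tix_eq; case: eqP => /= [e|/eqP ne].
      rewrite A'0 /=; first by rewrite A0 -S1 !write_stay.
      by rewrite tix_eq e eqxx.
    have N : tix k != tix l by rewrite tix_eq.
    have T : A' (tix k) = ohead (get k a.2).
      rewrite A'0 /=; first by rewrite A0 get_tix.
      by rewrite (negbTE N); case: ifP.
    rewrite T; case Eg: (get k a.2) T => [|x w] T /=.
      rewrite A'0 /=; first by rewrite A0 -S1 !write_stay.
      by rewrite (negbTE N) A0 get_tix Eg.
    rewrite get_put; case: eqP => [->|/eqP nl] /=.
      rewrite -S1; case: (holds_push x Stay (Hc (tix l))) => //.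
      by rewrite /holds /= get_tix.
    have K : A' i = scanned (tapes c i).
      rewrite A'0 /=; first by rewrite A0 -S1.
      by rewrite (negbTE N) (negbTE nl); case: ifP.
    rewrite -S1 write_stay K.
    case: b Ei A' A'0 T K => Ei A' A'0 T K /=; last by rewrite write_stay.
    rewrite get_put; case: eqP => [E|/eqP nk] /=; last by rewrite write_stay.
    by have := holds_pop (Hc i); rewrite {2}E get_tix Eg.
rewrite /step /= V ltn_eqF //= /mdelta /= V Ei /= !ffunE S1 get_tix.
split=> /=.
- by case: ifP => // _; rewrite /clip; case: ifP.
- congr pair; case: ifP => // _; rewrite /clip; case: ifP => // nt.
  by apply/val_inj; rewrite /= val_insubd ltnS nt inordK.
- by move=> i; rewrite !ffunE /= S1 -S1 !write_stay.
Qed.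

Lemma sim_iter n c a : sim c a ->
  sim (iter n.*2 (@step letter tmachine) c) (iter n (astep code) a).
Proof. by move=> H; elim: n => //= n IH; apply: sim_step. Qed.

End Machine.

Lemma leading_word_inl (w : seq letter) j :
  leading_word ([seq Some (inl x) | x <- w] ++ nseq j (None : cell letter bool)) = w.
Proof. by elim: w => [|x w /= ->] //; case: j. Qed.

(** A halted configuration is a fixed point of [step], so every time bound from twice the cost of
    the program on is valid. *)
Lemma machine_of_prog (p : prog) : exists M : machine letter,
  forall (x y : seq letter) n b c d t,
    exec p ([seq inl a | a <- x], [::], [::], [::]) n ([seq inl a | a <- y], b, c, d) ->
    n.*2 <= t -> outputs_within M x t y.
Proof.
pose code := compile p 0; exists (tmachine code) => x y n b c d t E le_t.
have S0 : sim (initial (tmachine code) x) (0, ([seq inl a | a <- x], [::], [::], [::])).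
  split=> //=; first by congr pair; apply: val_inj; rewrite /= inordK.
  move=> i; rewrite /holds; case: i => [[|[|[|[|i]]]]] //= _; try by exists 1.
  clear; case: x => [|a x]; first by exists 1.
  by exists 0; rewrite /= cats0 -map_comp.
have := compileP E [::] [::]; rewrite cats0 /= add0n -/code => R.
have [_ Ec Eh] := sim_iter n S0; rewrite R /= in Ec Eh.
have H : halted (control (iter n.*2 (@step letter (tmachine code)) (initial (tmachine code) x))).
  by rewrite Ec /= inordK.
have St k cf : halted (control cf) -> iter k (@step letter (tmachine code)) cf = cf.
  by move=> Hh; elim: k => //= k ->; rewrite /step Hh.
rewrite /outputs_within -(subnK le_t) iterD St //; split=> //.
have [j Ej] := Eh ord0; rewrite -[RHS](leading_word_inl y j) map_comp.
by congr leading_word; exact: Ej.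
Qed.

(** * Binary trees as data: parsing, copying and discarding them on the stacks *)

(** The common data type. The preorder code of a tree is self-delimiting, so the tree on top of a
    stack can be parsed whatever lies below it. *)
Inductive tree := Lf | Nd of tree & tree.

Definition sN : sym := inl (Some true).
Definition sL : sym := inl (Some false).
Definition mark : sym := inr false.
Definition tick : sym := inr true.

Fixpoint code (t : tree) : seq sym :=
  if t is Nd l r then sN :: code l ++ code r else [:: sL].
Definition tsize (t : tree) := size (code t).

Lemma tsize_gt0 t : 0 < tsize t. Proof. by case: t. Qed.
Lemma tsizeN l r : tsize (Nd l r) = (tsize l + tsize r).+1.
Proof. by rewrite /tsize /= size_cat. Qed.
Lemma code_nomark t : mark \notin code t.
Proof. by elim: t => //= l IHl r IHr; rewrite inE mem_cat !negb_or IHl IHr. Qed.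

Definition runs p (s s' : store) b := exists2 n, n <= b & exec p s n s'.

Lemma runsW p s s' b c : runs p s s' b -> b <= c -> runs p s s' c.
Proof. by case=> n nb E bc; exists n => //; apply: leq_trans bc. Qed.

Lemma runs_do o s : runs (Do o) s (effect o s) 1.
Proof. by exists 1 => //; constructor. Qed.

Lemma runs_seq p q s1 s2 s3 b c :
  runs p s1 s2 b -> runs q s2 s3 c -> runs (Seq p q) s1 s3 (b + c).
Proof.
by move=> [n nb E] [m mc F]; exists (n + m); [apply: leq_add | econstructor; eauto].
Qed.

Lemma runs_ifT k (P : pred (option sym)) p q s s' b : P (ohead (get k s)) ->
  runs p s s' b -> runs (If k P p q) s s' b.+2.
Proof. by move=> Ps [n nb E]; exists n.+2; [rewrite !ltnS | apply: ExIfT]. Qed.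

Lemma runs_ifF k (P : pred (option sym)) p q s s' b : ~~ P (ohead (get k s)) ->
  runs q s s' b -> runs (If k P p q) s s' b.+1.
Proof. by move=> Ps [n nb E]; exists n.+1; [rewrite !ltnS | apply: ExIfF]. Qed.

Lemma runs_whileT k (P : pred (option sym)) p s1 s2 s3 b c : P (ohead (get k s1)) ->
  runs p s1 s2 b -> runs (While k P p) s2 s3 c -> runs (While k P p) s1 s3 (b + c).+2.
Proof.
move=> Ps [n nb E] [m mb F]; exists (n + m).+2; first by rewrite !ltnS leq_add.
by econstructor; eauto.
Qed.

Lemma runs_whileF k (P : pred (option sym)) p s : ~~ P (ohead (get k s)) ->
  runs (While k P p) s s 1.
Proof. by move=> Ps; exists 1 => //; apply: ExWhileF. Qed.

Definition is_ (a : sym) : pred (option sym) := fun o => o == Some a.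
Definition isnt (a : sym) : pred (option sym) := fun o => o != Some a.
Definition skip := Seq (Do (Push 0 tick)) (Do (Pop 0)).

Fixpoint seqs (l : seq prog) : prog :=
  match l with [::] => skip | [:: p] => p | p :: l' => Seq p (seqs l') end.

Definition forest (ts : seq tree) := flatten [seq code t | t <- ts].

(* [size] occurs at different but convertible element types, which confuses
   [lia]. *)
Ltac nlia := rewrite /tsize; repeat match goal with
  |- context [@size ?T ?w] => let m := fresh "m" in set m := (@size T w); clearbody m
  end; lia.

Definition fetch_loop :=
  While 2 (is_ tick)
    (Seq (Do (Pop 2))
      (If 0 (is_ sN)
         (seqs [:: Do (Move true 0 1); Do (Push 2 tick); Do (Push 2 tick)])
         (Do (Move true 0 1)))).

(* The ticks on stack 2 count the trees that remain to be moved. *)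
Lemma fetch_loopP n ts r s1 s2 s3 : size (forest ts) = n ->
  runs fetch_loop (forest ts ++ r, s1, nseq (size ts) tick ++ mark :: s2, s3)
    (r, rev (forest ts) ++ s1, mark :: s2, s3) (8 * n).+1.
Proof.
elim: n ts r s1 => [|n IH] ts r s1 En.
  case: ts En => [|t ts] /=; first by move=> _; apply: (@runs_whileF 2).
  by rewrite size_cat; case: t => [|? ?] /=.
case: ts En => [|[|l t] ts] En; first by [].
- have R := IH ts r (sL :: s1) (_ : size (forest ts) = n).
  move: En => [En]; have {}R := R En.
  rewrite /forest /= -/(forest ts) rev_cons cat_rcons.
  apply: runsW; first apply: (runs_whileT (k := 2) _ _ R) => //.
    apply: runs_seq; first exact: runs_do.
    by apply: runs_ifF => //; exact: runs_do.
  by nlia.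
- have F : forest (Nd l t :: ts) = sN :: forest [:: l, t & ts] by rewrite /forest /= catA.
  have En' : size (forest [:: l, t & ts]) = n.
    by move: En; rewrite /= => -[<-]; rewrite /forest /= catA.
  have R := IH [:: l, t & ts] r (sN :: s1) En'.
  rewrite F rev_cons cat_rcons.
  apply: runsW; first apply: (runs_whileT (k := 2) _ _ R) => //.
    apply: runs_seq; first exact: runs_do.
    apply: runs_ifT => //.
    by apply: runs_seq; [exact: runs_do| apply: runs_seq; exact: runs_do].
  by nlia.
Qed.

(** The tree is parked in reverse order above a mark; [unfetch] and [clear] later restore or drop
    everything down to that mark. *)
Definition fetch :=
  seqs [:: Do (Push 1 mark); Do (Push 2 mark); Do (Push 2 tick); fetch_loop; Do (Pop 2)].

Lemma fetchP t r s1 s2 s3 :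
  runs fetch (code t ++ r, s1, s2, s3) (r, rev (code t) ++ mark :: s1, s2, s3)
    (8 * tsize t + 5).
Proof.
have R := @fetch_loopP _ [:: t] r (mark :: s1) s2 s3 erefl.
rewrite /forest /= cats0 in R.
apply: runsW.
  do 3![apply: runs_seq; first exact: runs_do].
  by apply: runs_seq; [exact: R | exact: runs_do].
nlia.
Qed.

Definition unfetch := Seq (While 1 (isnt mark) (Do (Move true 1 0))) (Do (Pop 1)).

Lemma unfetchP w r s1 s2 s3 : mark \notin w ->
  runs unfetch (r, w ++ mark :: s1, s2, s3) (rev w ++ r, s1, s2, s3) (3 * size w + 2).
Proof.
move=> Hw.
suff H : runs (While 1 (isnt mark) (Do (Move true 1 0))) (r, w ++ mark :: s1, s2, s3)
    (rev w ++ r, mark :: s1, s2, s3) (3 * size w + 1).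
  by apply: runsW; [apply: runs_seq; [exact: H|exact: runs_do]|nlia].
elim: w r Hw => [|a w IH] r /=; first by move=> _; apply: runs_whileF.
rewrite inE negb_or eq_sym rev_cons cat_rcons => /andP [Ha /IH R].
  apply: runsW; first apply: (runs_whileT (k := 1) (b := 1) _ _ (R (a :: r))); last nlia.
  by rewrite /isnt /=; apply: contra Ha => /eqP [->].
exact: runs_do.
Qed.

Definition clear := Seq (While 1 (isnt mark) (Do (Pop 1))) (Do (Pop 1)).

Lemma clearP w r s1 s2 s3 : mark \notin w ->
  runs clear (r, w ++ mark :: s1, s2, s3) (r, s1, s2, s3) (3 * size w + 2).
Proof.
move=> Hw.
suff H : runs (While 1 (isnt mark) (Do (Pop 1))) (r, w ++ mark :: s1, s2, s3)
    (r, mark :: s1, s2, s3) (3 * size w + 1).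
  by apply: runsW; [apply: runs_seq; [exact: H|exact: runs_do]|nlia].
elim: w Hw => [|a w IH] /=; first by move=> _; apply: runs_whileF.
rewrite inE negb_or eq_sym => /andP [Ha /IH R].
apply: runsW; first apply: (runs_whileT (k := 1) (b := 1) _ _ R); last nlia.
  by rewrite /isnt /=; apply: contra Ha => /eqP [->].
exact: runs_do.
Qed.

Definition discard := Seq fetch clear.
Lemma discardP t r s1 s2 s3 :
  runs discard (code t ++ r, s1, s2, s3) (r, s1, s2, s3) (11 * tsize t + 7).
Proof.
apply: runsW; first apply: runs_seq; [exact: fetchP|apply: clearP|].
  by rewrite mem_rev code_nomark.
by rewrite size_rev -/(tsize t); nlia.
Qed.

Definition dup := seqs [:: fetch; Do (Push 2 mark);
  While 1 (isnt mark) (Seq (Do (Move false 1 0)) (Do (Move true 1 2))); Do (Pop 1);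
  Do (Push 1 mark); While 2 (isnt mark) (Do (Move true 2 1)); Do (Pop 2); unfetch].

Lemma dupP t r s1 s2 s3 :
  runs dup (code t ++ r, s1, s2, s3) (code t ++ code t ++ r, s1, s2, s3) (19 * tsize t + 14).
Proof.
have H1 w r' s2' : mark \notin w ->
  runs (While 1 (isnt mark) (Seq (Do (Move false 1 0)) (Do (Move true 1 2))))
    (r', w ++ mark :: s1, s2', s3) (rev w ++ r', mark :: s1, rev w ++ s2', s3) (4 * size w + 1).
  elim: w r' s2' => [|a w IH] r' s2' /=; first by move=> _; apply: runs_whileF.
  rewrite inE negb_or eq_sym => /andP [Ha /IH R]; rewrite !rev_cons !cat_rcons.
  apply: runsW; first apply: (runs_whileT (k := 1) (b := 1 + 1) _ _ (R (a :: r') (a :: s2'))); last nlia.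
    by rewrite /isnt /=; apply: contra Ha => /eqP [->].
  by apply: runs_seq; exact: runs_do.
have H2 w r' s1' : mark \notin w ->
  runs (While 2 (isnt mark) (Do (Move true 2 1)))
    (r', s1', w ++ mark :: s2, s3) (r', rev w ++ s1', mark :: s2, s3) (3 * size w + 1).
  elim: w s1' => [|a w IH] s1' /=; first by move=> _; apply: runs_whileF.
  rewrite inE negb_or eq_sym => /andP [Ha /IH R]; rewrite !rev_cons !cat_rcons.
  apply: runsW; first apply: (runs_whileT (k := 2) (b := 1) _ _ (R (a :: s1'))); last nlia.
    by rewrite /isnt /=; apply: contra Ha => /eqP [->].
  exact: runs_do.
have N := code_nomark t; have N' : mark \notin rev (code t) by rewrite mem_rev.
apply: runsW.
  apply: runs_seq; first exact: fetchP.
  apply: runs_seq; first exact: runs_do.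
  apply: runs_seq; first exact: H1.
  apply: runs_seq; first exact: runs_do.
  apply: runs_seq; first exact: runs_do.
  rewrite revK /=; apply: runs_seq; first exact: H2.
  apply: runs_seq; first exact: runs_do.
  rewrite /= -[X in runs _ _ (X ++ _ ++ _, _, _, _)]revK; exact: unfetchP.
by rewrite !size_rev -/(tsize t); nlia.
Qed.

(** * Polynomial bounds *)

(** A family with a single parameter that is closed under sums, products and composition up to a
    larger parameter; the base is at least 2, so that constants are absorbed too. *)
Definition bnd (c s : nat) := s.+2 ^ c.

Lemma bnd_gt0 c s : 0 < bnd c s. Proof. by rewrite expn_gt0. Qed.
Lemma bnd_mono c c' s s' : c <= c' -> s <= s' -> bnd c s <= bnd c' s'.
Proof.
move=> Hc Hs; apply: leq_trans (_ : s'.+2 ^ c <= _); last exact: leq_pexp2l.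
by case: c {Hc} => // c; rewrite leq_exp2r.
Qed.
Lemma bnd_add c c' s : bnd c s + bnd c' s <= bnd (maxn c c').+1 s.
Proof.
rewrite {3}/bnd expnS -/(bnd _ s).
have H1 := @bnd_mono c (maxn c c') s s (leq_maxl _ _) (leqnn _).
have H2 := @bnd_mono c' (maxn c c') s s (leq_maxr _ _) (leqnn _).
by have := bnd_gt0 (maxn c c') s; nia.
Qed.
Lemma bnd_mul c c' s : bnd c s * bnd c' s = bnd (c + c') s.
Proof. by rewrite /bnd expnD. Qed.
Lemma bnd_id s : s <= bnd 1 s. Proof. by rewrite /bnd expn1; lia. Qed.
Lemma bnd_const k s : k <= bnd k s.
Proof.
by apply: leq_trans (ltnW (ltn_expl k (isT : 1 < 2))) _; case: k => // k; rewrite leq_exp2r.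
Qed.
Lemma bnd_comp c c' s : bnd c (bnd c' s) <= bnd (c'.+2 * c) s.
Proof.
rewrite {1}/bnd [X in _ <= X]/bnd expnM; case: c => // c; rewrite leq_exp2r //.
by have := bnd_gt0 c' s; rewrite !expnS -/(bnd c' s); nia.
Qed.

(* Polynomially bounded functions; stated so that bounds can be built from
   the outside in. *)
Definition pbounded (f : nat -> nat) := exists c, forall s, f s <= bnd c s.

Lemma pb_id : pbounded id. Proof. by exists 1; apply: bnd_id. Qed.
Lemma pb_const k : pbounded (fun=> k). Proof. by exists k => s; apply: bnd_const. Qed.
Lemma pb_bnd c : pbounded (bnd c). Proof. by exists c. Qed.
Lemma pb_add f g : pbounded f -> pbounded g -> pbounded (fun s => f s + g s).
Proof.
move=> [c Hc] [d Hd]; exists (maxn c d).+1 => s.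
by apply: leq_trans (bnd_add _ _ _); apply: leq_add.
Qed.
Lemma pb_mul f g : pbounded f -> pbounded g -> pbounded (fun s => f s * g s).
Proof.
by move=> [c Hc] [d Hd]; exists (c + d) => s; rewrite -bnd_mul leq_mul.
Qed.
Lemma pb_S f : pbounded f -> pbounded (fun s => (f s).+1).
Proof. by move=> H; have := pb_add (pb_const 1) H. Qed.
Lemma pb_comp c f : pbounded f -> pbounded (fun s => bnd c (f s)).
Proof.
move=> [d Hd]; exists (d.+2 * c) => s; apply: leq_trans (bnd_comp _ _ _).
exact: bnd_mono.
Qed.
Lemma pb_bound f c : pbounded f -> pbounded (fun s => f (bnd c s)).
Proof.
move=> [d Hd]; exists (c.+2 * d) => s; apply: leq_trans (bnd_comp _ _ _); exact: Hd.
Qed.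
Ltac pb := repeat first [apply: pb_id | apply: pb_const | apply: pb_S
  | apply: pb_add | apply: pb_mul | apply: pb_comp | apply: pb_bnd ].

(** * Polynomial-time functions on encoded data *)

Class Enc (T : Type) := enc : T -> tree.
#[export] Instance enc_tree : Enc tree := id.
#[export] Instance enc_bool : Enc bool := fun b => if b then Nd Lf Lf else Lf.
(** Unary: a natural number is a size or a loop count. Numbers that may be large are integers, whose
    encoding [enc_int] is binary. *)
#[export] Instance enc_nat : Enc nat :=
  fix f n := if n is n'.+1 then Nd Lf (f n') else Lf.
#[export] Instance enc_prod A B {EA : Enc A} {EB : Enc B} : Enc (A * B)%type :=
  fun x => Nd (enc x.1) (enc x.2).
#[export] Instance enc_seq A {EA : Enc A} : Enc (seq A) :=
  fix f s := if s is x :: s' then Nd (enc x) (f s') else Lf.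

Definition tsz {A} {EA : Enc A} (x : A) := tsize (enc x).

(* [p] replaces the tree on top of stack 0 and leaves everything else as it is,
   in polynomial time. *)
Definition PT {A B} {EA : Enc A} {EB : Enc B} (f : A -> B) : Prop :=
  exists p c, forall x, tsz (f x) <= bnd c (tsz x) /\
   forall r s1 s2 s3,
     runs p (code (enc x) ++ r, s1, s2, s3) (code (enc (f x)) ++ r, s1, s2, s3)
       (bnd c (tsz x)).

Section PTbasics.
Context {A B C : Type} {EA : Enc A} {EB : Enc B} {EC : Enc C}.
Implicit Types (f : A -> B) (g : B -> C).

Lemma PTI f p (g h : nat -> nat) : pbounded g -> pbounded h ->
  (forall x, tsz (f x) <= g (tsz x)) ->
  (forall x r s1 s2 s3,
    runs p (code (enc x) ++ r, s1, s2, s3) (code (enc (f x)) ++ r, s1, s2, s3) (h (tsz x))) ->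
  PT f.
Proof.
move=> [c Hc] [d Hd] Hs Hr; exists p, (maxn c d) => x; split=> [|r s1 s2 s3].
  apply: leq_trans (Hs x) _; apply: leq_trans (Hc _) _.
  exact: bnd_mono (leq_maxl _ _) _.
apply: runsW (Hr _ _ _ _ _) _; apply: leq_trans (Hd _) _.
exact: bnd_mono (leq_maxr _ _) _.
Qed.

Lemma PT_eq f f' : f =1 f' -> PT f -> PT f'.
Proof. by move=> E [p [c H]]; exists p, c => x; rewrite -E. Qed.

Lemma PT_tree (F : tree -> tree) f : PT F -> (forall a, F (enc a) = enc (f a)) -> PT f.
Proof.
move=> [p [c H]] E; exists p, c => x; have [H1 H2] := H (enc x).
by split; [rewrite /tsz -E | rewrite -E].
Qed.

Lemma PT_id : PT (@id A).
Proof.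
have [c Hc] : pbounded (fun s => s + 2) by pb.
exists skip, c => x; split=> [|r s1 s2 s3].
  by apply: leq_trans (Hc _); apply: leq_addr.
apply: runsW; last by apply: leq_trans (Hc _); apply: leq_addl.
by apply: (@runs_seq _ _ _ _ _ 1 1); exact: runs_do.
Qed.

Lemma PT_comp g f : PT g -> PT f -> PT (fun x => g (f x)).
Proof.
move=> [p [c Hp]] [q [d Hq]].
exists (Seq q p).
have [e He] : pbounded (fun s => bnd c (bnd d s) + (bnd d s + bnd c (bnd d s))) by pb.
exists e => x; split=> [|r s1 s2 s3].
  apply: leq_trans (He _); apply: leq_trans (Hp _).1 _; apply: leq_trans (leq_addr _ _).
  by apply: bnd_mono => //; exact: (Hq x).1.
apply: runsW; first by apply: runs_seq; [exact: (Hq x).2 | exact: (Hp _).2].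
apply: leq_trans (He _); apply: leq_trans (leq_addl _ _); rewrite leq_add2l.
by apply: bnd_mono => //; exact: (Hq x).1.
Qed.

Lemma PT_size f : PT f -> exists c, forall x, tsz (f x) <= bnd c (tsz x).
Proof. by move=> [p [c H]]; exists c => x; exact: (H x).1. Qed.
End PTbasics.

(** The argument is duplicated, and the first result is parked on stack 1 while the second function
    consumes the other copy. *)
Lemma PT_pair {A B C} {EA : Enc A} {EB : Enc B} {EC : Enc C} (f : A -> B) (g : A -> C) :
  PT f -> PT g -> PT (fun x => (f x, g x)).
Proof.
move=> [p [c Hp]] [q [d Hq]].
apply: (PTI (p := seqs [:: dup; p; fetch; q; unfetch; Do (Push 0 sN)])
  (g := fun s => (bnd c s + bnd d s).+1)
  (h := fun s => (19 * s + 14) + (bnd c s + ((8 * bnd c s + 5) + (bnd d s + ((3 * bnd c s + 2) + 1)))))); [pb|pb| |] => x.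
  by rewrite /tsz tsizeN ltnS leq_add ?(Hp x).1 ?(Hq x).1.
move=> r s1 s2 s3; apply: runs_seq; first exact: dupP.
apply: runs_seq; first exact: (Hp x).2.
apply: runs_seq; first by apply: runsW (fetchP _ _ _ _ _) _; have := (Hp x).1; rewrite /tsz; lia.
apply: runs_seq; first exact: (Hq x).2.
apply: runs_seq.
  apply: runsW; first by apply: unfetchP; rewrite mem_rev code_nomark.
  by rewrite size_rev -/(tsize _); have := (Hp x).1; rewrite /tsz; lia.
by rewrite revK /= -catA; apply: runs_do.
Qed.

Definition tfst t := if t is Nd l _ then l else Lf.
Definition tsnd t := if t is Nd _ r then r else Lf.

Lemma PT_treecase (f g : tree -> tree) : PT f -> PT g ->
  PT (fun x : tree => if x is Nd _ _ then f x else g x).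
Proof.
move=> [p [c Hp]] [q [d Hq]].
apply: (@PTI _ _ _ _ _ (If 0 (is_ sN) p q) (fun s => bnd c s + bnd d s)
  (fun s => (bnd c s + bnd d s).+2)); [pb|pb| |].
  by case=> [|l r]; [have := (Hq Lf).1|have := (Hp (Nd l r)).1]; lia.
case=> [|l t] r s1 s2 s3.
  apply: runsW; first by apply: runs_ifF => //; apply: (Hq Lf).2.
  by lia.
apply: runsW; first by apply: runs_ifT => //; apply: (Hp (Nd l t)).2.
by lia.
Qed.

Lemma PT_tfst : PT tfst.
Proof.
apply: (@PTI _ _ _ _ _ (If 0 (is_ sN) (seqs [:: Do (Pop 0); fetch; discard; unfetch]) skip)
  id (fun s => 22 * s + 17)); [pb|pb| |].
  by case=> // l r; rewrite /tsz /enc /enc_tree tsizeN /=; lia.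
case=> [|l t] r s1 s2 s3.
  apply: runsW; first by apply: runs_ifF => //; apply: runs_seq; exact: runs_do.
  by lia.
apply: runsW.
  apply: runs_ifT => //; apply: runs_seq; first exact: runs_do.
  rewrite /= -catA; apply: runs_seq; first exact: fetchP.
  apply: runs_seq; first exact: discardP.
  rewrite -[X in runs _ _ (X ++ _, _, _, _)]revK; apply: unfetchP.
  by rewrite mem_rev code_nomark.
by rewrite /tsz /enc /enc_tree tsizeN size_rev -/(tsize l); lia.
Qed.

Lemma PT_tsnd : PT tsnd.
Proof.
apply: (@PTI _ _ _ _ _ (If 0 (is_ sN) (seqs [:: Do (Pop 0); discard]) skip)
  id (fun s => 11 * s + 17)); [pb|pb| |].
  by case=> // l r; rewrite /tsz /enc /enc_tree tsizeN /=; lia.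
case=> [|l t] r s1 s2 s3.
  apply: runsW; first by apply: runs_ifF => //; apply: runs_seq; exact: runs_do.
  by lia.
apply: runsW.
  apply: runs_ifT => //; apply: runs_seq; first exact: runs_do.
  by rewrite /= -catA; exact: discardP.
by rewrite /tsz /enc /enc_tree tsizeN; lia.
Qed.

Lemma PT_const {A B} {EA : Enc A} {EB : Enc B} (b : B) : PT (fun _ : A => b).
Proof.
suff H w : exists p n, forall r s1 s2 s3, runs p (r, s1, s2, s3) (w ++ r, s1, s2, s3) n.
  have [p [n Hp]] := H (code (enc b)).
  apply: (@PTI _ _ _ _ _ (Seq discard p) (fun=> tsz b) (fun s => 11 * s + 7 + n)); [pb|pb|by []|].
  by move=> x r s1 s2 s3; apply: runs_seq; [exact: discardP|exact: Hp].
elim: w => [|a w [p [n Hp]]].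
  by exists skip, 2 => r s1 s2 s3; apply: (@runs_seq _ _ _ _ _ 1 1); exact: runs_do.
exists (Seq p (Do (Push 0 a))), (n + 1) => r s1 s2 s3.
by apply: runs_seq; [exact: Hp | exact: runs_do].
Qed.

Fixpoint spine t := if t is Nd _ r then (spine r).+1 else 0.

Lemma PT_if {A B} {EA : Enc A} {EB : Enc B} (b : A -> bool) (f g : A -> B) :
  PT b -> PT f -> PT g -> PT (fun x => if b x then f x else g x).
Proof.
move=> [p [c Hp]] [q [d Hq]] [q' [d' Hq']].
apply: (PTI (p := seqs [:: dup; p; If 0 (is_ sN) (Seq discard q) (Seq discard q')])
  (g := fun s => bnd d s + bnd d' s)
  (h := fun s => (19 * s + 14) + (bnd c s + (11 * bnd c s + 7 + (bnd d s + bnd d' s)).+2))); [pb|pb| |].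
  by move=> x; have := (Hq x).1; have := (Hq' x).1; case: (b x); lia.
move=> x r s1 s2 s3; apply: runs_seq; first exact: dupP.
apply: runs_seq; first exact: (Hp x).2.
have := (Hp x).1; case: (b x) => Hb.
  apply: runsW; first apply: runs_ifT => //; first apply: runs_seq; [exact: (@discardP (enc true))|exact: (Hq x).2|].
  by move: Hb; rewrite /tsz; lia.
apply: runsW; first apply: runs_ifF => //; first apply: runs_seq; [exact: (@discardP (enc false))|exact: (Hq' x).2|].
by move: Hb; rewrite /tsz; lia.
Qed.

Section Basic.
Context {A B C : Type} {EA : Enc A} {EB : Enc B} {EC : Enc C}.

Lemma PT_fst (f : A -> B * C) : PT f -> PT (fun x => (f x).1).
Proof. by move=> H; apply: (PT_comp (g := fst)) H; apply: PT_tree PT_tfst _. Qed.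
Lemma PT_snd (f : A -> B * C) : PT f -> PT (fun x => (f x).2).
Proof. by move=> H; apply: (PT_comp (g := snd)) H; apply: PT_tree PT_tsnd _. Qed.
Lemma PT_cons (f : A -> B) (g : A -> seq B) : PT f -> PT g -> PT (fun x => f x :: g x).
Proof.
move=> Hf Hg; apply: (PT_comp (g := fun p => p.1 :: p.2)) (PT_pair Hf Hg).
exact: PT_tree PT_id _.
Qed.
Lemma PT_behead (f : A -> seq B) : PT f -> PT (fun x => behead (f x)).
Proof. by move=> H; apply: (PT_comp (g := behead)) H; apply: PT_tree PT_tsnd _; case. Qed.
Lemma PT_S (f : A -> nat) : PT f -> PT (fun x => (f x).+1).
Proof.
move=> H; apply: (PT_comp (g := S)) H.
apply: (PT_tree (F := fun t => enc (Lf, t))) => //.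
exact: PT_tree (PT_pair (PT_const Lf) PT_id) _.
Qed.
Lemma PT_pred (f : A -> nat) : PT f -> PT (fun x => (f x).-1).
Proof. by move=> H; apply: (PT_comp (g := predn)) H; apply: PT_tree PT_tsnd _; case. Qed.
Lemma PT_nilp (f : A -> seq B) : PT f -> PT (fun x => nilp (f x)).
Proof.
move=> H; apply: (PT_comp (g := @nilp B)) H.
apply: PT_tree (PT_treecase (PT_const Lf) (PT_const (Nd Lf Lf))) _; by case.
Qed.
Lemma PT_eq0 (f : A -> nat) : PT f -> PT (fun x => f x == 0).
Proof.
move=> H; apply: (PT_comp (g := fun n => n == 0)) H.
apply: PT_tree (PT_treecase (PT_const Lf) (PT_const (Nd Lf Lf))) _; by case.
Qed.
Lemma PT_head (b : B) (f : A -> seq B) : PT f -> PT (fun x => head b (f x)).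
Proof.
move=> H; apply: (PT_comp (g := head b)) H.
apply: PT_tree (PT_treecase PT_tfst (PT_const (enc b))) _; by case.
Qed.
End Basic.

Lemma nseq_cons T k (a : T) s : nseq k a ++ a :: s = a :: nseq k a ++ s.
Proof. by elim: k => //= k ->. Qed.

Lemma tsz_pair {A B} {EA : Enc A} {EB : Enc B} (a : A) (b : B) :
  tsz (a, b) = (tsz a + tsz b).+1.
Proof. by rewrite /tsz /enc /enc_prod tsizeN. Qed.

Lemma tsz_nat (n : nat) : tsz n = n.*2.+1.
Proof. by elim: n => //= n IH; rewrite /tsz tsizeN -/(tsz _) IH. Qed.

(** The bound on all iterates is the essential hypothesis: each round is polynomial in the size of
    the current value, and repeated squaring shows that this size could otherwise explode. *)
Lemma PT_iter {X S} {EX : Enc X} {ES : Enc S} (n : X -> nat) (f : X -> S -> S) (s0 : X -> S) :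
  PT n -> PT s0 -> PT (fun p : X * S => f p.1 p.2) ->
  (exists c, forall x k, k <= n x -> tsz (iter k (f x) (s0 x)) <= bnd c (tsz x)) ->
  PT (fun x => iter (n x) (f x) (s0 x)).
Proof.
move=> Hn Hs Hf [c Hb].
have [p [d Hp]] : PT (fun x => (n x, (x, s0 x))).
  by apply: PT_pair => //; apply: PT_pair => //; apply: PT_id.
have [q [e Hq]] : PT (fun u : X * S => (u.1, f u.1 u.2)).
  by apply: PT_pair => //; apply: PT_fst PT_id.
have [g [a Hg]] : PT (fun u : X * S => u.2) by apply: PT_snd PT_id.
(* The unary count is moved to stack 3 as ticks, where the loop body, which changes only the top
   tree of stack 0, leaves it alone. *)
pose unary := While 0 (is_ sN) (seqs [:: Do (Pop 0); discard; Do (Push 3 tick)]).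
have L1 k r s1 s2 s3 : runs unary (code (enc k) ++ r, s1, s2, s3)
    (sL :: r, s1, s2, nseq k tick ++ s3) (22 * k + 1).
  elim: k s3 => [|k IH] s3; first by apply: runs_whileF.
  apply: runsW.
    apply: (runs_whileT (k := 0) (b := 1 + (18 + 1))) => //.
      apply: runs_seq; first exact: runs_do.
      apply: runs_seq; first exact: (@discardP Lf).
      exact: runs_do.
    by have := IH (tick :: s3); rewrite nseq_cons; exact.
  by lia.
have L2 x k y M r s1 s2 s3 : (forall j, j <= k -> tsz (iter j (f x) y) <= M) ->
    runs (While 3 (is_ tick) (Seq (Do (Pop 3)) q))
    (code (enc (x, y)) ++ r, s1, s2, nseq k tick ++ mark :: s3)
    (code (enc (x, iter k (f x) y)) ++ r, s1, s2, mark :: s3)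
    (k * (bnd e (tsz x + M).+1 + 3) + 1).
  elim: k y => [|k IH] y HM; first exact: runs_whileF.
  apply: runsW.
    apply: (runs_whileT (k := 3)) => //.
      by apply: runs_seq; [exact: runs_do | apply: (Hq (x, y)).2].
    rewrite iterSr; apply: IH => j jk; rewrite -iterSr; exact: HM.
  have : bnd e (tsz (x, y)) <= bnd e (tsz x + M).+1.
    by apply: bnd_mono => //; rewrite tsz_pair ltnS leq_add2l (HM 0).
  by lia.
apply: (PTI (p := seqs [:: p; Do (Pop 0); Do (Push 3 mark); unary; Do (Pop 0);
    While 3 (is_ tick) (Seq (Do (Pop 3)) q); Do (Pop 3); g])
  (g := bnd c)
  (h := fun s => bnd d s + (1 + (1 + ((22 * bnd d s + 1) + (1 +
    ((bnd d s * (bnd e (s + bnd c s).+1 + 3) + 1) + (1 +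
       bnd a (s + bnd c s).+1)))))))); [pb|pb| |].
  by move=> x; apply: Hb.
move=> x r s1 s2 s3.
have nx : n x <= bnd d (tsz x).
  by have := (Hp x).1; rewrite tsz_pair tsz_nat; lia.
apply: runs_seq; first exact: (Hp x).2.
apply: runs_seq; first exact: runs_do.
rewrite /= -!catA; apply: runs_seq; first exact: runs_do.
apply: runs_seq; first by apply: runsW (L1 _ _ _ _ _) _; lia.
apply: runs_seq; first exact: runs_do.
apply: runs_seq.
  apply: runsW.
    have := L2 x (n x) (s0 x) (bnd c (tsz x)) r s1 s2 s3 _.
    by rewrite /= -!catA; apply => j Hj; exact: Hb.
  by rewrite leq_add2r leq_mul2r nx orbT.
apply: runs_seq; first exact: runs_do.
apply: runsW.
  by have := (Hg (x, iter (n x) (f x) (s0 x))).2 r s1 s2 s3; rewrite /= -!catA; apply.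
by apply: bnd_mono => //; rewrite tsz_pair ltnS leq_add2l Hb.
Qed.

(** * Binary numerals and bit-serial arithmetic *)

Definition bval (s : seq bool) : nat := foldr (fun (b : bool) r => b + r.*2) 0 s.
(** The most significant digit comes last; the default [true] makes the empty numeral of 0
    canonical. *)
Definition canon (s : seq bool) : bool := last true s.

Lemma bval_bits n : bval (bits n) = n.
Proof.
have H p : bval (pos_bits p) = nat_of_pos p.
  by elim: p => //= p ->; rewrite ?NatTrec.doubleE ?NatTrec.trecE // ; lia.
by rewrite -[RHS](bin_of_natK n) /bits; case: (bin_of_nat n).
Qed.

Lemma canon_bits n : canon (bits n).
Proof.
rewrite /bits; case: (bin_of_nat n) => // p.
have : last false (pos_bits p) by elim: p => //= p; case: (pos_bits p).
by case: (pos_bits p).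
Qed.

Lemma canon_gt0 b s : canon (b :: s) -> 0 < bval (b :: s).
Proof.
elim: s b => [|a s IH] b; first by rewrite /canon /=; case: b.
by move=> H; have := IH a H; rewrite /=; lia.
Qed.

Lemma canon_inj s t : canon s -> canon t -> bval s = bval t -> s = t.
Proof.
elim: s t => [|b s IH] [|a t] //.
- by move=> _ /canon_gt0 H E; move: H; rewrite -E.
- by move=> /canon_gt0 H _ E; move: H; rewrite E.
move=> Hs Ht /= E.
have [Eb Ev] : b = a /\ bval s = bval t by move: E; case: a {Ht}; case: b {Hs} => /=; lia.
rewrite Eb (IH t) //; first by case: s Hs {IH E Ev}.
by case: t Ht {E Ev}.
Qed.

Lemma bits_bval s : canon s -> bits (bval s) = s.
Proof. by move=> H; apply: canon_inj => //; [exact: canon_bits|exact: bval_bits]. Qed.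

Lemma bval_lt s : bval s < 2 ^ size s.
Proof. by elim: s => //= b s IH; rewrite expnS; case: b => /=; lia. Qed.

Lemma canon_ge b s : canon (b :: s) -> 2 ^ size s <= bval (b :: s).
Proof.
elim: s b => [|a s IH] b; first by case: b.
by move=> /IH; rewrite /= expnS; lia.
Qed.

Definition blen n := size (bits n).

Lemma blen_le n k : (blen n <= k) = (n < 2 ^ k).
Proof.
apply/idP/idP => H.
  by have := bval_lt (bits n); rewrite bval_bits => /leq_trans; apply; rewrite leq_exp2l.
rewrite /blen; case E: (bits n) => [|b s] //=.
have : canon (b :: s) by rewrite -E canon_bits.
move/canon_ge; rewrite -E bval_bits => /leq_ltn_trans/(_ H).
by rewrite ltn_exp2l.
Qed.

Lemma blen_lt n : n < 2 ^ blen n. Proof. by rewrite -blen_le. Qed.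
Lemma blen_mono m n : m <= n -> blen m <= blen n.
Proof. by move=> H; rewrite blen_le (leq_ltn_trans H) ?blen_lt. Qed.
Lemma blen_add m n : blen (m + n) <= (maxn (blen m) (blen n)).+1.
Proof.
rewrite blen_le expnS mul2n -addnn.
have Hm : m < 2 ^ maxn (blen m) (blen n) by rewrite -blen_le leq_maxl.
have Hn : n < 2 ^ maxn (blen m) (blen n) by rewrite -blen_le leq_maxr.
lia.
Qed.
Lemma blen_mul m n : blen (m * n) <= blen m + blen n.
Proof.
rewrite blen_le expnD; have := blen_lt m; have := blen_lt n.
have : 0 < 2 ^ blen m by rewrite expn_gt0.
nia.
Qed.
Lemma blen_leq n : blen n <= n.
Proof. by rewrite blen_le ltn_expl. Qed.

(* Bit-serial arithmetic with carry bit [c]. *)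
Section Serial.
Variables d o : bool -> bool -> bool -> bool.
Fixpoint serial k c s t : seq bool :=
  if k is k'.+1 then o c (head false s) (head false t)
    :: serial k' (d c (head false s) (head false t)) (behead s) (behead t)
  else [::].
Fixpoint carry k c s t : bool :=
  if k is k'.+1 then carry k' (d c (head false s) (head false t)) (behead s) (behead t)
  else c.
End Serial.

(** The output digit serves addition and subtraction alike; only the carry rules differ. *)
Definition add_out (c x y : bool) := c (+) x (+) y.
Definition add_carry (c x y : bool) := if c then x || y else x && y.
Definition sub_carry (c x y : bool) := if x then c && y else c || y.

Lemma bval_head s : bval s = head false s + (bval (behead s)).*2.
Proof. by case: s. Qed.

Lemma serial_add k (c : bool) s t : c + bval s + bval t < 2 ^ k ->
  bval (serial add_carry add_out k c s t) = c + bval s + bval t.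
Proof.
elim: k c s t => [|k IH] c s t; first by rewrite expn0 ltnS leqn0 /= => /eqP ->.
rewrite [bval s]bval_head [bval t]bval_head expnS => H /=.
rewrite IH; last by move: H; case: c; case: (head _ s); case: (head _ t) => /=; lia.
by case: c {H}; case: (head _ s); case: (head _ t) => /=; lia.
Qed.

Lemma serial_sub k (c : bool) s t : c + bval t <= bval s -> bval s < 2 ^ k ->
  bval (serial sub_carry add_out k c s t) = bval s - (c + bval t).
Proof.
elim: k c s t => [|k IH] c s t.
  by rewrite expn0 ltnS leqn0 => H /eqP E; rewrite E.
rewrite [bval s]bval_head [bval t]bval_head expnS => H H' /=.
rewrite IH; first by move: H; case: c; case: (head _ s); case: (head _ t) => /=; lia.
  by move: H; case: c; case: (head _ s); case: (head _ t) => /=; lia.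
by move: H'; case: (head _ s) => /=; lia.
Qed.

Lemma carry_sub k (c : bool) s t : bval s < 2 ^ k -> bval t < 2 ^ k ->
  carry sub_carry k c s t = (bval s < c + bval t).
Proof.
elim: k c s t => [|k IH] c s t.
  by rewrite expn0 !ltnS !leqn0 => /eqP -> /eqP -> /=; case: c.
rewrite [bval s]bval_head [bval t]bval_head expnS => H H' /=.
rewrite IH; [|by move: H; case: (head _ s) => /=; lia|by move: H'; case: (head _ t) => /=; lia].
by case: c; case: (head _ s); case: (head _ t) => /=; lia.
Qed.

(* Reverses a list of bits without its leading zeros. *)
Fixpoint rnorm a r : seq bool :=
  if a is b :: a' then rnorm a' (if b || ~~ nilp r then b :: r else r) else r.

Lemma rnormP a r : canon r ->
  canon (rnorm a r) /\ bval (rnorm a r) = bval (catrev a r).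
Proof.
elim: a r => //= b a IH r Hr.
have Hb : canon (if b || ~~ nilp r then b :: r else r).
  by case: b => /=; [|case: r Hr => [|x r] //=]; rewrite /canon /=; case: r Hr.
have [H1 H2] := IH _ Hb; split=> //; rewrite H2 !catrevE.
have bcat u v v' : bval v = bval v' -> bval (u ++ v) = bval (u ++ v').
  by move=> E; elim: u => //= x u ->.
by apply: bcat; case: b {Hb H1 H2} => //=; case: r {Hr}.
Qed.

Definition addB s t := rnorm (rev (serial add_carry add_out (size s + size t).+1 false s t)) [::].
Definition subB s t := rnorm (rev (serial sub_carry add_out (size s + size t) false s t)) [::].
(** The borrow that remains after a subtraction decides the comparison. *)
Definition ltB s t := carry sub_carry (size s + size t) false s t.

Lemma addBP m n : addB (bits m) (bits n) = bits (m + n).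
Proof.
have [H1 H2] := rnormP (rev (serial add_carry add_out (blen m + blen n).+1 false (bits m) (bits n))) (erefl : canon [::]).
apply: canon_inj => //; first exact: canon_bits.
rewrite H2 catrevE revK cats0 serial_add !bval_bits //.
rewrite add0n -blen_le; apply: leq_trans (blen_add _ _) _; lia.
Qed.

Lemma bits_lt m n : m < 2 ^ (blen m + blen n).
Proof. by rewrite -blen_le leq_addr. Qed.

Lemma subBP m n : n <= m -> subB (bits m) (bits n) = bits (m - n).
Proof.
move=> Hn.
have [H1 H2] := rnormP (rev (serial sub_carry add_out (blen m + blen n) false (bits m) (bits n))) (erefl : canon [::]).
apply: canon_inj => //; first exact: canon_bits.
by rewrite H2 catrevE revK cats0 serial_sub !bval_bits // bits_lt.
Qed.

Lemma ltBP m n : ltB (bits m) (bits n) = (m < n).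
Proof. by rewrite /ltB carry_sub !bval_bits ?bits_lt // addnC bits_lt. Qed.

Lemma bits_double (b : bool) n : 0 < b + n.*2 -> bits (b + n.*2) = b :: bits n.
Proof.
move=> H; apply: canon_inj; rewrite ?canon_bits //=; last by rewrite !bval_bits.
rewrite /canon /=; case E: (bits n) => [|x s]; last by rewrite -[last _ _]/(canon (x :: s)) -E canon_bits.
have : n = 0 by rewrite -[n]bval_bits E.
by move=> En; move: H; rewrite En; case: b.
Qed.

Lemma bits_half n : behead (bits n) = bits n./2.
Proof.
case: n => // n; rewrite -{1}[n.+1]odd_double_half bits_double //.
by rewrite odd_double_half.
Qed.

Lemma bits_odd n : head false (bits n) = odd n.
Proof.
case: n => // n; rewrite -{1}[n.+1]odd_double_half bits_double //.
by rewrite odd_double_half.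
Qed.

(** * Sizes of encodings, and closure of [PT] under operations on numbers and lists *)

Lemma tsz_cons {A} {EA : Enc A} (a : A) s : tsz (a :: s) = (tsz a + tsz s).+1.
Proof. by rewrite /tsz tsizeN. Qed.
Lemma tsz_gt0 {A} {EA : Enc A} (a : A) : 0 < tsz a.
Proof. exact: tsize_gt0. Qed.
Lemma tsz_bool (b : bool) : tsz b <= 3. Proof. by case: b. Qed.
Lemma size_tsz {A} {EA : Enc A} (s : seq A) : size s <= tsz s.
Proof. by elim: s => // a s IH; rewrite tsz_cons /=; lia. Qed.
Lemma tsz_cat {A} {EA : Enc A} (s t : seq A) : tsz (s ++ t) <= tsz s + tsz t.
Proof. by elim: s => [|a s IH] /=; rewrite ?tsz_cons; lia. Qed.
Lemma tsz_behead {A} {EA : Enc A} (s : seq A) : tsz (behead s) <= tsz s.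
Proof. by case: s => // a s; rewrite tsz_cons /=; lia. Qed.
Lemma tsz_seq_le {A} {EA : Enc A} (s : seq A) M :
  (forall i a, i < size s -> tsz (nth a s i) <= M) -> tsz s <= (size s * M.+1).+1.
Proof.
elim: s => // a s IH H; rewrite tsz_cons /=.
have := H 0 a isT; rewrite /=.
have := IH (fun i b Hi => H i.+1 b Hi); lia.
Qed.

(** A hook, redefined whenever further closure lemmas become available. *)
Ltac pt_ext := fail.
(* Decomposes the body of a function along the closure lemmas. *)
Ltac pt_step := cbv beta; first [ assumption | pt_ext | lazymatch goal with
  | |- PT (fun x => x) => exact PT_id
  | |- PT fst => exact (PT_fst PT_id)
  | |- PT snd => exact (PT_snd PT_id)
  | |- PT (fun _ => ?c) => exact (PT_const c)
  | |- PT (fun x => fst (@?a x)) => apply (PT_fst (f := a))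
  | |- PT (fun x => snd (@?a x)) => apply (PT_snd (f := a))
  | |- PT (fun x => (@?a x, @?b x)) => apply (PT_pair (f := a) (g := b))
  | |- PT (fun x => @?a x :: @?b x) => apply (PT_cons (f := a) (g := b))
  | |- PT (fun x => behead (@?a x)) => apply (PT_behead (f := a))
  | |- PT (fun x => nilp (@?a x)) => apply (PT_nilp (f := a))
  | |- PT (fun x => head ?b (@?a x)) => apply (PT_head b (f := a))
  | |- PT (fun x => S (@?a x)) => apply (PT_S (f := a))
  | |- PT (fun x => predn (@?a x)) => apply (PT_pred (f := a))
  | |- PT (fun x => if _ then _ else _) => apply PT_if
  end
  | match goal with
  | H : PT ?n |- PT (fun x => ?n (@?a x)) => apply (PT_comp (g := n) (f := a) H)
  | H : PT (fun p => ?f p.1 p.2) |- PT (fun x => ?f (@?a x) (@?b x)) =>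
      apply (PT_comp (g := fun p => f p.1 p.2) (f := fun x => (a x, b x)) H)
  end ].
Ltac pt := repeat pt_step.

Section Iter.
Context {A S : Type} {EA : Enc A} {ES : Enc S}.

Lemma PT_iter_add (n : A -> nat) (f : A -> S -> S) (s0 : A -> S) :
  PT n -> PT s0 -> PT (fun p : A * S => f p.1 p.2) ->
  (exists c, forall x s, tsz (f x s) <= tsz s + bnd c (tsz x)) ->
  PT (fun x => iter (n x) (f x) (s0 x)).
Proof.
move=> Hn Hs Hf [c Hb]; apply: PT_iter => //.
have [a Ha] := PT_size Hn; have [b Hb'] := PT_size Hs.
have [d Hd] : pbounded (fun s => bnd b s + bnd a s * bnd c s) by pb.
exists d => x k Hk; apply: leq_trans (Hd _).
apply: (@leq_trans (bnd b (tsz x) + k * bnd c (tsz x))).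
  by elim: k {Hk} => [|k IH]; rewrite ?mul0n ?addn0 //= mulSn; have := Hb x (iter k (f x) (s0 x)); lia.
rewrite leq_add2l leq_mul2r; apply/orP; right; have := Ha x; rewrite tsz_nat; lia.
Qed.
End Iter.


Lemma PT_addn {A} {EA : Enc A} (m n : A -> nat) : PT m -> PT n -> PT (fun x => m x + n x).
Proof.
move=> Hm Hn; apply: (PT_eq (f := fun x => iter (m x) S (n x))).
  by move=> x; rewrite iter_succn addnC.
apply: PT_iter_add => //; first by apply: PT_S; apply: PT_snd PT_id.
by exists 1 => x s; rewrite !tsz_nat /bnd; lia.
Qed.

Lemma PT_subn {A} {EA : Enc A} (m n : A -> nat) : PT m -> PT n -> PT (fun x => m x - n x).
Proof.
move=> Hm Hn; apply: (PT_eq (f := fun x => iter (n x) predn (m x))).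
  by move=> x; elim: (n x) => [|k IH] /=; rewrite ?subn0 // IH subnS.
apply: PT_iter_add => //; first by apply: PT_pred; apply: PT_snd PT_id.
by exists 1 => x s; rewrite !tsz_nat /bnd; lia.
Qed.

Lemma PT_muln {A} {EA : Enc A} (m n : A -> nat) : PT m -> PT n -> PT (fun x => m x * n x).
Proof.
move=> Hm Hn; apply: (PT_eq (f := fun x => iter (m x) (addn (n x)) 0)).
  by move=> x; rewrite iter_addn_0 mulnC.
apply: PT_iter_add => //; first exact: PT_const.
  by apply: PT_addn; pt.
have [d Hd] := PT_size Hn.
by exists d => x s; have := Hd x; rewrite !tsz_nat; lia.
Qed.

Lemma PT_negb {A} {EA : Enc A} (b : A -> bool) : PT b -> PT (fun x => ~~ b x).
Proof.
move=> Hb; apply: (PT_eq (f := fun x => if b x then false else true)).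
  by move=> x; case: (b x).
by apply: PT_if => //; apply: PT_const.
Qed.
Lemma PT_andb {A} {EA : Enc A} (b c : A -> bool) : PT b -> PT c -> PT (fun x => b x && c x).
Proof. by move=> Hb Hc; apply: PT_if => //; apply: PT_const. Qed.
Lemma PT_orb {A} {EA : Enc A} (b c : A -> bool) : PT b -> PT c -> PT (fun x => b x || c x).
Proof. by move=> Hb Hc; apply: PT_if => //; apply: PT_const. Qed.
Lemma PT_addb {A} {EA : Enc A} (b c : A -> bool) : PT b -> PT c -> PT (fun x => b x (+) c x).
Proof.
move=> Hb Hc; apply: (PT_eq (f := fun x => if b x then ~~ c x else c x)).
  by move=> x; case: (b x).
by apply: PT_if => //; apply: PT_negb.
Qed.
Lemma PT_eqb {A} {EA : Enc A} (b c : A -> bool) : PT b -> PT c -> PT (fun x => b x == c x).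
Proof.
move=> Hb Hc; apply: (PT_eq (f := fun x => ~~ (b x (+) c x))).
  by move=> x; case: (b x); case: (c x).
by apply: PT_negb; apply: PT_addb.
Qed.
Lemma PT_natb {A} {EA : Enc A} (b : A -> bool) : PT b -> PT (fun x => b x : nat).
Proof. move=> Hb; apply: PT_comp Hb; apply: PT_tree (PT_id (A := tree)) _; by case. Qed.

Lemma PT_leq {A} {EA : Enc A} (m n : A -> nat) : PT m -> PT n -> PT (fun x => m x <= n x).
Proof. by move=> Hm Hn; apply: PT_eq0; apply: PT_subn. Qed.
Lemma PT_ltn {A} {EA : Enc A} (m n : A -> nat) : PT m -> PT n -> PT (fun x => m x < n x).
Proof. by move=> Hm Hn; apply: PT_leq => //; apply: PT_S. Qed.
Lemma PT_eqn {A} {EA : Enc A} (m n : A -> nat) : PT m -> PT n -> PT (fun x => m x == n x).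
Proof.
move=> Hm Hn; apply: (PT_eq (f := fun x => (m x <= n x) && (n x <= m x))).
  by move=> x; rewrite eqn_leq.
by apply: PT_andb; apply: PT_leq.
Qed.

Section SeqOps.
Context {A B : Type} {EA : Enc A} {EB : Enc B}.

Lemma PT_nth (b : B) (s : A -> seq B) (n : A -> nat) :
  PT s -> PT n -> PT (fun x => nth b (s x) (n x)).
Proof.
move=> Hs Hn; apply: (PT_eq (f := fun x => head b (iter (n x) behead (s x)))).
  move=> x; rewrite -nth0; set i := n x; move: (s x).
  by elim: i => [|i IH] l //; rewrite iterSr IH nth_behead.
apply: PT_head; apply: PT_iter_add => //; first by apply: PT_behead; apply: PT_snd PT_id.
by exists 1 => x l; apply: leq_trans (tsz_behead _) (leq_addr _ _).
Qed.

Lemma PT_size_seq (s : A -> seq B) : PT s -> PT (fun x => size (s x)).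
Proof.
move=> Hs; apply: (PT_comp (g := @size B)) Hs.
pose p1 := While 0 (is_ sN) (seqs [:: Do (Pop 0); discard; Do (Push 3 tick)]).
pose p2 := While 3 (is_ tick) (seqs [:: Do (Pop 3); Do (Push 0 sL); Do (Push 0 sN)]).
have L1 l r s1 s2 s3 : runs p1 (code (enc l) ++ r, s1, s2, s3)
    (sL :: r, s1, s2, nseq (size l) tick ++ s3) (11 * tsz l + 1).
  elim: l s3 => [|b l IH] s3; first by apply: runsW; first by apply: runs_whileF.
  apply: runsW.
    apply: (runs_whileT (k := 0) (b := 1 + (11 * tsz b + 7 + 1))) => //.
      apply: runs_seq; first exact: runs_do.
      rewrite /= -catA; apply: runs_seq; first exact: discardP.
      exact: runs_do.
    by have := IH (tick :: s3); rewrite nseq_cons; exact.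
  by rewrite tsz_cons; lia.
have L2 k m r s1 s2 s3 : runs p2 (code (enc m) ++ r, s1, s2, nseq k tick ++ mark :: s3)
    (code (enc (k + m)) ++ r, s1, s2, mark :: s3) (5 * k + 1).
  elim: k m => [|k IH] m; first exact: runs_whileF.
  apply: runsW.
    apply: (runs_whileT (k := 3) (b := 1 + (1 + 1))) => //.
      apply: runs_seq; first exact: runs_do.
      by apply: runs_seq; exact: runs_do.
    by have := IH m.+1; rewrite addnS; exact.
  by lia.
apply: (PTI (p := seqs [:: Do (Push 3 mark); p1; p2; Do (Pop 3)])
  (g := fun s => s.*2.+1) (h := fun s => 1 + (11 * s + 1 + ((5 * s + 1) + 1)))).
- have [c Hc] : pbounded (fun s => 2 * s + 1) by pb.
  by exists c => x; apply: leq_trans (Hc x); lia.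
- by pb.
- by move=> l; rewrite tsz_nat /= ltnS leq_double size_tsz.
move=> l r s1 s2 s3; apply: runs_seq; first exact: runs_do.
apply: runs_seq; first exact: L1.
apply: runs_seq.
  apply: runsW; first by have := L2 (size l) 0 r s1 s2 s3; rewrite addn0; apply.
  by rewrite leq_add2r leq_mul2l size_tsz orbT.
exact: runs_do.
Qed.

Lemma PT_mkseq (f : A -> nat -> B) (n : A -> nat) :
  PT n -> PT (fun p : A * nat => f p.1 p.2) -> PT (fun x => mkseq (f x) (n x)).
Proof.
move=> Hn Hf.
pose step x (st : nat * seq B) := (st.1.-1, f x st.1.-1 :: st.2).
have E x k i l : k <= i -> iter k (step x) (i, l) =
    (i - k, [seq f x j | j <- iota (i - k) k] ++ l).
  elim: k => [|k IH] Hk; first by rewrite subn0.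
  rewrite iterS IH /step /=; last lia.
  have -> : (i - k).-1 = i - k.+1 by lia.
  have -> : i - k = (i - k.+1).+1 by lia.
  by [].
apply: (PT_eq (f := fun x => (iter (n x) (step x) (n x, [::])).2)).
  by move=> x; rewrite E // subnn cats0.
apply: PT_snd; apply: PT_iter => //.
- by apply: PT_pair => //; apply: PT_const.
- by rewrite /step; pt.
have [a Ha] := PT_size Hn; have [c Hc] := PT_size Hf.
have [d Hd] : pbounded (fun s => (bnd a s + ((bnd a s) * (bnd c (s + bnd a s).+1).+1).+1).+1) by pb.
exists d => x k Hk; apply: leq_trans (Hd _).
have Hnx : n x <= bnd a (tsz x) by have := Ha x; rewrite tsz_nat; lia.
rewrite E // cats0 tsz_pair ltnS leq_add //.
  by apply: leq_trans (Ha x); rewrite !tsz_nat; lia.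
apply: leq_trans (tsz_seq_le (M := bnd c (tsz x + bnd a (tsz x)).+1) _) _.
  move=> i b; rewrite size_map size_iota => Hi.
  rewrite (nth_map 0) ?size_iota // nth_iota //.
  apply: leq_trans (Hc (x, _)) _; apply: bnd_mono => //.
  rewrite tsz_pair ltnS leq_add2l; apply: leq_trans (Ha x); rewrite !tsz_nat; lia.
by rewrite size_map size_iota ltnS leq_mul2r; apply/orP; right; lia.
Qed.

End SeqOps.

Section Sums.
Context {A : Type} {EA : Enc A}.

Lemma PT_sumn (s : A -> seq nat) : PT s -> PT (fun x => sumn (s x)).
Proof.
move=> Hs; apply: (PT_comp (g := sumn)) Hs.
pose step (l0 : seq nat) (st : seq nat * nat) := (behead st.1, head 0 st.1 + st.2).
have E l : iter (size l) (step l) (l, 0) = ([::], sumn l).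
  suff H t k u : size t = k -> iter k (step u) (t, sumn l - sumn t) = ([::], sumn l - sumn t + sumn t).
    by have := H l _ l erefl; rewrite subnn.
  elim: k t u (sumn l - sumn t) => [|k IH] [|a t] u m //= Ht; rewrite ?addn0 //.
  by case: Ht => Ht; rewrite -iterS iterSr /= (IH t u (a + m) Ht); congr pair; lia.
apply: (PT_eq (f := fun l => (iter (size l) (step l) (l, 0)).2)).
  by move=> l; rewrite E.
apply: PT_snd; apply: PT_iter.
- by apply: PT_size_seq; apply: PT_id.
- by apply: PT_pair PT_id _; apply: PT_const.
- apply: PT_pair; first by apply: PT_behead; apply: PT_fst (PT_snd PT_id).
  by apply: PT_addn; [apply: PT_head; apply: PT_fst (PT_snd PT_id) | apply: PT_snd (PT_snd PT_id)].
have [d Hd] : pbounded (fun s => s + 2) by pb.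
exists d => l k _; apply: leq_trans (Hd _).
have H : tsz (iter k (step l) (l, 0)).1 + (iter k (step l) (l, 0)).2.*2 <= tsz l.
  elim: k => [|k IH] /=; first by rewrite addn0.
  apply: leq_trans IH; case: (iter _ _ _) => -[|a u] v //=.
  by rewrite tsz_cons tsz_nat; lia.
by case: (iter _ _ _) H => u v /= H; rewrite tsz_pair tsz_nat addnS addn2 !ltnS.
Qed.

Lemma sumn_mkseq (F : nat -> nat) n : sumn (mkseq F n) = \sum_(i < n) F i.
Proof. by rewrite sumnE big_map -(big_mkord xpredT F) /index_iota subn0. Qed.

Lemma PT_sum (F : A -> nat -> nat) (n : A -> nat) : PT n ->
  PT (fun p : A * nat => F p.1 p.2) -> PT (fun x => \sum_(i < n x) F x i).
Proof.
move=> Hn HF; apply: (PT_eq (f := fun x => sumn (mkseq (F x) (n x)))).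
  by move=> x; rewrite sumn_mkseq.
by apply: PT_sumn; apply: PT_mkseq.
Qed.

(* Bounded quantification and search. *)
Definition alln n (P : nat -> bool) := \sum_(i < n) ~~ P i == 0.
Lemma allnP n (P : nat -> bool) : reflect (forall i, i < n -> P i) (alln n P).
Proof.
rewrite /alln sum_nat_eq0; apply: (iffP forallP) => H i => [Hi|].
  by have := H (Ordinal Hi); rewrite implyTb; case: (P _).
by apply/implyP => _; rewrite H.
Qed.
(** An index contributes 1 when [P] fails at it and at everything before it, so the sum is the least
    witness if there is one. *)
Definition findn n (P : nat -> bool) := \sum_(i < n) alln i.+1 (fun j => ~~ P j).

Lemma findn_P n (P : nat -> bool) : (exists2 i, i < n & P i) -> findn n P < n /\ P (findn n P).
Proof.
move=> [i0 Hi0 Pi0].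
have ex : exists i, P i by exists i0.
pose m := ex_minn ex; have [Pm lem] : P m /\ forall i, P i -> m <= i by rewrite /m; case: ex_minnP.
suff -> : findn n P = m by split=> //; apply: leq_ltn_trans (lem _ Pi0) Hi0.
have mn : m <= n by apply: leq_trans (lem _ Pi0) (ltnW Hi0).
rewrite /findn -(big_mkord xpredT (fun i => alln i.+1 (fun j => ~~ P j) : nat)) (big_cat_nat (leq0n m) mn) /=.
rewrite [X in X + _](eq_big_nat _ _ (F2 := fun=> 1)); last first.
  move=> i /andP [_ Hi]; apply/eqP; rewrite eqb1; apply/allnP => j Hj; apply/negP => /lem; lia.
rewrite [X in _ + X](eq_big_nat _ _ (F2 := fun=> 0)); last first.
  move=> i /andP [Hi _]; apply/eqP; rewrite eqb0; apply/negP => /allnP /(_ m).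
  by rewrite Pm ltnS => /(_ Hi).
by rewrite !sum_nat_const_nat muln0 addn0 muln1 subn0.
Qed.

Lemma PT_alln (P : A -> nat -> bool) (n : A -> nat) : PT n ->
  PT (fun p : A * nat => P p.1 p.2) -> PT (fun x => alln (n x) (P x)).
Proof.
move=> Hn HP; apply: PT_eq0; apply: (PT_sum (F := fun x i => ~~ P x i)) => //.
by apply: PT_natb; apply: PT_negb.
Qed.

End Sums.

Lemma PT_findn {A} {EA : Enc A} (P : A -> nat -> bool) (n : A -> nat) : PT n ->
  PT (fun p : A * nat => P p.1 p.2) -> PT (fun x => findn (n x) (P x)).
Proof.
move=> Hn HP.
apply: (PT_sum (F := fun x i => alln i.+1 (fun j => ~~ P x j))) => //.
apply: PT_natb; apply: (PT_alln (P := fun x j => ~~ P x.1 j)).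
  by apply: PT_S; apply: PT_snd PT_id.
by apply: PT_negb; pt.
Qed.

(** * Binary arithmetic in polynomial time *)

Lemma PT_enc {A B C} {EA : Enc A} {EB : Enc B} {EC : Enc C} (f : A -> B) (g : A -> C) :
  PT f -> (forall x, enc (f x) = enc (g x)) -> PT g.
Proof. by move=> [p [c H]] E; exists p, c => x; rewrite /tsz -E; exact: H. Qed.

Lemma PT_bool3 {A} {EA : Enc A} (d : bool -> bool -> bool -> bool) (a b c : A -> bool) :
  PT a -> PT b -> PT c -> PT (fun x => d (a x) (b x) (c x)).
Proof.
move=> Ha Hb Hc; apply: (PT_eq (f := fun x =>
  if a x then if b x then if c x then d true true true else d true true false
    else if c x then d true false true else d true false false
  else if b x then if c x then d false true true else d false true false
    else if c x then d false false true else d false false false)).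
  by move=> x; case: (a x); case: (b x); case: (c x).
by pt.
Qed.

Lemma tsz_bits_le (s : seq bool) : tsz s <= 4 * size s + 1.
Proof. by elim: s => // b s IH; rewrite tsz_cons /=; have := tsz_bool b; lia. Qed.
Lemma tsz_bits_ge (s : seq bool) : 2 * size s + 1 <= tsz s.
Proof. by elim: s => // b s IH; rewrite tsz_cons /=; have := @tsz_gt0 bool enc_bool b; lia. Qed.

Section SerialPT.
Variables d o : bool -> bool -> bool -> bool.
Definition serial_step (st : bool * (seq bool * (seq bool * seq bool))) :=
  let x := head false st.2.1 in let y := head false st.2.2.1 in
  (d st.1 x y, (behead st.2.1, (behead st.2.2.1, o st.1 x y :: st.2.2.2))).

Lemma iter_serial k c s t acc :
  let st := iter k serial_step (c, (s, (t, acc))) in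
  st.1 = carry d k c s t /\ st.2.2.2 = catrev (serial d o k c s t) acc.
Proof. by elim: k c s t acc => // k IH c s t acc; rewrite iterSr; apply: IH. Qed.

Lemma PT_serial_iter {A} {EA : Enc A} (k : A -> nat) (s t : A -> seq bool) :
  PT k -> PT s -> PT t ->
  PT (fun x => iter (k x) serial_step (false, (s x, (t x, [::])))).
Proof.
move=> Hk Hs Ht.
apply: (PT_iter_add (f := fun _ => serial_step)) => //; first by pt.
  rewrite /serial_step; pt; apply: PT_bool3; pt.
exists 3 => x [c [u [v w]]]; rewrite /serial_step /= !(tsz_pair, tsz_cons).
set a := tsz (d _ _ _); set b := tsz (o _ _ _).
have Ha : a <= 3 by exact: tsz_bool. have Hb : b <= 3 by exact: tsz_bool.
have := @tsz_gt0 bool enc_bool c; have := @tsz_behead bool enc_bool u; have := @tsz_behead bool enc_bool v.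
have : 8 <= bnd 3 (tsz x) by apply: (@bnd_mono 3 3 0).
lia.
Qed.
End SerialPT.

Section BitsPT.
Context {A : Type} {EA : Enc A}.

Lemma PT_rnorm (s : A -> seq bool) : PT s -> PT (fun x => rnorm (s x) [::]).
Proof.
move=> Hs; pose step (st : seq bool * seq bool) :=
  (behead st.1, let b := head false st.1 in if b || ~~ nilp st.2 then b :: st.2 else st.2).
have E a r : iter (size a) step (a, r) = ([::], rnorm a r).
  by elim: a r => // b a IH r; rewrite [size _]/= iterSr IH.
apply: (PT_eq (f := fun x => (iter (size (s x)) step (s x, [::])).2)).
  by move=> x; rewrite E.
apply: PT_snd; apply: (PT_iter_add (f := fun _ => step)).
- exact: PT_size_seq.
- by pt.
- by rewrite /step; pt; apply: PT_orb; pt; apply: PT_negb; pt.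
exists 3 => x [u v]; rewrite /step /= !tsz_pair.
have Hw b : tsz (if b || ~~ nilp v then b :: v else v) <= tsz v + 4.
  by case: ifP => _; rewrite ?tsz_cons; have := tsz_bool b; lia.
have := Hw (head false u); have := @tsz_behead bool enc_bool u.
have : 8 <= bnd 3 (tsz x) by apply: (@bnd_mono 3 3 0).
lia.
Qed.

Lemma PT_addB (s t : A -> seq bool) : PT s -> PT t -> PT (fun x => addB (s x) (t x)).
Proof.
move=> Hs Ht; apply: (PT_eq (f := fun x => rnorm
  (iter (size (s x) + size (t x)).+1 (serial_step add_carry add_out) (false, (s x, (t x, [::])))).2.2.2 [::])).
  by move=> x; rewrite /addB; have [_ ->] := iter_serial add_carry add_out (size (s x) + size (t x)).+1 false (s x) (t x) [::].
apply: PT_rnorm; apply: PT_snd; apply: PT_snd; apply: PT_snd.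
by apply: PT_serial_iter => //; apply: PT_S; apply: PT_addn; apply: PT_size_seq.
Qed.

Lemma PT_subB (s t : A -> seq bool) : PT s -> PT t -> PT (fun x => subB (s x) (t x)).
Proof.
move=> Hs Ht; apply: (PT_eq (f := fun x => rnorm
  (iter (size (s x) + size (t x)) (serial_step sub_carry add_out) (false, (s x, (t x, [::])))).2.2.2 [::])).
  by move=> x; rewrite /subB; have [_ ->] := iter_serial sub_carry add_out (size (s x) + size (t x)) false (s x) (t x) [::].
apply: PT_rnorm; apply: PT_snd; apply: PT_snd; apply: PT_snd.
by apply: PT_serial_iter => //; apply: PT_addn; apply: PT_size_seq.
Qed.

Lemma PT_ltB (s t : A -> seq bool) : PT s -> PT t -> PT (fun x => ltB (s x) (t x)).
Proof.
move=> Hs Ht; apply: (PT_eq (f := fun x =>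
  (iter (size (s x) + size (t x)) (serial_step sub_carry add_out) (false, (s x, (t x, [::])))).1)).
  by move=> x; rewrite /ltB; have [-> _] := iter_serial sub_carry add_out (size (s x) + size (t x)) false (s x) (t x) [::].
apply: PT_fst.
by apply: PT_serial_iter => //; apply: PT_addn; apply: PT_size_seq.
Qed.
End BitsPT.

(** Shift and add. Doubling leaves the empty numeral alone, since a digit in front of it would be a
    leading zero. *)
Definition mul_step (st : seq bool * (seq bool * seq bool)) :=
  let: b := st.2.1 in
  (behead st.1, (if nilp b then b else false :: b,
     if head false st.1 then addB st.2.2 b else st.2.2)).
Definition mulB s t := (iter (size s) mul_step (s, (t, [::]))).2.2.

Lemma mul_stepP m n j : exists2 a, m %/ 2 ^ j * (n * 2 ^ j) + a = m * n &
  iter j mul_step (bits m, (bits n, bits 0)) = (bits (m %/ 2 ^ j), (bits (n * 2 ^ j), bits a)).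
Proof.
elim: j => [|j [a E IH]]; first by exists 0; rewrite ?expn0 ?divn1 ?muln1 ?addn0.
rewrite iterS IH /mul_step /= bits_half bits_odd expnS mul2n.
set q := m %/ 2 ^ j; set p := n * 2 ^ j.
have -> : m %/ (2 ^ j).*2 = q./2 by rewrite -muln2 divnMA divn2.
have Ed : (if nilp (bits p) then bits p else false :: bits p) = bits p.*2.
  case: (posnP p) => [->|Hp] //.
  have := @bits_double false p; rewrite add0n double_gt0 => -> //.
  by case Eb: (bits p) => //; move: Hp; rewrite -(bval_bits p) Eb.
rewrite Ed.
exists (a + odd q * p).
  by rewrite -E -/q -/p -{2}(odd_double_half q) -doubleMr -/p; nia.
by case: (odd q) => /=; rewrite -doubleMr ?mul1n ?addBP ?mul0n ?addn0.
Qed.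

Lemma mulBP m n : mulB (bits m) (bits n) = bits (m * n).
Proof.
have [a E H] := mul_stepP m n (blen m).
rewrite /mulB -[X in iter X](erefl : blen m = _) -[[::]]/(bits 0) H /=.
by move: E; rewrite divn_small ?blen_lt // mul0n add0n => ->.
Qed.

(** * Integers in binary with a sign *)

#[export] Instance enc_int : Enc int := fun z => enc ((z < 0)%R, bits (absz z)).

Section IntPT.
Context {A : Type} {EA : Enc A}.
Implicit Types (z w : A -> int).

Lemma PT_neg z : PT z -> PT (fun x => z x < 0)%R.
Proof. by move=> H; apply: (PT_fst (f := fun x => ((z x < 0)%R, bits (absz (z x))))); apply: PT_enc H _. Qed.
Lemma PT_mag z : PT z -> PT (fun x => bits (absz (z x))).
Proof. by move=> H; apply: (PT_snd (f := fun x => ((z x < 0)%R, bits (absz (z x))))); apply: PT_enc H _. Qed.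
Lemma PT_int z (s : A -> bool) (a : A -> seq bool) : PT s -> PT a ->
  (forall x, (z x < 0)%R = s x /\ bits (absz (z x)) = a x) -> PT z.
Proof.
move=> Hs Ha E; apply: (PT_enc (PT_pair Hs Ha)) => x.
by have [E1 E2] := E x; rewrite [RHS]/enc /enc_int E1 E2.
Qed.

Lemma bits_eq0 n : nilp (bits n) = (n == 0).
Proof.
apply/idP/eqP => [/nilP E|-> //]; by rewrite -(bval_bits n) E.
Qed.

Lemma PT_addz z w : PT z -> PT w -> PT (fun x => z x + w x)%R.
Proof.
move=> Hz Hw.
have Sz := PT_neg Hz; have Sw := PT_neg Hw; have Mz := PT_mag Hz; have Mw := PT_mag Hw.
apply: (PT_int (s := fun x => if (z x < 0)%R == (w x < 0)%R then (z x < 0)%R else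
   if ltB (bits `|z x|) (bits `|w x|) then (w x < 0)%R else (z x < 0)%R && ltB (bits `|w x|) (bits `|z x|))
  (a := fun x => if (z x < 0)%R == (w x < 0)%R then addB (bits `|z x|) (bits `|w x|) else
   if ltB (bits `|z x|) (bits `|w x|) then subB (bits `|w x|) (bits `|z x|)
   else subB (bits `|z x|) (bits `|w x|))).
- apply: PT_if; [by apply: PT_eqb | by [] |]; apply: PT_if => //; first exact: PT_ltB.
  by apply: PT_andb => //; apply: PT_ltB.
- apply: PT_if; [by apply: PT_eqb | by apply: PT_addB |]; apply: PT_if => //; first exact: PT_ltB.
    exact: PT_subB.
  exact: PT_subB.
move=> x; move: (z x) (w x) => u v; rewrite !ltBP addBP; clear.
case: eqP => E; first by split; [lia | congr bits; lia].
case: ltnP => L; first by rewrite subBP ?(ltnW L) //; split; [lia | congr bits; lia].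
by rewrite subBP //; split; [lia | congr bits; lia].
Qed.

Lemma PT_oppz z : PT z -> PT (fun x => - z x)%R.
Proof.
move=> Hz; have Sz := PT_neg Hz; have Mz := PT_mag Hz.
apply: (PT_int (s := fun x => ~~ (z x < 0)%R && ~~ nilp (bits (absz (z x)))) (a := fun x => bits (absz (z x)))) => //.
  by apply: PT_andb; apply: PT_negb => //; apply: PT_nilp.
by move=> x; rewrite abszN bits_eq0; split => //; lia.
Qed.

Lemma PT_mulB (s t : A -> nat) : PT (fun x => bits (s x)) -> PT (fun x => bits (t x)) ->
  PT (fun x => bits (s x * t x)).
Proof.
move=> Hs Ht; apply: (PT_eq (f := fun x => (iter (size (bits (s x))) mul_step (bits (s x), (bits (t x), [::]))).2.2)).
  by move=> x; rewrite -mulBP.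
apply: PT_snd; apply: PT_snd; apply: (PT_iter (f := fun _ => mul_step)).
- exact: PT_size_seq.
- by pt.
- by rewrite /mul_step; pt; apply: PT_addB; pt.
have [a Ha] := PT_size Hs; have [b Hb] := PT_size Ht.
have [d Hd] : pbounded (fun s => (4 * bnd a s + 1 + (4 * (bnd b s + bnd a s) + 1 + (4 * (bnd a s + bnd b s) + 1)).+1).+1) by pb.
exists d => x k Hk; apply: leq_trans (Hd _).
have [c E ->] := mul_stepP (s x) (t x) k.
have As : blen (s x) <= bnd a (tsz x).
  by apply: leq_trans (Ha x); apply: leq_trans (tsz_bits_ge _); rewrite /blen; lia.
have Bt : blen (t x) <= bnd b (tsz x).
  by apply: leq_trans (Hb x); apply: leq_trans (tsz_bits_ge _); rewrite /blen; lia.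
have H1 : blen (s x %/ 2 ^ k) <= bnd a (tsz x) by apply: leq_trans (blen_mono (leq_div _ _)) As.
have H2 : blen (t x * 2 ^ k) <= bnd b (tsz x) + bnd a (tsz x).
  rewrite blen_le expnD; apply: leq_trans (_ : 2 ^ blen (t x) * 2 ^ k <= _).
    by rewrite ltn_pmul2r ?expn_gt0 // blen_lt.
  by rewrite leq_mul // leq_exp2l //; apply: leq_trans As.
have H3 : blen c <= bnd a (tsz x) + bnd b (tsz x).
  apply: leq_trans (blen_mono (_ : c <= s x * t x)) _; first by rewrite -E leq_addl.
  by apply: leq_trans (blen_mul _ _) _; apply: leq_add.
rewrite !tsz_pair ltnS; apply: leq_add.
  by apply: leq_trans (tsz_bits_le _) _; rewrite leq_add2r leq_mul2l H1 orbT.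
rewrite ltnS; apply: leq_add.
  by apply: leq_trans (tsz_bits_le _) _; rewrite leq_add2r leq_mul2l H2 orbT.
by apply: leq_trans (tsz_bits_le _) _; rewrite leq_add2r leq_mul2l H3 orbT.
Qed.

Lemma PT_mulz z w : PT z -> PT w -> PT (fun x => z x * w x)%R.
Proof.
move=> Hz Hw.
have Sz := PT_neg Hz; have Sw := PT_neg Hw; have Mz := PT_mag Hz; have Mw := PT_mag Hw.
have M := PT_mulB Mz Mw.
apply: (PT_int (s := fun x => ((z x < 0)%R (+) (w x < 0)%R) && ~~ nilp (bits (absz (z x) * absz (w x)))) (a := fun x => bits (absz (z x) * absz (w x)))) => //.
  by apply: PT_andb; [apply: PT_addb | apply: PT_negb; apply: PT_nilp].
move=> x; rewrite abszM bits_eq0; split=> //; clear.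
by move: (z x) (w x) => u v; nia.
Qed.

Lemma PT_lez z w : PT z -> PT w -> PT (fun x => z x <= w x)%R.
Proof.
move=> Hz Hw; apply: (PT_eq (f := fun x => ~~ (w x + - z x < 0)%R)).
  by move=> x; lia.
by apply: PT_negb; apply: PT_neg; apply: PT_addz => //; apply: PT_oppz.
Qed.
Lemma PT_ltz z w : PT z -> PT w -> PT (fun x => z x < w x)%R.
Proof.
move=> Hz Hw; apply: (PT_eq (f := fun x => (z x + - w x < 0)%R)).
  by move=> x; lia.
by apply: PT_neg; apply: PT_addz => //; apply: PT_oppz.
Qed.

Lemma tsz_int_le (z : int) : tsz z <= 4 * blen `|z| + 5.
Proof. by rewrite /tsz /enc /enc_int -/(tsz _) tsz_pair; have := tsz_bits_le (bits `|z|); have := tsz_bool (z < 0)%R; rewrite /blen; lia. Qed.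
Lemma tsz_int_ge (z : int) : 2 * blen `|z| <= tsz z.
Proof. by rewrite /tsz /enc /enc_int -/(tsz _) tsz_pair; have := tsz_bits_ge (bits `|z|); rewrite /blen; lia. Qed.
Lemma tsz_int_mono (z w : int) : `|z| <= `|w| -> tsz z <= 2 * tsz w + 5.
Proof. by move=> /blen_mono H; apply: leq_trans (tsz_int_le z) _; have := tsz_int_ge w; lia. Qed.
End IntPT.

Section IntPT2.
Context {A : Type} {EA : Enc A}.

Lemma PT_Posz (n : A -> nat) : PT n -> PT (fun x => n x : int).
Proof.
move=> Hn; apply: (PT_eq (f := fun x => iter (n x) (fun z => z + 1)%R (0 : int))).
  by move=> x; elim: (n x) => //= k ->; rewrite intS addrC.
apply: PT_iter => //; [by pt | by apply: PT_addz; pt |].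
have [a Ha] := PT_size Hn.
have [d Hd] : pbounded (fun s => 4 * bnd a s + 5) by pb.
exists d => x k Hk; apply: leq_trans (Hd _).
have -> : iter k (fun z => z + 1)%R (0 : int) = k.
  by elim: k {Hk} => //= k ->; rewrite intS addrC.
apply: leq_trans (tsz_int_le _) _; rewrite leq_add2r leq_mul2l; apply/orP; right.
apply: leq_trans (blen_leq _) _; apply: leq_trans Hk _.
by apply: leq_trans (Ha x); rewrite tsz_nat; lia.
Qed.

(** The exponent is unary, so the power has polynomially many bits. *)
Lemma PT_expz (z : A -> int) (n : A -> nat) : PT z -> PT n -> PT (fun x => z x ^+ n x)%R.
Proof.
move=> Hz Hn; apply: (PT_eq (f := fun x => iter (n x) (fun u => u * z x)%R (1 : int))).
  by move=> x; elim: (n x) => //= k ->; rewrite exprSr.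
apply: (PT_iter (f := fun x u => u * z x)%R) => //; [by pt | by apply: PT_mulz; pt |].
have [a Ha] := PT_size Hn; have [b Hb] := PT_size Hz.
have [d Hd] : pbounded (fun s => 4 * (1 + bnd a s * bnd b s) + 5) by pb.
exists d => x k Hk; apply: leq_trans (Hd _).
apply: leq_trans (tsz_int_le _) _; rewrite leq_add2r leq_mul2l; apply/orP; right.
apply: (@leq_trans (1 + k * blen `|z x|)).
  elim: k {Hk} => //= k IH; rewrite abszM; apply: leq_trans (blen_mul _ _) _; lia.
rewrite leq_add2l leq_mul //.
  by apply: leq_trans Hk _; apply: leq_trans (Ha x); rewrite tsz_nat; lia.
by apply: leq_trans (Hb x); have := tsz_int_ge (z x); lia.
Qed.

Lemma abszD (a b : int) : absz (a + b)%R <= absz a + absz b.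
Proof. lia. Qed.

Definition sumz (n : nat) (F : nat -> int) : int := (\sum_(i < n) F i)%R.

Lemma PT_sumz (F : A -> nat -> int) (n : A -> nat) : PT n ->
  PT (fun p : A * nat => F p.1 p.2) -> PT (fun x => sumz (n x) (F x)).
Proof.
move=> Hn HF.
pose step (x : A) (F : nat -> int) (st : nat * int) := (st.1.+1, st.2 + F st.1)%R.
have E x k : iter k (step x (F x)) (0, 0%R) = (k, \sum_(i < k) F x i)%R.
  by elim: k => [|k IH]; rewrite ?big_ord0 //= IH /step /= big_ord_recr.
apply: (PT_eq (f := fun x => (iter (n x) (step x (F x)) (0, 0%R)).2)).
  by move=> x; rewrite E.
apply: PT_snd; apply: (PT_iter (f := fun x => step x (F x))) => //; first by pt.
  by rewrite /step; pt; apply: PT_addz; pt.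
have [a Ha] := PT_size Hn; have [b Hb] := PT_size HF.
have [d Hd] : pbounded (fun s => (bnd a s + (4 * (bnd a s + bnd b (s + bnd a s).+1) + 5)).+1) by pb.
exists d => x k Hk; apply: leq_trans (Hd _).
have Hnx : tsz k <= bnd a (tsz x) by apply: leq_trans (Ha x); rewrite !tsz_nat; lia.
rewrite E tsz_pair ltnS; apply: leq_add => //.
apply: leq_trans (tsz_int_le _) _; rewrite leq_add2r leq_mul2l; apply/orP; right.
apply: (@leq_trans (k + bnd b (tsz x + bnd a (tsz x)).+1)); last by rewrite leq_add2r; move: Hnx; rewrite tsz_nat; lia.
set M := bnd b _.
have HM i : i < k -> blen `|F x i| <= M.
  move=> Hi; have := Hb (x, i); have := tsz_int_ge (F x i); rewrite /= => H1 H2.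
  have : bnd b (tsz (x, i)) <= M.
    by apply: bnd_mono => //; rewrite tsz_pair ltnS leq_add2l; apply: leq_trans Hnx; rewrite !tsz_nat; lia.
  lia.
rewrite blen_le.
have S : absz (\sum_(i < k) F x i)%R <= k * (2 ^ M).-1.
  elim: k HM {Hk Hnx} => [|k IH] HM; first by rewrite big_ord0.
  rewrite big_ord_recr /=; have := IH (fun i Hi => HM i (ltnW Hi)).
  have := HM k (ltnSn k); rewrite blen_le mulSn.
  move=> H1 H2; apply: leq_trans (abszD _ _) _.
  by rewrite addnC leq_add // -ltnS prednK ?expn_gt0.
apply: leq_ltn_trans S _; rewrite expnD.
have := ltn_expl k (isT : 1 < 2); have : 0 < 2 ^ M by rewrite expn_gt0.
move: (2 ^ k) (2 ^ M) => u v; nia.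
Qed.
End IntPT2.

(** * From polynomial-time functions on words to Turing machines *)

#[export] Instance enc_option A {EA : Enc A} : Enc (option A) :=
  fun o => if o is Some a then Nd Lf (enc a) else Lf.
#[export] Instance enc_letter : Enc letter := @enc_option bool _.

Definition nonempty : pred (option sym) := isSome.
Definition load_letter :=
  If 1 (is_ (inl None)) (seqs [:: Do (Pop 1); Do (Push 0 sL); Do (Push 0 sN)])
    (If 1 (is_ (inl (Some false)))
      (seqs [:: Do (Pop 1); Do (Push 0 sL); Do (Push 0 sL); Do (Push 0 sN); Do (Push 0 sN)])
      (seqs [:: Do (Pop 1); Do (Push 0 sL); Do (Push 0 sL); Do (Push 0 sN); Do (Push 0 sL); Do (Push 0 sN); Do (Push 0 sN)])).
Definition load := seqs [:: While 0 nonempty (Do (Move true 0 1)); Do (Push 0 sL);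
  While 1 nonempty load_letter].

Lemma loadP (w : seq letter) s2 s3 :
  runs load ([seq inl a | a <- w], [::], s2, s3) (code (enc w), [::], s2, s3) (15 * size w + 3).
Proof.
have L1 u (v : seq sym) : runs (While 0 nonempty (Do (Move true 0 1))) (u, v, s2, s3)
    ([::], rev u ++ v, s2, s3) (3 * size u + 1).
  elim: u v => [|a u IH] v; first exact: runs_whileF.
  rewrite rev_cons cat_rcons.
  apply: runsW; first apply: (runs_whileT (k := 0) (b := 1) _ _ (IH (a :: v))) => //.
    exact: runs_do.
  by rewrite /=; nlia.
have L2 (u v : seq letter) : runs (While 1 nonempty load_letter)
    (code (enc v), [seq inl a | a <- u], s2, s3) (code (enc (catrev u v)), [::], s2, s3) (12 * size u + 1).
  elim: u v => [|a u IH] v; first exact: runs_whileF.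
  apply: runsW; first apply: (runs_whileT (k := 1) (b := 10) _ _ (IH (a :: v))) => //.
    case: a => [[]|].
    - apply: runs_ifF => //; apply: runs_ifF => //.
      apply: runsW; first do 6![apply: runs_seq; first exact: runs_do]; [exact: runs_do|by []].
    - apply: runs_ifF => //; apply: runsW; first apply: runs_ifT => //.
        do 4![apply: runs_seq; first exact: runs_do]; exact: runs_do.
      by [].
    apply: runsW; first apply: runs_ifT => //.
      do 2![apply: runs_seq; first exact: runs_do]; exact: runs_do.
    by [].
  by rewrite /=; nlia.
apply: runsW.
  apply: runs_seq; first exact: L1.
  apply: runs_seq; first exact: runs_do.
  by have := L2 (rev w) [::]; rewrite map_rev cats0 catrevE revK cats0; apply.
by rewrite size_map size_rev; nlia.
Qed.

Definition unload_letter := Seq (Do (Pop 0))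
  (If 0 (is_ sN) (seqs [:: Do (Pop 0); Do (Pop 0);
      If 0 (is_ sN) (seqs [:: Do (Pop 0); Do (Pop 0); Do (Pop 0); Do (Push 1 (inl (Some true)))])
        (seqs [:: Do (Pop 0); Do (Push 1 (inl (Some false)))])])
    (seqs [:: Do (Pop 0); Do (Push 1 (inl None))])).
Definition unload := seqs [:: While 0 (is_ sN) unload_letter; Do (Pop 0);
  While 1 nonempty (Do (Move true 1 0))].

Lemma unloadP (w : seq letter) s2 s3 :
  runs unload (code (enc w), [::], s2, s3) ([seq inl a | a <- w], [::], s2, s3) (19 * size w + 3).
Proof.
have L1 (u v : seq sym) : runs (While 1 nonempty (Do (Move true 1 0))) (v, u, s2, s3)
    (rev u ++ v, [::], s2, s3) (3 * size u + 1).
  elim: u v => [|a u IH] v; first exact: runs_whileF.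
  rewrite rev_cons cat_rcons.
  apply: runsW; first apply: (runs_whileT (k := 1) (b := 1) _ _ (IH (a :: v))) => //.
    exact: runs_do.
  by rewrite /=; nlia.
have L2 (u v : seq letter) : runs (While 0 (is_ sN) unload_letter)
    (code (enc u), [seq inl a | a <- v], s2, s3) ([:: sL], [seq inl a | a <- catrev u v], s2, s3) (16 * size u + 1).
  elim: u v => [|a u IH] v; first exact: runs_whileF.
  apply: runsW; first apply: (runs_whileT (k := 0) (b := 14) _ _ (IH (a :: v))) => //.
  - case: a => [[]|].
    + apply: runsW; first apply: runs_seq; [exact: runs_do|apply: runs_ifT => //|].
        do 2![apply: runs_seq; first exact: runs_do].
        apply: runs_ifT => //; do 3![apply: runs_seq; first exact: runs_do]; exact: runs_do.
      by [].
    + apply: runsW; first apply: runs_seq; [exact: runs_do|apply: runs_ifT => //|].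
        do 2![apply: runs_seq; first exact: runs_do].
        apply: runs_ifF => //; apply: runs_seq; exact: runs_do.
      by [].
    apply: runsW; first apply: runs_seq; [exact: runs_do|apply: runs_ifF => //|].
      apply: runs_seq; exact: runs_do.
    by [].
  by rewrite /=; nlia.
apply: runsW.
  apply: runs_seq; first exact: (L2 w [::]).
  apply: runs_seq; first exact: runs_do.
  by have := L1 [seq inl a | a <- catrev w [::]] [::]; rewrite {2}catrevE !cats0 map_rev revK; apply.
by rewrite size_rev size_map; nlia.
Qed.

(** The input word is converted to the encoding of a list, transformed, and converted back. The time
    bound has the form [bnd d] of the input length, which is the value of the polynomial (X+2)^d. *)
Theorem PT_machine (f : seq letter -> seq letter) : PT f ->
  exists M : machine letter, exists p : {poly nat},
    forall w, outputs_within M w (p.[size w])%R (f w).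
Proof.
move=> [q [c Hq]].
have [M HM] := machine_of_prog (seqs [:: load; q; unload]).
have Hs (w : seq letter) : tsz w <= 6 * size w + 1.
  elim: w => [|a w IH] //; rewrite tsz_cons.
  have -> : size (a :: w) = (size w).+1 by [];
  have : tsz a <= 5 by case: a => [[]|]. 
  lia.
have [d Hd] : pbounded (fun s => 2 * (15 * s + 3 + (bnd c (6 * s + 1) + (19 * bnd c (6 * s + 1) + 3)))) by pb.
exists M, (('X + (2%:R)%:P) ^+ d)%R => w.
have R : runs (seqs [:: load; q; unload]) ([seq inl a | a <- w], [::], [::], [::])
    ([seq inl a | a <- f w], [::], [::], [::]) (15 * size w + 3 + (bnd c (6 * size w + 1) + (19 * bnd c (6 * size w + 1) + 3))).
  have B : bnd c (tsz w) <= bnd c (6 * size w + 1) by apply: bnd_mono.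
  apply: runs_seq; first exact: loadP.
  apply: runs_seq.
    by apply: runsW B; have := (Hq w).2 [::] [::] [::] [::]; rewrite !cats0; apply.
  apply: runsW; first exact: unloadP.
  rewrite leq_add2r leq_mul2l /=; apply: leq_trans (size_tsz _) _.
  by apply: leq_trans (Hq w).1 B.
have [n Hn E] := R.
apply: (HM _ _ _ _ _ _ _ E); rewrite horner_exp hornerD hornerX hornerC.
have -> : ((size w + 2%:R) ^+ d)%R = bnd d (size w).
  rewrite /bnd; elim: d {Hd} => // d IH; rewrite exprS IH expnS; congr (_ * _).
  by rewrite natn -[RHS]addn2.
by apply: leq_trans (Hd _); rewrite -mul2n leq_mul2l.
Qed.

(** * Weighted perfection: replication and complementation *)

Section Good.
Variable V : finType.
Implicit Types (e : rel V) (A B K S : {set V}) (w c : V -> nat).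

(** A clique of [e] is expressed as a stable set of [compl e], so that complementation merely
    exchanges two instances of one notion. *)
Definition stab e A := [forall u in A, forall v in A, (u != v) ==> ~~ e u v].
Definition compl e : rel V := fun u v => (u != v) && ~~ e u v.
Definition wt w A := \sum_(v in A) w v.

Lemma stabP e A : reflect {in A &, forall u v, u != v -> ~~ e u v} (stab e A).
Proof.
apply: (iffP forall_inP) => [H u v Hu Hv|H u Hu].
  by move/forall_inP: (H u Hu) => /(_ v Hv) /implyP.
by apply/forall_inP => v Hv; apply/implyP; apply: H.
Qed.

Lemma stab_sub e A B : A \subset B -> stab e B -> stab e A.
Proof.
by move=> /subsetP AB /stabP H; apply/stabP => u v /AB Hu /AB Hv; apply: H.
Qed.

Lemma stab_eq e e' A : {in A &, forall u v, u != v -> e u v = e' u v} -> stab e A -> stab e' A.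
Proof. by move=> E /stabP H; apply/stabP => u v Hu Hv uv; rewrite -E // H. Qed.

Lemma stab_complK e A : stab (compl (compl e)) A = stab e A.
Proof. by apply/idP/idP; apply: stab_eq => u v _ _ uv; rewrite /compl uv negbK. Qed.

Lemma stab1 e x : stab e [set x].
Proof. by apply/stabP => u v /set1P -> /set1P ->; rewrite eqxx. Qed.

Lemma stab0 e : stab e set0.
Proof. by apply/stabP => u v; rewrite inE. Qed.

Lemma stab_clique e A K : stab e A -> stab (compl e) K -> #|A :&: K| <= 1.
Proof.
move=> /stabP HA /stabP HK; apply/card_le1_eqP => u v /setIP [uA uK] /setIP [vA vK].
apply/eqP/negPn/negP => uv; have := HK v u vK uK uv.
by rewrite /compl uv HA.
Qed.

Definition mult (s : seq {set V}) v := count (fun A => v \in A) s.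

Lemma sum_mult (s : seq {set V}) w :
  \sum_v w v * mult s v = \sum_(A <- s) wt w A.
Proof.
elim: s => [|A s IH]; first by rewrite big_nil big1 // => v _; rewrite muln0.
rewrite big_cons -IH /wt [in RHS]big_mkcond -big_split /=; apply: eq_bigr => v _.
by rewrite mulnDr; case: (v \in A); rewrite ?muln1 ?muln0.
Qed.

Lemma wt_mult (s : seq {set V}) K : wt (mult s) K = \sum_(A <- s) #|A :&: K|.
Proof.
rewrite /wt big_mkcond (eq_bigr (fun v => (v \in K) * mult s v)); last first.
  by move=> v _; case: (v \in K); rewrite ?mul1n ?mul0n.
rewrite sum_mult; apply: eq_bigr => A _; rewrite /wt -big_mkcondr -sum1_card.
by rewrite [LHS]big_mkcond [RHS]big_mkcond; apply: eq_bigr => v _; rewrite inE; case: (v \in A).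
Qed.

Lemma wt_eq w w' A : {in A, w =1 w'} -> wt w A = wt w' A.
Proof. by move=> E; apply: eq_bigr. Qed.

(* Weighted perfection: [w] is covered by stable sets, as many as the weight
   of some clique. *)
Definition good e := forall w, exists s, [/\ all (stab e) s, mult s =1 w &
  exists2 K, stab (compl e) K & size s <= wt w K].

Definition dec w B v := w v - (v \in B).

Lemma wt_dec w B A : {in B, forall v, 0 < w v} -> wt (dec w B) A + #|A :&: B| = wt w A.
Proof.
move=> H; rewrite -sum1_card [X in _ + X](eq_bigl (fun v => (v \in A) && (v \in B))); last first.
  by move=> v; rewrite inE.
rewrite big_mkcondr -big_split /=; apply: eq_bigr => v _.
by rewrite /dec; case: ifP => [/H|]; lia.
Qed.

Lemma sum_wt w : \sum_v w v = wt w [set: V].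
Proof. by apply: eq_bigl => v; rewrite inE. Qed.

Lemma sum_dec w B x : {in B, forall v, 0 < w v} -> x \in B ->
  \sum_v dec w B v < \sum_v w v.
Proof.
move=> H xB; rewrite !sum_wt -[X in _ < X](wt_dec _ H) -[X in X < _]addn0 ltn_add2l setTI.
by apply/card_gt0P; exists x.
Qed.

Lemma sum_leq_size (s : seq {set V}) (F : {set V} -> nat) m :
  (forall A, A \in s -> F A <= m) -> \sum_(A <- s) F A <= size s * m.
Proof.
move=> H; apply: (@leq_trans (\sum_(A <- s) m)).
  by rewrite big_seq [X in _ <= X]big_seq; apply: leq_sum.
by rewrite big_const_seq count_predT iter_addn_0 mulnC.
Qed.

(* Lovász's replication lemma. *)
Lemma good_replication e :
  (forall U : {set V}, exists s, [/\ all (stab e) s, forall v, mult s v = (v \in U) &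
     exists K, [/\ K \subset U, stab (compl e) K & size s <= #|K|]]) ->
  good e.
Proof.
move=> H w; move: {2}(\sum_v w v) (leqnn (\sum_v w v)) => N.
elim: N w => [|N IH] w HN.
  exists [::]; split=> // [v|]; last by exists set0; rewrite ?stab0.
  by move: HN; rewrite (bigD1 v) //= leqn0 addn_eq0 => /andP [/eqP -> _].
have [/existsP [x wx]|/existsPn H1] := boolP [exists x, 1 < w x]; last first.
  have [s [Hs Hm [K [KU HK HsK]]]] := H [set v | w v == 1].
  exists s; split=> // [v|].
    by rewrite Hm inE; have := H1 v; case: (w v) => [|[]].
  exists K => //; apply: leq_trans HsK _; rewrite -sum1_card; apply: leq_sum => v vK.
  by have /subsetP/(_ v vK) := KU; rewrite inE => /eqP ->.
have Hx : {in [set x], forall v, 0 < w v} by move=> v /set1P ->; lia.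
(* Cover the weight with one copy of [x] removed. If some clique outweighs this cover, adding the
   singleton of [x] gives an optimal cover of [w]. *)
have [|s1 [Hs1 Hm1 [K1 HK1 Hk1]]] := IH (dec w [set x]).
  by rewrite -ltnS; apply: leq_trans HN; apply: (sum_dec Hx); rewrite inE.
have add_x K : stab (compl e) K -> size s1 < wt w K -> exists s, [/\ all (stab e) s, mult s =1 w &
    exists2 K, stab (compl e) K & size s <= wt w K].
  move=> HK Hk; exists ([set x] :: s1); split; [by rewrite /= stab1 | | by exists K].
  move=> v /=; rewrite Hm1 /dec inE; case: eqP => [->|] /=; lia.
have [/existsP [K /andP [HK Hk]]|/existsPn H2] := boolP [exists K, stab (compl e) K && (size s1 < wt w K)].
  exact: add_x HK Hk.
have Hle K : stab (compl e) K -> wt w K <= size s1.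
  by move=> HK; have := H2 K; rewrite HK /= -leqNgt.
(* Otherwise no clique outweighs [s1]; a member of [s1] through [x] is taken away from [w], and the
   rest is covered anew. *)
have [B Bs xB] : exists2 B, B \in s1 & x \in B.
  by apply/hasP; rewrite has_count -/(mult s1 x) Hm1 /dec inE eqxx /=; lia.
have Bw : {in B, forall v, 0 < w v}.
  move=> v vB; have : 0 < mult s1 v by rewrite -has_count; apply/hasP; exists B.
  by rewrite Hm1 /dec; lia.
have [|s2 [Hs2 Hm2 [K2 HK2 Hk2]]] := IH (dec w B).
  by rewrite -ltnS; apply: leq_trans HN; apply: (sum_dec Bw xB).
exists (B :: s2); split.
- by rewrite /= Hs2 andbT (allP Hs1).
- move=> v /=; rewrite Hm2 /dec; case: (boolP (v \in B)) => [/Bw|]; lia.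
exists K1 => //=.
have K1le : size s1 <= wt w K1 by apply: leq_trans Hk1 _; rewrite -(wt_dec K1 Hx) leq_addr.
(* If the new cover were no shorter than [s1], the clique [K2] would miss [B] and hence [x]. Then
   the other members of [s1] carry its whole weight, at most one vertex each, and they are one too
   few. *)
apply: leq_trans K1le; rewrite ltnNge; apply/negP => Hc.
have E2 := wt_dec K2 Bw; have L2 := Hle _ HK2.
have K2B : #|K2 :&: B| = 0 by lia.
have xK2 : x \notin K2.
  apply/negP => xK; have /eqP := K2B; rewrite cards_eq0 => /eqP/setP/(_ x).
  by rewrite !inE xK xB.
have Ew : wt w K2 = wt (mult s1) K2.
  apply: wt_eq => v vK; rewrite Hm1 /dec inE; case: eqP => [vx|]; last by rewrite subn0.
  by move: xK2; rewrite -vx vK.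
have : \sum_(A <- s1) #|A :&: K2| <= (size s1).-1.
  rewrite (perm_big _ (perm_to_rem Bs)) big_cons (setIC B) K2B -(size_rem Bs) -[X in _ <= X]muln1.
  apply: sum_leq_size => A As; apply: stab_clique HK2.
  by apply: (allP Hs1); apply: mem_rem As.
rewrite -wt_mult -Ew.
have : 0 < size s1 by case: (s1) Bs.
lia.
Qed.

Lemma wt_sub w A B : A \subset B -> wt w A <= wt w B.
Proof.
move=> AB; rewrite /wt [X in _ <= X](big_setID A) /= (setIidPr AB); exact: leq_addr.
Qed.

(* Lovász's weak perfect graph theorem: some clique meets every stable set of
   maximal weight, and it can be removed. *)
Lemma good_compl e : good e -> good (compl e).
Proof.
move=> He w; move: {2}(\sum_v w v) (leqnn (\sum_v w v)) => N.
elim: N w => [|N IH] w HN.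
  exists [::]; split=> // [v|]; last by exists set0; rewrite ?stab0.
  by move: HN; rewrite (bigD1 v) //= leqn0 addn_eq0 => /andP [/eqP -> _].
have [S0 HS0 Smax] : exists2 S0, stab e S0 & forall S, stab e S -> wt w S <= wt w S0.
  have := @arg_maxnP _ (set0 : {set V}) (stab e) (wt w) (stab0 e).
  by case=> S0 H1 H2; exists S0.
set a := wt w S0 in Smax.
have [a0|a_gt0] := posnP a.
  exists [::]; split=> // [v|]; last by exists set0; rewrite ?stab0.
  by have := Smax [set v] (stab1 _ _); rewrite a0 /wt big_set1 leqn0 => /eqP ->.
pose sup := [set v | 0 < w v].
have wt_sup S : wt w (S :&: sup) = wt w S.
  rewrite /wt [in RHS](big_setID sup) /= [X in _ = _ + X]big1 ?addn0 // => v.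
  by rewrite !inE -eqn0Ngt => /andP [/eqP ->].
pose T := enum [set S | [&& stab e S, wt w S == a & S \subset sup]].
have TP S : S \in T -> [/\ stab e S, wt w S = a & S \subset sup].
  by rewrite mem_enum inE => /and3P [? /eqP ? ?].
(* Goodness of [e] is applied to the weight that counts the maximum stable sets through each vertex.
   Comparing total weights shows that the cover has at least as many members as [T]; so does the
   weight of [K], and hence [K] meets every set of [T]. *)
have [s [Hs Hm [K HK Hk]]] := He (mult T).
have E1 : size T * a = \sum_(B <- s) wt w B.
  rewrite -sum_mult (eq_bigr (fun v => w v * mult T v)); last by move=> v _; rewrite Hm.
  rewrite sum_mult big_seq (eq_bigr (fun=> a)); last by move=> S /TP [].
  by rewrite -big_seq big_const_seq count_predT iter_addn_0 mulnC.
have L1 : size T <= size s.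
  rewrite -(leq_pmul2r a_gt0) E1; apply: sum_leq_size => B /(allP Hs); exact: Smax.
have hit S : S \in T -> S :&: K != set0.
  move=> ST; apply/negP => /eqP SK.
  have : size T <= \sum_(A <- T) #|A :&: K| by rewrite -wt_mult; apply: leq_trans Hk.
  rewrite (perm_big _ (perm_to_rem ST)) big_cons SK cards0 leqNgt => /negP; apply.
  apply: (@leq_ltn_trans (size (rem S T))); last by rewrite size_rem //; case: (T) ST.
  rewrite -[X in _ <= X]muln1; apply: sum_leq_size => A /mem_rem/TP [HA _ _].
  exact: stab_clique HK.
pose K' := K :&: sup.
have HK' : stab (compl e) K' by apply: stab_sub HK; apply: subsetIl.
have K'w : {in K', forall v, 0 < w v} by move=> v; rewrite !inE => /andP [].
have hit' S : stab e S -> wt w S = a -> exists2 v, v \in S & v \in K'.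
  move=> HS Ea; have /set0Pn [v] : (S :&: sup) :&: K != set0.
    by apply: hit; rewrite mem_enum inE wt_sup Ea eqxx subsetIr (stab_sub _ HS) ?subsetIl.
  by rewrite !inE => /andP [/andP [vS vs] vK]; exists v; rewrite // !inE vK.
have [x _ xK'] := hit' S0 HS0 erefl.
have [|s' [Hs' Hm' [S' HS' Hk']]] := IH (dec w K').
  by rewrite -ltnS; apply: leq_trans HN; apply: (sum_dec K'w xK').
exists (K' :: s'); split; first by rewrite /= HK'.
- move=> v /=; rewrite Hm' /dec; case: (boolP (v \in K')) => [/K'w|]; lia.
exists S0; first by rewrite stab_complK.
rewrite -/a /=; apply: leq_ltn_trans Hk' _.
rewrite stab_complK in HS'.
have E := wt_dec S' K'w; have := Smax S' HS'; rewrite leq_eqVlt => /predU1P [Ea|]; last lia.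
have [v vS vK] := hit' _ HS' Ea.
have : 0 < #|S' :&: K'| by apply/card_gt0P; exists v; rewrite in_setI vS vK.
lia.
Qed.
End Good.

(** The colour classes of an optimal colouring of an induced subgraph form the cover, and a largest
    clique of the subgraph has as many vertices. *)
Lemma perfect_good (G : sgraph) : perfect G -> good (@adj G).
Proof.
move=> HG; apply: good_replication => U.
have := HG U; rewrite /chromatic_number; case: ex_minnP => k /existsP [f Hf] _ Ek.
pose cls (i : 'I_k) : {set G} := [set val u | u in [set u : induced U | f u == i]].
exists [seq cls i | i <- enum 'I_k]; split.
- apply/allP => A /mapP [i _ ->]; apply/stabP => u v /imsetP [u']; rewrite inE => /eqP fu ->.
  move=> /imsetP [v']; rewrite inE => /eqP fv -> _.
  have := forallP (forallP Hf u') v'; rewrite fu fv eqxx.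
  by case E: (adj _ _) => //=; move: E; rewrite /= => ->.
- move=> v; rewrite /mult count_map -sum1_count big_enum_cond /=.
  case: (boolP (v \in U)) => vU; last first.
    apply: big1 => i /imsetP [u _ Ev]; move: vU; rewrite Ev; case: u {Ev} => /= u ->.
    by [].
  rewrite (big_pred1 (f (exist _ v vU))) // => i /=.
  apply/imsetP/eqP => [[u]|->]; last by exists (exist _ v vU); rewrite ?inE.
  rewrite inE => /eqP <- Ev; congr (f _); apply: val_inj; exact: esym.
have [K HK EK] : exists2 K : {set induced U}, clique K & #|K| = clique_number (induced U).
  have C0 : clique (set0 : {set induced U}) by apply/forall_inP => u; rewrite inE.
  have := @eq_bigmax_cond _ (fun K : {set induced U} => clique K) (fun K => #|K|).
  rewrite /clique_number; case; first by apply/card_gt0P; exists set0; rewrite unfold_in.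
  by move=> K HK E; exists K.
exists [set val u | u in K]; split.
- by apply/subsetP => v /imsetP [u _ ->]; apply: (valP u).
- apply/stabP => u v /imsetP [u' Ku ->] /imsetP [v' Kv ->] uv.
  have := forall_inP (forall_inP HK u' Ku) v' Kv.
  rewrite /compl (inj_eq val_inj) in uv *; rewrite uv /= negbK.
  by move=> ->.
by rewrite size_map size_enum_ord card_imset ?EK -?Ek //; apply: val_inj.
Qed.

Local Open Scope ring_scope.

(** * Integral quadratic forms and power iteration *)

Section Dot.
Variable N : nat.
Implicit Types (x y u v : nat -> int) (A : nat -> nat -> int).

Definition dot x y : int := \sum_(i < N) x i * y i.
Definition app A x (i : nat) : int := \sum_(j < N) A i j * x j.
Definition quad A x : int := dot x (app A x).
Definition basis (j : nat) : nat -> int := fun i => (i == j)%:R.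

Lemma dotC x y : dot x y = dot y x.
Proof. by apply: eq_bigr => i _; rewrite mulrC. Qed.

Lemma dot_ge0 x : 0 <= dot x x.
Proof. by apply: sumr_ge0 => i _; rewrite -expr2 sqr_ge0. Qed.

Lemma dot_eq x x' y y' : (forall i, (i < N)%N -> x i = x' i) ->
  (forall i, (i < N)%N -> y i = y' i) -> dot x y = dot x' y'.
Proof. by move=> Hx Hy; apply: eq_bigr => i _; rewrite Hx ?Hy. Qed.

Lemma dot_lin (a b : int) x y z :
  dot x (fun i => a * y i + b * z i) = a * dot x y + b * dot x z.
Proof.
rewrite /dot !mulr_sumr -big_split /=; apply: eq_bigr => i _; ring.
Qed.

Lemma dot_basis j x : (j < N)%N -> dot (basis j) x = x j.
Proof.
move=> Hj; rewrite /dot (bigD1 (Ordinal Hj)) //= big1 ?addr0 /basis ?eqxx ?mul1r // => i.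
by rewrite -val_eqE /= => /negbTE ->; rewrite mul0r.
Qed.

(** Lagrange's identity: the difference of the two sides is half the sum of the squared minors x_i
    y_j - x_j y_i. *)
Lemma cauchy_schwarz x y : dot x y ^+ 2 <= dot x x * dot y y.
Proof.
have H : 0 <= \sum_(i < N) \sum_(j < N) (x i * y j - x j * y i) ^+ 2.
  by apply: sumr_ge0 => i _; apply: sumr_ge0 => j _; apply: sqr_ge0.
have E : \sum_(i < N) \sum_(j < N) (x i * y j - x j * y i) ^+ 2 =
    (dot x x * dot y y - dot x y ^+ 2) *+ 2.
  rewrite /dot expr2 !big_distrlr /= -sumrB -sumrMnl.
  rewrite (eq_bigr (fun i : 'I_N => \sum_(j < N) (x i * x i * (y j * y j) - x i * y i * (x j * y j))
     + \sum_(j < N) (y i * y i * (x j * x j) - x i * y i * (x j * y j)))); last first.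
    by move=> i _; rewrite -big_split /=; apply: eq_bigr => j _; ring.
  rewrite big_split /= [X in _ + X = _](_ : _ = \sum_(i < N) \sum_(j < N)
     (x i * x i * (y j * y j) - x i * y i * (x j * y j))).
    rewrite -big_split /=; apply: eq_bigr => i _.
    by rewrite -sumrB -mulr2n.
  by rewrite exchange_big /=; apply: eq_bigr => i _; apply: eq_bigr => j _; ring.
by rewrite E pmulrn_lge0 // subr_ge0 in H.
Qed.

Definition symmx A := forall i j, (i < N)%N -> (j < N)%N -> A i j = A j i.

Lemma app_adj A x y : symmx A -> dot (app A x) y = dot x (app A y).
Proof.
move=> HA; rewrite /dot /app (eq_bigr (fun i : 'I_N => \sum_(j < N) A i j * x j * y i)); last first.
  by move=> i _; rewrite mulr_suml.
rewrite exchange_big /=; apply: eq_bigr => j _; rewrite mulr_sumr; apply: eq_bigr => i _.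
rewrite HA //; ring.
Qed.

Lemma app_norm A (a : int) x : (forall i j, (i < N)%N -> (j < N)%N -> `|A i j| <= a) ->
  dot (app A x) (app A x) <= (N%:R * a) ^+ 2 * dot x x.
Proof.
move=> HA.
have row i : (i < N)%N -> app A x i ^+ 2 <= N%:R * a ^+ 2 * dot x x.
  move=> Hi; apply: le_trans (cauchy_schwarz (A i) x) _.
  apply: ler_wpM2r; first exact: dot_ge0.
  rewrite /dot; apply: le_trans (_ : \sum_(j < N) a ^+ 2 <= _).
    apply: ler_sum => j _; rewrite -expr2 -real_normK ?num_real //.
    by rewrite ler_sqr ?nnegrE ?(le_trans _ (HA i j Hi _)) // HA.
  by rewrite sumr_const card_ord mulr_natl.
rewrite /dot; apply: le_trans (_ : \sum_(i < N) (N%:R * a ^+ 2 * dot x x) <= _).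
  by apply: ler_sum => i _; rewrite -expr2 row.
rewrite sumr_const card_ord -mulr_natl le_eqVlt; apply/orP; left; apply/eqP; ring.
Qed.

Lemma quad_bound A (a b d : int) x y : (forall i j, (i < N)%N -> (j < N)%N -> `|A i j| <= a) ->
  (forall i, (i < N)%N -> `|x i| <= b) -> (forall i, (i < N)%N -> `|y i| <= d) ->
  `|dot x (app A y)| <= N%:R ^+ 2 * a * b * d.
Proof.
move=> HA Hx Hy; rewrite /dot /app.
apply: le_trans (ler_norm_sum _ _ _) _.
apply: le_trans (_ : \sum_(i < N) (N%:R * a * b * d) <= _); last first.
  rewrite sumr_const card_ord -mulr_natl le_eqVlt; apply/orP; left; apply/eqP; ring.
apply: ler_sum => i _; rewrite mulr_sumr; apply: le_trans (ler_norm_sum _ _ _) _.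
apply: le_trans (_ : \sum_(j < N) (a * b * d) <= _); last first.
  rewrite sumr_const card_ord -mulr_natl le_eqVlt; apply/orP; left; apply/eqP; ring.
apply: ler_sum => j _; rewrite !normrM mulrA [a * b]mulrC.
apply: ler_pM; rewrite ?mulr_ge0 ?normr_ge0 ?Hy //.
by apply: ler_pM; rewrite ?normr_ge0 ?Hx ?HA.
Qed.

Lemma quad_expand A (p q : int) x y : symmx A ->
  quad A (fun i => p * x i + q * y i) =
  p ^+ 2 * quad A x + (p * q * dot y (app A x)) *+ 2 + q ^+ 2 * quad A y.
Proof.
move=> HA; rewrite /quad.
have E i : app A (fun i => p * x i + q * y i) i = p * app A x i + q * app A y i.
  rewrite /app !mulr_sumr -big_split /=; apply: eq_bigr => j _; ring.
rewrite (dot_eq (x' := fun i => p * x i + q * y i) (y' := fun i => p * app A x i + q * app A y i)) //.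
rewrite dot_lin ![dot (fun i => _ + _) _]dotC !dot_lin.
rewrite [dot (app A y) x]app_adj // [dot (app A x) x]dotC [dot (app A x) y]dotC [dot (app A y) y]dotC.
rewrite -[dot y (app A x)]app_adj // [dot (app A y) x]dotC -[dot x (app A y)]app_adj // [dot (app A x) y]dotC.
ring.
Qed.

End Dot.

(** The arithmetic of [B_norm]: s is the squared length of u, q = u.Au and t the squared length of
    Au, so that the left side of the conclusion is the squared length of cu - Au. *)
Lemma B_norm_arith (c d s q t m : int) : 0 < d -> t <= m * s -> 0 <= s -> m *+ 2 = c ->
  - (d * s) <= q *+ 4 -> 0 < c -> c * (c * s - q) - (c * q - t) <= (c ^+ 2 + c * d) * s.
Proof.
move=> d0 H1 H2 E H c0.
have h1 : 0 <= c * (q *+ 4 + d * s) by rewrite mulr_ge0 ?(ltW c0) //; lia.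
have h2 : 0 <= c * s * (d - 1) by rewrite !mulr_ge0 ?(ltW c0) //; lia.
have h3 : t *+ 2 <= c * s by rewrite -E mulrnAl lerMn2r.
by lra.
Qed.

(* Power iteration for [c - A]: a vector at which [A] is quite negative makes
   the powers grow so fast that some iterate of a basis vector is a direction
   in which [A] is negative as well. *)
Section Power.
Variables (N : nat) (A : nat -> nat -> int) (a d : int).
Hypothesis N_gt0 : (0 < N)%N.
Hypothesis symA : symmx N A.
Hypothesis boundA : forall i j, (i < N)%N -> (j < N)%N -> `|A i j| <= a.
Hypothesis a_gt0 : 0 < a.
Hypothesis d_gt0 : 0 < d.
Implicit Types (x y u v : nat -> int).
Let c := (N%:R * a) ^+ 2 *+ 2.
Definition powstep (c : int) x (i : nat) := c * x i - app N A x i.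
Let B := powstep c.

Lemma c_gt0 : 0 < c.
Proof. by rewrite /c pmulrn_lgt0 // exprn_gt0 // mulr_gt0 // ltr0n. Qed.

Lemma B_dot x y : dot N x (B y) = c * dot N x y - dot N x (app N A y).
Proof. by have := dot_lin N c (-1) x y (app N A y); rewrite mulN1r => <-; apply: dot_eq => // i _; rewrite mulN1r. Qed.

Lemma B_adj x y : dot N (B x) y = dot N x (B y).
Proof. by rewrite dotC !B_dot dotC -app_adj // [dot N (app N A y) x]dotC. Qed.

Lemma iterB_adj k x y : dot N (iter k B x) y = dot N x (iter k B y).
Proof. by elim: k x y => //= k IH x y; rewrite B_adj IH -iterSr. Qed.

Lemma B_norm u : - (d * dot N u u) <= quad N A u *+ 4 ->
  dot N (B u) (B u) <= (c ^+ 2 + c * d) * dot N u u.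
Proof.
move=> H; rewrite B_dot dotC B_dot [dot N (B u) _]dotC B_dot [dot N _ (app N A u)]dotC -/(quad N A u).
rewrite [dot N (app N A u) u]dotC -/(quad N A u).
have H1 := app_norm u boundA; have H2 := dot_ge0 N u; have := c_gt0.
have E : (N%:R * a) ^+ 2 *+ 2 = c by [].
move=> c0; exact: B_norm_arith d_gt0 H1 H2 E H c0.
Qed.

(** Cauchy-Schwarz turns a lower bound on x.B^k x into one on the squared length of B^k x, which
    equals x.B^(2k) x by symmetry. The exponent can thus be doubled again and again, which takes the
    place of an eigenvector argument and explains the powers of two. *)
Lemma iterB_norm x l : l = (2 ^ trunc_log 2 l)%N -> (c + d) * dot N x x <= dot N x (B x) ->
  (c + d) ^+ (l.*2) * dot N x x <= dot N (iter l B x) (iter l B x).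
Proof.
move=> -> Hx; set j := trunc_log 2 l.
have [x0|xn0] := eqVneq (dot N x x) 0; first by rewrite x0 mulr0 dot_ge0.
have x_gt0 : 0 < dot N x x by rewrite lt_def xn0 dot_ge0.
have cd0 : 0 <= c + d by rewrite addr_ge0 // ltW // c_gt0.
have sq k : (c + d) ^+ k * dot N x x <= dot N x (iter k B x) ->
    (c + d) ^+ k.*2 * dot N x x <= dot N (iter k B x) (iter k B x).
  move=> H; rewrite -(ler_pM2l x_gt0).
  apply: le_trans (cauchy_schwarz N x (iter k B x)).
  have : ((c + d) ^+ k * dot N x x) ^+ 2 <= dot N x (iter k B x) ^+ 2.
    by rewrite ler_sqr // nnegrE ?(le_trans _ H) // mulr_ge0 ?exprn_ge0 // ltW.
  by apply: le_trans; rewrite exprMn -exprM muln2 expr2 le_eqVlt; apply/orP; left; apply/eqP; ring.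
apply: (sq); elim: j => [|j IH]; first by rewrite expn0 expr1.
rewrite expnS mul2n; apply: le_trans (sq _ IH) _.
by rewrite -addnn iterD iterB_adj.
Qed.

(** If no iterate of a basis vector were such a direction, then by [B_norm] each of them would grow
    by at most c(c+d) in squared length per step, so that the squared length of B^l x is at most N
    (c(c+d))^l times that of x. By [iterB_norm] it is at least (c+d)^(2l) times that of x.
    Bernoulli's inequality makes ((c+d)/c)^l exceed N as soon as l > N c; a power of two between N c
    and 2 N c is used. *)
Lemma power_violation x (L : nat) : quad N A x < - (d * dot N x x) ->
  ((N * `|c|).*2 <= L)%N ->
  exists i l, [/\ (i < N)%N, (l < L.+1)%N, 0 < dot N (iter l B (basis i)) (iter l B (basis i)) &
    quad N A (iter l B (basis i)) *+ 4 < - (d * dot N (iter l B (basis i)) (iter l B (basis i)))].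
Proof.
move=> Hx HL.
pose viol i l := quad N A (iter l B (basis i)) *+ 4 < - (d * dot N (iter l B (basis i)) (iter l B (basis i))).
have [/existsP [i /existsP [l H]]|/existsPn H] := boolP [exists i : 'I_N, exists l : 'I_L.+1, viol i l].
  exists i, l; split=> //; rewrite lt_def dot_ge0 andbT; apply/eqP => E; move: H; rewrite /viol E mulr0 oppr0.
  have H1 := app_norm (iter l B (basis i)) boundA; rewrite E mulr0 in H1.
  have := cauchy_schwarz N (iter l B (basis i)) (app N A (iter l B (basis i))).
  by rewrite E mul0r -/(quad _ _ _); nia.
exfalso.
have NV i l : (i < N)%N -> (l < L.+1)%N -> ~~ viol i l.
  by move=> Hi Hl; have /existsPn /(_ (Ordinal Hl)) := H (Ordinal Hi).
have c0 := c_gt0.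
have grow i l : (i < N)%N -> (l <= L)%N ->
    dot N (iter l B (basis i)) (iter l B (basis i)) <= (c ^+ 2 + c * d) ^+ l.
  move=> Hi; elim: l => [|l IH] Hl; first by rewrite /= dot_basis // /basis eqxx.
  rewrite iterS; apply: le_trans (B_norm _) _; first by rewrite leNgt; apply: NV => //; rewrite ltnS ltnW.
  rewrite [_ ^+ l.+1]exprS; apply: ler_wpM2l; last exact: IH (ltnW Hl).
  by rewrite addr_ge0 ?sqr_ge0 // mulr_ge0 ?ltW.
have NC : (0 < N * `|c|)%N by rewrite muln_gt0 N_gt0 absz_gt0 gt_eqF.
pose l := (2 ^ (trunc_log 2 (N * `|c|)).+1)%N.
have l1 : (N * `|c| < l)%N by apply: trunc_log_ltn.
have l2 : (l <= L)%N.
  by apply: leq_trans HL; rewrite /l expnS mul2n leq_double; apply: trunc_logP.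
have El : l = (2 ^ trunc_log 2 l)%N by rewrite /l trunc_expnK.
have x_gt0 : 0 < dot N x x.
  rewrite lt_def dot_ge0 andbT; apply/eqP => E; move: Hx; rewrite E mulr0 oppr0.
  have H1 := app_norm x boundA; rewrite E mulr0 in H1.
  by have := cauchy_schwarz N x (app N A x); rewrite E mul0r -/(quad _ _ _); nia.
have up : dot N (iter l B x) (iter l B x) <= N%:R * (c ^+ 2 + c * d) ^+ l * dot N x x.
  rewrite {1}/dot; apply: le_trans (_ : \sum_(i < N) ((c ^+ 2 + c * d) ^+ l * dot N x x) <= _); last first.
    by rewrite sumr_const card_ord -[_ *+ N]mulr_natl mulrA.
  apply: ler_sum => i _; rewrite -expr2 -(dot_basis (iter l B x) (ltn_ord i)) -iterB_adj.
  apply: le_trans (cauchy_schwarz _ _ _) _; apply: ler_wpM2r; first exact: dot_ge0.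
  exact: grow.
have low : (c + d) ^+ l.*2 * dot N x x <= dot N (iter l B x) (iter l B x).
  apply: iterB_norm => //; rewrite B_dot -/(quad N A x); lia.
have {up low} := le_trans low up; rewrite ler_pM2r //.
have -> : c ^+ 2 + c * d = c * (c + d) by ring.
have cd0 : 0 < c + d by exact: addr_gt0.
rewrite exprMn -addnn exprD mulrA ler_pM2r ?exprn_gt0 // leNgt => /negP; apply.
have bern k : c ^+ k * (c + k%:R * d) <= c * (c + d) ^+ k.
  elim: k => [|k IH]; first by rewrite mul0r addr0 !expr0 mul1r mulr1.
  have := exprn_gt0 k c0; rewrite !exprS; move: IH (ler0n int k); rewrite -natr1.
  move: (c ^+ k) ((c + d) ^+ k) (k%:R : int) c0 d_gt0; clear.
  move: c d => C D P Q K c0 d0 IH K0 P0; nia.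
rewrite -(ltr_pM2l c0); apply: lt_le_trans (bern l).
have -> : c * (N%:R * c ^+ l) = c ^+ l * (N%:R * c) by ring.
rewrite ltr_pM2l ?exprn_gt0 //.
have : (N%:R * c : int) < l%:R.
  have -> : N%:R * c = ((N * `|c|)%N)%:R :> int.
    by rewrite natrM [(`|c|%N)%:R]natz gtz0_abs.
  by rewrite ltr_nat.
have := ler0n int l.
by move: c0 d_gt0; clear; move: c d (N%:R : int) (l%:R : int) => C D n k c0 d0 k0 H; nia.
Qed.

End Power.


(** * Rounding a direction of negativity to small integers *)

Definition zabs (z : int) : int := if z < 0 then - z else z.
Lemma zabsE z : zabs z = `|z|.
Proof. by rewrite /zabs; case: ltrP => H; [rewrite ltr0_norm|rewrite ger0_norm]. Qed.

Definition nsum (n : nat) (F : nat -> nat) : nat := (\sum_(i < n) F i)%N.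

(* The entry of [u] scaled to range over [-R, R] when [m] bounds [u]. *)
Definition scaled (R : nat) (m z : int) : int :=
  let f : int := nsum R (fun k => (k.+1%:Z * m <= zabs z * R%:Z)%R : nat) in
  if z < 0 then - f else f.

Lemma nsum_le (n : nat) (F : nat -> bool) : (nsum n (fun i => F i : nat) <= n)%N.
Proof.
apply: leq_trans (_ : (\sum_(i < n) 1 <= _)%N); last by rewrite sum1_card card_ord.
by apply: leq_sum => i _; apply: leq_b1.
Qed.

Lemma scaled_le R m z : `|scaled R m z| <= R.
Proof.
have := nsum_le R (fun k => (k.+1%:Z * m <= zabs z * R%:Z)%R); rewrite /scaled /=.
by case: ifP => _; lia.
Qed.

Lemma count_floor (R : nat) (m t : int) : 0 < m -> 0 <= t -> t <= m * R ->
  let f := nsum R (fun k => (k.+1%:Z * m <= t)%R : nat) in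
  (f%:Z * m <= t) /\ (t < f.+1%:Z * m).
Proof.
move=> m0 t0; elim: R => [|R IH] Ht /=; first by rewrite /nsum big_ord0; split; lia.
rewrite /nsum big_ord_recr /= -/(nsum R (fun k => (k.+1%:Z * m <= t)%R : nat)).
case: (lerP (R.+1%:Z * m) t) => H.
  have E : nsum R (fun k => (k.+1%:Z * m <= t)%R : nat) = R.
    rewrite /nsum -[RHS]card_ord -sum1_card; apply: eq_bigr => i _.
    suff -> : (i.+1%:Z * m <= t)%R by [].
    apply: le_trans H; apply: ler_wpM2r; first exact: ltW.
    by rewrite lez_nat ltnS ltnW.
  rewrite E addn1; split=> //; move: Ht; nia.
case: (lerP t (m * R)) => H'; first by rewrite addn0; apply: IH.
have E : nsum R (fun k => (k.+1%:Z * m <= t)%R : nat) = R.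
  rewrite /nsum -[RHS]card_ord -sum1_card; apply: eq_bigr => i _.
  suff -> : (i.+1%:Z * m <= t)%R by [].
  apply: le_trans (ltW H'); rewrite mulrC; apply: ler_wpM2l; first exact: ltW.
  by rewrite lez_nat.
by rewrite E addn0; split; [rewrite mulrC ltW|].
Qed.

Lemma scaled_err R (m z : int) : 0 < m -> `|z| <= m -> `|R%:Z * z - m * scaled R m z| <= m.
Proof.
move=> m0 Hz; rewrite /scaled.
have [] := @count_floor R m (zabs z * R%:Z) m0.
- by rewrite zabsE mulr_ge0.
- by rewrite zabsE; apply: ler_wpM2r.
set f := nsum _ _; rewrite zabsE; case: (ltrP z 0) => Hz0 H1 H2.
  by move: H1 H2; rewrite (ltr0_norm Hz0) => H1 H2; nia.
by move: H1 H2; rewrite (ger0_norm Hz0) => H1 H2; nia.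
Qed.

Lemma quad_scale N A (m : int) v : quad N A (fun i => m * v i) = m ^+ 2 * quad N A v.
Proof.
rewrite /quad /dot mulr_sumr; apply: eq_bigr => i _.
have -> : app N A (fun i => m * v i) i = m * app N A v i.
  by rewrite /app mulr_sumr; apply: eq_bigr => j _; ring.
ring.
Qed.

Lemma quad_eq N A x y : (forall i, (i < N)%N -> x i = y i) -> quad N A x = quad N A y.
Proof.
by move=> H; apply: dot_eq => // i Hi; apply: eq_bigr => j _; rewrite H.
Qed.

(** The arithmetic of [scaled_violation]. With r = Ru - mv the rounding error, M is m^2, n the
    squared dimension, s = u.Au, t the squared length of u, p = r.Au and q = r.Ar. *)
Lemma scaled_arith (R d a n M s t p q g : int) : 1 <= R -> 0 <= d -> 0 <= a -> 0 <= n ->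
  0 < M -> M <= t -> s *+ 4 < - (d * t) -> 24%:R * n * a <= d * R -> 8%:R * g <= d * R ^+ 2 ->
  - (n * a * M) <= p -> q <= n * a * M -> R ^+ 2 * s - (R * p) *+ 2 + q <= M * - g.
Proof.
move=> R1 d0 a0 n0 M0 Mt Hs HR Hg Hp Hq.
have R0 : 0 <= R by lia.
have h1 : R ^+ 2 * (s *+ 4) <= R ^+ 2 * - (d * t) by apply: ler_wpM2l (ltW Hs); rewrite exprn_ge0.
have h2 : R ^+ 2 * d * M <= R ^+ 2 * d * t by apply: ler_wpM2l => //; rewrite mulr_ge0 ?exprn_ge0.
have h3 : R * - (n * a * M) <= R * p by apply: ler_wpM2l.
have h4 : 1 * (n * a * M) <= R * (n * a * M) by apply: ler_wpM2r => //; rewrite !mulr_ge0 ?(ltW M0).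
have h5 : 24%:R * n * a * (R * M) <= d * R * (R * M) by apply: ler_wpM2r => //; rewrite !mulr_ge0 ?(ltW M0).
have h6 : 8%:R * g * M <= d * R ^+ 2 * M by apply: ler_wpM2r => //; rewrite ltW.
rewrite !expr2 in h1 h2 h6 *; lra.
Qed.

(** Expand m^2 v.Av around Ru, where v is the rounded vector. The entries of the error Ru - mv are
    at most m, so the error terms grow only linearly in R, while the negative main term grows with
    R^2. *)
Lemma scaled_violation N A (a d g : int) (R : nat) u m :
  symmx N A -> (forall i j, (i < N)%N -> (j < N)%N -> `|A i j| <= a) ->
  0 < m -> (forall i, (i < N)%N -> `|u i| <= m) -> (exists2 i, (i < N)%N & `|u i| = m) ->
  quad N A u *+ 4 < - (d * dot N u u) -> (0 < R)%N -> 0 <= d -> 0 <= a ->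
  24%:R * N%:R ^+ 2 * a <= d * R%:R -> 8%:R * g <= d * R%:R ^+ 2 ->
  quad N A (fun i => scaled R m (u i)) <= - g.
Proof.
move=> sA bA m0 bu [i0 Hi0 Ei0] Hu R0 d0 a0 HR Hg.
set v := fun i => _; pose r i := R%:Z * u i - m * v i.
have br i : (i < N)%N -> `|r i| <= m by move=> Hi; apply: scaled_err => //; apply: bu.
have E : m ^+ 2 * quad N A v = R%:R ^+ 2 * quad N A u - (R%:R * dot N r (app N A u)) *+ 2 + quad N A r.
  rewrite -(quad_scale N A m v) (@quad_eq _ _ _ (fun i => R%:R * u i + -1 * r i)).
    by rewrite quad_expand //; ring.
  by move=> i Hi; rewrite /r natz; ring.
have B1 := quad_bound bA br bu.
have B2 := quad_bound bA br br; rewrite -/(quad N A r) in B2.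
have U : m ^+ 2 <= dot N u u.
  rewrite -Ei0 real_normK ?num_real //.
  by have := cauchy_schwarz N (basis i0) u; rewrite !dot_basis // /basis eqxx mul1r.
have m2 : 0 < m ^+ 2 by rewrite exprn_gt0.
rewrite -(ler_pM2l m2) E.
apply: (@scaled_arith _ d a (N%:R ^+ 2) _ _ (dot N u u)) => //; first by rewrite ler1n.
- by rewrite exprn_ge0.
- by move: B1; rewrite ler_norml expr2 !mulrA => /andP [].
by apply: le_trans (ler_norm _) (le_trans B2 _); rewrite expr2 !mulrA.
Qed.


(** The termination argument shared by both perceptron methods. That the potential never rises also
    bounds the final point. *)
Lemma potential_iter (T : Type) (step : T -> T) (done : pred T) (f : T -> int) z0 (k : nat) :
  (forall z, 0 <= f z) -> (forall z, ~~ done z -> f (step z) <= f z - 1) ->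
  (forall z, done z -> step z = z) -> f z0 < k%:Z ->
  done (iter k step z0) /\ f (iter k step z0) <= f z0.
Proof.
move=> f0 dec fix_ Hk.
have le z : f (step z) <= f z.
  by have [/fix_ ->|/dec] := boolP (done z); lia.
have lek j : f (iter j step z0) <= f z0 by elim: j => //= j; apply: le_trans (le _).
split=> //; apply/negPn/negP => nd.
have nd' j : (j <= k)%N -> ~~ done (iter j step z0).
  move=> jk; apply: contra nd => dj; rewrite -(subnK jk) iterD.
  by elim: (k - j)%N => //= i IH; rewrite fix_.
have H j : (j <= k)%N -> f (iter j step z0) <= f z0 - j%:Z.
  elim: j => [|j IH] jk; first by rewrite subr0.
  by have := IH (ltnW jk); have := dec _ (nd' j (ltnW jk)); rewrite /=; lia.
by have := H k (leqnn _); have := f0 (iter k step z0); lia.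
Qed.

(** * Deciding the maximum weight of a stable set by semidefinite programming *)

Definition has_edge (E : seq (seq bool)) (i j : nat) : bool := nth false (nth [::] E i) j.
Definition ent (Z : seq (seq int)) (i j : nat) : int := nth 0 (nth [::] Z i) j.
Definition mk2 (n : nat) (f : nat -> nat -> int) : seq (seq int) :=
  mkseq (fun i => mkseq (f i) n) n.

Lemma ent_mk2 n f i j : (i < n)%N -> (j < n)%N -> ent (mk2 n f) i j = f i j.
Proof. by move=> Hi Hj; rewrite /ent /mk2 !nth_mkseq. Qed.

Section Theta.
Variables (n : nat) (E : seq (seq bool)) (w : seq nat) (s : nat).

(** The constants: [th_M] is the integral stand-in for 1, [th_d] the tolerated negativity, and
    [th_D] their ratio. [th_R] bounds the entries of test vectors and [th_a] those of the matrix;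
    [th_c] and [th_L] are the shift and the length of the power iteration. [th_G] is the guaranteed
    violation, larger than the squared length of a step, and [th_T] exceeds the initial
    potential. *)
Definition th_W := nsum n (nth 0%N w).
Definition th_D := (2 * n.+1 * s.+1)%N.
Definition th_R := (24 * (n.+1 * n.+1 * n.+1) * th_D)%N.
Definition th_d := (80 * (n.+1 * n.+1) * (th_R * th_R) + 2 * (th_W * th_W))%N.
Definition th_M := (th_D * th_d)%N.
Definition th_a := (th_M * n.+1)%N.
Definition th_c := ((n.+1 * th_a) * (n.+1 * th_a) * 2)%N.
Definition th_L := (2 * (n.+1 * th_c))%N.
Definition th_G := (9 * (n * n) * (th_R * th_R * (th_R * th_R)) + 1)%N.
Definition th_T := ((th_M * n) * (th_M * n) + 1)%N.

(** The bordered matrix of the theta body: zero on the edges, with its diagonal repeated in the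
    border, which has index [n], and with [th_M] in the corner. *)
Definition th_A (Z : seq (seq int)) (i j : nat) : int :=
  if i == n then (if j == n then th_M%:Z else ent Z j j)
  else if j == n then ent Z i i else if has_edge E i j then 0 else ent Z i j.

Definition th_pow (Z : seq (seq int)) (i l : nat) : seq int :=
  iter l (fun u => mkseq (fun k => th_c%:Z * nth 0 u k - sumz n.+1 (fun j => th_A Z k j * nth 0 u j)) n.+1)
    (mkseq (fun k => if k == i then 1 else 0) n.+1).

Definition th_max (u : seq int) : int :=
  zabs (nth 0 u (findn n.+1 (fun i => alln n.+1 (fun j => zabs (nth 0 u j) <= zabs (nth 0 u i))))).

Definition th_cand (Z : seq (seq int)) (i l : nat) : seq int :=
  let u := th_pow Z i l in let m := th_max u in
  mkseq (fun k => scaled th_R m (nth 0 u k)) n.+1.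

Definition th_viol (Z : seq (seq int)) (v : seq int) : bool :=
  sumz n.+1 (fun i => nth 0 v i * sumz n.+1 (fun j => th_A Z i j * nth 0 v j)) <= - th_G%:Z.

Definition th_row (Z : seq (seq int)) (i : nat) : bool :=
  ~~ alln th_L.+1 (fun l => ~~ th_viol Z (th_cand Z i l)).
Definition th_neg (Z : seq (seq int)) : bool := ~~ alln n.+1 (fun i => ~~ th_row Z i).
Definition th_vec (Z : seq (seq int)) : seq int :=
  let i := findn n.+1 (th_row Z) in
  th_cand Z i (findn th_L.+1 (fun l => th_viol Z (th_cand Z i l))).

(** The threshold is [th_M] times s - 1/2; the half leaves room for the length of a step on one side
    and for the tolerated negativity on the other. *)
Definition th_low (Z : seq (seq int)) : bool :=
  2%:Z * sumz n (fun i => (nth 0%N w i)%:Z * ent Z i i) < th_M%:Z * (2%:Z * s%:Z - 1).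

(** A perceptron step: the linear functional that [Z] violates, but that the matrix of a
    sufficiently heavy stable set satisfies, is added to [Z]. Entries at edges are never changed. *)
Definition th_step (Z : seq (seq int)) : seq (seq int) :=
  if th_low Z then mk2 n (fun i j => ent Z i j + (if i == j then (nth 0%N w i)%:Z else 0))
  else if th_neg Z then
    let v := th_vec Z in
    mk2 n (fun i j => ent Z i j + (if has_edge E i j then 0 else
      nth 0 v i * nth 0 v j + (if i == j then 2%:Z * nth 0 v n * nth 0 v i else 0)))
  else Z.

Definition th_small (Z : seq (seq int)) : bool :=
  alln n (fun i => alln n (fun j => zabs (ent Z i j) <= th_a%:Z)).

(** The iteration starts at the zero matrix, which the empty list represents through default values.
    Smallness of the entries is checked because the power iteration is reliable only for a bounded
    matrix. *)
Definition theta_test : bool :=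
  (s == 0)%N || (let Z := iter th_T th_step [::] in
    [&& ~~ th_low Z, ~~ th_neg Z & th_small Z]).

Lemma th_M_gt0 : (0 < th_M)%N.
Proof.
clear; rewrite /th_M /th_d /th_R /th_D; nia.
Qed.

Section Correct.
Variable e : rel 'I_n.
Hypothesis adjE : forall i j : 'I_n, has_edge E i j = e i j.
Hypothesis e_sym : symmetric e.
Hypothesis e_irr : irreflexive e.
Let wf (i : 'I_n) := nth 0%N w i.

Lemma th_vecP Z : th_neg Z -> (forall k, `|nth 0 (th_vec Z) k| <= th_R%:Z) /\ th_viol Z (th_vec Z).
Proof.
move=> /negP H.
have [i Hi Hr] : exists2 i, (i < n.+1)%N & th_row Z i.
  have [/existsP [i Hi]|/existsPn H'] := boolP [exists i : 'I_n.+1, th_row Z i]; first by exists i.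
  by exfalso; apply: H; apply/allnP => i Hi; apply: (H' (Ordinal Hi)).
have [_ {Hi}Hr'] := findn_P (ex_intro2 _ _ i Hi Hr).
have /negP H2 := Hr'.
have [l Hl Hv] : exists2 l, (l < th_L.+1)%N & th_viol Z (th_cand Z (findn n.+1 (th_row Z)) l).
  have [/existsP [l Hl]|/existsPn H'] := boolP [exists l : 'I_th_L.+1, th_viol Z (th_cand Z (findn n.+1 (th_row Z)) l)].
    by exists l.
  by exfalso; apply: H2; apply/allnP => l Hl; apply: (H' (Ordinal Hl)).
have [Hl' Hv'] := findn_P (ex_intro2 (fun l => (l < th_L.+1)%N) (fun l => th_viol Z (th_cand Z (findn n.+1 (th_row Z)) l)) l Hl Hv).
split=> // k; rewrite /th_vec /th_cand.
case: (ltnP k n.+1) => Hk; first by rewrite nth_mkseq // scaled_le.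
by rewrite nth_default ?size_mkseq // normr0.
Qed.

Section Yes.
Variable S : {set 'I_n}.
Hypothesis stabS : stab e S.
Hypothesis wS : (s <= wt wf S)%N.
Hypothesis s_gt0 : (0 < s)%N.

(** The hidden solution: the incidence vector of [S] times its transpose, scaled by [th_M]. *)
Let zs (i j : 'I_n) : int := th_M%:Z * ((i \in S) && (j \in S))%:R.
Definition th_pot (Z : seq (seq int)) : int :=
  \sum_(i < n) \sum_(j < n) (ent Z i j - zs i j) ^+ 2.

Lemma th_pot_update Z (g : nat -> nat -> int) :
  th_pot (mk2 n (fun i j => ent Z i j + g i j)) =
  th_pot Z + (\sum_(i < n) \sum_(j < n) g i j * ent Z i j - \sum_(i < n) \sum_(j < n) g i j * zs i j) *+ 2
    + \sum_(i < n) \sum_(j < n) g i j ^+ 2.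
Proof.
rewrite /th_pot -sumrB -sumrMnl -!big_split /=; apply: eq_bigr => i _.
rewrite -sumrB -sumrMnl -!big_split /=; apply: eq_bigr => j _.
rewrite ent_mk2 //; ring.
Qed.

Lemma diag_sum (f : 'I_n -> 'I_n -> int) (h : 'I_n -> int) :
  \sum_(i < n) \sum_(j < n) (if (i == j :> nat) then h i else 0) * f i j = \sum_(i < n) h i * f i i.
Proof.
apply: eq_bigr => i _; rewrite (bigD1 i) //= eqxx big1 ?addr0 // => j ji.
by rewrite eq_sym val_eqE (negbTE ji) mul0r.
Qed.

Lemma sum_S (h : 'I_n -> int) : \sum_(i in S) h i = \sum_(i < n) h i * (i \in S)%:R.
Proof.
by rewrite big_mkcond; apply: eq_bigr => i _; case: (i \in S); rewrite ?mulr1 ?mulr0.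
Qed.

Lemma th_W2 : \sum_(i < n) ((wf i)%:Z) ^+ 2 <= th_M%:Z.
Proof.
have H : (\sum_(i < n) wf i ^ 2 <= th_W * th_W)%N.
  rewrite /th_W /nsum big_distrl /=; apply: leq_sum => i _.
  by rewrite -mulnn leq_mul2l (bigD1 i) //= leq_addr orbT.
have -> : \sum_(i < n) ((wf i)%:Z) ^+ 2 = (\sum_(i < n) wf i ^ 2)%N%:Z.
  by rewrite -[RHS]natz natr_sum; apply: eq_bigr => i _; rewrite natrX natz.
rewrite lez_nat; apply: leq_trans H _; rewrite /th_M /th_d /th_D.
move: (th_W * th_W)%N (80 * _ * _)%N => x y; nia.
Qed.

(** The inner product of the step with the target is at least s [th_M], whereas with [Z] it is below
    (s - 1/2) [th_M]; the cross term gains more than [th_M], which pays for the squared length of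
    the step ([th_W2]). *)
Lemma low_dec Z : th_low Z -> th_pot (th_step Z) <= th_pot Z - 1.
Proof.
move=> low; rewrite /th_step low th_pot_update.
have E1 : \sum_(i < n) \sum_(j < n) (if (i == j :> nat) then (wf i)%:Z else 0) * ent Z i j
    = \sum_(i < n) (wf i)%:Z * ent Z i i by rewrite (diag_sum (fun i j => ent Z i j)).
have E2 : \sum_(i < n) \sum_(j < n) (if (i == j :> nat) then (wf i)%:Z else 0) * zs i j
    = th_M%:Z * (wt wf S)%:Z.
  rewrite diag_sum /wt -[(\sum_(v in S) _)%N%:Z]natz natr_sum sum_S mulr_sumr; apply: eq_bigr => i _.
  rewrite /zs andbb natz; ring.
have E3 : \sum_(i < n) \sum_(j < n) (if (i == j :> nat) then (wf i)%:Z else 0) ^+ 2 = \sum_(i < n) (wf i)%:Z ^+ 2.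
  apply: eq_bigr => i _; rewrite (bigD1 i) //= eqxx big1 ?addr0 // => j ji.
  by rewrite eq_sym val_eqE (negbTE ji) expr0n.
rewrite E1 E2 E3; have W2 := th_W2; move: low; rewrite /th_low /sumz -lezD1.
have : th_M%:Z * s%:Z <= th_M%:Z * (wt wf S)%:Z by apply: ler_wpM2l.
by move=> H1 H2; lra.
Qed.

(** The coefficients of the entries of [Z] in the quadratic form of [th_A], see [th_quad]; this is
    also the step taken for the vector [x]. *)
Definition th_g (x : nat -> int) (i j : nat) : int :=
  if has_edge E i j then 0 else x i * x j + (if i == j then 2%:Z * x n * x i else 0).

Lemma th_quad Z (x : nat -> int) : quad n.+1 (th_A Z) x =
  th_M%:Z * x n ^+ 2 + \sum_(i < n) \sum_(j < n) th_g x i j * ent Z i j.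
Proof.
rewrite /quad /dot /app big_ord_recr /= big_ord_recr /= {3}/th_A eqxx.
have -> : \sum_(i < n) x i * \sum_(j < n.+1) th_A Z i j * x j =
  \sum_(i < n) (x i * ent Z i i * x n) + \sum_(i < n) \sum_(j < n) (if has_edge E i j then 0 else x i * x j) * ent Z i j.
  rewrite -big_split /=; apply: eq_bigr => i _.
  rewrite big_ord_recr /= {2}/th_A (ltn_eqF (ltn_ord i)) eqxx mulrDr addrC mulrA; congr (_ + _).
  rewrite mulr_sumr; apply: eq_bigr => j _; rewrite /th_A !(ltn_eqF (ltn_ord _)).
  by case: ifP => _; rewrite ?mul0r ?mulr0 //; ring.
have -> : \sum_(j < n) th_A Z n j * x j = \sum_(j < n) ent Z j j * x j.
  by apply: eq_bigr => j _; rewrite /th_A eqxx (ltn_eqF (ltn_ord _)).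
have -> : \sum_(i < n) \sum_(j < n) th_g x i j * ent Z i j =
   \sum_(i < n) \sum_(j < n) (if has_edge E i j then 0 else x i * x j) * ent Z i j
   + \sum_(i < n) (2%:Z * x n * x i * ent Z i i).
  rewrite -big_split /=; apply: eq_bigr => i _.
  have -> : 2%:Z * x n * x i * ent Z i i = \sum_(j < n) (if i == j :> nat then 2%:Z * x n * x i else 0) * ent Z i j.
    rewrite (bigD1 i) //= eqxx big1 ?addr0 // => j ji.
    by rewrite eq_sym val_eqE (negbTE ji) mul0r.
  rewrite -big_split /=; apply: eq_bigr => j _; rewrite /th_g adjE.
  case: (boolP (e i j)) => [eij|_]; last by rewrite mulrDl.
  case: eqP => [/val_inj ij|_]; last by rewrite !mul0r addr0.
  by move: eij; rewrite ij e_irr.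
have -> : \sum_(i < n) 2%:Z * x n * x i * ent Z i i = (x n * \sum_(i < n) ent Z i i * x i) *+ 2.
  by rewrite mulr_sumr -sumrMnl; apply: eq_bigr => i _; rewrite -[2%:Z]natz; ring.
have -> : \sum_(i < n) x i * ent Z i i * x n = x n * \sum_(i < n) ent Z i i * x i.
  by rewrite mulr_sumr; apply: eq_bigr => i _; ring.
ring.
Qed.

(** On the target the bordered form is [th_M] times the square of x_n + x(S), because stability of
    [S] makes the entries at edges vanish. In particular it is nonnegative. *)
Lemma th_g_star (x : nat -> int) :
  \sum_(i < n) \sum_(j < n) th_g x i j * zs i j = th_M%:Z * ((x n + \sum_(i in S) x i) ^+ 2 - x n ^+ 2).
Proof.
have -> : (x n + \sum_(i in S) x i) ^+ 2 - x n ^+ 2 = (\sum_(i in S) x i) * (\sum_(i in S) x i)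
   + 2%:Z * x n * \sum_(i in S) x i by rewrite -[2%:Z]natz; ring.
rewrite sum_S big_distrlr /= mulr_sumr -big_split /= mulr_sumr; apply: eq_bigr => i _.
have -> : 2%:Z * x n * (x i * (i \in S)%:R) = \sum_(j < n) (if i == j :> nat then 2%:Z * x n * (x i * (i \in S)%:R) else 0).
  rewrite (bigD1 i) //= eqxx big1 ?addr0 // => j ji.
  by rewrite eq_sym val_eqE (negbTE ji).
rewrite -big_split /= mulr_sumr; apply: eq_bigr => j _; rewrite /th_g /zs adjE.
case: (boolP (e i j)) => [eij|_].
  have -> : (i \in S) && (j \in S) = false.
    apply/negP => /andP [iS jS]; have ij : i != j by apply: contraTneq eij => ->; rewrite e_irr.
    by have /stabP /(_ i j iS jS ij) := stabS; rewrite eij.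
  case: eqP => [/val_inj ij|_]; first by move: eij; rewrite ij e_irr.
  have : ~~ ((i \in S) && (j \in S)).
    apply/negP => /andP [iS jS]; have ij : i != j by apply: contraTneq eij => ->; rewrite e_irr.
    by have /stabP /(_ i j iS jS ij) := stabS; rewrite eij.
  by case: (i \in S); case: (j \in S) => //=; rewrite !(mul0r, mulr0, addr0).
case: eqP => [/val_inj ->|_]; first by rewrite andbb; case: (j \in S) => /=; ring.
by case: (i \in S); case: (j \in S) => /=; ring.
Qed.

(** The form is at most -[th_G] at [Z] and nonnegative at the target, so the cross term gains twice
    [th_G], while the squared length of the step is below [th_G]. *)
Lemma neg_dec Z : ~~ th_low Z -> th_neg Z -> th_pot (th_step Z) <= th_pot Z - 1.
Proof.
move=> /negbTE low neg; rewrite /th_step low neg.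
have [bv viol] := th_vecP neg.
set x := fun k => nth 0 (th_vec Z) k.
rewrite -[X in mk2 n X]/(fun i j => ent Z i j + th_g x i j) th_pot_update.
have {}viol : quad n.+1 (th_A Z) x <= - th_G%:Z by exact: viol.
rewrite th_quad in viol; rewrite th_g_star.
have G2 : \sum_(i < n) \sum_(j < n) th_g x i j ^+ 2 <= th_G%:Z - 1.
  have G1 i j : th_g x i j ^+ 2 <= 9%:Z * (th_R * th_R * (th_R * th_R))%N%:Z.
    rewrite /th_g; case: ifP => _; first by rewrite expr0n.
    have := bv i; have := bv j; have := bv n; rewrite -/(x i) -/(x j) -/(x n) !ler_norml.
    move: (x i) (x j) (x n) (th_R) => p q r R /andP [r1 r2] /andP [q1 q2] /andP [p1 p2].
    have H (a b : int) : - R%:Z <= a -> a <= R%:Z -> - R%:Z <= b -> b <= R%:Z -> - (R * R)%:Z <= a * b <= (R * R)%:Z.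
      by move=> *; nia.
    have /andP [a1 a2] := H p q p1 p2 q1 q2; have /andP [b1 b2] := H r p r1 r2 p1 p2.
    rewrite PoszM; move: (R * R)%N a1 a2 b1 b2 => R2.
    by case: eqP => _; rewrite ?addr0 -?mulrA; move: (p * q) (r * p) => a b a1 a2 b1 b2; nia.
  apply: le_trans (_ : \sum_(i < n) \sum_(j < n) 9%:Z * (th_R * th_R * (th_R * th_R))%N%:Z <= _).
    by apply: ler_sum => i _; apply: ler_sum => j _; apply: G1.
  rewrite !sumr_const !card_ord /th_G; move: (_ * _ * (_ * _))%N => r.
  rewrite -!mulrnA -mulr_natl natz; lia.
move: viol G2; have : 0 <= th_M%:Z * (x n + \sum_(i in S) x i) ^+ 2 by rewrite mulr_ge0 ?sqr_ge0.
rewrite mulrBr; move: (th_pot Z) (_ * _ ^+ 2) (_ * _ ^+ 2) (\sum_(i < n) _) (\sum_(i < n) _) => p q r y y'; lia.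
Qed.

Lemma pot_start : th_pot [::] < th_T%:Z.
Proof.
rewrite /th_pot; apply: le_lt_trans (_ : \sum_(i < n) \sum_(j < n) (th_M * th_M)%N%:Z < _).
  apply: ler_sum => i _; apply: ler_sum => j _; rewrite /ent !nth_nil sub0r sqrrN /zs PoszM.
  by case: (_ && _); rewrite ?mulr1 ?mulr0 ?expr0n ?mulr_ge0 // expr2.
rewrite !sumr_const !card_ord -!mulrnA -mulr_natl natz /th_T; lia.
Qed.

Lemma test_yes : theta_test.
Proof.
rewrite /theta_test; apply/orP; right.
have [] := @potential_iter _ th_step (fun Z => ~~ th_low Z && ~~ th_neg Z) th_pot [::] th_T _ _ _ pot_start.
- by move=> Z; apply: sumr_ge0 => i _; apply: sumr_ge0 => j _; apply: sqr_ge0.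
- move=> Z; rewrite negb_and !negbK; case: (boolP (th_low Z)) => [/low_dec //|nl] /= H.
  exact: neg_dec.
- by move=> Z /andP [/negbTE l1 /negbTE l2]; rewrite /th_step l1 l2.
set Z := iter _ _ _ => /andP [l1 l2] Hp /=; rewrite l1 l2 /=.
(* The final potential bounds the squared deviation of every single entry from the target, whose
   entries lie between 0 and [th_M]. *)
apply/allnP => i Hi; apply/allnP => j Hj; rewrite zabsE.
have H1 : (ent Z i j - zs (Ordinal Hi) (Ordinal Hj)) ^+ 2 <= th_pot Z.
  rewrite /th_pot (bigD1 (Ordinal Hi)) //= (bigD1 (Ordinal Hj)) //= -addrA lerDl.
  apply: addr_ge0; first by apply: sumr_ge0 => k _; apply: sqr_ge0.
  by apply: sumr_ge0 => k _; apply: sumr_ge0 => m _; apply: sqr_ge0.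
have H2 := le_lt_trans (le_trans H1 Hp) pot_start.
have H3 : 0 <= zs (Ordinal Hi) (Ordinal Hj) <= th_M%:Z.
  by rewrite /zs; case: (_ \in S); case: (_ \in S) => /=; rewrite ?mulr1 ?mulr0 ?lexx ?andbT //.
move: H2 H3; rewrite /th_T /th_a; move: (ent Z i j) (zs _ _) (th_M) => x z M H2 /andP [z0 z1].
have : `|x - z| <= (M * n)%N%:Z.
  rewrite leNgt; apply/negP => Hc; move: H2; apply/negP; rewrite -leNgt -real_normK ?num_real //.
  by move: Hc; move: (`|x - z|) (M * n)%N => t m; nia.
by rewrite !ler_norml; lia.
Qed.
End Yes.

Lemma iter_sym Z k : (forall i j : 'I_n, ent Z i j = ent Z j i) ->
  forall i j : 'I_n, ent (iter k th_step Z) i j = ent (iter k th_step Z) j i.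
Proof.
move=> H; elim: k => // k IH i j; rewrite iterS /th_step.
case: ifP => _; last case: ifP => _ //.
  rewrite !ent_mk2 // IH [j == i :> nat]eq_sym; case: eqP => // ij.
  by rewrite ij.
rewrite !ent_mk2 // IH !adjE e_sym [j == i :> nat]eq_sym; case: ifP => // _.
case: eqP => [ij|_]; first by rewrite ij.
by rewrite mulrC.
Qed.

Section No.
Hypothesis gc : good (compl e).
Hypothesis test : theta_test.

(** Weak duality. Goodness of the complement gives a cover of the weights by cliques, with no more
    members than the weight of some stable set. The diagonal of an almost positive semidefinite
    matrix sums to little more than [th_M] over a clique; if fewer than s cliques cover, their total
    cannot reach the threshold of [th_low]. *)
Lemma test_no : exists2 S, stab e S & (s <= wt wf S)%N.
Proof.
have [s1 [Hs1 Hm [S HS Hk]]] := gc wf; rewrite stab_complK in HS.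
exists S => //; rewrite leqNgt; apply/negP => Hlt.
move: test; rewrite /theta_test; case: eqP => [s0|_] /=; first by move: Hlt; rewrite s0.
set Z := iter _ _ _ => /and3P [nlow nneg small].
have symZ : forall i j : 'I_n, ent Z i j = ent Z j i.
  by apply: iter_sym => i j; rewrite /ent !nth_nil.
have symA : symmx n.+1 (th_A Z).
  move=> i j Hi Hj; rewrite /th_A; case: (i =P n) => [Ei|/eqP ni]; case: (j =P n) => [Ej|/eqP nj] //.
  have Hi' : (i < n)%N by lia. have Hj' : (j < n)%N by lia.
  have -> : has_edge E i j = e (Ordinal Hi') (Ordinal Hj') by rewrite -adjE.
  have -> : has_edge E j i = e (Ordinal Hj') (Ordinal Hi') by rewrite -adjE.
  by rewrite e_sym; case: ifP => // _; exact: (symZ (Ordinal Hi') (Ordinal Hj')).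
have bZ i j : (i < n)%N -> (j < n)%N -> `|ent Z i j| <= th_a%:Z.
  by move=> Hi Hj; have /allnP /(_ i Hi) /allnP /(_ j Hj) := small; rewrite zabsE.
have bA i j : (i < n.+1)%N -> (j < n.+1)%N -> `|th_A Z i j| <= th_a%:Z.
  move=> Hi Hj; rewrite /th_A.
  have aM : th_M%:Z <= th_a%:Z by rewrite /th_a lez_nat; nia.
  case: (i =P n) => [Ei|/eqP ni]; case: (j =P n) => [Ej|/eqP nj] //; try (apply: bZ; lia).
  by case: ifP => _; [rewrite normr0 | apply: bZ; lia].
have M0 := th_M_gt0.
(* A vector that violated this would, through power iteration and rounding, yield one of the
   candidates that [th_neg] has ruled out. *)
have nonneg x : - ((th_d%:Z * dot n.+1 x x)) <= quad n.+1 (th_A Z) x.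
  rewrite leNgt; apply/negP => Hx.
  have a0 : 0 < th_a%:Z by rewrite ltz_nat /th_a muln_gt0 M0.
  have d0 : 0 < th_d%:Z by rewrite ltz_nat; move: M0; rewrite /th_M muln_gt0 => /andP [].
  have [|i [l [Hi Hl u0 Hq]]] := @power_violation n.+1 (th_A Z) th_a%:Z th_d%:Z isT symA bA a0 d0 x th_L Hx.
    rewrite -mul2n /th_L leq_mul2l /= leq_mul2l; apply/orP; right.
    rewrite /th_c natz; lia.
  have Ec : (n.+1%:R * th_a%:Z) ^+ 2 *+ 2 = th_c%:Z by rewrite natz /th_c !PoszM; ring.
  rewrite Ec in u0 Hq.
  set u := iter l _ _ in u0 Hq.
  have Eu k : (k < n.+1)%N -> nth 0 (th_pow Z i l) k = u k.
    rewrite /u /th_pow; clear -Hi; elim: l k => [|l IH] k Hk.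
      by rewrite /= nth_mkseq // /basis; case: (k == i).
    rewrite !iterS nth_mkseq // IH // /powstep; congr (_ - _).
    by rewrite /sumz /app; apply: eq_bigr => j _; rewrite IH.
  set m := th_max (th_pow Z i l).
  have [i0 Hi0 Em] : exists2 i0, (i0 < n.+1)%N & m = `|u i0| /\ forall k, (k < n.+1)%N -> `|u k| <= m.
    have [j Hj] : exists j : 'I_n.+1, forall k : 'I_n.+1, `|u k| <= `|u j|.
      have [j _ Hj] := @arg_maxP _ int 'I_n.+1 ord0 xpredT (fun k => `|u k|) isT.
      by exists j => k; apply: Hj.
    pose top i1 := alln n.+1 (fun j => zabs (nth 0 (th_pow Z i l) j) <= zabs (nth 0 (th_pow Z i l) i1)).
    have topj : top j by apply/allnP => k Hk0; rewrite !zabsE !Eu //; apply: (Hj (Ordinal Hk0)).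
    have [H1 H2] := findn_P (ex_intro2 (fun k => (k < n.+1)%N) (fun k => top k) (j : nat) (ltn_ord j) topj).
    exists (findn n.+1 top) => //.
    rewrite /m /th_max zabsE -/top Eu //; split=> // k Hk0.
    by move/allnP: H2 => /(_ k Hk0); rewrite !zabsE !Eu.
  case: Em => Em bu.
  have m0 : 0 < m.
    have m_ge0 : 0 <= m by rewrite Em.
    rewrite lt_def m_ge0 andbT; apply/eqP => mz; move: u0; rewrite /dot big1 ?ltxx // => k _.
    by have := bu k (ltn_ord k); rewrite mz normr_le0 => /eqP ->; rewrite mul0r.
  have R0 : (0 < th_R)%N by rewrite /th_R /th_D; nia.
  have V : quad n.+1 (th_A Z) (fun k => scaled th_R m (u k)) <= - th_G%:Z.
    apply: (scaled_violation symA bA m0 bu (ex_intro2 _ _ i0 Hi0 (esym Em)) Hq R0 (ltW d0) (ltW a0)).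
      rewrite !natz /th_a /th_M /th_R; move: (th_D) (th_d) => D d; clear; rewrite expr2 -!PoszM lez_nat; nia.
    rewrite !natz /th_G /th_d; move: (th_R) (th_W) R0 => R W R0; clear -R0; rewrite expr2 -!PoszM lez_nat; nia.
  move: nneg; rewrite /th_neg negbK => /allnP /(_ i Hi); rewrite /th_row negbK => /allnP /(_ l Hl) /negP; apply.
  have V' : quad n.+1 (th_A Z) (fun k => nth 0 (th_cand Z i l) k) <= - th_G%:Z.
    rewrite (@quad_eq _ _ _ (fun k => scaled th_R m (u k))) // => k Hk0.
    by rewrite nth_mkseq // Eu.
  exact: V'.
(* The test vector is 1 on the border and -1 on the clique: off-diagonal terms vanish on the edges,
   and what remains is [th_M] minus the diagonal sum. *)
have cover K : K \in s1 -> \sum_(i in K) ent Z i i <= th_M%:Z + th_d%:Z * n.+1%:Z.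
  move=> /(allP Hs1) /stabP HK.
  pose x (k : nat) : int := if k == n then 1 else - [exists i in K, val i == k]%:R.
  have xn : x n = 1 by rewrite /x eqxx.
  have xi (i : 'I_n) : x i = - (i \in K)%:R.
    rewrite /x (ltn_eqF (ltn_ord i)); congr (- (nat_of_bool _)%:R).
    by apply/exists_inP/idP => [[j jK /eqP/val_inj <-]|iK] //; exists i.
  have := nonneg x; rewrite th_quad xn expr1n mulr1.
  have -> : \sum_(i < n) \sum_(j < n) th_g x i j * ent Z i j = - \sum_(i in K) ent Z i i.
    rewrite [in RHS]big_mkcond -sumrN; apply: eq_bigr => i _.
    rewrite (bigD1 i) //= [X in _ + X]big1 ?addr0 => [|j ji]; last first.
      rewrite /th_g adjE; case: ifP => [_|/negbT eij]; first by rewrite mul0r.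
      rewrite eq_sym val_eqE (negbTE ji) addr0 !xi.
      case: (boolP (i \in K)) => iK; last by rewrite oppr0 !mul0r.
      case: (boolP (j \in K)) => jK; last by rewrite oppr0 mulr0 mul0r.
      have ij : i != j by rewrite eq_sym.
      by have := HK i j iK jK ij; rewrite /compl ij eij.
    rewrite /th_g adjE e_irr eqxx xn !xi; rewrite -[2%:Z]natz; case: (i \in K) => /=; ring.
  have : dot n.+1 x x <= n.+1%:Z.
    apply: le_trans (_ : \sum_(i < n.+1) 1 <= _); last by rewrite sumr_const card_ord natz.
    apply: ler_sum => i _; rewrite /x; case: ifP => _ //.
    by case: [exists i0 in K, _]; rewrite ?oppr0 ?mulr0 ?mulrNN.
  move=> H1 H2; have H3 : th_d%:Z * dot n.+1 x x <= th_d%:Z * n.+1%:Z by apply: ler_wpM2l.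
  rewrite -lerN2 in H3; have := le_trans H3 H2.
  by rewrite lerNl opprB lerBlDl.
have total : \sum_(i < n) (wf i)%:Z * ent Z i i = \sum_(K <- s1) \sum_(i in K) ent Z i i.
  rewrite (eq_bigr (fun i => (mult s1 i)%:Z * ent Z i i)); last by move=> i _; rewrite Hm.
  elim: (s1) => [|K t IH]; first by rewrite big_nil big1 // => i _; rewrite mul0r.
  rewrite big_cons -IH [X in _ = X + _]big_mkcond -big_split /=; apply: eq_bigr => i _.
  by rewrite PoszD mulrDl; case: (i \in K); rewrite ?mul1r ?mul0r.
move: nlow; rewrite /th_low /sumz total -leNgt => low.
have : \sum_(K <- s1) \sum_(i in K) ent Z i i <= (size s1)%:Z * (th_M%:Z + th_d%:Z * n.+1%:Z).
  rewrite big_seq; apply: le_trans (_ : \sum_(K <- s1 | K \in s1) (th_M%:Z + th_d%:Z * n.+1%:Z) <= _).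
    exact: ler_sum.
  by rewrite -big_seq big_const_seq count_predT iter_addr_0 -mulr_natl natz.
move: low; set y := \sum_(K <- s1) _.
have d0 : (0 < th_d)%N by move: M0; rewrite /th_M muln_gt0 => /andP [].
have Hs : (size s1 < s)%N by apply: leq_ltn_trans Hk Hlt.
rewrite /th_M /th_D; clear - d0 Hs.
move: (size s1) (th_d) d0 Hs => k d d0 Hs; rewrite !PoszM => H1 H2.
have {}Hs : k%:Z + 1 <= s%:Z by lia.
have N0 : 0 < n.+1%:Z by [].
move: (n.+1%:Z) N0 H1 H2 => N N0 H1 H2.
have dN : 0 < d%:Z * N by rewrite mulr_gt0.
have : (k%:Z + 1) * (2%:Z * N * s.+1%:Z * d%:Z + d%:Z * N) <= s%:Z * (2%:Z * N * s.+1%:Z * d%:Z + d%:Z * N).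
  apply: ler_wpM2r => //; by rewrite addr_ge0 ?(ltW dN) // !mulr_ge0 // ltW.
have -> : s.+1%:Z = s%:Z + 1 by lia.
by move: H1 H2; lra.
Qed.
End No.

Theorem theta_testP : good (compl e) ->
  reflect (exists2 S, stab e S & (s <= wt wf S)%N) theta_test.
Proof.
move=> gc; apply: (iffP idP) => [|[S HS Hw]]; first exact: test_no.
case: (posnP s) => [s0|s0]; last exact: test_yes HS Hw s0.
by rewrite /theta_test s0 eqxx.
Qed.
End Correct.
End Theta.


(** * Polynomial time of the semidefinite test *)

Lemma PT_nsum {A} {EA : Enc A} (F : A -> nat -> nat) (n : A -> nat) : PT n ->
  PT (fun p : A * nat => F p.1 p.2) -> PT (fun x => nsum (n x) (F x)).
Proof. exact: PT_sum. Qed.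

Ltac pt_user := fail.
Ltac pt_ext ::= first [ pt_user | lazymatch goal with
  | |- PT (fun x => addn (@?a x) (@?b x)) => apply (PT_addn (m := a) (n := b))
  | |- PT (fun x => muln (@?a x) (@?b x)) => apply (PT_muln (m := a) (n := b))
  | |- PT (fun x => subn (@?a x) (@?b x)) => apply (PT_subn (m := a) (n := b))
  | |- PT (fun x => leq (S (@?a x)) (@?b x)) => apply (PT_ltn (m := a) (n := b))
  | |- PT (fun x => leq (@?a x) (@?b x)) => apply (PT_leq (m := a) (n := b))
  | |- PT (fun x => @eq_op Datatypes_nat__canonical__eqtype_Equality (@?a x) 0) => apply (PT_eq0 (f := a))
  | |- PT (fun x => @eq_op Datatypes_nat__canonical__eqtype_Equality (@?a x) (@?b x)) => apply (PT_eqn (m := a) (n := b))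
  | |- PT (fun x => @eq_op Datatypes_bool__canonical__eqtype_Equality (@?a x) (@?b x)) => apply (PT_eqb (b := a) (c := b))
  | |- PT (fun x => andb (@?a x) (@?b x)) => apply (PT_andb (b := a) (c := b))
  | |- PT (fun x => orb (@?a x) (@?b x)) => apply (PT_orb (b := a) (c := b))
  | |- PT (fun x => negb (@?a x)) => apply (PT_negb (b := a))
  | |- PT (fun x => nat_of_bool (@?a x)) => apply (PT_natb (b := a))
  | |- PT (fun x => size (@?a x)) => apply (PT_size_seq (s := a))
  | |- PT (fun x => nth ?d (@?a x) (@?b x)) => apply (PT_nth d (s := a) (n := b))
  | |- PT (fun x => mkseq (@?f x) (@?n x)) => apply (PT_mkseq (f := f) (n := n))
  | |- PT (fun x => nsum (@?n x) (@?f x)) => apply (PT_nsum (F := f) (n := n))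
  | |- PT (fun x => alln (@?n x) (@?f x)) => apply (PT_alln (P := f) (n := n))
  | |- PT (fun x => findn (@?n x) (@?f x)) => apply (PT_findn (P := f) (n := n))
  | |- PT (fun x => sumz (@?n x) (@?f x)) => apply (PT_sumz (F := f) (n := n))
  | |- PT (fun x => Posz (@?a x)) => apply (PT_Posz (n := a))
  | |- PT (fun x => Algebra.add (@?a x) (@?b x)) => apply (PT_addz (z := a) (w := b))
  | |- PT (fun x => Algebra.opp (@?a x)) => apply (PT_oppz (z := a))
  | |- PT (fun x => GRing.mul (@?a x) (@?b x)) => apply (PT_mulz (z := a) (w := b))
  | |- PT (fun x => GRing.exp (@?a x) (@?b x)) => apply (PT_expz (z := a) (n := b))
  | |- PT (fun x => Order.le (@?a x) (@?b x)) => apply (PT_lez (z := a) (w := b))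
  | |- PT (fun x => Order.lt (@?a x) 0) => apply (PT_neg (z := a))
  | |- PT (fun x => Order.lt (@?a x) (@?b x)) => apply (PT_ltz (z := a) (w := b))
  | |- PT (fun x => let y := @?a x in @?b x y) => cbv zeta
  end ].

Section Ctx.
Context {A : Type} {EA : Enc A}.
Implicit Types (n s : A -> nat) (E : A -> seq (seq bool)) (w : A -> seq nat).

Lemma PT_zabs (z : A -> int) : PT z -> PT (fun x => zabs (z x)).
Proof. by move=> Hz; rewrite /zabs; pt. Qed.

Lemma PT_has_edge E (i j : A -> nat) : PT E -> PT i -> PT j -> PT (fun x => has_edge (E x) (i x) (j x)).
Proof. by move=> *; rewrite /has_edge; pt. Qed.
Lemma PT_ent (Z : A -> seq (seq int)) (i j : A -> nat) : PT Z -> PT i -> PT j -> PT (fun x => ent (Z x) (i x) (j x)).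
Proof. by move=> *; rewrite /ent; pt. Qed.
Lemma PT_mk2 n (f : A -> nat -> nat -> int) : PT n -> PT (fun p : A * nat * nat => f p.1.1 p.1.2 p.2) ->
  PT (fun x => mk2 (n x) (f x)).
Proof.
move=> Hn Hf; rewrite /mk2; apply: (PT_mkseq (f := fun x i => mkseq (f x i) (n x))) => //.
by apply: (PT_mkseq (f := fun (p : A * nat) j => f p.1 p.2 j)) => //; pt.
Qed.
End Ctx.

Ltac pt_user ::= lazymatch goal with
  | |- PT (fun x => zabs (@?a x)) => apply (PT_zabs (z := a))
  | |- PT (fun x => has_edge (@?a x) (@?b x) (@?c x)) => apply (PT_has_edge (E := a) (i := b) (j := c))
  | |- PT (fun x => ent (@?a x) (@?b x) (@?c x)) => apply (PT_ent (Z := a) (i := b) (j := c))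
  | |- PT (fun x => mk2 (@?a x) (@?b x)) => apply (PT_mk2 (n := a) (f := b))
  end.

Ltac pt3 := match goal with
  | H : PT (fun p => ?f p.1.1 p.1.2 p.2) |- PT (fun x => ?f (@?a x) (@?b x) (@?c x)) =>
      apply (PT_comp (g := fun p => f p.1.1 p.1.2 p.2) (f := fun x => (a x, b x, c x)) H)
  end.

Lemma blen_exp (P : nat) k : (blen (P ^ k) <= k * blen P + 1)%N.
Proof.
elim: k => [|k IH]; first by rewrite expn0.
by rewrite expnS mulSn -addnA; apply: leq_trans (blen_mul _ _) _; rewrite leq_add2l.
Qed.

Lemma tsz_ints (u : seq int) (M : nat) : (forall i, (i < size u)%N -> (absz (nth 0%R u i) <= M)%N) ->
  (tsz u <= (size u * (4 * blen M + 5).+1).+1)%N.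
Proof.
move=> H; apply: tsz_seq_le => i a Hi; rewrite (set_nth_default 0) //.
apply: leq_trans (tsz_int_le _) _; rewrite leq_add2r leq_mul2l /=.
exact: blen_mono (H i Hi).
Qed.

Lemma blen_tsz {A} {EA : Enc A} (z : A -> int) c x :
  (forall x, tsz (z x) <= bnd c (tsz x))%N -> (blen (absz (z x)) <= bnd c (tsz x))%N.
Proof. by move=> H; apply: leq_trans (H x); have := tsz_int_ge (z x); lia. Qed.

Lemma nat_tsz {A} {EA : Enc A} (k : A -> nat) c x :
  (forall x, tsz (k x) <= bnd c (tsz x))%N -> (k x <= bnd c (tsz x))%N.
Proof. by move=> H; apply: leq_trans (H x); rewrite tsz_nat; lia. Qed.

Section Ctx2.
Context {A : Type} {EA : Enc A}.
Implicit Types (n s i l : A -> nat) (E : A -> seq (seq bool)) (w : A -> seq nat) (Z : A -> seq (seq int)).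

Lemma PT_scaled (R : A -> nat) (m z : A -> int) : PT R -> PT m -> PT z ->
  PT (fun x => scaled (R x) (m x) (z x)).
Proof. by move=> *; rewrite /scaled; pt. Qed.
Lemma PT_th_W n w : PT n -> PT w -> PT (fun x => th_W (n x) (w x)).
Proof. by move=> *; rewrite /th_W; pt. Qed.
Lemma PT_th_D n s : PT n -> PT s -> PT (fun x => th_D (n x) (s x)).
Proof. by move=> *; rewrite /th_D; pt. Qed.
Lemma PT_th_R n s : PT n -> PT s -> PT (fun x => th_R (n x) (s x)).
Proof. by move=> *; rewrite /th_R; pt; apply: PT_th_D. Qed.
Lemma PT_th_d n w s : PT n -> PT w -> PT s -> PT (fun x => th_d (n x) (w x) (s x)).
Proof. by move=> *; rewrite /th_d; pt; by [apply: PT_th_R | apply: PT_th_W]. Qed.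
Lemma PT_th_M n w s : PT n -> PT w -> PT s -> PT (fun x => th_M (n x) (w x) (s x)).
Proof. by move=> *; rewrite /th_M; pt; by [apply: PT_th_D | apply: PT_th_d]. Qed.
Lemma PT_th_a n w s : PT n -> PT w -> PT s -> PT (fun x => th_a (n x) (w x) (s x)).
Proof. by move=> *; rewrite /th_a; pt; apply: PT_th_M. Qed.
Lemma PT_th_c n w s : PT n -> PT w -> PT s -> PT (fun x => th_c (n x) (w x) (s x)).
Proof. by move=> *; rewrite /th_c; pt; apply: PT_th_a. Qed.
Lemma PT_th_L n w s : PT n -> PT w -> PT s -> PT (fun x => th_L (n x) (w x) (s x)).
Proof. by move=> *; rewrite /th_L; pt; apply: PT_th_c. Qed.
Lemma PT_th_G n s : PT n -> PT s -> PT (fun x => th_G (n x) (s x)).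
Proof. by move=> *; rewrite /th_G; pt; apply: PT_th_R. Qed.
Lemma PT_th_T n w s : PT n -> PT w -> PT s -> PT (fun x => th_T (n x) (w x) (s x)).
Proof. by move=> *; rewrite /th_T; pt; apply: PT_th_M. Qed.
Lemma PT_th_A n E w s Z i l : PT n -> PT E -> PT w -> PT s -> PT Z -> PT i -> PT l ->
  PT (fun x => th_A (n x) (E x) (w x) (s x) (Z x) (i x) (l x)).
Proof. by move=> *; rewrite /th_A; pt; apply: PT_th_M. Qed.
Lemma PT_th_max n (u : A -> seq int) : PT n -> PT u -> PT (fun x => th_max (n x) (u x)).
Proof. by move=> *; rewrite /th_max; pt. Qed.
End Ctx2.

Ltac pt_user ::= first [ lazymatch goal with
  | |- PT (fun x => zabs (@?a x)) => apply (PT_zabs (z := a))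
  | |- PT (fun x => has_edge (@?a x) (@?b x) (@?c x)) => apply (PT_has_edge (E := a) (i := b) (j := c))
  | |- PT (fun x => ent (@?a x) (@?b x) (@?c x)) => apply (PT_ent (Z := a) (i := b) (j := c))
  | |- PT (fun x => mk2 (@?a x) (@?b x)) => apply (PT_mk2 (n := a) (f := b))
  | |- PT (fun x => scaled (@?a x) (@?b x) (@?c x)) => apply (PT_scaled (R := a) (m := b) (z := c))
  | |- PT (fun x => th_W _ _) => apply PT_th_W
  | |- PT (fun x => th_R _ _) => apply PT_th_R
  | |- PT (fun x => th_M _ _ _) => apply PT_th_M
  | |- PT (fun x => th_a _ _ _) => apply PT_th_a
  | |- PT (fun x => th_c _ _ _) => apply PT_th_c
  | |- PT (fun x => th_L _ _ _) => apply PT_th_L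
  | |- PT (fun x => th_G _ _) => apply PT_th_G
  | |- PT (fun x => th_T _ _ _) => apply PT_th_T
  | |- PT (fun x => th_A _ _ _ _ _ _ _) => apply PT_th_A
  | |- PT (fun x => th_max _ _) => apply PT_th_max
  end | pt3 ].

Section Ctx3.
Context {A : Type} {EA : Enc A}.
Implicit Types (n s i l : A -> nat) (E : A -> seq (seq bool)) (w : A -> seq nat) (Z : A -> seq (seq int)).

(** The entries after k rounds are at most P^k in absolute value, where P is [th_c] plus the sum of
    the absolute values of the matrix entries. As k is bounded by a unary number, they have
    polynomially many bits. *)
Lemma PT_th_pow n E w s Z i l : PT n -> PT E -> PT w -> PT s -> PT Z -> PT i -> PT l ->
  PT (fun x => th_pow (n x) (E x) (w x) (s x) (Z x) (i x) (l x)).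
Proof.
move=> Hn HE Hw Hs HZ Hi Hl; rewrite /th_pow.
apply: (PT_iter (f := fun x u => mkseq (fun k => (th_c (n x) (w x) (s x))%:Z * nth 0 u k -
  sumz (n x).+1 (fun j => th_A (n x) (E x) (w x) (s x) (Z x) k j * nth 0 u j)) (n x).+1)); [by [] | by pt | by pt |].
pose P x := (th_c (n x) (w x) (s x))%:Z + sumz (n x).+1 (fun k => sumz (n x).+1 (fun j => zabs (th_A (n x) (E x) (w x) (s x) (Z x) k j))).
have [a Ha] : exists a, forall x, (tsz (P x) <= bnd a (tsz x))%N by apply: PT_size; rewrite /P; pt.
have [b Hb] := PT_size Hn; have [c Hc] := PT_size Hl.
have [d Hd] : pbounded (fun t => ((bnd b t).+1 * (4 * (bnd c t * bnd a t + 1) + 5).+1).+1)%N by pb.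
exists d => x k Hk; apply: leq_trans (Hd _); set f := (X in iter k X).
set u := iter k _ _.
have [Hsz Hu] : size u = (n x).+1 /\ forall j, (j < (n x).+1)%N -> `|nth 0 u j| <= P x ^+ k.
  rewrite /u; clear Hk; elim: k {u} => [|k [IH1 IH2]].
    split; first by rewrite size_mkseq.
    by move=> j Hj; rewrite nth_mkseq // expr0; case: ifP; rewrite ?normr0.
  rewrite iterS; split; first by rewrite /f size_mkseq.
  move=> j Hj; rewrite {1}/f nth_mkseq //; set v := iter k _ _ in IH1 IH2 *.
  have P0 : 0 <= P x.
    rewrite /P addr_ge0 //; apply: sumr_ge0 => ? _; apply: sumr_ge0 => ? _.
    by rewrite zabsE.
  rewrite exprS {1}/P mulrDl; apply: le_trans (ler_normB _ _) _; apply: lerD.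
    by rewrite normrM ger0_norm //; apply: ler_wpM2l => //; apply: IH2.
  apply: le_trans (ler_norm_sum _ _ _) _.
  rewrite [X in _ <= X * _](bigD1 (Ordinal Hj)) //= mulrDl -[X in X <= _]addr0; apply: lerD; last first.
    rewrite mulr_ge0 ?exprn_ge0 //; apply: sumr_ge0 => ? _; apply: sumr_ge0 => ? _.
    by rewrite zabsE.
  rewrite mulr_suml; apply: ler_sum => m _; rewrite normrM zabsE.
  by apply: ler_wpM2l => //; apply: IH2.
apply: leq_trans (tsz_ints (M := (absz (P x)) ^ k) _) _.
  rewrite Hsz => j Hj; have := Hu j Hj; rewrite -lez_nat -!abszE => H.
  apply: le_trans H _; rewrite -abszX; exact: lez_abs.
rewrite Hsz ltnS; apply: leq_mul; first by rewrite ltnS; apply: nat_tsz.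
rewrite ltnS leq_add2r leq_mul2l /=; apply: leq_trans (blen_exp _ _) _.
rewrite leq_add2r; apply: leq_mul; last exact: blen_tsz.
by apply: leq_trans Hk _; apply: nat_tsz.
Qed.

End Ctx3.

Section Ctx4.
Context {A : Type} {EA : Enc A}.
Implicit Types (n s i l : A -> nat) (E : A -> seq (seq bool)) (w : A -> seq nat) (Z : A -> seq (seq int)).

Lemma PT_th_cand n E w s Z i l : PT n -> PT E -> PT w -> PT s -> PT Z -> PT i -> PT l ->
  PT (fun x => th_cand (n x) (E x) (w x) (s x) (Z x) (i x) (l x)).
Proof. by move=> *; rewrite /th_cand; pt; apply: PT_th_pow; pt. Qed.

Lemma PT_th_viol n E w s Z (v : A -> seq int) : PT n -> PT E -> PT w -> PT s -> PT Z -> PT v ->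
  PT (fun x => th_viol (n x) (E x) (w x) (s x) (Z x) (v x)).
Proof. by move=> *; rewrite /th_viol; pt. Qed.
End Ctx4.

Section Ctx5.
Context {A : Type} {EA : Enc A}.
Implicit Types (n s i l : A -> nat) (E : A -> seq (seq bool)) (w : A -> seq nat) (Z : A -> seq (seq int)).
Lemma PT_th_row n E w s Z i : PT n -> PT E -> PT w -> PT s -> PT Z -> PT i ->
  PT (fun x => th_row (n x) (E x) (w x) (s x) (Z x) (i x)).
Proof. by move=> *; rewrite /th_row; pt; apply: PT_th_viol; pt; apply: PT_th_cand; pt. Qed.
End Ctx5.

Section Ctx5b.
Context {A : Type} {EA : Enc A}.
Implicit Types (n s i l : A -> nat) (E : A -> seq (seq bool)) (w : A -> seq nat) (Z : A -> seq (seq int)).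
Lemma PT_th_vec n E w s Z : PT n -> PT E -> PT w -> PT s -> PT Z ->
  PT (fun x => th_vec (n x) (E x) (w x) (s x) (Z x)).
Proof.
move=> Hn HE Hw Hs HZ; rewrite /th_vec; cbv zeta; apply: PT_th_cand => //.
  by pt; apply: PT_th_row; pt.
pt; apply: PT_th_viol; pt; apply: PT_th_cand; pt; apply: PT_th_row; pt.
Qed.
Lemma PT_th_low n w s Z : PT n -> PT w -> PT s -> PT Z ->
  PT (fun x => th_low (n x) (w x) (s x) (Z x)).
Proof. by move=> *; rewrite /th_low; pt. Qed.
End Ctx5b.

Section Ctx6.
Context {A : Type} {EA : Enc A}.
Implicit Types (n s i l : A -> nat) (E : A -> seq (seq bool)) (w : A -> seq nat) (Z : A -> seq (seq int)).
Lemma PT_th_neg n E w s Z : PT n -> PT E -> PT w -> PT s -> PT Z ->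
  PT (fun x => th_neg (n x) (E x) (w x) (s x) (Z x)).
Proof. by move=> *; rewrite /th_neg; pt; apply: PT_th_row; pt. Qed.
Lemma PT_th_small n w s Z : PT n -> PT w -> PT s -> PT Z ->
  PT (fun x => th_small (n x) (w x) (s x) (Z x)).
Proof. by move=> *; rewrite /th_small; pt. Qed.
Lemma PT_th_step n E w s Z : PT n -> PT E -> PT w -> PT s -> PT Z ->
  PT (fun x => th_step (n x) (E x) (w x) (s x) (Z x)).
Proof.
move=> Hn HE Hw Hs HZ; have V := PT_th_vec Hn HE Hw Hs HZ.
rewrite /th_step; cbv zeta; apply: PT_if; first exact: PT_th_low.
  by pt.
apply: PT_if; [exact: PT_th_neg | | by []].
apply: PT_mk2 => //; pt; by match goal with |- PT (fun p => th_vec _ _ _ _ _) => apply: (PT_comp V (PT_fst (PT_fst PT_id))) end.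
Qed.
End Ctx6.

Lemma cand_le n E w s Z i l k : (absz (nth 0%R (th_cand n E w s Z i l) k) <= th_R n s)%N.
Proof.
rewrite /th_cand -lez_nat abszE; case: (ltnP k n.+1) => Hk; first by rewrite nth_mkseq // scaled_le.
by rewrite nth_default ?size_mkseq // normr0.
Qed.

Lemma tsz_mk2 n (f : nat -> nat -> int) M :
  (forall i j, (i < n)%N -> (j < n)%N -> (absz (f i j) <= M)%N) ->
  (tsz (mk2 n f) <= (n * (n * (4 * blen M + 5).+1).+2).+1)%N.
Proof.
move=> H; rewrite /mk2 -[X in (_ <= (X * _).+1)%N](size_mkseq (fun i => mkseq (f i) n)).
apply: tsz_seq_le => i a; rewrite size_mkseq => Hi; rewrite nth_mkseq //.
rewrite -[X in (_ <= (X * _).+1)%N](size_mkseq (f i)); apply: tsz_ints => j; rewrite size_mkseq => Hj.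
by rewrite nth_mkseq // H.
Qed.

Section Ctx7.
Context {A : Type} {EA : Enc A}.
Implicit Types (n s : A -> nat) (E : A -> seq (seq bool)) (w : A -> seq nat).

(** One step changes an entry by at most [th_W] plus three times the square of [th_R], so all
    entries stay polynomially bounded over the [th_T] steps. *)
Theorem PT_theta_test n E w s : PT n -> PT E -> PT w -> PT s ->
  PT (fun x => theta_test (n x) (E x) (w x) (s x)).
Proof.
move=> Hn HE Hw Hs; rewrite /theta_test; cbv zeta.
have I : PT (fun x => iter (th_T (n x) (w x) (s x)) (th_step (n x) (E x) (w x) (s x)) [::]); last first.
  pt; [exact: PT_th_low | exact: PT_th_neg | exact: PT_th_small].
apply: (PT_iter (f := fun x => th_step (n x) (E x) (w x) (s x))); [by pt|by pt|by apply: PT_th_step; pt|].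
pose B x := (th_W (n x) (w x) + 3 * (th_R (n x) (s x) * th_R (n x) (s x)))%N.
have HB : PT B by rewrite /B; pt.
have HT : PT (fun x => th_T (n x) (w x) (s x)) by pt.
have [a Ha] := PT_size HB; have [b Hb] := PT_size Hn; have [c Hc] := PT_size HT.
have [d Hd] : pbounded (fun t => (bnd b t * (bnd b t * (4 * (bnd c t * bnd a t) + 5).+1).+2).+1)%N by pb.
exists d => x k Hk; apply: leq_trans (Hd _).
set f := th_step _ _ _ _.
have [->|[g [-> Hg]]] : iter k f [::] = [::] \/ exists g, iter k f [::] = mk2 (n x) g /\
    forall i j, (i < n x)%N -> (j < n x)%N -> (absz (g i j) <= k * B x)%N.
- clear Hk; elim: k => [|k IH]; first by left.
  rewrite iterS; set Z := iter k f [::] in IH *.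
  have HZ i j : (i < n x)%N -> (j < n x)%N -> (absz (ent Z i j) <= k * B x)%N.
    move=> Hi Hj; case: IH => [->|[g [-> Hg]]]; first by rewrite /ent !nth_nil.
    by rewrite ent_mk2 // Hg.
  rewrite /f /th_step; case: ifP => _; last case: ifP => _.
  + right; eexists; split; first by [].
    move=> i j Hi Hj; apply: leq_trans (abszD _ _) _; rewrite mulSn addnC; apply: leq_add; last exact: HZ.
    case: ifP => _ //; rewrite /B /th_W /nsum (bigD1 (Ordinal Hi)) //= -!addnA; exact: leq_addr.
  + right; eexists; split; first by [].
    move=> i j Hi Hj; apply: leq_trans (abszD _ _) _; rewrite mulSn addnC; apply: leq_add; last exact: HZ.
    case: ifP => _ //; apply: leq_trans (leq_addl _ _).
    have H := cand_le (n x) (E x) (w x) (s x) Z.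
    rewrite /th_vec; set i0 := findn _ _; set l0 := findn _ _.
    have := H i0 l0 i; have := H i0 l0 j; have := H i0 l0 (n x).
    move: (nth 0 _ i) (nth 0 _ j) (nth 0 _ (n x)) (th_R _ _) => p q r R Hr Hq Hp.
    have m1 : (absz (p * q)%R <= R * R)%N by rewrite abszM leq_mul.
    have m2 : (absz (r * p)%R <= R * R)%N by rewrite abszM leq_mul.
    rewrite -mulrA; move: m1 m2; case: ifP => _; move: (p * q) (r * p) (R * R)%N => u v t; lia.
  case: IH => [E0|[g [Eg Hg]]]; [by left|right; exists g; split=> // i j Hi Hj].
  by apply: leq_trans (Hg i j Hi Hj) _; rewrite leq_mul2r leqnSn orbT.
- exact: ltn0Sn.
apply: leq_trans (tsz_mk2 Hg) _; rewrite ltnS; apply: leq_mul; first exact: nat_tsz.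
rewrite !ltnS; apply: leq_mul; first exact: nat_tsz.
rewrite ltnS leq_add2r leq_mul2l /=; apply: leq_trans (blen_leq _) _.
by apply: leq_mul; [apply: leq_trans Hk _; apply: (nat_tsz _ Hc) | apply: (nat_tsz _ Ha)].
Qed.
End Ctx7.

Local Close Scope ring_scope.

(** * Maximum weight stable sets by self-reduction *)

(** On good graphs exactly the thresholds up to the maximum weight are accepted, so counting the
    positive ones gives that maximum. *)
Definition th_alpha n E w := nsum (th_W n w) (fun s => theta_test n E w s.+1).
Definition zero_at n (w : seq nat) v := mkseq (fun i => if i == v then 0 else nth 0 w i) n.
Definition mws_step n E a (st : nat * seq nat) :=
  (st.1.+1, if theta_test n E (zero_at n st.2 st.1) a then zero_at n st.2 st.1 else st.2).
(** The weight of each vertex in turn is set to zero if the maximum survives this; the vertices that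
    keep a positive weight form the answer. *)
Definition mws n E w : seq bool :=
  mkseq (fun i => 0 < nth 0 (iter n (mws_step n E (th_alpha n E w)) (0, w)).2 i) n.

Definition setm n (U : seq bool) : {set 'I_n} := [set i : 'I_n | nth false U i].
Definition wtm n (w : seq nat) (i : 'I_n) : nat := nth 0 w i.
Arguments setm : clear implicits.
Arguments wtm : clear implicits.

Lemma good_ext (V : finType) (e e' : rel V) : (forall u v, u != v -> e u v = e' u v) -> good e -> good e'.
Proof.
move=> He ge w; have [s [Hs Hm [K HK Hk]]] := ge w.
exists s; split=> //.
  by apply/allP => A /(allP Hs); apply: stab_eq => u v _ _; apply: He.
exists K => //; apply: stab_eq HK => u v _ _ uv; by rewrite /compl uv He.
Qed.

Section Mws.
Variables (n : nat) (E : seq (seq bool)) (e : rel 'I_n).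
Hypothesis adjE : forall i j : 'I_n, has_edge E i j = e i j.
Hypothesis e_sym : symmetric e.
Hypothesis e_irr : irreflexive e.
Hypothesis gc : good (compl e).

Let testP w s := theta_testP w s adjE e_sym e_irr gc.

Lemma wt_tot w S : wt (wtm n w) S <= th_W n w.
Proof. by rewrite /th_W /nsum [X in X <= _]big_mkcond; apply: leq_sum => i _; case: ifP. Qed.

Lemma th_alphaP w : (exists2 S, stab e S & wt (wtm n w) S = th_alpha n E w) /\
  forall S, stab e S -> wt (wtm n w) S <= th_alpha n E w.
Proof.
have [S0 HS0 Smax] : exists2 S0, stab e S0 & forall S, stab e S -> wt (wtm n w) S <= wt (wtm n w) S0.
  have := @arg_maxnP _ (set0 : {set 'I_n}) (stab e) (wt (wtm n w)) (stab0 e).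
  by case=> S0 H1 H2; exists S0.
suff Ea : wt (wtm n w) S0 = th_alpha n E w by split; [exists S0 | rewrite -Ea].
rewrite /th_alpha /nsum; set a := wt _ _ in Smax *.
have aW : a <= th_W n w by exact: wt_tot.
rewrite -(big_mkord xpredT (fun i => theta_test n E w i.+1 : nat)) (big_cat_nat (leq0n a) aW) /=.
rewrite [X in X + _](eq_big_nat _ _ (F2 := fun=> 1)); last first.
  by move=> i /andP [_ Hi]; apply/eqP; rewrite eqb1; apply/testP; exists S0.
rewrite [X in _ + X](eq_big_nat _ _ (F2 := fun=> 0)); last first.
  move=> i /andP [Hi _]; apply/eqP; rewrite eqb0; apply/negP => /testP [S HS Hw].
  by have := Smax S HS; rewrite /a leqNgt => /negP; apply; apply: leq_ltn_trans Hw.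
by rewrite !sum_nat_const_nat muln0 addn0 muln1 subn0.
Qed.

(** Invariant: a stable set of weight at least [a] still exists, and each such set contains every
    processed vertex of positive weight. After all vertices are processed the support lies inside
    such a set and carries its whole weight. *)
Lemma mwsP w : [/\ stab e (setm n (mws n E w)),
  forall S, stab e S -> wt (wtm n w) S <= wt (wtm n w) (setm n (mws n E w)) &
  forall i : 'I_n, i \in setm n (mws n E w) -> 0 < wtm n w i].
Proof.
have [[S0 HS0 ES0] Smax] := th_alphaP w; set a := th_alpha n E w in ES0 Smax.
pose st k := iter k (mws_step n E a) (0, w).
have Hst k : [/\ (st k).1 = k, forall i : 'I_n, wtm n (st k).2 i <= wtm n w i,
    exists2 S, stab e S & a <= wt (wtm n (st k).2) S &
    forall i : 'I_n, i < k -> 0 < wtm n (st k).2 i -> forall S, stab e S -> a <= wt (wtm n (st k).2) S -> i \in S].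
  elim: k => [|k [I1 I2 I3 I4]]; first by split=> //; exists S0; rewrite ?ES0.
  rewrite /st iterS -/(st k) /mws_step /= I1; case: testP => [H|H].
    have Hz (i : 'I_n) : wtm n (zero_at n (st k).2 k) i = if i == k :> nat then 0 else wtm n (st k).2 i.
      by rewrite /wtm /zero_at nth_mkseq.
    have Hle (i : 'I_n) : wtm n (zero_at n (st k).2 k) i <= wtm n (st k).2 i by rewrite Hz; case: ifP.
    split=> // [i|i Hi]; first by apply: leq_trans (Hle i) _.
    rewrite Hz; case: eqP => // nik i0 S HS HSa; apply: (I4 i) => //; first by move: Hi; rewrite ltnS leq_eqVlt => /predU1P [].
    by apply: leq_trans HSa _; apply: leq_sum.
  split=> // i; rewrite ltnS leq_eqVlt => /predU1P [ik|/I4 //] i0 S HS HSa.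
  apply/negPn/negP => iS; apply: H; exists S => //; apply: leq_trans HSa _.
  apply: leq_sum => j jS; rewrite /wtm /zero_at nth_mkseq //; case: eqP => // jk.
  by move: iS; rewrite (_ : i = j) ?jS //; apply: val_inj; rewrite /= ik jk.
have [_ Hle [S HS HSa] Hin] := Hst n.
have EM : setm n (mws n E w) = [set i | 0 < wtm n (st n).2 i].
  by apply/setP => i; rewrite !inE /mws nth_mkseq.
have sub : setm n (mws n E w) \subset S.
  by rewrite EM; apply/subsetP => i; rewrite inE => i0; apply: (Hin i).
have E1 : wt (wtm n (st n).2) S = wt (wtm n (st n).2) (setm n (mws n E w)).
  rewrite /wt [LHS](big_setID (setm n (mws n E w))) /= (setIidPr sub) [X in _ + X]big1 ?addn0 // => i.
  by rewrite EM !inE -eqn0Ngt => /andP [/eqP ->].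
split; first exact: stab_sub sub HS.
  move=> S' /Smax H; apply: leq_trans H _; apply: leq_trans HSa _; rewrite E1.
  by apply: leq_sum.
by move=> i; rewrite EM inE => H; apply: leq_trans H _.
Qed.
End Mws.

(** * A stable set that meets all maximum cliques *)

Definition coE n (E : seq (seq bool)) :=
  mkseq (fun i => mkseq (fun j => (i != j) && ~~ has_edge E i j) n) n.
Definition maxclique n E (U : seq bool) :=
  mws n (coE n E) (mkseq (fun i => nth false U i : nat) n).
Definition msize n (U : seq bool) := nsum n (fun i => nth false U i : nat).
Definition diffm n (U S : seq bool) := mkseq (fun i => nth false U i && ~~ nth false S i) n.

Definition hit_step n E U k (w : seq nat) :=
  let K := maxclique n E (diffm n U (mws n E w)) in
  if msize n K == k then mkseq (fun i => nth 0 w i + nth false K i) n else w.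
(** The method of Grötschel, Lovász and Schrijver: [w] counts the maximum cliques found so far at
    each vertex. As long as a stable set of maximum weight misses some maximum clique of [U], that
    clique is added; linear independence allows at most n additions. *)
Definition hit n E U :=
  mws n E (iter n (hit_step n E U (msize n (maxclique n E U))) (mkseq (fun=> 0) n)).

Lemma msizeE n U : msize n U = #|setm n U|.
Proof.
rewrite /msize /nsum -sum1_card big_mkcond [RHS]big_mkcond /=.
by apply: eq_bigr => i _; rewrite inE; case: (nth _ _ _).
Qed.

Lemma setm_diff n U S : setm n (diffm n U S) = setm n U :\: setm n S.
Proof. by apply/setP => i; rewrite !inE nth_mkseq // andbC. Qed.

Definition om (V : finType) (e : rel V) (A : {set V}) :=
  \max_(K : {set V} | stab (compl e) K && (K \subset A)) #|K|.

Section Om.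
Variables (V : finType) (e : rel V).
Implicit Types A B K : {set V}.
Lemma om_ge A K : stab (compl e) K -> K \subset A -> #|K| <= om e A.
Proof. by move=> HK KA; rewrite /om (bigD1 K) ?HK //= leq_maxl. Qed.
Lemma om_ex A : exists K, [/\ stab (compl e) K, K \subset A & #|K| = om e A].
Proof.
have C0 : 0 < #|[pred K : {set V} | stab (compl e) K && (K \subset A)]|.
  by apply/card_gt0P; exists set0; rewrite inE stab0 sub0set.
have [K /andP [HK KA] Ek] := eq_bigmax_cond (fun K : {set V} => #|K|) C0.
by exists K.
Qed.
Lemma om_sub A B : A \subset B -> om e A <= om e B.
Proof. by move=> AB; have [K [HK KA <-]] := om_ex A; apply: om_ge (subset_trans KA AB). Qed.
Lemma om_gt0 A x : x \in A -> 0 < om e A.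
Proof. by move=> xA; rewrite -(cards1 x); apply: om_ge; rewrite ?stab1 ?sub1set. Qed.
End Om.

(* Vectors of clique sets: a functional that vanishes on the old ones but not
   on the new one shows linear independence. *)
Section Free.
Variable n : nat.
Local Open Scope ring_scope.
Definition cvec (K : {set 'I_n}) : 'rV[rat]_n := \row_i (i \in K)%:R.

Lemma free_cliques (Ks : seq {set 'I_n}) (K S : {set 'I_n}) (k : nat) : (0 < k)%N ->
  free [seq cvec A | A <- Ks] -> (forall A, A \in Ks -> #|A| = k /\ #|A :&: S| = 1%N) ->
  #|K| = k -> K :&: S = set0 -> free (cvec K :: [seq cvec A | A <- Ks]).
Proof.
move=> k0 Hf HA EK KS; rewrite free_cons Hf andbT.
(* The functional takes the value k |A :&: S| - |A| at the incidence vector of A: zero for the old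
   cliques, -k for the new one. *)
pose c : 'cV[rat]_n := \col_i (k%:R * (i \in S)%:R - 1).
pose f : {linear 'rV[rat]_n -> 'rV[rat]_1} := mulmxr c.
have fE A : cvec A *m c = (k%:R * #|A :&: S|%:R - #|A|%:R)%:M.
  apply/matrixP => i j; rewrite !ord1 !mxE eqxx mulr1n.
  rewrite (eq_bigr (fun i => k%:R * ((i \in A) && (i \in S))%:R - (i \in A)%:R)); last first.
    by move=> x _; rewrite !mxE; case: (x \in A); case: (x \in S); rewrite /=; ring.
  rewrite sumrB -mulr_sumr -!natr_sum; congr (_ * _%:R - _%:R).
    by rewrite -sum1_card [RHS]big_mkcond; apply: eq_bigr => x _; rewrite inE; case: (_ && _).
  by rewrite -sum1_card [RHS]big_mkcond; apply: eq_bigr => x _; case: (_ \in _).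
apply/negP => Hin.
have : (<<[seq cvec A | A <- Ks]>> <= lker (linfun f))%VS.
  apply/span_subvP => v /mapP [A /HA [cA sA] ->]; rewrite memv_ker lfunE /= fE cA sA mulr1 subrr.
  by apply/eqP/matrixP => i j; rewrite !mxE mul0rn.
move=> /subvP /(_ _ Hin); rewrite memv_ker lfunE /= fE KS cards0 EK mulr0 sub0r.
move=> /eqP/matrixP/(_ 0 0); rewrite !mxE eqxx mulr1n => /eqP; rewrite oppr_eq0 pnatr_eq0.
by case: k k0 {HA EK c f fE}.
Qed.

Lemma free_size (Ks : seq {set 'I_n}) : free [seq cvec A | A <- Ks] -> (size Ks <= n)%N.
Proof.
rewrite /free => /eqP; rewrite size_map => <-.
by apply: leq_trans (dimvS (subvf _)) _; rewrite dimvf /dim /= mul1n.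
Qed.
End Free.

Section Hit.
Variables (n : nat) (E : seq (seq bool)) (e : rel 'I_n).
Hypothesis adjE : forall i j : 'I_n, has_edge E i j = e i j.
Hypothesis e_sym : symmetric e.
Hypothesis e_irr : irreflexive e.
Hypothesis ge : good e.
Let gc := good_compl ge.

Lemma maxcliqueP U : [/\ stab (compl e) (setm n (maxclique n E U)),
  setm n (maxclique n E U) \subset setm n U & msize n (maxclique n E U) = om e (setm n U)].
Proof.
have adjC (i j : 'I_n) : has_edge (coE n E) i j = compl e i j.
  by rewrite {1}/has_edge /coE !nth_mkseq // adjE /compl -val_eqE.
have symC : symmetric (compl e) by move=> i j; rewrite /compl eq_sym e_sym.
have irrC : irreflexive (compl e) by move=> i; rewrite /compl eqxx.
have gC : good (compl (compl e)) by apply: good_ext ge => u v uv; rewrite /compl uv negbK.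
rewrite /maxclique; set w := mkseq (fun i => nth false U i : nat) n; have [H1 H2 H3] := mwsP adjC symC irrC gC w.
have wE (i : 'I_n) : wtm n w i = (i \in setm n U) by rewrite /wtm nth_mkseq // inE.
have wtE A : wt (wtm n w) A = #|A :&: setm n U|.
  rewrite /wt -sum1_card [LHS]big_mkcond [RHS]big_mkcond; apply: eq_bigr => i _.
  by rewrite wE in_setI; case: (i \in A); case: (i \in setm n U).
have sub : setm n (maxclique n E U) \subset setm n U.
  by apply/subsetP => i /H3; rewrite wE; case: (i \in _).
split=> //; apply/eqP; rewrite msizeE eqn_leq om_ge //=.
have [K [HK KU <-]] := om_ex e (setm n U).
have := H2 K HK; rewrite !wtE (setIidPl KU) => H; apply: leq_trans H _.
by apply: subset_leq_card; apply: subsetIl.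
Qed.

Lemma hitP U : setm n U != set0 -> [/\ stab e (setm n (hit n E U)),
  setm n (hit n E U) \subset setm n U & om e (setm n U :\: setm n (hit n E U)) < om e (setm n U)].
Proof.
move=> /set0Pn [x xU]; set k := om e (setm n U).
have k0 : 0 < k by apply: om_gt0 xU.
have Ek : msize n (maxclique n E U) = k by have [] := maxcliqueP U.
rewrite /hit Ek.
pose inv w (Ks : seq {set 'I_n}) := [/\ wtm n w =1 mult Ks, free [seq cvec A | A <- Ks] &
  forall A, A \in Ks -> [/\ stab (compl e) A, A \subset setm n U & #|A| = k]].
(* A cover of [U] by k stable sets has each of its classes meet each k-clique of [U] exactly once.
   So a class has weight [size Ks], and a stable set of maximum weight, which meets each clique at
   most once, must meet all of them. *)
have meets w Ks : inv w Ks -> forall A, A \in Ks -> #|A :&: setm n (mws n E w)| = 1.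
  move=> [Hw _ HK]; have [H1 H2 _] := mwsP adjE e_sym e_irr gc w.
  have [s [Hs Hm [K0 HK0 Hk0]]] := ge (fun i => i \in setm n U).
  have s_le : size s <= k.
    apply: leq_trans Hk0 _; rewrite [X in X <= _](_ : _ = #|K0 :&: setm n U|).
      by apply: om_ge; [apply: stab_sub HK0; apply: subsetIl | apply: subsetIr].
    rewrite /wt -sum1_card [LHS]big_mkcond [RHS]big_mkcond; apply: eq_bigr => i _.
    by rewrite in_setI; case: (i \in K0); case: (i \in setm n U).
  have one B A : B \in s -> A \in Ks -> #|B :&: A| = 1.
    move=> Bs /HK [sA AU cA]; apply/eqP; rewrite eqn_leq (stab_clique (allP Hs _ Bs) sA) /= lt0n.
    apply/negP => /eqP z.
    have : wt (mult s) A = k.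
      rewrite -cA -sum1_card; apply: eq_bigr => i iA; rewrite Hm.
      by have /subsetP/(_ i iA) -> := AU.
    rewrite wt_mult (perm_big _ (perm_to_rem Bs)) big_cons z => Ekk.
    have : \sum_(B0 <- rem B s) #|B0 :&: A| <= size (rem B s) * 1.
      by apply: sum_leq_size => B0 /mem_rem B0s; apply: stab_clique sA; apply: (allP Hs).
    rewrite size_rem // muln1 => Hle.
    have : k <= (size s).-1 by apply: leq_trans Hle; rewrite -[X in X <= _]Ekk.
    lia.
  case: s Hs Hm Hk0 s_le one => [|B s] Hs Hm Hk0 s_le one.
    by have := Hm x; rewrite /= xU.
  have wB : wt (wtm n w) B = size Ks.
    rewrite (@wt_eq _ _ (mult Ks)); last by move=> i _; rewrite Hw.
    rewrite wt_mult big_seq (eq_bigr (fun=> 1)) -?big_seq ?big_const_seq ?count_predT ?iter_addn_0 ?mul1n //.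
    by move=> A AK; rewrite setIC one // mem_head.
  have : stab e B by move: Hs => /= /andP [].
  move=> /H2; rewrite wB (@wt_eq _ _ (mult Ks)); last by move=> i _; rewrite Hw.
  rewrite wt_mult => Hge A AK; apply/eqP; have [sA _ _] := HK A AK; rewrite eqn_leq setIC (stab_clique H1 sA) /= lt0n.
  apply/negP => /eqP z; move: Hge; rewrite (perm_big _ (perm_to_rem AK)) big_cons setIC z leqNgt => /negP; apply.
  apply: (@leq_ltn_trans (size (rem A Ks) * 1)); last by rewrite size_rem // muln1; case: (Ks) AK.
  apply: sum_leq_size => A' /mem_rem A's; rewrite setIC; apply: (stab_clique H1).
  by have [sA' _ _] := HK A' A's.
have subU w Ks : inv w Ks -> setm n (mws n E w) \subset setm n U.
  move=> [Hw _ HK]; have [_ _ H3] := mwsP adjE e_sym e_irr gc w.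
  apply/subsetP => i /H3; rewrite Hw -has_count => /hasP [A AK iA].
  by have [_ /subsetP AU _] := HK A AK; apply: AU.
have add w Ks : inv w Ks -> om e (setm n U :\: setm n (mws n E w)) = k ->
    exists K, inv (hit_step n E U k w) (K :: Ks).
  move=> I Eom; have Im := meets _ _ I; case: I => Hw Hf HK.
  have [c1 c2 c3] := maxcliqueP (diffm n U (mws n E w)).
  set K := maxclique n E _ in c1 c2 c3; rewrite setm_diff in c2 c3.
  exists (setm n K); split.
  - move=> i; rewrite /hit_step -/K c3 Eom eqxx /wtm nth_mkseq // -/(wtm n w i) Hw /= addnC.
    by rewrite inE.
  - apply: (free_cliques (S := setm n (mws n E w)) k0) => //.
    + by move=> A AK; split; [have [] := HK A AK | exact: Im].
    + by rewrite -msizeE c3.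
    + by apply/setP => i; rewrite in_setI in_set0; apply/negP => /andP [iK iS]; have := subsetP c2 i iK; rewrite in_setD iS.
  move=> A; rewrite inE => /predU1P [->|/HK //]; split=> //.
    by apply: subset_trans c2 (subsetDl _ _).
  by rewrite -msizeE c3.
pose w0 : seq nat := mkseq (fun=> 0) n.
(* After j rounds there are j independent cliques, unless the iteration has already become
   stationary at a good stable set. *)
have reach j : exists Ks, inv (iter j (hit_step n E U k) w0) Ks /\
    (j <= size Ks \/ om e (setm n U :\: setm n (mws n E (iter j (hit_step n E U k) w0))) < k).
  elim: j => [|j [Ks [I H]]].
    exists [::]; split; last by left.
    by split=> // [i|]; rewrite ?free_nil ?nil_free // /wtm nth_mkseq.
  set w := iter j _ _ in I H.
  have [Eom|Nom] := eqVneq (om e (setm n U :\: setm n (mws n E w))) k.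
    have [K I'] := add w Ks I Eom; exists (K :: Ks); split; [by rewrite iterS -/w|left].
    by case: H => [H|]; [rewrite /= ltnS | rewrite Eom ltnn].
  have lt : om e (setm n U :\: setm n (mws n E w)) < k.
    by rewrite ltn_neqAle Nom; apply: om_sub; apply: subsetDl.
  have Ew : hit_step n E U k w = w.
    by rewrite /hit_step; have [_ _ ->] := maxcliqueP (diffm n U (mws n E w)); rewrite setm_diff (negbTE Nom).
  by exists Ks; rewrite iterS -/w Ew; split; [|right].
have [Ks [I H]] := reach n; set w := iter n _ w0 in I H *.
have [H1 _ _] := mwsP adjE e_sym e_irr gc w.
split=> //; first exact: subU I.
case: H => // Hn; rewrite ltn_neqAle om_sub ?subsetDl // andbT; apply/negP => /eqP Eom.
have [K [_ /(@free_size n (K :: Ks)) /= Hf _]] := add w Ks I Eom.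
by have := leq_trans Hf Hn; rewrite ltnn.
Qed.
End Hit.

(** * Colouring the blocks one after another *)

Definition min_idx n (R : seq bool) (blk : seq nat) :=
  findn n (fun i => nth false R i && alln n (fun j => ~~ nth false R j || (nth 0 blk i <= nth 0 blk j))).
Definition low_block n R blk :=
  mkseq (fun i => nth false R i && (nth 0 blk i == nth 0 blk (min_idx n R blk))) n.
Definition color_step n E blk (st : seq bool * (nat * seq nat)) :=
  let S := hit n E (low_block n st.1 blk) in
  (diffm n st.1 S, (st.2.1.+1,
    mkseq (fun i => if nth false S i && nth false st.1 i then st.2.1.+1 else nth 0 st.2.2 i) n)).
Definition color n E blk :=
  (iter n (color_step n E blk) (mkseq (fun=> true) n, (0, mkseq (fun=> 0) n))).2.2.

Section Color.
Variables (n : nat) (E : seq (seq bool)) (e : rel 'I_n) (blk : seq nat).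
Hypothesis adjE : forall i j : 'I_n, has_edge E i j = e i j.
Hypothesis e_sym : symmetric e.
Hypothesis e_irr : irreflexive e.
Hypothesis ge : good e.
Let B := wtm n blk.

Definition blockset (b : nat) : {set 'I_n} := [set u | B u == b].
Definition color_bound (i : 'I_n) := \sum_(b < (B i).+1) om e (blockset b).

Lemma low_blockP R : setm n R != set0 -> exists b,
  [/\ setm n (low_block n R blk) = setm n R :&: blockset b, setm n R :&: blockset b != set0 &
   forall i, i \in setm n R -> b <= B i].
Proof.
move=> /set0Pn [x xR].
have [i0 i0R Hi0] : exists2 i : 'I_n, i \in setm n R & forall j, j \in setm n R -> B i <= B j.
  by have := arg_minnP B xR; case=> i iR Hi; exists i.
have Hp : nth false R i0 && alln n (fun j => ~~ nth false R j || (nth 0 blk i0 <= nth 0 blk j)).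
  move: i0R; rewrite inE => -> /=; apply/allnP => j Hj; case: (boolP (nth false R j)) => //= jR.
  by apply: (Hi0 (Ordinal Hj)); rewrite inE.
have [Hlt /andP [mR /allnP mle]] := findn_P (ex_intro2 (fun i => i < n) (fun i => nth false R i && alln n (fun j => ~~ nth false R j || (nth 0 blk i <= nth 0 blk j))) (i0 : nat) (ltn_ord i0) Hp).
exists (nth 0 blk (min_idx n R blk)); split.
- by apply/setP => i; rewrite !inE nth_mkseq.
- apply/set0Pn; exists (Ordinal Hlt); rewrite !inE /B /wtm /= mR /=; exact: eqxx.
by move=> i; rewrite inE => iR; have := mle i (ltn_ord i); rewrite iR.
Qed.

(** The fourth clause is the budget: rounds already spent plus the clique numbers of what is left in
    the blocks up to that of [i]. The last clause ensures that n rounds are enough. *)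
Definition color_inv t (st : seq bool * (nat * seq nat)) :=
  [/\ st.2.1 = t,
   forall i : 'I_n, i \notin setm n st.1 -> 0 < wtm n st.2.2 i <= minn t (color_bound i),
   forall i j : 'I_n, i \notin setm n st.1 -> j \notin setm n st.1 -> e i j -> wtm n st.2.2 i != wtm n st.2.2 j,
   forall i : 'I_n, i \in setm n st.1 ->
     t + \sum_(b < (B i).+1) om e (setm n st.1 :&: blockset b) <= color_bound i
   & setm n st.1 != set0 -> #|setm n st.1| + t <= n].

(** Each round removes from the lowest remaining block a stable set that meets all its maximum
    cliques. The clique number of that block drops by at least one, which pays for the round in the
    budget of every remaining vertex. *)
Lemma color_invS t st : color_inv t st -> color_inv t.+1 (color_step n E blk st).
Proof.
case: st => R [t' col] [/= -> I1 I2 I3 I4]; rewrite /color_step /=.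
set U := low_block n R blk; set S := hit n E U.
have colE (i : 'I_n) : wtm n (mkseq (fun i => if nth false S i && nth false R i then t.+1 else nth 0 col i) n) i
    = if (i \in setm n S) && (i \in setm n R) then t.+1 else wtm n col i.
  by rewrite /wtm nth_mkseq // !inE.
have [R0|Rn0] := eqVneq (setm n R) set0.
  split=> //=; rewrite ?setm_diff ?R0 ?set0D ?eqxx //.
  - move=> i _; rewrite colE R0 in_set0 andbF; have := I1 i; rewrite R0 in_set0 => /(_ isT); lia.
  - by move=> i j _ _ eij; rewrite !colE R0 !in_set0 !andbF; apply: I2; rewrite ?R0 ?in_set0.
  - by move=> i; rewrite inE.
have [b [EU Un0 bmin]] := low_blockP Rn0.
have [S1 S2 S3] : [/\ stab e (setm n S), setm n S \subset setm n U & om e (setm n U :\: setm n S) < om e (setm n U)].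
  by apply: (hitP adjE e_sym e_irr ge); rewrite EU.
have SR : setm n S \subset setm n R by apply: subset_trans S2 _; rewrite EU subsetIl.
have [x xS] : exists x, x \in setm n S.
  by apply/set0Pn; apply: contraTneq S3 => ->; rewrite setD0 ltnn.
have RI (i : 'I_n) : (i \in setm n S) && (i \in setm n R) = (i \in setm n S).
  by apply: andb_idr; apply: (subsetP SR).
have notin (i : 'I_n) : i \notin setm n R :\: setm n S -> (i \in setm n S) || (i \notin setm n R).
  by rewrite in_setD negb_and negbK.
have new (i : 'I_n) : i \in setm n S -> t < color_bound i.
  move=> iS; have iR := subsetP SR i iS; have := I3 i iR.
  rewrite (bigD1 ord_max) //=; suff : 0 < om e (setm n R :&: blockset (B i)) by lia.
  by apply: (@om_gt0 _ e _ i); rewrite in_setI iR inE eqxx.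
split; rewrite ?setm_diff //=.
- move=> i /notin; rewrite colE RI; case: (boolP (i \in setm n S)) => [iS _|_ /= /I1]; last lia.
  by have := new i iS; lia.
- move=> i j /notin Hi /notin Hj eij; rewrite !colE !RI; move: Hi Hj.
  case: (boolP (i \in setm n S)) => [iS _|_ /= iR]; case: (boolP (j \in setm n S)) => [jS _|_ /= jR].
  + have ij : i != j by apply: contraTneq eij => ->; rewrite e_irr.
    by have /stabP /(_ i j iS jS ij) := S1; rewrite eij.
  + by have := I1 j jR; lia.
  + by have := I1 i iR; lia.
  + exact: I2.
- move=> i; rewrite in_setD => /andP [iS iR]; apply: leq_trans (I3 i iR).
  rewrite addSnnS leq_add2l.
  have bi : b < (B i).+1 by rewrite ltnS; apply: bmin.
  rewrite (bigD1 (Ordinal bi)) //= [X in _ <= X](bigD1 (Ordinal bi)) //= -addSn; apply: leq_add.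
    have -> : (setm n R :\: setm n S) :&: blockset b = setm n U :\: setm n S.
      by rewrite EU; apply/setP => u; rewrite !in_setI !in_setD !in_setI; case: (u \in setm n S); case: (u \in setm n R).
    by rewrite -EU.
  by apply: leq_sum => k _; apply: om_sub; apply: setSI; apply: subsetDl.
move=> _; have := I4 Rn0.
have : #|setm n R :\: setm n S| < #|setm n R|.
  apply: proper_card; rewrite properE subsetDl /=; apply/negP => /subsetP /(_ x (subsetP SR x xS)).
  by rewrite in_setD xS.
by move=> H1 H2; apply: leq_trans H2; rewrite addnS ltn_add2r.
Qed.

Theorem colorP : [/\ forall i : 'I_n, 0 < wtm n (color n E blk) i <= minn n (color_bound i) &
  forall i j : 'I_n, e i j -> wtm n (color n E blk) i != wtm n (color n E blk) j].
Proof.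
have H t : color_inv t (iter t (color_step n E blk) (mkseq (fun=> true) n, (0, mkseq (fun=> 0) n))).
  elim: t => [|t IH]; last by rewrite iterS; apply: color_invS.
  have RT : setm n (mkseq (fun=> true) n) = [set: 'I_n] by apply/setP => i; rewrite !inE nth_mkseq.
  split; rewrite /= ?RT //.
  - by move=> i; rewrite inE.
  - by move=> i; rewrite inE.
  - by move=> i _; rewrite add0n; apply: leq_sum => b _; rewrite setTI.
  - by rewrite cardsT card_ord addn0.
have [_ I1 I2 _ I4] := H n.
have R0 i : i \notin setm n (iter n (color_step n E blk) (mkseq (fun=> true) n, (0, mkseq (fun=> 0) n))).1.
  apply/negP => iR; have := I4; case: eqP => [E0|_]; first by move: iR; rewrite E0 inE.
  move=> /(_ isT); have : 0 < #|setm n (iter n (color_step n E blk) (mkseq (fun=> true) n, (0, mkseq (fun=> 0) n))).1|.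
    by apply/card_gt0P; exists i.
  lia.
by split=> [i|i j]; [apply: I1 | apply: I2].
Qed.
End Color.

Local Open Scope ring_scope.

(** * A perceptron method for the clique relaxation *)

(** Remove a vertex of largest value and use induction: among k distinct positive integers the
    largest is at least k. *)
Lemma distinct_sum (V : finType) (K : {set V}) (c : V -> nat) :
  {in K &, injective c} -> {in K, forall i, (0 < c i)%N} ->
  (#|K| * #|K|.+1 <= 2 * \sum_(i in K) c i)%N.
Proof.
move Ek : #|K| => k; elim: k K Ek => [|k IH] K Ek Hi Hp; first by [].
have [x0 x0K] : exists x, x \in K by apply/card_gt0P; rewrite Ek.
have [x xK' xmax] := arg_maxnP c x0K; have {xK'}xK : x \in K by [].
have cx : (k.+1 <= c x)%N.
  rewrite -Ek cardE -(size_map c) -[c x](size_iota 1).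
  apply: uniq_leq_size.
    by rewrite map_inj_in_uniq ?enum_uniq // => u v; rewrite !mem_enum; apply: Hi.
  move=> y /mapP [v]; rewrite mem_enum => vK ->; rewrite mem_iota Hp //=.
  by rewrite add1n ltnS; apply: xmax.
rewrite (big_setD1 x) //=.
have Ek' : #|K :\ x| = k by move: Ek; rewrite (cardsD1 x) xK add1n => -[].
have := IH (K :\ x) Ek'.
have sub i : i \in K :\ x -> i \in K by rewrite in_setD1 => /andP [].
move=> /(_ (fun u v Hu Hv => Hi u v (sub u Hu) (sub v Hv)) (fun i H => Hp i (sub i H))).
move: (\sum_(i in _) _)%N cx => s cx; nia.
Qed.

(** The arithmetic of [lp_exp_dec]: p is the potential, v and s are the weighted sums of the current
    vector and of the hidden colouring over the chosen vertices of the groups, and t is the squared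
    length of the step. *)
Lemma lp_exp_arith (p v s t : int) (W M B ee : nat) : (ee * W + ee.+1 <= M)%N ->
  s <= B%:Z -> t <= W%:Z -> (ee.+1 * (B * M))%N%:Z < ee%:Z * v -> (0 < ee)%N -> (0 < B)%N ->
  p + (- v - M%:Z * - s) *+ 2 + t <= p - 1.
Proof.
move=> MM cB dW H ee0 B0.
have h1 : M%:Z * s <= M%:Z * B%:Z by apply: ler_wpM2l.
have h2 : (ee * W + ee.+1 <= B * M)%N by apply: leq_trans MM _; rewrite leq_pmull.
have h3 : ee%:Z * (v - M%:Z * B%:Z) > ee%:Z * W%:Z.
  move: H h2; rewrite -lez_nat PoszD !PoszM; have -> : ee.+1%:Z = ee%:Z + 1 by lia.
  have e0 : 0 <= ee%:Z by [].
  move: (ee%:Z) e0 => e' e0 H h2; lra.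
rewrite ltr_pM2l ?ltz_nat // -lezD1 in h3; have W0 : 0 <= W%:Z by [].
by move: h1 h3 dW W0; lra.
Qed.

Section Lp.
Variables (n : nat) (E : seq (seq bool)) (m : nat) (gm : seq (seq bool)) (gw : seq nat) (B ee : nat).

Definition gin (gm : seq (seq bool)) (g i : nat) := nth false (nth [::] gm g) i.
Definition lp_W := nsum m (nth 0%N gw).
(** The integral stand-in for 1, so large that relative slacks of 1/(ee+1) and 1/ee outweigh the
    squared lengths of the two kinds of steps. *)
Definition lp_M := (ee * (lp_W * lp_W) + ee.+1 * n.+1)%N.
Definition gargmax (X : seq int) g :=
  findn n (fun i => gin gm g i && alln n (fun j => ~~ gin gm g j || (nth 0 X j <= nth 0 X i))).
Definition lp_K (X : seq int) v := maxclique n E (mkseq (fun u => nth 0 X u <= nth 0 X v) n).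
(** With denominators cleared: X_v / M falls short of (|K|+1)/2 even after weakening by the factor
    ee/(ee+1). *)
Definition lp_viol (X : seq int) v :=
  (2 * ee.+1)%N%:Z * nth 0 X v < ((msize n (lp_K X v)).+1 * (lp_M * ee))%N%:Z.
Definition lp_bad X := ~~ alln n (fun v => ~~ lp_viol X v).
Definition lp_val (X : seq int) := sumz m (fun g => (nth 0%N gw g)%:Z * nth 0 X (gargmax X g)).
Definition lp_exp X := (ee.+1 * (B * lp_M))%N%:Z < ee%:Z * lp_val X.
(** Either a clique whose values are too small is raised by 1, or, if the objective exceeds the
    budget [B], the latest vertex of every group is lowered by the weight of the group. *)
Definition lp_step (X : seq int) : seq int :=
  if lp_bad X then
    let K := lp_K X (findn n (lp_viol X)) in
    mkseq (fun i => nth 0 X i + (nth false K i : nat)%:Z) n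
  else if lp_exp X then
    mkseq (fun i => nth 0 X i + - (nsum m (fun g => if gargmax X g == i then nth 0%N gw g else 0%N))%:Z) n
  else X.
Definition lp_T := (n * ((n * lp_M) * (n * lp_M)) + 1)%N.
Definition lp_X := iter lp_T lp_step (mkseq (fun=> 0) n).

Variable e : rel 'I_n.
Hypothesis adjE : forall i j : 'I_n, has_edge E i j = e i j.
Hypothesis e_sym : symmetric e.
Hypothesis e_irr : irreflexive e.
Hypothesis ge : good e.
Variable c : 'I_n -> nat.
Hypothesis c_bound : forall i, (0 < c i <= n)%N.
Hypothesis c_proper : forall i j, e i j -> c i != c j.
Hypothesis gne : forall g, (g < m)%N -> exists i : 'I_n, gin gm g i.
Hypothesis c_cost : (\sum_(g < m) nth 0 gw g * \max_(i < n | gin gm g i) c i <= B)%N.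
Hypothesis B_gt0 : (0 < B)%N.
Hypothesis ee_gt0 : (0 < ee)%N.

Lemma gargmaxP X g : (g < m)%N -> exists i : 'I_n, [/\ gargmax X g = i, gin gm g i &
  forall j : 'I_n, gin gm g j -> nth 0 X j <= nth 0 X i].
Proof.
move=> /gne [i0 Hi0].
have [i Hi Hmax] := @arg_maxP _ int 'I_n i0 (fun i => gin gm g i) (fun i => nth 0 X i) Hi0.
have Hp : gin gm g i && alln n (fun j => ~~ gin gm g j || (nth 0 X j <= nth 0 X i)).
  rewrite Hi /=; apply/allnP => j Hj; case: (boolP (gin gm g j)) => //= Hgj.
  exact: (Hmax (Ordinal Hj)).
have [Hlt /andP [H1 /allnP H2]] := findn_P (ex_intro2 (fun i => (i < n)%N) (fun i => gin gm g i && alln n (fun j => ~~ gin gm g j || (nth 0 X j <= nth 0 X i))) (i : nat) (ltn_ord i) Hp).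
exists (Ordinal Hlt); split=> // j Hj.
by have := H2 j (ltn_ord j); rewrite Hj.
Qed.

Definition lp_pot (X : seq int) : int := \sum_(i < n) (nth 0 X i - lp_M%:Z * (c i)%:Z) ^+ 2.

Lemma lp_pot_update X (g : nat -> int) :
  lp_pot (mkseq (fun i => nth 0 X i + g i) n) =
  lp_pot X + (\sum_(i < n) g i * nth 0 X i - lp_M%:Z * \sum_(i < n) g i * (c i)%:Z) *+ 2 + \sum_(i < n) g i ^+ 2.
Proof.
rewrite /lp_pot mulr_sumr -sumrB -sumrMnl -!big_split /=; apply: eq_bigr => i _.
rewrite nth_mkseq //; ring.
Qed.

Lemma lp_K_P X (v : 'I_n) : let K := setm n (lp_K X v) in
  [/\ stab (compl e) K, {in K, forall u : 'I_n, nth 0 X u <= nth 0 X v},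
     msize n (lp_K X v) = #|K| & #|K| = om e [set u : 'I_n | nth 0 X u <= nth 0 X v]].
Proof.
have [H1 H2 H3] := maxcliqueP adjE e_sym ge (mkseq (fun u => nth 0 X u <= nth 0 X v) n).
have EU : setm n (mkseq (fun u => nth 0 X u <= nth 0 X v) n) = [set u : 'I_n | nth 0 X u <= nth 0 X v].
  by apply/setP => u; rewrite !inE nth_mkseq.
rewrite EU in H2 H3.
split=> //; first by move=> u uK; have := subsetP H2 u uK; rewrite inE.
  exact: msizeE.
by rewrite -msizeE.
Qed.

(** All of [K] lies below X_v, so the sum of [X] over [K] is less than M k(k+1)/2 times ee/(ee+1),
    while the hidden colouring sums to at least k(k+1)/2 by [distinct_sum]. Doubling the gap gives
    at least k+1 by the choice of [lp_M]; raising k entries by 1 costs k. *)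
Lemma lp_bad_dec X : lp_bad X -> lp_pot (lp_step X) <= lp_pot X - 1.
Proof.
move=> bad; rewrite /lp_step bad.
have [v0 Hv0 viol0] : exists2 v, (v < n)%N & lp_viol X v.
  have [/existsP [v Hv]|/existsPn H'] := boolP [exists v : 'I_n, lp_viol X v]; first by exists v.
  by exfalso; move/negP: bad; apply; apply/allnP => v Hv; apply: (H' (Ordinal Hv)).
have [Hv viol] := findn_P (ex_intro2 (fun v => (v < n)%N) (fun v => lp_viol X v) v0 Hv0 viol0).
move: viol; rewrite -/(lp_viol X); set v := Ordinal Hv; rewrite -[findn n (lp_viol X)]/(v : nat) => viol.
have [HK HKv HKs HKo] := lp_K_P X v.
set K := setm n (lp_K X v) in HK HKv HKs HKo.
rewrite lp_pot_update.
have sumK (h : 'I_n -> int) : \sum_(i < n) (nth false (lp_K X v) i : nat)%:Z * h i = \sum_(i in K) h i.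
  rewrite [RHS]big_mkcond; apply: eq_bigr => i _; rewrite /K inE.
  by case: (nth _ _ _); rewrite ?mul1r ?mul0r.
rewrite (sumK (fun i => nth 0 X i)) (sumK (fun i => (c i)%:Z)).
have -> : \sum_(i < n) (nth false (lp_K X v) i : nat)%:Z ^+ 2 = #|K|%:Z.
  rewrite -HKs /msize /nsum -[RHS]natz natr_sum; apply: eq_bigr => i _.
  by case: (nth _ _ _).
have C : (#|K| * #|K|.+1)%N%:Z <= 2%:Z * \sum_(i in K) (c i)%:Z.
  have : (#|K| * #|K|.+1 <= 2 * \sum_(i in K) c i)%N.
    apply: distinct_sum => [i j iK jK cij|i _]; last by have /andP [] := c_bound i.
    apply/eqP/negPn/negP => ij; have /stabP /(_ i j iK jK ij) := HK.
    rewrite /compl ij /= negbK => /c_proper; by rewrite cij eqxx.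
  have -> : \sum_(i in K) (c i)%:Z = (\sum_(i in K) c i)%N%:Z.
    by rewrite -[RHS]natz natr_sum; apply: eq_bigr => i _; rewrite natz.
  by rewrite -PoszM lez_nat.
have SX : \sum_(i in K) nth 0 X i <= #|K|%:Z * nth 0 X v.
  rewrite -natz mulr_natl -sumr_const; apply: ler_sum => i iK; exact: HKv.
have k0 : (0 < #|K|)%N.
  by rewrite HKo; apply: (@om_gt0 _ e _ v); rewrite inE.
have Kn : (#|K| <= n)%N by rewrite -[X in (_ <= X)%N]card_ord max_card.
move: viol; rewrite /lp_viol HKs.
have MM : (ee.+1 * n.+1 <= lp_M)%N by rewrite /lp_M leq_addl.
move: (lp_pot X) (\sum_(i in K) nth 0 X i) (\sum_(i in K) (c i)%:Z) (nth 0 X v) C SX => p x y t C SX viol.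
move: #|K| k0 Kn viol C SX => k k0 Kn viol C SX; clear - ee_gt0 MM k0 Kn viol C SX.
move: lp_M MM viol => M MM viol.
have h1 : (2 * ee.+1)%N%:Z * (k%:Z * t) <= k%:Z * (k.+1 * (M * ee))%N%:Z.
  by rewrite mulrCA; apply: ler_wpM2l => //; apply: ltW.
have h2 : (2 * ee.+1)%N%:Z * x <= (2 * ee.+1)%N%:Z * (k%:Z * t) by apply: ler_wpM2l.
have h3 : (ee.+1 * M)%N%:Z * (k * k.+1)%N%:Z <= (ee.+1 * M)%N%:Z * (2%:Z * y) by apply: ler_wpM2l.
have h4 : (ee.+1 * k.+1 <= M * (k * k.+1))%N.
  apply: (@leq_trans (M * 1)%N); first by rewrite muln1; apply: leq_trans MM; rewrite leq_mul2l ltnS Kn orbT.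
  by rewrite leq_mul2l muln_gt0 k0 orbT.
have h5 : ee.+1%:Z * ((x - M%:Z * y) *+ 2 + k%:Z) <= ee.+1%:Z * (-1).
  move: h1 h2 h3 h4; rewrite -lez_nat !PoszM; have -> : ee.+1%:Z = ee%:Z + 1 by lia.
  have -> : k.+1%:Z = k%:Z + 1 by lia.
  move: (ee%:Z) (k%:Z) (M%:Z) => e' k' M' h1 h2 h3 h4; lra.
rewrite ler_pM2l // in h5; lia.
Qed.

(** At the chosen vertices the hidden colouring has weighted sum at most [B], because each chosen
    vertex belongs to its group. The objective of [X] exceeds M B by more than the squared length of
    the step. *)
Lemma lp_exp_dec X : ~~ lp_bad X -> lp_exp X -> lp_pot (lp_step X) <= lp_pot X - 1.
Proof.
move=> /negbTE nbad Hexp; rewrite /lp_step nbad Hexp lp_pot_update.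
pose d (i : nat) := nsum m (fun g => if gargmax X g == i then nth 0%N gw g else 0%N).
rewrite -[X in _ + X](_ : \sum_(i < n) (d i)%:Z ^+ 2 = _); last by apply: eq_bigr => i _; rewrite sqrrN.
have swap (h : nat -> int) : \sum_(i < n) - (d i)%:Z * h i = - \sum_(g < m) (nth 0%N gw g)%:Z * h (gargmax X g).
  rewrite -sumrN (eq_bigr (fun i : 'I_n => \sum_(g < m) - ((if gargmax X g == i then nth 0%N gw g else 0%N)%:Z * h i))); last first.
    move=> i _; rewrite sumrN mulNr -mulr_suml; congr (- (_ * _)).
    by rewrite /d /nsum -[LHS]natz natr_sum; apply: eq_bigr => g _; rewrite natz.
  rewrite exchange_big /=; apply: eq_bigr => g _.
  have [i [-> _ _]] := gargmaxP X (ltn_ord g).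
  rewrite (bigD1 i) //= eqxx big1 ?addr0 // => j ji.
  by rewrite eq_sym val_eqE (negbTE ji) mul0r oppr0.
rewrite (swap (fun i => nth 0 X i)).
pose c' (i : nat) : int := if insub i is Some i' then (c i')%:Z else 0.
have c'E (i : 'I_n) : c' i = (c i)%:Z by rewrite /c' valK.
have -> : \sum_(i < n) - (d i)%:Z * (c i)%:Z = \sum_(i < n) - (d i)%:Z * c' i.
  by apply: eq_bigr => i _; rewrite c'E.
rewrite swap.
have cB : \sum_(g < m) (nth 0%N gw g)%:Z * c' (gargmax X g) <= B%:Z.
  have H : (\sum_(g < m) nth 0%N gw g * \max_(i < n | gin gm g i) c i <= B)%N by [].
  apply: le_trans (_ : (\sum_(g < m) nth 0 gw g * \max_(i < n | gin gm g i) c i)%N%:Z <= _); last by rewrite lez_nat.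
  rewrite -[X in _ <= X]natz natr_sum; apply: ler_sum => g _; rewrite natz PoszM.
  apply: ler_wpM2l => //; have [i [-> Hi _]] := gargmaxP X (ltn_ord g).
  by rewrite c'E lez_nat [X in (_ <= X)%N](bigD1 i) //= leq_maxl.
have dW : \sum_(i < n) (d i)%:Z ^+ 2 <= (lp_W * lp_W)%N%:Z.
  have dsum : (\sum_(i < n) d i <= lp_W)%N.
    rewrite /d /nsum exchange_big /= /lp_W /nsum; apply: leq_sum => g _.
    have [i [-> _ _]] := gargmaxP X (ltn_ord g).
    rewrite (bigD1 i) //= eqxx big1 ?addn0 // => j ji.
    by rewrite eq_sym val_eqE (negbTE ji).
  apply: le_trans (_ : (\sum_(i < n) d i * lp_W)%N%:Z <= _).
    rewrite -[X in _ <= X]natz natr_sum; apply: ler_sum => i _; rewrite natz PoszM expr2.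
    apply: ler_wpM2l => //; rewrite lez_nat; apply: leq_trans dsum.
    by rewrite (bigD1 i) //= leq_addr.
  by rewrite lez_nat -big_distrl /= leq_mul2r dsum orbT.
move: Hexp; rewrite /lp_exp /lp_val /sumz; set v := \sum_(g < m) _ * nth 0 X _.
have MM : (ee * (lp_W * lp_W) + ee.+1 <= lp_M)%N by rewrite /lp_M; nia.
move: (lp_pot X) v (\sum_(g < m) _) (\sum_(i < n) _) (lp_W * lp_W)%N lp_M MM cB dW => p v s t W M MM cB dW H.
exact: lp_exp_arith MM cB dW H ee_gt0 B_gt0.
Qed.

Lemma lp_start : lp_pot (mkseq (fun=> 0) n) < lp_T%:Z.
Proof.
rewrite /lp_pot; apply: le_lt_trans (_ : \sum_(i < n) ((n * lp_M) * (n * lp_M))%N%:Z < _).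
  apply: ler_sum => i _; rewrite nth_mkseq // sub0r sqrrN expr2.
  have /andP [_ Hc] := c_bound i; by rewrite -!PoszM lez_nat; apply: leq_mul; rewrite mulnC leq_mul2r Hc orbT.
rewrite sumr_const card_ord -mulr_natl natz /lp_T; lia.
Qed.

(** The first two clauses say that the iteration has stopped for lack of violations. The third holds
    because the potential never rises: each entry stays within n^2 M of M times a colour that is at
    most n. *)
Theorem lp_XP : [/\ forall v : 'I_n,
    ((om e [set u : 'I_n | (nth 0%R lp_X u <= nth 0%R lp_X v)%R]).+1 * (lp_M * ee))%N%:Z <= (2 * ee.+1)%N%:Z * nth 0 lp_X v,
   ee%:Z * \sum_(g < m) (nth 0%N gw g)%:Z * nth 0 lp_X (gargmax lp_X g) <= (ee.+1 * (B * lp_M))%N%:Z &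
   forall v : 'I_n, nth 0 lp_X v <= (2 * n * n * lp_M)%N%:Z].
Proof.
have [] := @potential_iter _ lp_step (fun X => ~~ lp_bad X && ~~ lp_exp X) lp_pot (mkseq (fun=> 0) n) lp_T _ _ _ lp_start.
- by move=> X; apply: sumr_ge0 => i _; apply: sqr_ge0.
- move=> X; rewrite negb_and !negbK; case: (boolP (lp_bad X)) => [/lp_bad_dec //|nl] /= H.
  exact: lp_exp_dec.
- by move=> X /andP [/negbTE l1 /negbTE l2]; rewrite /lp_step l1 l2.
rewrite -/lp_X => /andP [nb ne] Hp; split.
- move=> v; move: nb; rewrite /lp_bad negbK => /allnP /(_ v (ltn_ord v)); rewrite /lp_viol -leNgt.
  by have [_ _ -> ->] := lp_K_P lp_X v.
- by rewrite leNgt.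
move=> v; have H1 : (nth 0 lp_X v - lp_M%:Z * (c v)%:Z) ^+ 2 <= lp_pot lp_X.
  by rewrite /lp_pot (bigD1 v) //= lerDl; apply: sumr_ge0 => ? _; apply: sqr_ge0.
have := le_lt_trans (le_trans H1 Hp) lp_start; rewrite /lp_T.
have /andP [_ Hc] := c_bound v; have n0 : (0 < n)%N by case: (n) v {H1 Hc} => // -[].
move: (nth 0 lp_X v) lp_M (c v) Hc => x M y Hc H; clear - Hc H n0.
have My : (M * y <= M * n)%N by rewrite leq_mul2l Hc orbT.
rewrite leNgt; apply/negP => Hx; move: H; apply/negP; rewrite -leNgt.
have Hz : (n * (n * M))%N%:Z < x - M%:Z * y%:Z.
  rewrite -PoszM; have : (M * n <= n * n * M)%N by rewrite [(n * n * M)%N]mulnC leq_mul2l leq_pmull ?orbT.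
  lia.
have Hz2 : (n * (n * M))%N%:Z ^+ 2 + 1 <= (x - M%:Z * y%:Z) ^+ 2.
  have z0 : 0 <= (n * (n * M))%N%:Z by [].
  move: (n * (n * M))%N%:Z (x - M%:Z * y%:Z) z0 Hz => a b a0 ab; nia.
apply: le_trans Hz2; rewrite PoszD lerD2r expr2 -PoszM lez_nat.
move: (n * M)%N => t; rewrite -[X in (_ <= X)%N]mulnA leq_mul2l; apply/orP; right.
by rewrite leq_mul2l leq_pmull ?orbT.
Qed.
End Lp.


(** * Geometric blocks with a shifted offset *)

Definition divc (a J : nat) := nsum a (fun k => (k.+1 * J <= a)%N : nat).

(** Counting a predicate that is closed downwards finds its threshold; quotients, logarithms and
    maxima are computed in this form. *)
Lemma nsum_prefix (L : nat) (P : nat -> bool) : (forall t, P t.+1 -> P t) ->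
  let l := nsum L (fun t => P t : nat) in
  [/\ (l <= L)%N, forall t, (t < l)%N -> P t & (l < L)%N -> ~~ P l].
Proof.
move=> anti /=; have mono s t : (s <= t)%N -> P t -> P s.
  by elim: t => [|t IH]; [rewrite leqn0 => /eqP -> | rewrite leq_eqVlt => /predU1P [-> //|st] /anti; apply: IH].
elim: L => [|L [IH1 IH2 IH3]]; first by rewrite /nsum big_ord0.
rewrite /nsum big_ord_recr /= -/(nsum L (fun t => P t : nat)).
set l := nsum L _ in IH1 IH2 IH3 *.
have [lL|Ll] := ltnP l L.
  have nPL : ~~ P L by apply: contra (IH3 lL); apply: mono; apply: ltnW.
  by rewrite (negbTE nPL) addn0; split=> // [|_]; [apply: ltnW | apply: IH3].
have El : l = L by apply/eqP; rewrite eqn_leq IH1.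
case PL: (P L); rewrite ?addn1 ?addn0 El.
  split=> // [t|]; last by rewrite ltnn.
  by rewrite ltnS leq_eqVlt => /predU1P [->|H] //; apply: IH2; rewrite El.
by split=> // [t tL|_]; [apply: IH2; rewrite El | rewrite PL].
Qed.

Lemma divcE a J : (0 < J)%N -> divc a J = (a %/ J)%N.
Proof.
move=> J0; have [] := @nsum_prefix a (fun k => (k.+1 * J <= a)%N).
  by move=> t; apply: leq_trans; rewrite leq_mul2r leqnSn orbT.
rewrite -/(divc a J) => H1 H2 H3; apply/eqP; rewrite eqn_leq; apply/andP; split.
  case E: (divc a J) => [|l] //; rewrite leq_divRL //; apply: H2; by rewrite E.
case: (ltnP (divc a J) a) => [/H3|H].
  by rewrite -ltnNge -ltn_divLR.
by apply: leq_trans (leq_div _ _) H.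
Qed.

Lemma lp_avg_arith (S : int) (ee M B : nat) (al : rat) : (0 < ee)%N -> (0 < M%:R :> rat) ->
  al = 1 + ee%:R^-1 -> ee%:Z * S <= (ee.+1 * (B * M))%N%:Z ->
  2%:R * S%:~R / M%:R <= 2%:R * al * B%:R :> rat.
Proof.
move=> ee0 M0 Ea H; have e0 : (0 < ee%:R :> rat) by rewrite ltr0n.
rewrite -mulrA -[X in _ <= X]mulrA ler_pM2l // ler_pdivrMr // -(ler_pM2l e0).
have -> : ee%:R * (al * B%:R * M%:R) = (ee.+1 * (B * M))%N%:R.
  rewrite !natrM -natr1 Ea; field; exact: lt0r_neq0.
by rewrite [ee%:R]pmulrn -rmorphM /= [X in _ <= X]pmulrn ler_int.
Qed.

Lemma cancel_denom (al b t J : rat) : b - 1 != 0 ->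
  al * (b / (b - 1)) * t * (J * (b - 1)) = J * al * b * t.
Proof. by move=> b1; field. Qed.

Lemma factor_rearrange (al r B J : rat) : J * (2%:R * al ^+ 2 * r * B) = (J * al * r) * (2%:R * al * B).
Proof. ring. Qed.

Section Round.
Variables (n : nat) (E : seq (seq bool)) (m : nat) (gm : seq (seq bool)) (gw : seq nat) (ee J : nat).

(** With x_v = 2 X_v / M and rho = 1 + 1/J this is the least t with x_v at most rho^t, as [lev_pred]
    and [levP] show after clearing denominators. *)
Definition lev (X : seq int) (v : nat) :=
  nsum (J * (4 * (n * n))) (fun t =>
    ((lp_M n m gw ee)%:Z * J.+1%:Z ^+ t < 2%:Z * nth 0 X v * J%:Z ^+ t)%R : nat).
(** A block consists of J consecutive levels, so it spans a factor rho^J close to e; [j] is the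
    shift of the cut points. *)
Definition cand (B j : nat) :=
  let X := lp_X n E m gm gw B ee in
  color n E (mkseq (fun v => divc (lev X v + j) J) n).
Definition gmax (col : seq nat) g :=
  nsum n (fun t => ~~ alln n (fun v => ~~ (gin gm g v && (t < nth 0%N col v)%N)) : nat).
Definition ccost (col : seq nat) := nsum m (fun g => nth 0 gw g * gmax col g)%N.
(** The budget is not known in advance, so all its possible values are tried along with all the
    offsets. The weights [gw] are unary, which keeps the number of trials polynomial. *)
Definition best_opt (B j : nat) :=
  alln (n * lp_W m gw).+1 (fun B' => alln J (fun j' => (ccost (cand B j) <= ccost (cand B' j'))%N)).
Definition best :=
  let B := findn (n * lp_W m gw).+1 (fun B => ~~ alln J (fun j => ~~ best_opt B j)) in
  cand B (findn J (best_opt B)).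

Lemma bestP : (0 < J)%N -> (exists B j, best = cand B j) /\
  forall B j, (B < (n * lp_W m gw).+1)%N -> (j < J)%N -> (ccost best <= ccost (cand B j))%N.
Proof.
move=> J0; split; first by rewrite /best; eexists; eexists; reflexivity.
pose N := (n * lp_W m gw).+1.
have [[B0 j0] _ Hmin] := @arg_minnP _ (ord0 : 'I_N, Ordinal J0) xpredT (fun p : 'I_N * 'I_J => ccost (cand p.1 p.2)) isT.
have opt0 : best_opt B0 j0.
  by apply/allnP => B Hb; apply/allnP => j Hj; apply: (Hmin (Ordinal Hb, Ordinal Hj)).
have ex0 : ~~ alln J (fun j => ~~ best_opt B0 j).
  by apply/negP => /allnP /(_ j0 (ltn_ord j0)); rewrite opt0.
have [_ /negP H2] := findn_P (ex_intro2 (fun B => (B < N)%N) (fun B => ~~ alln J (fun j => ~~ best_opt B j)) (B0 : nat) (ltn_ord B0) ex0).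
set B := findn N _ in H2.
have [j Hj Hopt] : exists2 j, (j < J)%N & best_opt B j.
  have [/existsP [j Hj]|/existsPn H'] := boolP [exists j : 'I_J, best_opt B j]; first by exists j.
  by exfalso; apply: H2; apply/allnP => j Hj; apply: (H' (Ordinal Hj)).
have [_ /allnP H4] := findn_P (ex_intro2 (fun j => (j < J)%N) (fun j => best_opt B j) j Hj Hopt).
by move=> B1 j1 HB1 Hj1; have /allnP := H4 B1 HB1; apply.
Qed.

Variable e : rel 'I_n.
Hypothesis adjE : forall i j : 'I_n, has_edge E i j = e i j.
Hypothesis e_sym : symmetric e.
Hypothesis e_irr : irreflexive e.
Hypothesis ge : good e.

Lemma gmaxE col g : (forall i : 'I_n, (wtm n col i <= n)%N) ->
  gmax col g = \max_(i < n | gin gm g i) wtm n col i.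
Proof.
move=> Hc; have [] := @nsum_prefix n (fun t => ~~ alln n (fun v => ~~ (gin gm g v && (t < nth 0%N col v)%N))).
  move=> t; apply: contra => /allnP H; apply/allnP => v Hv; apply: contra (H v Hv) => /andP [-> /= Ht].
  exact: ltnW.
rewrite -/(gmax col g) => H1 H2 H3; apply/eqP; rewrite eqn_leq; apply/andP; split.
  case El: (gmax col g) => [|l] //.
  have := H2 l; rewrite El => /(_ (ltnSn l)) /negP Hn.
  have [/existsP [i /andP [Hi Hl]]|/existsPn H'] := boolP [exists i : 'I_n, gin gm g i && (l < nth 0%N col i)%N].
    by apply: leq_trans Hl _; rewrite (bigD1 i) //= leq_maxl.
  by exfalso; apply: Hn; apply/allnP => v Hv; apply: (H' (Ordinal Hv)).
apply/bigmax_leqP => i Hi; case: (ltnP (gmax col g) n) => [/H3|Hn]; last by apply: leq_trans (Hc i) Hn.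
by rewrite negbK => /allnP /(_ i (ltn_ord i)); rewrite Hi /= -leqNgt.
Qed.

Lemma cand_proper B j : (forall i : 'I_n, (0 < wtm n (cand B j) i <= n)%N) /\
  forall i i' : 'I_n, e i i' -> wtm n (cand B j) i != wtm n (cand B j) i'.
Proof.
have [H1 H2] := colorP (mkseq (fun v => divc (lev (lp_X n E m gm gw B ee) v + j) J) n) adjE e_sym e_irr ge.
by split=> // i; have := H1 i; rewrite /cand; lia.
Qed.

Hypothesis J_gt0 : (0 < J)%N.
Hypothesis ee_gt0 : (0 < ee)%N.
Hypothesis gne : forall g, (g < m)%N -> exists i : 'I_n, gin gm g i.

Section Offset.
Variable c : 'I_n -> nat.
Hypothesis c_bound : forall i, (0 < c i <= n)%N.
Hypothesis c_proper : forall i j, e i j -> c i != c j.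
Variable B : nat.
Hypothesis c_cost : (\sum_(g < m) nth 0 gw g * \max_(i < n | gin gm g i) c i <= B)%N.
Hypothesis B_gt0 : (0 < B)%N.

Let X := lp_X n E m gm gw B ee.
Let M := lp_M n m gw ee.
Let rho : rat := 1 + J%:R^-1.
Let al : rat := 1 + ee%:R^-1.
Let x (v : nat) : rat := (2%:Z * nth 0 X v)%:~R / M%:R.

Let M_gt0 : (0 < M%:R :> rat).
Proof. by rewrite ltr0n /M /lp_M addn_gt0 muln_gt0 orbT. Qed.
Let J_gt0' : (0 < J%:R :> rat). Proof. by rewrite ltr0n. Qed.
Let ee_gt0' : (0 < ee%:R :> rat). Proof. by rewrite ltr0n. Qed.
Let rho_gt1 : 1 < rho. Proof. by rewrite ltrDl invr_gt0. Qed.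
Let rho_gt0 : 0 < rho. Proof. exact: lt_trans rho_gt1. Qed.
Let al_gt0 : 0 < al. Proof. by rewrite addr_gt0 ?invr_gt0. Qed.

Let LX := lp_XP adjE e_sym ge c_bound c_proper gne c_cost B_gt0 ee_gt0.

Lemma om_x (v : 'I_n) : (om e [set u : 'I_n | nth 0 X u <= nth 0 X v]).+1%:R <= al * x v.
Proof.
have [/(_ v) H _ _] := LX; rewrite -/X -/M in H.
rewrite /x mulrA ler_pdivlMr //.
have -> : al = ee.+1%:R / ee%:R by rewrite /al -natr1 mulrDl mul1r divff ?gt_eqF.
rewrite mulrAC ler_pdivlMr // -mulrA -natrM -natrM.
have : (((om e [set u : 'I_n | (nth 0%R X u <= nth 0%R X v)%R]).+1 * (M * ee))%N%:Z)%:~R <= ((2 * ee.+1)%N%:Z * nth 0 X v)%:~R :> rat.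
  by rewrite ler_int.
rewrite pmulrn => /le_trans; apply.
have -> : (2 * ee.+1)%N%:Z * nth 0 X v = ee.+1%:Z * (2%:Z * nth 0 X v) by rewrite PoszM; ring.
by rewrite [X in X <= _]rmorphM /= -pmulrn.
Qed.

(** The vertex itself is a clique, so the left side of [om_x] is at least 2, while the factor 1 +
    1/ee is at most 2. *)
Lemma x_ge1 (v : 'I_n) : 1 <= x v.
Proof.
have H := om_x v.
have H2 : (2%:R <= (om e [set u : 'I_n | nth 0 X u <= nth 0 X v]).+1%:R :> rat).
  by rewrite ler_nat ltnS; apply: (@om_gt0 _ e _ v); rewrite inE.
have al2 : al <= 2%:R by rewrite /al -[2%:R]/(1 + 1) lerD2l invf_le1 // ler1n.
have x0 : 0 <= x v by rewrite -(pmulr_rge0 _ al_gt0); apply: le_trans H; rewrite ler0n.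
have := le_trans H2 H; have : al * x v <= 2%:R * x v by apply: ler_wpM2r.
by lra.
Qed.

Lemma lev_pred (v t : nat) :
  (M%:Z * J.+1%:Z ^+ t < 2%:Z * nth 0 X v * J%:Z ^+ t) = (rho ^+ t < x v).
Proof.
rewrite /x ltr_pdivlMr //.
have -> : rho = J.+1%:R / J%:R by rewrite /rho -natr1 mulrDl mul1r divff ?gt_eqF.
rewrite expr_div_n [X in _ = (X < _)]mulrAC ltr_pdivrMr ?exprn_gt0 // -(ltr_int rat) !rmorphM /= !rmorphXn /=.
by rewrite [M%:~R * _]mulrC -!pmulrn.
Qed.

Lemma x_le (v : 'I_n) : x v <= (4 * (n * n))%:R.
Proof.
have [_ _ /(_ v) H] := LX; rewrite -/X -/M in H.
rewrite /x ler_pdivrMr // -natrM.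
have : (2%:Z * nth 0 X v)%:~R <= (2%:Z * (2 * n * n * M)%N%:Z)%:~R :> rat by rewrite ler_int ler_wpM2l.
move=> /le_trans; apply; rewrite -PoszM -pmulrn ler_nat; lia.
Qed.

Lemma levP (v : 'I_n) : x v <= rho ^+ lev X v /\ rho ^+ lev X v <= rho * x v.
Proof.
have [] := @nsum_prefix (J * (4 * (n * n))) (fun t => M%:Z * J.+1%:Z ^+ t < 2%:Z * nth 0 X v * J%:Z ^+ t).
  move=> t; rewrite !lev_pred; apply: lt_trans; rewrite exprS -[X in X < _]mul1r ltr_pM2r // exprn_gt0 //.
rewrite -/(lev X v) => H1 H2 H3; split.
  case: (ltnP (lev X v) (J * (4 * (n * n)))) => [/H3|H].
    by rewrite lev_pred -leNgt.
  apply: le_trans (x_le v) _; apply: le_trans (_ : rho ^+ (J * (4 * (n * n))) <= _); last first.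
    by rewrite ler_eXn2l // ltW.
  (* Bernoulli gives rho^J at least 2, so the cap in [lev] reaches 2^(4n^2), beyond the bound 4n^2
     on x_v. *)
  have b2 : 2%:R <= rho ^+ J.
    have bern k : 1 + k%:R * J%:R^-1 <= rho ^+ k.
      elim: k => [|k IH]; first by rewrite mul0r addr0.
      rewrite exprS -natr1 /rho mulrDl mul1r mulrDl mul1r addrA; apply: lerD => //.
      have J1 : 0 <= J%:R^-1 :> rat by rewrite invr_ge0 ler0n.
      rewrite -[X in X <= _]mulr1; apply: ler_wpM2l => //; apply: le_trans IH.
      by rewrite lerDl mulr_ge0 ?ler0n.
    by have := bern J; rewrite divff ?gt_eqF.
  rewrite exprM; apply: le_trans (_ : 2%:R ^+ (4 * (n * n)) <= _).
    by rewrite -natrX ler_nat ltnW // ltn_expl.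
  by apply: lerXn2r => //; rewrite nnegrE ?ler0n // exprn_ge0 // ltW.
case El: (lev X v) H2 => [|l] H2.
  by rewrite expr0; apply: le_trans (x_ge1 v) _; by rewrite ler_peMl ?(ltW rho_gt1) //; exact: le_trans ler01 (x_ge1 v).
rewrite exprS ler_pM2l //; apply: ltW; rewrite -lev_pred; exact: H2.
Qed.

Lemma lev_mono (u v : nat) : nth 0 X u <= nth 0 X v -> (lev X u <= lev X v)%N.
Proof.
move=> H; apply: leq_sum => t _; case: (boolP (_ < _)) => // Hu.
rewrite (_ : (_ < _) = true) //; apply: lt_le_trans Hu _.
by apply: ler_wpM2r; [apply: exprn_ge0 | apply: ler_wpM2l].
Qed.

Variable j : nat.
Hypothesis jJ : (j < J)%N.
Let blk := mkseq (fun v => divc (lev X v + j) J) n.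
Let blkE (v : 'I_n) : wtm n blk v = ((lev X v + j) %/ J)%N.
Proof. by rewrite /wtm nth_mkseq // divcE. Qed.

(** Take the vertex v of the block with the largest value. The block lies among the vertices not
    above v, so [om_x] bounds its clique number by x_v, and the level of v plus j is below
    (k+1)J. *)
Lemma block_om k : (om e (blockset n blk k))%:R <= al * rho ^+ (k.+1 * J - 1 - j).
Proof.
have [E0|/set0Pn [u0 u0k]] := eqVneq (blockset n blk k) set0.
  have [K [_ KA <-]] := om_ex e (blockset n blk k).
  have -> : #|K| = 0%N by apply/eqP; rewrite cards_eq0 -subset0 -E0.
  by rewrite mulr_ge0 ?exprn_ge0 ?(ltW al_gt0) ?(ltW rho_gt0).
have [v vk vmax] := @arg_maxP _ int 'I_n u0 (fun u => u \in blockset n blk k) (fun u => nth 0 X u) u0k.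
have [H1 H2] := levP v.
have sub : (om e (blockset n blk k) <= om e [set u : 'I_n | (nth 0%R X u <= nth 0%R X v)%R])%N.
  by apply: om_sub; apply/subsetP => u uk; rewrite inE; apply: vmax.
apply: le_trans (_ : al * x v <= _).
  by apply: le_trans (om_x v); rewrite ler_nat; apply: leq_trans sub _.
apply: ler_wpM2l; first exact: ltW.
apply: le_trans H1 _; rewrite ler_eXn2l // ?ltW //.
move: vk; rewrite inE blkE => /eqP Ek.
have := ltn_ceil (lev X v + j) J_gt0; rewrite Ek; lia.
Qed.

(** The colour of v is at most the sum of the clique numbers of the blocks up to its own, hence up
    to the block of g; their bounds from [block_om] form a geometric series of ratio rho^J. *)
Lemma cand_bound (v : 'I_n) (g : 'I_n) : nth 0 X v <= nth 0 X g ->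
  (wtm n (cand B j) v)%:R <= al * (rho ^+ J / (rho ^+ J - 1)) *
    rho ^+ (lev X g + (J - 1 - (lev X g + j) %% J)).
Proof.
move=> vg; have [/(_ v) H _] := colorP blk adjE e_sym e_irr ge.
have {}H : (wtm n (cand B j) v <= color_bound e blk v)%N by rewrite /cand -/X -/blk; lia.
set b := rho ^+ J.
have b1 : 0 < b - 1 by rewrite subr_gt0 exprn_egt1 // -?lt0n // gt_eqF.
pose K := ((lev X g + j) %/ J)%N.
have KE : (lev X g + (J - 1 - (lev X g + j) %% J) = K.+1 * J - 1 - j)%N.
  have := divn_eq (lev X g + j) J; have := ltn_pmod (lev X g + j) J_gt0; rewrite -/K mulSn; lia.
have bK : (wtm n blk v <= K)%N by rewrite blkE; apply: leq_div2r; rewrite leq_add2r lev_mono.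
have step : (color_bound e blk v)%:R <= al * \sum_(k < K.+1) rho ^+ (k.+1 * J - 1 - j).
  rewrite /color_bound natr_sum mulr_sumr.
  apply: le_trans (_ : \sum_(k < K.+1) (om e (blockset n blk k))%:R <= _); last by apply: ler_sum => k _; apply: block_om.
  rewrite -(big_mkord xpredT (fun k => (om e (blockset n blk k))%:R)) -[X in _ <= X](big_mkord xpredT (fun k => (om e (blockset n blk k))%:R)).
  have le1 : ((wtm n blk v).+1 <= K.+1)%N by rewrite ltnS.
  by rewrite [X in _ <= X](big_cat_nat (leq0n _) le1) /= lerDl; apply: sumr_ge0 => ? _; rewrite ler0n.
apply: le_trans (_ : (color_bound e blk v)%:R <= _); first by rewrite ler_nat.
apply: le_trans step _; rewrite -mulrA; apply: ler_wpM2l; first exact: ltW.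
rewrite KE -mulrA mulrCA ler_pdivlMl // -?mulrA.
have geo k : (b - 1) * \sum_(i < k) rho ^+ (i.+1 * J - 1 - j) <= rho ^+ (k.+1 * J - 1 - j).
  elim: k => [|k IH]; first by rewrite big_ord0 mulr0 exprn_ge0 // ltW.
  rewrite big_ord_recr /= mulrDr.
  have -> : rho ^+ (k.+2 * J - 1 - j) = b * rho ^+ (k.+1 * J - 1 - j).
    rewrite /b -exprD; congr (_ ^+ _); rewrite !mulSn; lia.
  by move: IH; move: (\sum_(i < k) _) (rho ^+ (k.+1 * J - 1 - j)) => s t; lra.
apply: le_trans (geo K.+1) _; rewrite /b -exprD.
by rewrite le_eqVlt; apply/orP; left; apply/eqP; congr (_ ^+ _); rewrite !mulSn; lia.
Qed.
End Offset.

Section Average.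
Variables (c : 'I_n -> nat) (B : nat).
Hypothesis c_bound : forall i, (0 < c i <= n)%N.
Hypothesis c_proper : forall i j, e i j -> c i != c j.
Hypothesis c_cost : (\sum_(g < m) nth 0 gw g * \max_(i < n | gin gm g i) c i <= B)%N.

(** As j varies, the residues run through all values once, and the geometric sum of the powers of
    rho equals (rho^J - 1)/(rho - 1) with rho - 1 = 1/J. *)
Lemma offset_sum (rho : rat) L : rho = 1 + J%:R^-1 ->
  \sum_(j < J) rho ^+ (J - 1 - (L + j) %% J) = J%:R * (rho ^+ J - 1).
Proof.
move=> Er; have HL (j : 'I_J) : (J - 1 - (L + j) %% J < J)%N by lia.
pose h (j : 'I_J) : 'I_J := Ordinal (HL j).
have hinj : injective h.
  move=> i j /(congr1 val) /= Hij; apply: val_inj => /=.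
  have H : ((L + i) = (L + j) %[mod J])%N.
    by have := ltn_pmod (L + i) J_gt0; have := ltn_pmod (L + j) J_gt0; lia.
  by move/eqP: H; rewrite eqn_modDl !modn_small // => /eqP.
rewrite -[LHS]/(\sum_(j < J) rho ^+ (h j)).
have <- : \sum_(r < J) rho ^+ r = \sum_(j < J) rho ^+ (h j) by rewrite (reindex_inj hinj).
have r1 : rho - 1 = J%:R^-1 by rewrite Er [1 + _]addrC addrK.
by rewrite subrX1 r1 mulrA divff ?mul1r // pnatr_eq0 -lt0n.
Qed.

Lemma pow_sub1_gt0 (rho : rat) : 1 < rho -> 0 < rho ^+ J - 1.
Proof. by move=> r1; rewrite subr_gt0 exprn_egt1 // -lt0n. Qed.

(** The best candidate is no worse than the average over the offsets. In the average of [cand_bound]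
    the factor rho^J - 1 of [offset_sum] cancels its denominator. One further rho is lost by
    rounding x up to a level, one factor 1 + 1/ee in the clique bounds and one in the objective. *)
Lemma best_bound (B_gt0 : (0 < B)%N) : (B <= n * lp_W m gw)%N ->
  (ccost best)%:R <= 2%:R * (1 + ee%:R^-1) ^+ 2 * (1 + J%:R^-1) ^+ J.+1 * B%:R :> rat.
Proof.
move=> Bn; have [[B' [j' E']] Hbest] := bestP J_gt0.
set X := lp_X n E m gm gw B ee.
have [M EM] : {M : nat | M = lp_M n m gw ee} by exists (lp_M n m gw ee).
have [rho Er] : {rho : rat | rho = 1 + J%:R^-1} by exists (1 + J%:R^-1).
have [al Ea] : {al : rat | al = 1 + ee%:R^-1} by exists (1 + ee%:R^-1).
rewrite -Er -Ea.
pose x (v : nat) : rat := (2%:Z * nth 0 X v)%:~R / M%:R.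
have M0 : (0 < M%:R :> rat) by rewrite ltr0n EM /lp_M addn_gt0 muln_gt0 orbT.
have e0 : (0 < ee%:R :> rat) by rewrite ltr0n.
have j0 : (0 < J%:R :> rat) by rewrite ltr0n.
have al0 : 0 < al by rewrite Ea addr_gt0 ?invr_gt0.
have r1 : 1 < rho by rewrite Er ltrDl invr_gt0.
have r0 : 0 < rho by apply: lt_trans r1.
have b1 := pow_sub1_gt0 r1.
have [_ H2 _] := lp_XP adjE e_sym ge c_bound c_proper gne c_cost B_gt0 ee_gt0; rewrite -/X -EM in H2.
have sumx : \sum_(g < m) (nth 0%N gw g)%:R * x (gargmax n gm X g) <= 2%:R * al * B%:R.
  have -> : \sum_(g < m) (nth 0%N gw g)%:R * x (gargmax n gm X g) =
     2%:R * (\sum_(g < m) (nth 0%N gw g)%:Z * nth 0 X (gargmax n gm X g))%:~R / M%:R.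
    rewrite rmorph_sum mulr_sumr mulr_suml; apply: eq_bigr => g _; rewrite /x !rmorphM /= -!pmulrn; ring.
  exact: lp_avg_arith ee_gt0 M0 Ea H2.
have gb g j : (g < m)%N -> (j < J)%N ->
   (gmax (cand B j) g)%:R <= al * (rho ^+ J / (rho ^+ J - 1)) * rho ^+ lev X (gargmax n gm X g) *
     rho ^+ (J - 1 - (lev X (gargmax n gm X g) + j) %% J).
  move=> gm0 jJ; have [i [-> Hi Hmax]] := gargmaxP gne X gm0.
  have [Hc _] := cand_proper B j.
  rewrite gmaxE; last by move=> v; have /andP [] := Hc v.
  have [v Hv ->] : exists2 v : 'I_n, gin gm g v & \max_(i < n | gin gm g i) wtm n (cand B j) i = wtm n (cand B j) v.
    have A0 : (0 < #|(fun i : 'I_n => gin gm g i)|)%N by apply/card_gt0P; exists i.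
    by have [v Hv Ev] := eq_bigmax_cond (fun i : 'I_n => wtm n (cand B j) i) A0; exists v.
  rewrite -mulrA -exprD; have := cand_bound c_bound c_proper c_cost B_gt0 jJ (Hmax v Hv); rewrite -Er -Ea; apply.
(* Multiply by J: J times the best cost is at most the sum over the offsets. Each group is then
   estimated at its vertex of largest value. *)
rewrite -(ler_pM2l j0).
apply: le_trans (_ : \sum_(j < J) (ccost (cand B j))%:R <= _).
  rewrite mulr_natl -[X in _ *+ X]card_ord -sumr_const; apply: ler_sum => j _; rewrite ler_nat.
  by apply: Hbest; rewrite ?ltnS.
apply: le_trans (_ : \sum_(j < J) \sum_(g < m) (nth 0%N gw g)%:R * (al * (rho ^+ J / (rho ^+ J - 1)) * rho ^+ lev X (gargmax n gm X g) *
     rho ^+ (J - 1 - (lev X (gargmax n gm X g) + j) %% J)) <= _).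
  apply: ler_sum => j _; rewrite /ccost /nsum natr_sum; apply: ler_sum => g _.
  by rewrite natrM; apply: ler_wpM2l; [exact: ler0n | apply: gb].
rewrite exchange_big /=.
apply: le_trans (_ : \sum_(g < m) (J%:R * al * rho ^+ J.+1) * ((nth 0%N gw g)%:R * x (gargmax n gm X g)) <= _).
  apply: ler_sum => g _; rewrite -mulr_sumr -mulr_sumr (offset_sum _ Er).
  have [i [-> Hi Hmax]] := gargmaxP gne X (ltn_ord g).
  have [_ H] := levP c_bound c_proper c_cost B_gt0 i; rewrite -Er -/X -EM -/(x i) in H.
  have -> : al * (rho ^+ J / (rho ^+ J - 1)) * rho ^+ lev X i * (J%:R * (rho ^+ J - 1)) =
     J%:R * al * rho ^+ J * rho ^+ lev X i.
    exact: cancel_denom (lt0r_neq0 b1).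
  rewrite [X in _ <= X]mulrCA; apply: ler_wpM2l; first exact: ler0n.
  rewrite exprSr mulrA -[X in _ <= X]mulrA; apply: ler_wpM2l; last exact: H.
  apply: mulr_ge0; [exact: ltW (mulr_gt0 j0 al0) | exact: ltW (exprn_gt0 _ r0)].
rewrite -mulr_sumr.
have -> : J%:R * (2%:R * al ^+ 2 * rho ^+ J.+1 * B%:R) = (J%:R * al * rho ^+ J.+1) * (2%:R * al * B%:R).
  exact: factor_rearrange.
apply: ler_wpM2l; last exact: sumx.
exact: mulr_ge0 (ltW (mulr_gt0 j0 al0)) (ltW (exprn_gt0 _ r0)).
Qed.
End Average.
End Round.


(** * Rounding rational weights to small integers *)

(** Weights are rounded up to multiples of W/(m n ee). As maxima are at most n, the m groups
    together add at most W/ee to the objective, and W is a lower bound for it. *)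
Lemma rounding_transfer (m n ee : nat) (w : nat -> rat) (W kappa : rat) (w' q x : nat -> nat) :
  (0 < m)%N -> (0 < n)%N -> (0 < ee)%N -> 0 < W -> 0 <= kappa ->
  (forall g, (g < m)%N -> (m * n * ee)%:R * w g <= (w' g)%:R * W) ->
  (forall g, (g < m)%N -> (w' g)%:R * W <= (m * n * ee)%:R * w g + W) ->
  (forall g, (g < m)%N -> (x g <= n)%N) ->
  W <= \sum_(g < m) w g * (x g)%:R ->
  (\sum_(g < m) w' g * q g)%:R <= kappa * (\sum_(g < m) w' g * x g)%:R ->
  \sum_(g < m) w g * (q g)%:R <= kappa * (1 + ee%:R^-1) * \sum_(g < m) w g * (x g)%:R.
Proof.
move=> m0 n0 ee0 W0 k0 Hlo Hhi Hx HW Hk.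
have N0 : 0 < (m * n * ee)%:R :> rat by rewrite ltr0n !muln_gt0 m0 n0.
have e0 : 0 < ee%:R :> rat by rewrite ltr0n.
set C := \sum_(g < m) w g * (x g)%:R in HW *.
have s1 : (m * n * ee)%:R * \sum_(g < m) w g * (q g)%:R <= W * (\sum_(g < m) w' g * q g)%:R.
  rewrite natr_sum !mulr_sumr; apply: ler_sum => g _; rewrite [(w' _ * _)%:R]natrM !mulrA.
  by apply: ler_wpM2r; [exact: ler0n | rewrite [W * _]mulrC; apply: Hlo].
have s2 : W * (\sum_(g < m) w' g * x g)%:R <= (m * n * ee)%:R * C + W * (m * n)%:R.
  have -> : W * (m * n)%:R = \sum_(g < m) W * n%:R.
    by rewrite sumr_const card_ord -[RHS]mulr_natr natrM [m%:R * _]mulrC mulrA.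
  rewrite natr_sum !mulr_sumr -big_split /=; apply: ler_sum => g _; rewrite [(w' _ * _)%:R]natrM !mulrA.
  apply: le_trans (_ : ((m * n * ee)%:R * w g + W) * (x g)%:R <= _).
    by rewrite [W * _]mulrC ler_wpM2r ?ler0n // Hhi.
  rewrite mulrDl lerD2l; apply: ler_wpM2l; [exact: ltW | by rewrite ler_nat Hx].
have s3 : W * (m * n)%:R <= (m * n)%:R * C by rewrite mulrC; apply: ler_wpM2l; rewrite ?ler0n.
rewrite -(ler_pM2l N0); apply: le_trans s1 _.
apply: le_trans (_ : W * (kappa * (\sum_(g < m) w' g * x g)%:R) <= _).
  by apply: ler_wpM2l; [exact: ltW | exact: Hk].
have -> : (m * n * ee)%:R * (kappa * (1 + ee%:R^-1) * C) = kappa * ((m * n * ee)%:R * C + (m * n)%:R * C).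
  rewrite natrM; field; exact: lt0r_neq0.
rewrite mulrCA; apply: ler_wpM2l => //; apply: le_trans s2 _; by rewrite lerD2l.
Qed.

Lemma cube_split (u r : rat) : 2%:R * u ^+ 3 * r = 2%:R * u ^+ 2 * r * u.
Proof. ring. Qed.

Section Weights.
Variables (n : nat) (E : seq (seq bool)) (m : nat) (gm : seq (seq bool)) (a b : seq int) (ee J : nat).

Definition heaviest :=
  findn m (fun g => alln m (fun h => nth 0 a h * nth 0 b g <= nth 0 a g * nth 0 b h)).
(** The weight relative to the heaviest one, scaled by m n ee and rounded up; it never exceeds m n
    ee and is therefore affordable in unary. *)
Definition unary_weights :=
  mkseq (fun g => nsum (m * n * ee) (fun k =>
    (k%:Z * (nth 0 a heaviest * nth 0 b g) < (m * n * ee)%N%:Z * (nth 0 a g * nth 0 b heaviest))%R : nat)) m.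
Definition solve := best n E m gm unary_weights ee J.

Variable e : rel 'I_n.
Hypothesis adjE : forall i j : 'I_n, has_edge E i j = e i j.
Hypothesis e_sym : symmetric e.
Hypothesis e_irr : irreflexive e.
Hypothesis ge : good e.
Hypothesis J_gt0 : (0 < J)%N.
Hypothesis ee_gt0 : (0 < ee)%N.
Hypothesis gne : forall g, (g < m)%N -> exists i : 'I_n, gin gm g i.
Hypothesis ab_gt0 : forall g, (g < m)%N -> 0 < nth 0 a g /\ 0 < nth 0 b g.

Let w (g : nat) : rat := (nth 0 a g)%:~R / (nth 0 b g)%:~R.

Lemma heaviestP : (0 < m)%N -> (heaviest < m)%N /\ forall g, (g < m)%N -> w g <= w heaviest.
Proof.
move=> m0; have [g0 _ gmax] := @arg_maxP _ rat _ (Ordinal m0) xpredT (fun g : 'I_m => w g) isT.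
have cmp g h : (g < m)%N -> (h < m)%N -> (nth 0 a h * nth 0 b g <= nth 0 a g * nth 0 b h) = (w h <= w g).
  move=> /ab_gt0 [_ gb] /ab_gt0 [_ hb].
  by rewrite /w ler_pdivrMr ?ltr0z // mulrAC ler_pdivlMr ?ltr0z // -!intrM ler_int.
have [H1 /allnP H2] := findn_P (ex_intro2 (fun g => (g < m)%N) (fun g => alln m (fun h => nth 0 a h * nth 0 b g <= nth 0 a g * nth 0 b h)) (g0 : nat) (ltn_ord g0)
  (introT (allnP _ _) (fun h Hh => etrans (cmp _ _ (ltn_ord g0) Hh) (gmax (Ordinal Hh) isT)))).
by split=> // g Hg; rewrite -cmp //; apply: H2.
Qed.

Lemma unary_weightsP g : (g < m)%N ->
  (m * n * ee)%:R * w g <= (nth 0%N unary_weights g)%:R * w heaviest /\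
  (nth 0%N unary_weights g)%:R * w heaviest <= (m * n * ee)%:R * w g + w heaviest.
Proof.
move=> Hg; have m0 : (0 < m)%N by apply: leq_ltn_trans Hg.
have [Hs Hmax] := heaviestP m0; rewrite nth_mkseq //.
have [as0 bs0] := ab_gt0 Hs; have [ag0 bg0] := ab_gt0 Hg.
have ws0 : 0 < w heaviest by rewrite /w divr_gt0 ?ltr0z.
have cmp (k : nat) : (k%:Z * (nth 0 a heaviest * nth 0 b g) < (m * n * ee)%N%:Z * (nth 0 a g * nth 0 b heaviest)) = (k%:R * w heaviest < (m * n * ee)%:R * w g).
  by rewrite /w !mulrA ltr_pdivrMr ?ltr0z // [X in _ = (_ < X)]mulrAC ltr_pdivlMr ?ltr0z // -(ltr_int rat) !rmorphM /= -!pmulrn.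
have [] := @nsum_prefix (m * n * ee) (fun k => k%:Z * (nth 0 a heaviest * nth 0 b g) < (m * n * ee)%N%:Z * (nth 0 a g * nth 0 b heaviest)).
  move=> t; rewrite !cmp; apply: le_lt_trans; rewrite ler_pM2r // ler_nat //.
set l := nsum _ _; move: l => l H1 H2 H3; split.
  case: (ltnP l (m * n * ee)) => [/H3|H]; first by rewrite cmp -leNgt.
  have -> : l = (m * n * ee)%N by apply/eqP; rewrite eqn_leq H1.
  by apply: ler_wpM2l; [exact: ler0n | exact: Hmax].
case: l H2 {H1 H3} => [|l] H2.
  have wg0 : 0 <= w g by rewrite /w divr_ge0 // ler0z ltW.
  rewrite mul0r; exact: addr_ge0 (mulr_ge0 (ler0n _ _) wg0) (ltW ws0).
by have := H2 l (ltnSn l); rewrite cmp -natr1 mulrDl mul1r lerD2r => /ltW.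
Qed.

Lemma solve_proper : (forall i : 'I_n, (0 < nth 0 solve i <= n)%N) /\
  forall i j : 'I_n, e i j -> nth 0%N solve i != nth 0%N solve j.
Proof.
have [[B [j Ej]] _] := @bestP n E m gm unary_weights ee J J_gt0; rewrite /solve Ej.
exact: (cand_proper m gm unary_weights ee J adjE e_sym e_irr ge).
Qed.

(** The exact budget of [c] for the rounded weights is among those tried, so [best_bound] applies to
    it. The heaviest weight is a lower bound for the cost of [c], because every group maximum is at
    least 1. *)
Lemma solve_bound (c : 'I_n -> nat) : (forall i, (0 < c i <= n)%N) -> (forall i j, e i j -> c i != c j) ->
  \sum_(g < m) w g * (\max_(i < n | gin gm g i) nth 0 solve i)%:R <=
    2%:R * (1 + ee%:R^-1) ^+ 3 * (1 + J%:R^-1) ^+ J.+1 * \sum_(g < m) w g * (\max_(i < n | gin gm g i) c i)%:R.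
Proof.
move=> c_bound c_proper.
have [m0|m0] := posnP m; first by rewrite !(big1 _ xpredT) ?mulr0 // => -[g Hg]; exfalso; rewrite m0 in Hg.
have [i0 _] := gne m0; have n0 : (0 < n)%N by apply: leq_ltn_trans (ltn_ord i0).
have [Hs Hmax] := heaviestP m0.
pose q g := (\max_(i < n | gin gm g i) nth 0%N solve i)%N.
pose x g := (\max_(i < n | gin gm g i) c i)%N.
have xn g : (g < m)%N -> (x g <= n)%N by move=> _; apply/bigmax_leqP => i _; have /andP [] := c_bound i.
have x1 g : (g < m)%N -> (0 < x g)%N.
  move=> /gne [i Hi]; have /andP [ci _] := c_bound i; apply: leq_trans ci _.
  by rewrite /x (bigD1 i) //= leq_maxl.
have w0 g : (g < m)%N -> 0 < w g by move=> /ab_gt0 [? ?]; rewrite /w divr_gt0 ?ltr0z.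
pose B := (\sum_(g < m) nth 0 unary_weights g * x g)%N.
have uw1 : (0 < nth 0 unary_weights heaviest)%N.
  have [H _] := unary_weightsP Hs; rewrite lt0n; apply/eqP => E0; move: H.
  rewrite E0 mul0r leNgt; move/negP; apply; apply: mulr_gt0; last exact: w0.
  by rewrite ltr0n !muln_gt0 m0 n0 ee_gt0.
have B0 : (0 < B)%N.
  rewrite /B (bigD1 (Ordinal Hs)) //= addn_gt0; apply/orP; left.
  by rewrite muln_gt0 uw1 x1.
have Bn : (B <= n * lp_W m unary_weights)%N.
  rewrite /lp_W /nsum big_distrr /=; apply: leq_sum => g _; rewrite mulnC leq_mul2r.
  by rewrite xn ?orbT.
have := best_bound adjE e_sym e_irr ge J_gt0 ee_gt0 gne c_bound c_proper (leqnn B) B0 Bn.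
rewrite -/solve; set kap := (2%:R * _ ^+ 2 * _) => Hk.
have k0 : 0 <= kap.
  by rewrite /kap !mulr_ge0 ?exprn_ge0 ?addr_ge0 ?invr_ge0 ?ler0n.
have -> : 2%:R * (1 + ee%:R^-1) ^+ 3 * (1 + J%:R^-1) ^+ J.+1 = kap * (1 + ee%:R^-1) :> rat.
  exact: cube_split.
apply: (@rounding_transfer m n ee w (w heaviest) kap (nth 0%N unary_weights) q x) => //.
- exact: w0.
- by move=> g /unary_weightsP [].
- by move=> g /unary_weightsP [].
- rewrite (bigD1 (Ordinal Hs)) //= ler_wpDr ?sumr_ge0 //.
    by move=> g _; rewrite mulr_ge0 ?ler0n // ltW // w0.
  rewrite -[X in X <= _]mulr1 ler_pM2l ?w0 // ler1n; exact: x1.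
move: Hk; rewrite /B /ccost /nsum.
have -> : (\sum_(i < m) nth 0 unary_weights i * gmax n gm solve i = \sum_(g < m) nth 0 unary_weights g * q g)%N.
  apply: eq_bigr => g _; rewrite gmaxE //.
  by have [H _] := solve_proper; move=> i; have /andP [] := H i.
by [].
Qed.
End Weights.

Local Close Scope ring_scope.

(** * Polynomial time of the combinatorial subroutines *)

Definition PB {A} {EA : Enc A} (b : A -> nat) := exists c, forall x, b x <= bnd c (tsz x).

Section PolyBound.
Context {A : Type} {EA : Enc A}.
Implicit Types a b : A -> nat.

Lemma PB_tsz {B} {EB : Enc B} (f : A -> B) : PT f -> PB (fun x => tsz (f x)).
Proof. exact: PT_size. Qed.
Lemma PB_nat a : PT a -> PB a.
Proof. by move=> H; have [c Hc] := PT_size H; exists c => x; apply: leq_trans (Hc x); rewrite tsz_nat; lia. Qed.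
Lemma PB_const (k : nat) : PB (fun _ : A => k).
Proof. have [c Hc] : pbounded (fun=> k) by pb. by exists c => x; apply: (Hc (tsz x)). Qed.
Lemma PB_add a b : PB a -> PB b -> PB (fun x => a x + b x).
Proof.
move=> [c Hc] [d Hd]; have [e He] : pbounded (fun t => bnd c t + bnd d t) by pb.
by exists e => x; apply: leq_trans (He _); apply: leq_add.
Qed.
Lemma PB_mul a b : PB a -> PB b -> PB (fun x => a x * b x).
Proof.
move=> [c Hc] [d Hd]; have [e He] : pbounded (fun t => bnd c t * bnd d t) by pb.
by exists e => x; apply: leq_trans (He _); apply: leq_mul.
Qed.
Lemma PB_S a : PB a -> PB (fun x => (a x).+1).
Proof. by move=> H; have [c Hc] := PB_add H (PB_const 1); exists c => x; rewrite -addn1. Qed.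

(** [PT_iter] with the size bound obtained from a loop invariant. *)
Lemma PT_iter_inv {S} {ES : Enc S} (n : A -> nat) (f : A -> S -> S) (s0 : A -> S)
    (I : A -> nat -> S -> Prop) b :
  PT n -> PT s0 -> PT (fun p : A * S => f p.1 p.2) -> PB b ->
  (forall x, I x 0 (s0 x)) -> (forall x k s, k < n x -> I x k s -> I x k.+1 (f x s)) ->
  (forall x k s, k <= n x -> I x k s -> tsz s <= b x) ->
  PT (fun x => iter (n x) (f x) (s0 x)).
Proof.
move=> Hn H0 Hf [c Hc] I0 IS Ib; apply: PT_iter => //; exists c => x k Hk.
apply: leq_trans (Hc x); apply: (Ib x k) => //.
by elim: k Hk => [|k IH] Hk; [apply: I0 | apply: IS => //; apply: IH; apply: ltnW].
Qed.
End PolyBound.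

Ltac pbt := repeat first [ match goal with
  | |- PB (fun x => addn (@?a x) (@?b x)) => apply (PB_add (a := a) (b := b))
  | |- PB (fun x => muln (@?a x) (@?b x)) => apply (PB_mul (a := a) (b := b))
  | |- PB (fun x => S (@?a x)) => apply (PB_S (a := a))
  | |- PB (fun _ => ?c) => apply (PB_const c)
  | |- PB (fun x => tsz (@?a x)) => apply (PB_tsz (f := a))
  | |- PB _ => apply PB_nat
  end ].

Lemma tsz_nats (u : seq nat) M : (forall i, i < size u -> nth 0 u i <= M) ->
  tsz u <= (size u * (2 * M).+2).+1.
Proof.
move=> H; apply: tsz_seq_le => i a Hi; rewrite (set_nth_default 0) // tsz_nat.
have := H i Hi; lia.
Qed.
Lemma tsz_bools (u : seq bool) : tsz u <= (size u * 4).+1.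
Proof. by apply: tsz_seq_le => i a _; case: (nth _ _ _). Qed.
Lemma nth_tsz (u : seq nat) i : nth 0 u i <= tsz u.
Proof.
elim: u i => [|x u IH] [|i] //=; rewrite tsz_cons ?tsz_nat; first lia.
by apply: leq_trans (IH i) _; lia.
Qed.

Section Mws.
Context {A : Type} {EA : Enc A}.
Implicit Types (n a : A -> nat) (E : A -> seq (seq bool)) (w : A -> seq nat) (U R S : A -> seq bool).

Lemma PT_zero_at n w (i : A -> nat) : PT n -> PT w -> PT i -> PT (fun x => zero_at (n x) (w x) (i x)).
Proof. by move=> *; rewrite /zero_at; pt. Qed.
Lemma PT_coE n E : PT n -> PT E -> PT (fun x => coE (n x) (E x)).
Proof. by move=> *; rewrite /coE; pt; try apply: (PT_mkseq (f := fun (p : A * nat) j => (p.2 != j) && ~~ has_edge (E p.1) p.2 j)); pt. Qed.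
Lemma PT_msize n U : PT n -> PT U -> PT (fun x => msize (n x) (U x)).
Proof. by move=> *; rewrite /msize; pt. Qed.
Lemma PT_diffm n U S : PT n -> PT U -> PT S -> PT (fun x => diffm (n x) (U x) (S x)).
Proof. by move=> *; rewrite /diffm; pt. Qed.
Lemma PT_min_idx n R (b : A -> seq nat) : PT n -> PT R -> PT b -> PT (fun x => min_idx (n x) (R x) (b x)).
Proof.
move=> Hn HR Hb; rewrite /min_idx; pt.
all: try by apply: (PT_alln (P := fun (p : A * nat) j => ~~ nth false (R p.1) j || (nth 0 (b p.1) p.2 <= nth 0 (b p.1) j))); pt.
Qed.
Lemma PT_low_block n R (b : A -> seq nat) : PT n -> PT R -> PT b -> PT (fun x => low_block (n x) (R x) (b x)).
Proof. by move=> Hn HR Hb; have M := PT_min_idx Hn HR Hb; rewrite /low_block; pt; try apply: (PT_comp M (PT_fst PT_id)). Qed.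
Lemma PT_th_alpha n E w : PT n -> PT E -> PT w -> PT (fun x => th_alpha (n x) (E x) (w x)).
Proof. by move=> *; rewrite /th_alpha; pt; apply: PT_theta_test; pt. Qed.
End Mws.

Ltac pt_user ::= first [ lazymatch goal with
  | |- PT (fun x => has_edge _ _ _) => apply PT_has_edge
  | |- PT (fun x => zero_at _ _ _) => apply PT_zero_at
  | |- PT (fun x => coE _ _) => apply PT_coE
  | |- PT (fun x => msize _ _) => apply PT_msize
  | |- PT (fun x => diffm _ _ _) => apply PT_diffm
  | |- PT (fun x => low_block _ _ _) => apply PT_low_block
  | |- PT (fun x => th_alpha _ _ _) => apply PT_th_alpha
  | |- PT (fun x => theta_test _ _ _ _) => apply PT_theta_test
  end | pt3 ].

Section Mws2.
Context {A : Type} {EA : Enc A}.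
Implicit Types (n a : A -> nat) (E : A -> seq (seq bool)) (w : A -> seq nat) (U R S : A -> seq bool).

Lemma PT_mws n E w : PT n -> PT E -> PT w -> PT (fun x => mws (n x) (E x) (w x)).
Proof.
move=> Hn HE Hw; rewrite /mws.
have I : PT (fun x => iter (n x) (mws_step (n x) (E x) (th_alpha (n x) (E x) (w x))) (0, w x)); last first.
  by pt; apply: (PT_comp I (PT_fst PT_id)).
have Ha := PT_th_alpha Hn HE Hw.
apply (PT_iter_inv (n := n)
  (f := fun x => mws_step (n x) (E x) (th_alpha (n x) (E x) (w x)))
  (s0 := fun x => (0, w x))
  (I := fun x k st => st.1 = k /\ (st.2 = w x \/ size st.2 = n x /\ forall i, nth 0 st.2 i <= nth 0 (w x) i))
  (b := fun x => 2 * n x + 3 + (tsz (w x) + (n x * (2 * tsz (w x)).+2).+1))).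
- by [].
- by pt.
- by rewrite /mws_step; pt.
- by pbt.
- by split=> //; left.
- move=> x k [k' v] /= _ [-> H]; split=> //; case: ifP => _; last exact: H.
  right; rewrite size_mkseq; split=> // i; case: (ltnP i (n x)) => Hi; last by rewrite nth_default ?size_mkseq.
  by rewrite nth_mkseq //; case: ifP => // _; case: H => [->|[_ ]].
- move=> x k [k' v] /= Hk [-> H]; rewrite tsz_pair tsz_nat.
  case: H => [->|[Hs Hv]]; first lia.
  have : tsz v <= (size v * (2 * tsz (w x)).+2).+1.
    by apply: tsz_nats => i _; apply: leq_trans (Hv i) (nth_tsz _ _).
  rewrite Hs; lia.
Qed.
End Mws2.

Section Hit.
Context {A : Type} {EA : Enc A}.
Implicit Types (n a : A -> nat) (E : A -> seq (seq bool)) (w : A -> seq nat) (U R S : A -> seq bool).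

Lemma PT_maxclique n E U : PT n -> PT E -> PT U -> PT (fun x => maxclique (n x) (E x) (U x)).
Proof. by move=> *; rewrite /maxclique; apply: PT_mws => //; [apply: PT_coE | pt]. Qed.
End Hit.

Section Hit2.
Context {A : Type} {EA : Enc A}.
Implicit Types (n a : A -> nat) (E : A -> seq (seq bool)) (w : A -> seq nat) (U R S : A -> seq bool).

Lemma PT_hit_step n E U a w : PT n -> PT E -> PT U -> PT a -> PT w ->
  PT (fun x => hit_step (n x) (E x) (U x) (a x) (w x)).
Proof.
move=> Hn HE HU Ha Hw; have HK : PT (fun x => maxclique (n x) (E x) (diffm (n x) (U x) (mws (n x) (E x) (w x)))).
  by apply: PT_maxclique => //; apply: PT_diffm => //; apply: PT_mws.
by rewrite /hit_step; cbv zeta; pt; apply: (PT_comp HK (PT_fst PT_id)).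
Qed.
End Hit2.

Section Hit3.
Context {A : Type} {EA : Enc A}.
Implicit Types (n a : A -> nat) (E : A -> seq (seq bool)) (w : A -> seq nat) (U R S : A -> seq bool).

Lemma PT_hit n E U : PT n -> PT E -> PT U -> PT (fun x => hit (n x) (E x) (U x)).
Proof.
move=> Hn HE HU; have Hm : PT (fun x => msize (n x) (maxclique (n x) (E x) (U x))).
  by apply: PT_msize => //; apply: PT_maxclique.
rewrite /hit; apply: PT_mws => //.
apply (PT_iter_inv (n := n)
  (f := fun x => hit_step (n x) (E x) (U x) (msize (n x) (maxclique (n x) (E x) (U x))))
  (s0 := fun x => mkseq (fun=> 0) (n x))
  (I := fun x k v => size v = n x /\ forall i, nth 0 v i <= k)
  (b := fun x => (n x * (2 * n x).+2).+1)).
- by [].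
- by pt.
- by apply: PT_hit_step; pt; apply: PT_maxclique; pt.
- by pbt.
- move=> x; rewrite size_mkseq; split=> // i.
  by case: (ltnP i (n x)) => Hi; [rewrite nth_mkseq | rewrite nth_default ?size_mkseq].
- move=> x k v _ [Hs Hv]; rewrite /hit_step; set K := maxclique _ _ _; case: ifP => _; last by split=> // i; apply: leqW.
  rewrite size_mkseq; split=> // i; case: (ltnP i (n x)) => Hi; last by rewrite nth_default ?size_mkseq.
  by rewrite nth_mkseq //; have := Hv i; case: (nth false K i); lia.
- move=> x k v Hk [Hs Hv]; rewrite -Hs; apply: tsz_nats => i _; apply: leq_trans (Hv i) _; by rewrite Hs.
Qed.
End Hit3.

Section Color.
Context {A : Type} {EA : Enc A}.
Implicit Types (n a : A -> nat) (E : A -> seq (seq bool)) (w b : A -> seq nat) (U R S : A -> seq bool).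

Lemma PT_color_step n E b (st : A -> seq bool * (nat * seq nat)) : PT n -> PT E -> PT b -> PT st ->
  PT (fun x => color_step (n x) (E x) (b x) (st x)).
Proof.
move=> Hn HE Hb Hst; have HS : PT (fun x => hit (n x) (E x) (low_block (n x) (st x).1 (b x))).
  by apply: PT_hit => //; apply: PT_low_block => //; pt.
rewrite /color_step; cbv zeta; pt; by [exact: HS | apply: (PT_comp HS (PT_fst PT_id))].
Qed.
End Color.

Section Color2.
Context {A : Type} {EA : Enc A}.
Implicit Types (n a : A -> nat) (E : A -> seq (seq bool)) (w b : A -> seq nat) (U R S : A -> seq bool).

Lemma PT_color n E b : PT n -> PT E -> PT b -> PT (fun x => color (n x) (E x) (b x)).
Proof.
move=> Hn HE Hb; rewrite /color.
have I : PT (fun x => iter (n x) (color_step (n x) (E x) (b x)) (mkseq (fun=> true) (n x), (0, mkseq (fun=> 0) (n x)))); last first.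
  exact: PT_snd (PT_snd I).
apply (PT_iter_inv (n := n)
  (f := fun x => color_step (n x) (E x) (b x))
  (s0 := fun x => (mkseq (fun=> true) (n x), (0, mkseq (fun=> 0) (n x))))
  (I := fun x k st => [/\ size st.1 = n x, st.2.1 = k, size st.2.2 = n x & forall i, nth 0 st.2.2 i <= k])
  (b := fun x => (n x * 4 + 2 * n x + (n x * (2 * n x).+2) + 10))).
- by [].
- by pt.
- by apply: PT_color_step; pt.
- by pbt; pt.
- move=> x /=; rewrite !size_mkseq; split=> // i.
  by case: (ltnP i (n x)) => Hi; [rewrite nth_mkseq | rewrite nth_default ?size_mkseq].
- move=> x k [R [t v]] _ [/= Hs -> Hs' Hv]; rewrite /color_step /=; set K := hit _ _ _.
  rewrite !size_mkseq; split=> // i; case: (ltnP i (n x)) => Hi; last by rewrite nth_default ?size_mkseq.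
  by rewrite nth_mkseq //; case: ifP => // _; apply: leqW.
- move=> x k [R [t v]] Hk [/= Hs -> Hs' Hv]; rewrite !tsz_pair tsz_nat.
  have := tsz_bools R; have : tsz v <= (size v * (2 * n x).+2).+1.
    by apply: tsz_nats => i _; apply: leq_trans (Hv i) _.
  rewrite Hs Hs'; move: (tsz R) (tsz v) (n x * (2 * n x).+2) => p q r; lia.
Qed.
End Color2.

Local Open Scope ring_scope.

Ltac pt_user ::= first [ lazymatch goal with
  | |- PT (fun x => has_edge _ _ _) => apply PT_has_edge
  | |- PT (fun x => maxclique _ _ _) => apply PT_maxclique
  | |- PT (fun x => msize _ _) => apply PT_msize
  | |- PT (fun x => color _ _ _) => apply PT_color
  end | pt3 ].

(** * Polynomial time of the relaxation and of the rounding *)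

Lemma PT_gin {A} {EA : Enc A} (gm : A -> seq (seq bool)) (g : A -> nat) (v : A -> nat) :
  PT gm -> PT g -> PT v -> PT (fun x => gin (gm x) (g x) (v x)).
Proof.
move=> Hgm Hg Hv; by rewrite /gin; pt.
Qed.

Ltac pt_user ::= first [ lazymatch goal with
  | |- PT (fun x => has_edge _ _ _) => apply PT_has_edge
  | |- PT (fun x => maxclique _ _ _) => apply PT_maxclique
  | |- PT (fun x => msize _ _) => apply PT_msize
  | |- PT (fun x => color _ _ _) => apply PT_color
  | |- PT (fun x => gin _ _ _) => apply PT_gin
  end | pt3 ].

Lemma PT_lp_W {A} {EA : Enc A} (m : A -> nat) (gw : A -> seq nat) :
  PT m -> PT gw -> PT (fun x => lp_W (m x) (gw x)).
Proof.
move=> Hm Hgw; by rewrite /lp_W; pt.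
Qed.

Ltac pt_user ::= first [ lazymatch goal with
  | |- PT (fun x => has_edge _ _ _) => apply PT_has_edge
  | |- PT (fun x => maxclique _ _ _) => apply PT_maxclique
  | |- PT (fun x => msize _ _) => apply PT_msize
  | |- PT (fun x => color _ _ _) => apply PT_color
  | |- PT (fun x => gin _ _ _) => apply PT_gin
  | |- PT (fun x => lp_W _ _) => apply PT_lp_W
  end | pt3 ].

Lemma PT_lp_M {A} {EA : Enc A} (n : A -> nat) (m : A -> nat) (gw : A -> seq nat) (ee : nat) :
  PT n -> PT m -> PT gw -> PT (fun x => lp_M (n x) (m x) (gw x) ee).
Proof.
move=> Hn Hm Hgw; by rewrite /lp_M; pt.
Qed.

Ltac pt_user ::= first [ lazymatch goal with
  | |- PT (fun x => has_edge _ _ _) => apply PT_has_edge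
  | |- PT (fun x => maxclique _ _ _) => apply PT_maxclique
  | |- PT (fun x => msize _ _) => apply PT_msize
  | |- PT (fun x => color _ _ _) => apply PT_color
  | |- PT (fun x => gin _ _ _) => apply PT_gin
  | |- PT (fun x => lp_W _ _) => apply PT_lp_W
  | |- PT (fun x => lp_M _ _ _ _) => apply PT_lp_M
  end | pt3 ].

Lemma PT_gargmax {A} {EA : Enc A} (n : A -> nat) (gm : A -> seq (seq bool)) (X : A -> seq int) (g : A -> nat) :
  PT n -> PT gm -> PT X -> PT g -> PT (fun x => gargmax (n x) (gm x) (X x) (g x)).
Proof.
move=> Hn Hgm HX Hg; by rewrite /gargmax; pt.
Qed.

Ltac pt_user ::= first [ lazymatch goal with
  | |- PT (fun x => has_edge _ _ _) => apply PT_has_edge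
  | |- PT (fun x => maxclique _ _ _) => apply PT_maxclique
  | |- PT (fun x => msize _ _) => apply PT_msize
  | |- PT (fun x => color _ _ _) => apply PT_color
  | |- PT (fun x => gin _ _ _) => apply PT_gin
  | |- PT (fun x => lp_W _ _) => apply PT_lp_W
  | |- PT (fun x => lp_M _ _ _ _) => apply PT_lp_M
  | |- PT (fun x => gargmax _ _ _ _) => apply PT_gargmax
  end | pt3 ].

Lemma PT_lp_K {A} {EA : Enc A} (n : A -> nat) (E : A -> seq (seq bool)) (X : A -> seq int) (v : A -> nat) :
  PT n -> PT E -> PT X -> PT v -> PT (fun x => lp_K (n x) (E x) (X x) (v x)).
Proof.
move=> Hn HE HX Hv; by rewrite /lp_K; pt.
Qed.

Ltac pt_user ::= first [ lazymatch goal with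
  | |- PT (fun x => has_edge _ _ _) => apply PT_has_edge
  | |- PT (fun x => maxclique _ _ _) => apply PT_maxclique
  | |- PT (fun x => msize _ _) => apply PT_msize
  | |- PT (fun x => color _ _ _) => apply PT_color
  | |- PT (fun x => gin _ _ _) => apply PT_gin
  | |- PT (fun x => lp_W _ _) => apply PT_lp_W
  | |- PT (fun x => lp_M _ _ _ _) => apply PT_lp_M
  | |- PT (fun x => gargmax _ _ _ _) => apply PT_gargmax
  | |- PT (fun x => lp_K _ _ _ _) => apply PT_lp_K
  end | pt3 ].

Lemma PT_lp_viol {A} {EA : Enc A} (n : A -> nat) (E : A -> seq (seq bool)) (m : A -> nat) (gw : A -> seq nat) (X : A -> seq int) (v : A -> nat) (ee : nat) :
  PT n -> PT E -> PT m -> PT gw -> PT X -> PT v -> PT (fun x => lp_viol (n x) (E x) (m x) (gw x) ee (X x) (v x)).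
Proof.
move=> Hn HE Hm Hgw HX Hv; by rewrite /lp_viol; pt.
Qed.

Ltac pt_user ::= first [ lazymatch goal with
  | |- PT (fun x => has_edge _ _ _) => apply PT_has_edge
  | |- PT (fun x => maxclique _ _ _) => apply PT_maxclique
  | |- PT (fun x => msize _ _) => apply PT_msize
  | |- PT (fun x => color _ _ _) => apply PT_color
  | |- PT (fun x => gin _ _ _) => apply PT_gin
  | |- PT (fun x => lp_W _ _) => apply PT_lp_W
  | |- PT (fun x => lp_M _ _ _ _) => apply PT_lp_M
  | |- PT (fun x => gargmax _ _ _ _) => apply PT_gargmax
  | |- PT (fun x => lp_K _ _ _ _) => apply PT_lp_K
  | |- PT (fun x => lp_viol _ _ _ _ _ _ _) => apply PT_lp_viol
  end | pt3 ].

Lemma PT_lp_bad {A} {EA : Enc A} (n : A -> nat) (E : A -> seq (seq bool)) (m : A -> nat) (gw : A -> seq nat) (X : A -> seq int) (ee : nat) :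
  PT n -> PT E -> PT m -> PT gw -> PT X -> PT (fun x => lp_bad (n x) (E x) (m x) (gw x) ee (X x)).
Proof.
move=> Hn HE Hm Hgw HX; by rewrite /lp_bad; pt.
Qed.

Ltac pt_user ::= first [ lazymatch goal with
  | |- PT (fun x => has_edge _ _ _) => apply PT_has_edge
  | |- PT (fun x => maxclique _ _ _) => apply PT_maxclique
  | |- PT (fun x => msize _ _) => apply PT_msize
  | |- PT (fun x => color _ _ _) => apply PT_color
  | |- PT (fun x => gin _ _ _) => apply PT_gin
  | |- PT (fun x => lp_W _ _) => apply PT_lp_W
  | |- PT (fun x => lp_M _ _ _ _) => apply PT_lp_M
  | |- PT (fun x => gargmax _ _ _ _) => apply PT_gargmax
  | |- PT (fun x => lp_K _ _ _ _) => apply PT_lp_K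
  | |- PT (fun x => lp_viol _ _ _ _ _ _ _) => apply PT_lp_viol
  | |- PT (fun x => lp_bad _ _ _ _ _ _) => apply PT_lp_bad
  end | pt3 ].

Lemma PT_lp_val {A} {EA : Enc A} (n : A -> nat) (m : A -> nat) (gm : A -> seq (seq bool)) (gw : A -> seq nat) (X : A -> seq int) :
  PT n -> PT m -> PT gm -> PT gw -> PT X -> PT (fun x => lp_val (n x) (m x) (gm x) (gw x) (X x)).
Proof.
move=> Hn Hm Hgm Hgw HX; by rewrite /lp_val; pt.
Qed.

Ltac pt_user ::= first [ lazymatch goal with
  | |- PT (fun x => has_edge _ _ _) => apply PT_has_edge
  | |- PT (fun x => maxclique _ _ _) => apply PT_maxclique
  | |- PT (fun x => msize _ _) => apply PT_msize
  | |- PT (fun x => color _ _ _) => apply PT_color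
  | |- PT (fun x => gin _ _ _) => apply PT_gin
  | |- PT (fun x => lp_W _ _) => apply PT_lp_W
  | |- PT (fun x => lp_M _ _ _ _) => apply PT_lp_M
  | |- PT (fun x => gargmax _ _ _ _) => apply PT_gargmax
  | |- PT (fun x => lp_K _ _ _ _) => apply PT_lp_K
  | |- PT (fun x => lp_viol _ _ _ _ _ _ _) => apply PT_lp_viol
  | |- PT (fun x => lp_bad _ _ _ _ _ _) => apply PT_lp_bad
  | |- PT (fun x => lp_val _ _ _ _ _) => apply PT_lp_val
  end | pt3 ].

Lemma PT_lp_exp {A} {EA : Enc A} (n : A -> nat) (m : A -> nat) (gm : A -> seq (seq bool)) (gw : A -> seq nat) (B : A -> nat) (X : A -> seq int) (ee : nat) :
  PT n -> PT m -> PT gm -> PT gw -> PT B -> PT X -> PT (fun x => lp_exp (n x) (m x) (gm x) (gw x) (B x) ee (X x)).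
Proof.
move=> Hn Hm Hgm Hgw HB HX; by rewrite /lp_exp; pt.
Qed.

Ltac pt_user ::= first [ lazymatch goal with
  | |- PT (fun x => has_edge _ _ _) => apply PT_has_edge
  | |- PT (fun x => maxclique _ _ _) => apply PT_maxclique
  | |- PT (fun x => msize _ _) => apply PT_msize
  | |- PT (fun x => color _ _ _) => apply PT_color
  | |- PT (fun x => gin _ _ _) => apply PT_gin
  | |- PT (fun x => lp_W _ _) => apply PT_lp_W
  | |- PT (fun x => lp_M _ _ _ _) => apply PT_lp_M
  | |- PT (fun x => gargmax _ _ _ _) => apply PT_gargmax
  | |- PT (fun x => lp_K _ _ _ _) => apply PT_lp_K
  | |- PT (fun x => lp_viol _ _ _ _ _ _ _) => apply PT_lp_viol
  | |- PT (fun x => lp_bad _ _ _ _ _ _) => apply PT_lp_bad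
  | |- PT (fun x => lp_val _ _ _ _ _) => apply PT_lp_val
  | |- PT (fun x => lp_exp _ _ _ _ _ _ _) => apply PT_lp_exp
  end | pt3 ].

Lemma PT_lp_step {A} {EA : Enc A} (n : A -> nat) (E : A -> seq (seq bool)) (m : A -> nat) (gm : A -> seq (seq bool)) (gw : A -> seq nat) (B : A -> nat) (X : A -> seq int) (ee : nat) :
  PT n -> PT E -> PT m -> PT gm -> PT gw -> PT B -> PT X -> PT (fun x => lp_step (n x) (E x) (m x) (gm x) (gw x) (B x) ee (X x)).
Proof.
move=> Hn HE Hm Hgm Hgw HB HX; by rewrite /lp_step; pt.
Qed.

Ltac pt_user ::= first [ lazymatch goal with
  | |- PT (fun x => has_edge _ _ _) => apply PT_has_edge
  | |- PT (fun x => maxclique _ _ _) => apply PT_maxclique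
  | |- PT (fun x => msize _ _) => apply PT_msize
  | |- PT (fun x => color _ _ _) => apply PT_color
  | |- PT (fun x => gin _ _ _) => apply PT_gin
  | |- PT (fun x => lp_W _ _) => apply PT_lp_W
  | |- PT (fun x => lp_M _ _ _ _) => apply PT_lp_M
  | |- PT (fun x => gargmax _ _ _ _) => apply PT_gargmax
  | |- PT (fun x => lp_K _ _ _ _) => apply PT_lp_K
  | |- PT (fun x => lp_viol _ _ _ _ _ _ _) => apply PT_lp_viol
  | |- PT (fun x => lp_bad _ _ _ _ _ _) => apply PT_lp_bad
  | |- PT (fun x => lp_val _ _ _ _ _) => apply PT_lp_val
  | |- PT (fun x => lp_exp _ _ _ _ _ _ _) => apply PT_lp_exp
  | |- PT (fun x => lp_step _ _ _ _ _ _ _ _) => apply PT_lp_step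
  end | pt3 ].

Lemma PT_lp_T {A} {EA : Enc A} (n : A -> nat) (m : A -> nat) (gw : A -> seq nat) (ee : nat) :
  PT n -> PT m -> PT gw -> PT (fun x => lp_T (n x) (m x) (gw x) ee).
Proof.
move=> Hn Hm Hgw; by rewrite /lp_T; pt.
Qed.

Ltac pt_user ::= first [ lazymatch goal with
  | |- PT (fun x => has_edge _ _ _) => apply PT_has_edge
  | |- PT (fun x => maxclique _ _ _) => apply PT_maxclique
  | |- PT (fun x => msize _ _) => apply PT_msize
  | |- PT (fun x => color _ _ _) => apply PT_color
  | |- PT (fun x => gin _ _ _) => apply PT_gin
  | |- PT (fun x => lp_W _ _) => apply PT_lp_W
  | |- PT (fun x => lp_M _ _ _ _) => apply PT_lp_M
  | |- PT (fun x => gargmax _ _ _ _) => apply PT_gargmax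
  | |- PT (fun x => lp_K _ _ _ _) => apply PT_lp_K
  | |- PT (fun x => lp_viol _ _ _ _ _ _ _) => apply PT_lp_viol
  | |- PT (fun x => lp_bad _ _ _ _ _ _) => apply PT_lp_bad
  | |- PT (fun x => lp_val _ _ _ _ _) => apply PT_lp_val
  | |- PT (fun x => lp_exp _ _ _ _ _ _ _) => apply PT_lp_exp
  | |- PT (fun x => lp_step _ _ _ _ _ _ _ _) => apply PT_lp_step
  | |- PT (fun x => lp_T _ _ _ _) => apply PT_lp_T
  end | pt3 ].

(** One step changes an entry by at most [lp_W] + 1, so the entries grow linearly with the number of
    steps. *)
Lemma PT_lp_X {A} {EA : Enc A} (n : A -> nat) (E : A -> seq (seq bool)) (m : A -> nat) (gm : A -> seq (seq bool)) (gw : A -> seq nat) (B : A -> nat) (ee : nat) :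
  PT n -> PT E -> PT m -> PT gm -> PT gw -> PT B -> PT (fun x => lp_X (n x) (E x) (m x) (gm x) (gw x) (B x) ee).
Proof.
move=> Hn HE Hm Hgm Hgw HB; rewrite /lp_X.
apply (PT_iter_inv (n := fun x => lp_T (n x) (m x) (gw x) ee)
  (f := fun x => lp_step (n x) (E x) (m x) (gm x) (gw x) (B x) ee) (s0 := fun x => mkseq (fun=> 0%R) (n x))
  (I := fun x k X => size X = n x /\ forall i, (absz (nth 0%R X i) <= k * (lp_W (m x) (gw x)).+1)%N)
  (b := fun x => (n x * (4 * (lp_T (n x) (m x) (gw x) ee * (lp_W (m x) (gw x)).+1) + 5).+1).+1)).
- by pt.
- by pt.
- by pt; apply: PT_lp_step; pt.
- by pbt; pt.
- move=> x; rewrite size_mkseq; split=> // i.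
  by case: (ltnP i (n x)) => Hi; [rewrite nth_mkseq | rewrite nth_default ?size_mkseq].
- move=> x k X _ [Hs HX]; rewrite /lp_step; case: ifP => _; last case: ifP => _; last first.
  + by split=> // i; apply: leq_trans (HX i) _; rewrite leq_mul2r leqnSn orbT.
  + rewrite size_mkseq; split=> // i; case: (ltnP i (n x)) => Hi; last by rewrite nth_default ?size_mkseq.
    rewrite nth_mkseq //; apply: leq_trans (abszD _ _) _; rewrite mulSn addnC; apply: leq_add; last exact: HX.
    rewrite abszN /=; apply: leqW; rewrite /lp_W /nsum; apply: leq_sum => g _; by case: ifP.
  rewrite size_mkseq; split=> // i; case: (ltnP i (n x)) => Hi; last by rewrite nth_default ?size_mkseq.
  rewrite nth_mkseq //; apply: leq_trans (abszD _ _) _; rewrite mulSn addnC; apply: leq_add; last exact: HX.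
  by case: (nth _ _ _).
- move=> x k X Hk [Hs HX]; apply: leq_trans (tsz_ints (M := lp_T (n x) (m x) (gw x) ee * (lp_W (m x) (gw x)).+1) _) _.
    by move=> i _; apply: leq_trans (HX i) _; rewrite leq_mul2r Hk orbT.
  by rewrite Hs ltnS leq_mul2l !ltnS leq_add2r leq_mul2l /= blen_leq orbT.
Qed.

Ltac pt_user ::= first [ lazymatch goal with
  | |- PT (fun x => has_edge _ _ _) => apply PT_has_edge
  | |- PT (fun x => maxclique _ _ _) => apply PT_maxclique
  | |- PT (fun x => msize _ _) => apply PT_msize
  | |- PT (fun x => color _ _ _) => apply PT_color
  | |- PT (fun x => gin _ _ _) => apply PT_gin
  | |- PT (fun x => lp_W _ _) => apply PT_lp_W
  | |- PT (fun x => lp_M _ _ _ _) => apply PT_lp_M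
  | |- PT (fun x => gargmax _ _ _ _) => apply PT_gargmax
  | |- PT (fun x => lp_K _ _ _ _) => apply PT_lp_K
  | |- PT (fun x => lp_viol _ _ _ _ _ _ _) => apply PT_lp_viol
  | |- PT (fun x => lp_bad _ _ _ _ _ _) => apply PT_lp_bad
  | |- PT (fun x => lp_val _ _ _ _ _) => apply PT_lp_val
  | |- PT (fun x => lp_exp _ _ _ _ _ _ _) => apply PT_lp_exp
  | |- PT (fun x => lp_step _ _ _ _ _ _ _ _) => apply PT_lp_step
  | |- PT (fun x => lp_T _ _ _ _) => apply PT_lp_T
  | |- PT (fun x => lp_X _ _ _ _ _ _ _) => apply PT_lp_X
  end | pt3 ].

Lemma PT_divc {A} {EA : Enc A} (a : A -> nat) (J : nat) :
  PT a -> PT (fun x => divc (a x) J).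
Proof.
move=> Ha; by rewrite /divc; pt.
Qed.

Ltac pt_user ::= first [ lazymatch goal with
  | |- PT (fun x => has_edge _ _ _) => apply PT_has_edge
  | |- PT (fun x => maxclique _ _ _) => apply PT_maxclique
  | |- PT (fun x => msize _ _) => apply PT_msize
  | |- PT (fun x => color _ _ _) => apply PT_color
  | |- PT (fun x => gin _ _ _) => apply PT_gin
  | |- PT (fun x => lp_W _ _) => apply PT_lp_W
  | |- PT (fun x => lp_M _ _ _ _) => apply PT_lp_M
  | |- PT (fun x => gargmax _ _ _ _) => apply PT_gargmax
  | |- PT (fun x => lp_K _ _ _ _) => apply PT_lp_K
  | |- PT (fun x => lp_viol _ _ _ _ _ _ _) => apply PT_lp_viol
  | |- PT (fun x => lp_bad _ _ _ _ _ _) => apply PT_lp_bad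
  | |- PT (fun x => lp_val _ _ _ _ _) => apply PT_lp_val
  | |- PT (fun x => lp_exp _ _ _ _ _ _ _) => apply PT_lp_exp
  | |- PT (fun x => lp_step _ _ _ _ _ _ _ _) => apply PT_lp_step
  | |- PT (fun x => lp_T _ _ _ _) => apply PT_lp_T
  | |- PT (fun x => lp_X _ _ _ _ _ _ _) => apply PT_lp_X
  | |- PT (fun x => divc _ _) => apply PT_divc
  end | pt3 ].

Lemma PT_lev {A} {EA : Enc A} (n : A -> nat) (m : A -> nat) (gw : A -> seq nat) (X : A -> seq int) (v : A -> nat) (ee J : nat) :
  PT n -> PT m -> PT gw -> PT X -> PT v -> PT (fun x => lev (n x) (m x) (gw x) ee J (X x) (v x)).
Proof.
move=> Hn Hm Hgw HX Hv; by rewrite /lev; pt.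
Qed.

Ltac pt_user ::= first [ lazymatch goal with
  | |- PT (fun x => has_edge _ _ _) => apply PT_has_edge
  | |- PT (fun x => maxclique _ _ _) => apply PT_maxclique
  | |- PT (fun x => msize _ _) => apply PT_msize
  | |- PT (fun x => color _ _ _) => apply PT_color
  | |- PT (fun x => gin _ _ _) => apply PT_gin
  | |- PT (fun x => lp_W _ _) => apply PT_lp_W
  | |- PT (fun x => lp_M _ _ _ _) => apply PT_lp_M
  | |- PT (fun x => gargmax _ _ _ _) => apply PT_gargmax
  | |- PT (fun x => lp_K _ _ _ _) => apply PT_lp_K
  | |- PT (fun x => lp_viol _ _ _ _ _ _ _) => apply PT_lp_viol
  | |- PT (fun x => lp_bad _ _ _ _ _ _) => apply PT_lp_bad
  | |- PT (fun x => lp_val _ _ _ _ _) => apply PT_lp_val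
  | |- PT (fun x => lp_exp _ _ _ _ _ _ _) => apply PT_lp_exp
  | |- PT (fun x => lp_step _ _ _ _ _ _ _ _) => apply PT_lp_step
  | |- PT (fun x => lp_T _ _ _ _) => apply PT_lp_T
  | |- PT (fun x => lp_X _ _ _ _ _ _ _) => apply PT_lp_X
  | |- PT (fun x => divc _ _) => apply PT_divc
  | |- PT (fun x => lev _ _ _ _ _ _ _) => apply PT_lev
  end | pt3 ].

Lemma PT_cand {A} {EA : Enc A} (n : A -> nat) (E : A -> seq (seq bool)) (m : A -> nat) (gm : A -> seq (seq bool)) (gw : A -> seq nat) (B : A -> nat) (j : A -> nat) (ee J : nat) :
  PT n -> PT E -> PT m -> PT gm -> PT gw -> PT B -> PT j -> PT (fun x => cand (n x) (E x) (m x) (gm x) (gw x) ee J (B x) (j x)).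
Proof.
move=> Hn HE Hm Hgm Hgw HB Hj; by rewrite /cand; pt.
Qed.

Ltac pt_user ::= first [ lazymatch goal with
  | |- PT (fun x => has_edge _ _ _) => apply PT_has_edge
  | |- PT (fun x => maxclique _ _ _) => apply PT_maxclique
  | |- PT (fun x => msize _ _) => apply PT_msize
  | |- PT (fun x => color _ _ _) => apply PT_color
  | |- PT (fun x => gin _ _ _) => apply PT_gin
  | |- PT (fun x => lp_W _ _) => apply PT_lp_W
  | |- PT (fun x => lp_M _ _ _ _) => apply PT_lp_M
  | |- PT (fun x => gargmax _ _ _ _) => apply PT_gargmax
  | |- PT (fun x => lp_K _ _ _ _) => apply PT_lp_K
  | |- PT (fun x => lp_viol _ _ _ _ _ _ _) => apply PT_lp_viol
  | |- PT (fun x => lp_bad _ _ _ _ _ _) => apply PT_lp_bad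
  | |- PT (fun x => lp_val _ _ _ _ _) => apply PT_lp_val
  | |- PT (fun x => lp_exp _ _ _ _ _ _ _) => apply PT_lp_exp
  | |- PT (fun x => lp_step _ _ _ _ _ _ _ _) => apply PT_lp_step
  | |- PT (fun x => lp_T _ _ _ _) => apply PT_lp_T
  | |- PT (fun x => lp_X _ _ _ _ _ _ _) => apply PT_lp_X
  | |- PT (fun x => divc _ _) => apply PT_divc
  | |- PT (fun x => lev _ _ _ _ _ _ _) => apply PT_lev
  | |- PT (fun x => cand _ _ _ _ _ _ _ _ _) => apply PT_cand
  end | pt3 ].

Lemma PT_gmax {A} {EA : Enc A} (n : A -> nat) (gm : A -> seq (seq bool)) (col : A -> seq nat) (g : A -> nat) :
  PT n -> PT gm -> PT col -> PT g -> PT (fun x => gmax (n x) (gm x) (col x) (g x)).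
Proof.
move=> Hn Hgm Hcol Hg; by rewrite /gmax; pt.
Qed.

Ltac pt_user ::= first [ lazymatch goal with
  | |- PT (fun x => has_edge _ _ _) => apply PT_has_edge
  | |- PT (fun x => maxclique _ _ _) => apply PT_maxclique
  | |- PT (fun x => msize _ _) => apply PT_msize
  | |- PT (fun x => color _ _ _) => apply PT_color
  | |- PT (fun x => gin _ _ _) => apply PT_gin
  | |- PT (fun x => lp_W _ _) => apply PT_lp_W
  | |- PT (fun x => lp_M _ _ _ _) => apply PT_lp_M
  | |- PT (fun x => gargmax _ _ _ _) => apply PT_gargmax
  | |- PT (fun x => lp_K _ _ _ _) => apply PT_lp_K
  | |- PT (fun x => lp_viol _ _ _ _ _ _ _) => apply PT_lp_viol
  | |- PT (fun x => lp_bad _ _ _ _ _ _) => apply PT_lp_bad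
  | |- PT (fun x => lp_val _ _ _ _ _) => apply PT_lp_val
  | |- PT (fun x => lp_exp _ _ _ _ _ _ _) => apply PT_lp_exp
  | |- PT (fun x => lp_step _ _ _ _ _ _ _ _) => apply PT_lp_step
  | |- PT (fun x => lp_T _ _ _ _) => apply PT_lp_T
  | |- PT (fun x => lp_X _ _ _ _ _ _ _) => apply PT_lp_X
  | |- PT (fun x => divc _ _) => apply PT_divc
  | |- PT (fun x => lev _ _ _ _ _ _ _) => apply PT_lev
  | |- PT (fun x => cand _ _ _ _ _ _ _ _ _) => apply PT_cand
  | |- PT (fun x => gmax _ _ _ _) => apply PT_gmax
  end | pt3 ].

Lemma PT_ccost {A} {EA : Enc A} (n : A -> nat) (m : A -> nat) (gm : A -> seq (seq bool)) (gw : A -> seq nat) (col : A -> seq nat) :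
  PT n -> PT m -> PT gm -> PT gw -> PT col -> PT (fun x => ccost (n x) (m x) (gm x) (gw x) (col x)).
Proof.
move=> Hn Hm Hgm Hgw Hcol; by rewrite /ccost; pt.
Qed.

Ltac pt_user ::= first [ lazymatch goal with
  | |- PT (fun x => has_edge _ _ _) => apply PT_has_edge
  | |- PT (fun x => maxclique _ _ _) => apply PT_maxclique
  | |- PT (fun x => msize _ _) => apply PT_msize
  | |- PT (fun x => color _ _ _) => apply PT_color
  | |- PT (fun x => gin _ _ _) => apply PT_gin
  | |- PT (fun x => lp_W _ _) => apply PT_lp_W
  | |- PT (fun x => lp_M _ _ _ _) => apply PT_lp_M
  | |- PT (fun x => gargmax _ _ _ _) => apply PT_gargmax
  | |- PT (fun x => lp_K _ _ _ _) => apply PT_lp_K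
  | |- PT (fun x => lp_viol _ _ _ _ _ _ _) => apply PT_lp_viol
  | |- PT (fun x => lp_bad _ _ _ _ _ _) => apply PT_lp_bad
  | |- PT (fun x => lp_val _ _ _ _ _) => apply PT_lp_val
  | |- PT (fun x => lp_exp _ _ _ _ _ _ _) => apply PT_lp_exp
  | |- PT (fun x => lp_step _ _ _ _ _ _ _ _) => apply PT_lp_step
  | |- PT (fun x => lp_T _ _ _ _) => apply PT_lp_T
  | |- PT (fun x => lp_X _ _ _ _ _ _ _) => apply PT_lp_X
  | |- PT (fun x => divc _ _) => apply PT_divc
  | |- PT (fun x => lev _ _ _ _ _ _ _) => apply PT_lev
  | |- PT (fun x => cand _ _ _ _ _ _ _ _ _) => apply PT_cand
  | |- PT (fun x => gmax _ _ _ _) => apply PT_gmax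
  | |- PT (fun x => ccost _ _ _ _ _) => apply PT_ccost
  end | pt3 ].

Lemma PT_best_opt {A} {EA : Enc A} (n : A -> nat) (E : A -> seq (seq bool)) (m : A -> nat) (gm : A -> seq (seq bool)) (gw : A -> seq nat) (B : A -> nat) (j : A -> nat) (ee J : nat) :
  PT n -> PT E -> PT m -> PT gm -> PT gw -> PT B -> PT j -> PT (fun x => best_opt (n x) (E x) (m x) (gm x) (gw x) ee J (B x) (j x)).
Proof.
move=> Hn HE Hm Hgm Hgw HB Hj; by rewrite /best_opt; pt.
Qed.

Ltac pt_user ::= first [ lazymatch goal with
  | |- PT (fun x => has_edge _ _ _) => apply PT_has_edge
  | |- PT (fun x => maxclique _ _ _) => apply PT_maxclique
  | |- PT (fun x => msize _ _) => apply PT_msize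
  | |- PT (fun x => color _ _ _) => apply PT_color
  | |- PT (fun x => gin _ _ _) => apply PT_gin
  | |- PT (fun x => lp_W _ _) => apply PT_lp_W
  | |- PT (fun x => lp_M _ _ _ _) => apply PT_lp_M
  | |- PT (fun x => gargmax _ _ _ _) => apply PT_gargmax
  | |- PT (fun x => lp_K _ _ _ _) => apply PT_lp_K
  | |- PT (fun x => lp_viol _ _ _ _ _ _ _) => apply PT_lp_viol
  | |- PT (fun x => lp_bad _ _ _ _ _ _) => apply PT_lp_bad
  | |- PT (fun x => lp_val _ _ _ _ _) => apply PT_lp_val
  | |- PT (fun x => lp_exp _ _ _ _ _ _ _) => apply PT_lp_exp
  | |- PT (fun x => lp_step _ _ _ _ _ _ _ _) => apply PT_lp_step
  | |- PT (fun x => lp_T _ _ _ _) => apply PT_lp_T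
  | |- PT (fun x => lp_X _ _ _ _ _ _ _) => apply PT_lp_X
  | |- PT (fun x => divc _ _) => apply PT_divc
  | |- PT (fun x => lev _ _ _ _ _ _ _) => apply PT_lev
  | |- PT (fun x => cand _ _ _ _ _ _ _ _ _) => apply PT_cand
  | |- PT (fun x => gmax _ _ _ _) => apply PT_gmax
  | |- PT (fun x => ccost _ _ _ _ _) => apply PT_ccost
  | |- PT (fun x => best_opt _ _ _ _ _ _ _ _ _) => apply PT_best_opt
  end | pt3 ].

Lemma PT_best {A} {EA : Enc A} (n : A -> nat) (E : A -> seq (seq bool)) (m : A -> nat) (gm : A -> seq (seq bool)) (gw : A -> seq nat) (ee J : nat) :
  PT n -> PT E -> PT m -> PT gm -> PT gw -> PT (fun x => best (n x) (E x) (m x) (gm x) (gw x) ee J).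
Proof.
move=> Hn HE Hm Hgm Hgw; by rewrite /best; pt.
Qed.

Ltac pt_user ::= first [ lazymatch goal with
  | |- PT (fun x => has_edge _ _ _) => apply PT_has_edge
  | |- PT (fun x => maxclique _ _ _) => apply PT_maxclique
  | |- PT (fun x => msize _ _) => apply PT_msize
  | |- PT (fun x => color _ _ _) => apply PT_color
  | |- PT (fun x => gin _ _ _) => apply PT_gin
  | |- PT (fun x => lp_W _ _) => apply PT_lp_W
  | |- PT (fun x => lp_M _ _ _ _) => apply PT_lp_M
  | |- PT (fun x => gargmax _ _ _ _) => apply PT_gargmax
  | |- PT (fun x => lp_K _ _ _ _) => apply PT_lp_K
  | |- PT (fun x => lp_viol _ _ _ _ _ _ _) => apply PT_lp_viol
  | |- PT (fun x => lp_bad _ _ _ _ _ _) => apply PT_lp_bad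
  | |- PT (fun x => lp_val _ _ _ _ _) => apply PT_lp_val
  | |- PT (fun x => lp_exp _ _ _ _ _ _ _) => apply PT_lp_exp
  | |- PT (fun x => lp_step _ _ _ _ _ _ _ _) => apply PT_lp_step
  | |- PT (fun x => lp_T _ _ _ _) => apply PT_lp_T
  | |- PT (fun x => lp_X _ _ _ _ _ _ _) => apply PT_lp_X
  | |- PT (fun x => divc _ _) => apply PT_divc
  | |- PT (fun x => lev _ _ _ _ _ _ _) => apply PT_lev
  | |- PT (fun x => cand _ _ _ _ _ _ _ _ _) => apply PT_cand
  | |- PT (fun x => gmax _ _ _ _) => apply PT_gmax
  | |- PT (fun x => ccost _ _ _ _ _) => apply PT_ccost
  | |- PT (fun x => best_opt _ _ _ _ _ _ _ _ _) => apply PT_best_opt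
  | |- PT (fun x => best _ _ _ _ _ _ _) => apply PT_best
  end | pt3 ].

Lemma PT_heaviest {A} {EA : Enc A} (m : A -> nat) (wa : A -> seq int) (wb : A -> seq int) :
  PT m -> PT wa -> PT wb -> PT (fun x => heaviest (m x) (wa x) (wb x)).
Proof.
move=> Hm Hwa Hwb; by rewrite /heaviest; pt.
Qed.

Ltac pt_user ::= first [ lazymatch goal with
  | |- PT (fun x => has_edge _ _ _) => apply PT_has_edge
  | |- PT (fun x => maxclique _ _ _) => apply PT_maxclique
  | |- PT (fun x => msize _ _) => apply PT_msize
  | |- PT (fun x => color _ _ _) => apply PT_color
  | |- PT (fun x => gin _ _ _) => apply PT_gin
  | |- PT (fun x => lp_W _ _) => apply PT_lp_W
  | |- PT (fun x => lp_M _ _ _ _) => apply PT_lp_M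
  | |- PT (fun x => gargmax _ _ _ _) => apply PT_gargmax
  | |- PT (fun x => lp_K _ _ _ _) => apply PT_lp_K
  | |- PT (fun x => lp_viol _ _ _ _ _ _ _) => apply PT_lp_viol
  | |- PT (fun x => lp_bad _ _ _ _ _ _) => apply PT_lp_bad
  | |- PT (fun x => lp_val _ _ _ _ _) => apply PT_lp_val
  | |- PT (fun x => lp_exp _ _ _ _ _ _ _) => apply PT_lp_exp
  | |- PT (fun x => lp_step _ _ _ _ _ _ _ _) => apply PT_lp_step
  | |- PT (fun x => lp_T _ _ _ _) => apply PT_lp_T
  | |- PT (fun x => lp_X _ _ _ _ _ _ _) => apply PT_lp_X
  | |- PT (fun x => divc _ _) => apply PT_divc
  | |- PT (fun x => lev _ _ _ _ _ _ _) => apply PT_lev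
  | |- PT (fun x => cand _ _ _ _ _ _ _ _ _) => apply PT_cand
  | |- PT (fun x => gmax _ _ _ _) => apply PT_gmax
  | |- PT (fun x => ccost _ _ _ _ _) => apply PT_ccost
  | |- PT (fun x => best_opt _ _ _ _ _ _ _ _ _) => apply PT_best_opt
  | |- PT (fun x => best _ _ _ _ _ _ _) => apply PT_best
  | |- PT (fun x => heaviest _ _ _) => apply PT_heaviest
  end | pt3 ].

Lemma PT_unary_weights {A} {EA : Enc A} (n : A -> nat) (m : A -> nat) (wa : A -> seq int) (wb : A -> seq int) (ee : nat) :
  PT n -> PT m -> PT wa -> PT wb -> PT (fun x => unary_weights (n x) (m x) (wa x) (wb x) ee).
Proof.
move=> Hn Hm Hwa Hwb; by rewrite /unary_weights; pt.
Qed.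

Ltac pt_user ::= first [ lazymatch goal with
  | |- PT (fun x => has_edge _ _ _) => apply PT_has_edge
  | |- PT (fun x => maxclique _ _ _) => apply PT_maxclique
  | |- PT (fun x => msize _ _) => apply PT_msize
  | |- PT (fun x => color _ _ _) => apply PT_color
  | |- PT (fun x => gin _ _ _) => apply PT_gin
  | |- PT (fun x => lp_W _ _) => apply PT_lp_W
  | |- PT (fun x => lp_M _ _ _ _) => apply PT_lp_M
  | |- PT (fun x => gargmax _ _ _ _) => apply PT_gargmax
  | |- PT (fun x => lp_K _ _ _ _) => apply PT_lp_K
  | |- PT (fun x => lp_viol _ _ _ _ _ _ _) => apply PT_lp_viol
  | |- PT (fun x => lp_bad _ _ _ _ _ _) => apply PT_lp_bad
  | |- PT (fun x => lp_val _ _ _ _ _) => apply PT_lp_val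
  | |- PT (fun x => lp_exp _ _ _ _ _ _ _) => apply PT_lp_exp
  | |- PT (fun x => lp_step _ _ _ _ _ _ _ _) => apply PT_lp_step
  | |- PT (fun x => lp_T _ _ _ _) => apply PT_lp_T
  | |- PT (fun x => lp_X _ _ _ _ _ _ _) => apply PT_lp_X
  | |- PT (fun x => divc _ _) => apply PT_divc
  | |- PT (fun x => lev _ _ _ _ _ _ _) => apply PT_lev
  | |- PT (fun x => cand _ _ _ _ _ _ _ _ _) => apply PT_cand
  | |- PT (fun x => gmax _ _ _ _) => apply PT_gmax
  | |- PT (fun x => ccost _ _ _ _ _) => apply PT_ccost
  | |- PT (fun x => best_opt _ _ _ _ _ _ _ _ _) => apply PT_best_opt
  | |- PT (fun x => best _ _ _ _ _ _ _) => apply PT_best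
  | |- PT (fun x => heaviest _ _ _) => apply PT_heaviest
  | |- PT (fun x => unary_weights _ _ _ _ _) => apply PT_unary_weights
  end | pt3 ].

Lemma PT_solve {A} {EA : Enc A} (n : A -> nat) (E : A -> seq (seq bool)) (m : A -> nat) (gm : A -> seq (seq bool)) (wa : A -> seq int) (wb : A -> seq int) (ee J : nat) :
  PT n -> PT E -> PT m -> PT gm -> PT wa -> PT wb -> PT (fun x => solve (n x) (E x) (m x) (gm x) (wa x) (wb x) ee J).
Proof.
move=> Hn HE Hm Hgm Hwa Hwb; by rewrite /solve; pt.
Qed.

Ltac pt_user ::= first [ lazymatch goal with
  | |- PT (fun x => has_edge _ _ _) => apply PT_has_edge
  | |- PT (fun x => maxclique _ _ _) => apply PT_maxclique
  | |- PT (fun x => msize _ _) => apply PT_msize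
  | |- PT (fun x => color _ _ _) => apply PT_color
  | |- PT (fun x => gin _ _ _) => apply PT_gin
  | |- PT (fun x => lp_W _ _) => apply PT_lp_W
  | |- PT (fun x => lp_M _ _ _ _) => apply PT_lp_M
  | |- PT (fun x => gargmax _ _ _ _) => apply PT_gargmax
  | |- PT (fun x => lp_K _ _ _ _) => apply PT_lp_K
  | |- PT (fun x => lp_viol _ _ _ _ _ _ _) => apply PT_lp_viol
  | |- PT (fun x => lp_bad _ _ _ _ _ _) => apply PT_lp_bad
  | |- PT (fun x => lp_val _ _ _ _ _) => apply PT_lp_val
  | |- PT (fun x => lp_exp _ _ _ _ _ _ _) => apply PT_lp_exp
  | |- PT (fun x => lp_step _ _ _ _ _ _ _ _) => apply PT_lp_step
  | |- PT (fun x => lp_T _ _ _ _) => apply PT_lp_T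
  | |- PT (fun x => lp_X _ _ _ _ _ _ _) => apply PT_lp_X
  | |- PT (fun x => divc _ _) => apply PT_divc
  | |- PT (fun x => lev _ _ _ _ _ _ _) => apply PT_lev
  | |- PT (fun x => cand _ _ _ _ _ _ _ _ _) => apply PT_cand
  | |- PT (fun x => gmax _ _ _ _) => apply PT_gmax
  | |- PT (fun x => ccost _ _ _ _ _) => apply PT_ccost
  | |- PT (fun x => best_opt _ _ _ _ _ _ _ _ _) => apply PT_best_opt
  | |- PT (fun x => best _ _ _ _ _ _ _) => apply PT_best
  | |- PT (fun x => heaviest _ _ _) => apply PT_heaviest
  | |- PT (fun x => unary_weights _ _ _ _ _) => apply PT_unary_weights
  | |- PT (fun x => solve _ _ _ _ _ _ _ _) => apply PT_solve
  end | pt3 ].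

Local Close Scope ring_scope.

(** * Reading and writing lists of numbers *)

Section Fold.
Context {A B S : Type} {EA : Enc A} {EB : Enc B} {ES : Enc S}.

Lemma iter_foldl (z : B) (h : S -> B -> S) (s : seq B) (t : S) :
  (iter (size s) (fun st => (behead st.1, h st.2 (head z st.1))) (s, t)).2 = foldl h t s.
Proof. by elim: s t => // b s IH t; rewrite [size _]/= iterSr IH. Qed.

Lemma PT_foldl (z : B) (h : A -> S -> B -> S) (s : A -> seq B) (t : A -> S) (I : A -> nat -> S -> Prop) b :
  PT s -> PT t -> PT (fun p : A * S * B => h p.1.1 p.1.2 p.2) -> PB b ->
  (forall x, I x 0 (t x)) -> (forall x k v c, I x k v -> I x k.+1 (h x v c)) ->
  (forall x k v, k <= size (s x) -> I x k v -> tsz v <= b x) ->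
  PT (fun x => foldl (h x) (t x) (s x)).
Proof.
move=> Hs Ht Hh Hb I0 IS Ib.
apply: (PT_eq (f := fun x => (iter (size (s x)) (fun st => (behead st.1, h x st.2 (head z st.1))) (s x, t x)).2)).
  by move=> x; rewrite iter_foldl.
apply: PT_snd; apply (PT_iter_inv (n := fun x => size (s x))
  (f := fun x st => (behead st.1, h x st.2 (head z st.1))) (s0 := fun x => (s x, t x))
  (I := fun x k st => tsz st.1 <= tsz (s x) /\ I x k st.2) (b := fun x => (tsz (s x) + b x).+1)).
- by pt.
- by pt.
- apply: PT_pair; first by pt.
  apply: (PT_comp (g := fun p => h p.1.1 p.1.2 p.2) (f := fun p => (p.1, p.2.2, head z p.2.1)) Hh); by pt.
- by apply: PB_S; apply: PB_add => //; apply: PB_tsz.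
- by move=> x /=; split.
- move=> x k [u v] _ [/= H1 H2]; split; last exact: IS.
  by apply: leq_trans (tsz_behead _) H1.
- by move=> x k [u v] Hk [/= H1 H2]; rewrite tsz_pair ltnS leq_add // (Ib x k).
Qed.
End Fold.

(** The digits arrive least significant first and are accumulated in reverse; [rnorm] reverses them
    back. *)
Definition read_bits (s : seq bool) : int := bval (rnorm s [::]).
Definition read_letter (st : seq bool * seq int) (c : letter) : seq bool * seq int :=
  if c is Some b then (b :: st.1, st.2) else ([::], read_bits st.1 :: st.2).
Definition read_nats (w : seq letter) := (foldl read_letter ([::], [::]) w).2.

Lemma read_nats_encode s : read_nats (encode_nats s) = rev [seq Posz n | n <- s].
Proof.
rewrite /read_nats /encode_nats; suff H acc : foldl read_letter ([::], acc)
   (flatten [seq rcons [seq Some b | b <- bits n] None | n <- s]) = ([::], catrev [seq Posz n | n <- s] acc).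
  by rewrite H.
elim: s acc => //= n s IH acc; rewrite foldl_cat -cats1 foldl_cat.
have -> cur acc' : foldl read_letter (cur, acc') [seq Some b | b <- bits n] = (catrev (bits n) cur, acc').
  by elim: (bits n) cur => //= b u IHu cur; rewrite IHu.
rewrite /= IH; congr (_, catrev _ (_ :: _)); rewrite /read_bits.
have [|_ ->] := @rnormP (catrev (bits n) [::]) [::]; first by [].
by rewrite -/(rev (bits n)) catrevE revK cats0 bval_bits.
Qed.

Lemma PT_isSome {A B} {EA : Enc A} {EB : Enc B} (f : A -> option B) : PT f -> PT (fun x => isSome (f x)).
Proof.
apply: PT_comp; apply: PT_tree (PT_treecase (PT_const (enc true)) (PT_const (enc false))) _.
by case.
Qed.
Lemma PT_odflt {A B} {EA : Enc A} {EB : Enc B} (f : A -> option B) b : PT f -> PT (fun x => odflt b (f x)).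
Proof.
apply: PT_comp; apply: PT_tree (PT_treecase PT_tsnd (PT_const (enc b))) _.
by case.
Qed.
Lemma PT_Some {A B} {EA : Enc A} {EB : Enc B} (f : A -> B) : PT f -> PT (fun x => Some (f x)).
Proof.
apply: PT_comp; apply: (PT_tree (F := fun t => enc (Lf, t))) => //.
exact: PT_tree (PT_pair (PT_const Lf) PT_id) _.
Qed.

Lemma PT_read_bits {A} {EA : Enc A} (s : A -> seq bool) : PT s -> PT (fun x => read_bits (s x)).
Proof.
move=> Hs; apply: (PT_int (s := fun=> false) (a := fun x => rnorm (s x) [::])).
- by pt.
- exact: PT_rnorm.
by move=> x; rewrite /read_bits; split=> //=; apply: bits_bval; have [] := @rnormP (s x) [::] isT.
Qed.

Lemma blen_read_bits s : blen (absz (read_bits s)) <= size s.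
Proof.
rewrite /read_bits /= blen_le; have [_ ->] := @rnormP s [::] isT.
by rewrite catrevE cats0 -(size_rev s) bval_lt.
Qed.

Lemma PT_read_nats : PT read_nats.
Proof.
apply: PT_snd; apply (PT_foldl None (h := fun _ => read_letter) (s := id) (t := fun=> ([::], [::]))
  (I := fun w k st => size st.1 <= k /\ size st.2 <= k /\ forall i, blen (absz (nth 0%R st.2 i)) <= k)
  (b := fun w => ((tsz w * 4).+1 + (tsz w * (4 * tsz w + 5).+1).+1).+1)).
- exact: PT_id.
- exact: PT_const.
- apply: (PT_eq (f := fun p : seq letter * (seq bool * seq int) * letter =>
     if isSome p.2 then (odflt false p.2 :: p.1.2.1, p.1.2.2) else ([::], read_bits p.1.2.1 :: p.1.2.2))).
    by move=> [[w st] [b|]].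
  apply: PT_if; first by apply: PT_isSome; pt.
    by apply: PT_pair; [apply: PT_cons; [apply: PT_odflt|]|]; pt.
  by apply: PT_pair; [|apply: PT_cons; [apply: PT_read_bits|]]; pt.
- pbt; by [exact: PT_id | exact: PB_tsz PT_id].
- by move=> w; split=> //; split=> // i; rewrite nth_nil.
- move=> w k [u v] [b|] [/= H1 [H2 H3]].
    by split=> //; split=> [|i]; [apply: leqW | apply: leqW].
  by split=> //; split=> // -[|i] /=; [apply: leqW; apply: leq_trans (blen_read_bits _) H1 | apply: leqW].
- move=> w k [u v] Hk [/= H1 [H2 H3]].
  have Hw : k <= tsz w by apply: leq_trans Hk (size_tsz w).
  rewrite tsz_pair ltnS; apply: leq_add.
    apply: leq_trans (tsz_bools u) _; rewrite ltnS leq_mul2r /=; exact: leq_trans H1 Hw.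
  apply: leq_trans (tsz_seq_le (M := 4 * tsz w + 5) _) _; last first.
    by rewrite ltnS leq_mul2r (leq_trans H2 Hw) orbT.
  move=> i a Hi; rewrite (set_nth_default 0%R) //; apply: leq_trans (tsz_int_le _) _.
  rewrite leq_add2r leq_mul2l /=; exact: leq_trans (H3 i) Hw.
Qed.

Definition push_bits (acc : seq letter) (s : seq bool) := foldl (fun acc b => Some b :: acc) acc s.
Definition write_nats (s : seq nat) : seq letter :=
  foldl (fun u c => c :: u) [::] (foldl (fun acc n => None :: push_bits acc (bits n)) [::] s).

Lemma write_natsE s : write_nats s = encode_nats s.
Proof.
have rv T (u v : seq T) : foldl (fun u c => c :: u) v u = catrev u v by elim: u v => //= a u IH v; rewrite IH.
rewrite /write_nats rv; suff H acc : foldl (fun acc n => None :: push_bits acc (bits n)) acc s = catrev (encode_nats s) acc.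
  by rewrite H -/(rev _) -/(rev _) revK.
elim: s acc => //= n s IH acc; rewrite IH /encode_nats /= -/(encode_nats s).
rewrite !catrevE rev_cat -cats1 rev_cat /= -catA /=; congr (_ ++ (_ :: _)).
rewrite /push_bits; elim: (bits n) acc => //= b u IHu acc; rewrite IHu rev_cons cat_rcons //.
Qed.

Lemma tsz_letters (u : seq letter) : tsz u <= (size u * 8).+1.
Proof. by apply: tsz_seq_le => i a _; case: (nth _ _ _) => [[]|]. Qed.

Lemma PT_push_bits {A} {EA : Enc A} (acc : A -> seq letter) (s : A -> seq bool) : PT acc -> PT s ->
  PT (fun x => push_bits (acc x) (s x)).
Proof.
move=> Ha Hs; rewrite /push_bits; apply (PT_foldl false (h := fun _ acc b => Some b :: acc) (s := s) (t := acc)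
  (I := fun x k v => size v <= size (acc x) + k) (b := fun x => ((size (acc x) + size (s x)) * 8).+1)) => //.
- by apply: PT_cons; [apply: PT_Some|]; pt.
- by pbt; pt.
- by move=> x; rewrite addn0.
- by move=> x k v c H; rewrite /= addnS ltnS.
- move=> x k v Hk H; apply: leq_trans (tsz_letters _) _; rewrite ltnS leq_mul2r /=.
  by apply: leq_trans H _; rewrite leq_add2l.
Qed.

Lemma size_push acc s : size (push_bits acc s) = size acc + size s.
Proof. by rewrite /push_bits; elim: s acc => [|b s IH] acc /=; rewrite ?addn0 // IH addSnnS. Qed.

(** The detour through [Posz] converts the unary number to binary, because [PT_Posz] and [PT_mag]
    then apply. *)
Definition push_nth (s : seq nat) (k : nat) (acc : seq letter) := None :: push_bits acc (bits (absz (Posz (nth 0 s k)))).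
Definition push_nats (s : seq nat) (n : nat) : nat * seq letter :=
  iter n (fun st => (st.1.+1, push_nth s st.1 st.2)) (0, [::]).

Lemma push_natsE s : (push_nats s (size s)).2 = foldl (fun acc n => None :: push_bits acc (bits n)) [::] s.
Proof.
suff H n : n <= size s -> push_nats s n = (n, foldl (fun acc n => None :: push_bits acc (bits n)) [::] (take n s)).
  by rewrite H // take_size.
elim: n => [|n IH] Hn; first by rewrite take0.
rewrite /push_nats iterS -/(push_nats s n) IH; last exact: ltnW.
by rewrite (take_nth 0) // -cats1 foldl_cat.
Qed.

Lemma PT_write_nats {A} {EA : Enc A} (s : A -> seq nat) : PT s -> PT (fun x => write_nats (s x)).
Proof.
move=> Hs; have H1 : PT (fun x => (push_nats (s x) (size (s x))).2).
  apply: PT_snd; apply (PT_iter_inv (n := fun x => size (s x))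
    (f := fun x st => (st.1.+1, push_nth (s x) st.1 st.2)) (s0 := fun=> (0, [::]))
    (I := fun x k st => st.1 = k /\ size st.2 <= k * (tsz (s x)).+1)
    (b := fun x => 2 * size (s x) + 2 + (size (s x) * (tsz (s x)).+1 * 8).+1)).
  - by pt.
  - by pt.
  - apply: PT_pair; first by pt.
    apply: PT_cons; first by pt.
    apply: PT_push_bits; first by pt.
    by apply: (PT_mag (z := fun p : A * (nat * seq letter) => Posz (nth 0 (s p.1) p.2.1))); pt.
  - pbt; pt.
  - by [].
  - move=> x k [k' v] _ [/= -> H]; split=> //; rewrite /push_nth [size _]/= size_push mulSn addSn ltnS addnC.
    by apply: leq_add => //; apply: leq_trans (blen_leq _) (nth_tsz _ _).
  - move=> x k [k' v] Hk [/= -> H]; rewrite tsz_pair tsz_nat.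
    apply: leq_trans (_ : (k.*2.+1 + (size v * 8).+1).+1 <= _).
      rewrite ltnS leq_add2l; exact: tsz_letters.
    have Hq : size v <= size (s x) * (tsz (s x)).+1 by apply: leq_trans H _; rewrite leq_mul2r Hk orbT.
    by cbv beta; move: (size (s x) * _) Hq => q; lia.
apply: (PT_eq (f := fun x => foldl (fun u c => c :: u) [::] (push_nats (s x) (size (s x))).2)).
  by move=> x; rewrite push_natsE.
apply (PT_foldl None (h := fun _ (u : seq letter) (c : letter) => c :: u) (s := fun x => (push_nats (s x) (size (s x))).2) (t := fun=> [::])
  (I := fun x k v => size v <= k) (b := fun x => (size (push_nats (s x) (size (s x))).2 * 8).+1)) => //.
- by pt.
- by apply: PT_cons; pt.
- by apply: PB_S; apply: PB_mul; [apply: PB_nat; apply: PT_size_seq | apply: PB_const].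
- by move=> x k v Hk H; apply: leq_trans (tsz_letters _) _; rewrite ltnS leq_mul2r /=; apply: leq_trans H Hk.
Qed.

Local Open Scope ring_scope.

(** * The numerical bound 2e < 5.437 *)

Lemma pow2_bound (x y : rat) a k b : a = 2%N -> 0 <= x -> x ^+ (a ^ k) <= b -> b ^+ 2 <= y ->
  x ^+ (a ^ k.+1) <= y.
Proof.
move=> -> x0 H; apply: le_trans; rewrite expnSr exprM; apply: lerXn2r => //; rewrite nnegrE.
  exact: exprn_ge0.
by apply: le_trans H; apply: exprn_ge0.
Qed.


(** Seventeen squarings starting from 1 + 2^(-17), each rounded up to twelve decimals, bound the
    power with exponent 2^17. The Horner form in 1/1000 keeps all numerals small. *)
Lemma exp1_sq1 : (1 + 1000%:R^-1 * (0 + 1000%:R^-1 * (7 + 1000%:R^-1 * (629 + 1000%:R^-1 * 395)))) ^+ 2 <= (1 + 1000%:R^-1 * (0 + 1000%:R^-1 * (15 + 1000%:R^-1 * (258 + 1000%:R^-1 * 849)))) :> rat. Proof. lra. Qed.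
Lemma exp1_sq2 : (1 + 1000%:R^-1 * (0 + 1000%:R^-1 * (15 + 1000%:R^-1 * (258 + 1000%:R^-1 * 849)))) ^+ 2 <= (1 + 1000%:R^-1 * (0 + 1000%:R^-1 * (30 + 1000%:R^-1 * (517 + 1000%:R^-1 * 931)))) :> rat. Proof. lra. Qed.
Lemma exp1_sq3 : (1 + 1000%:R^-1 * (0 + 1000%:R^-1 * (30 + 1000%:R^-1 * (517 + 1000%:R^-1 * 931)))) ^+ 2 <= (1 + 1000%:R^-1 * (0 + 1000%:R^-1 * (61 + 1000%:R^-1 * (36 + 1000%:R^-1 * 794)))) :> rat. Proof. lra. Qed.
Lemma exp1_sq4 : (1 + 1000%:R^-1 * (0 + 1000%:R^-1 * (61 + 1000%:R^-1 * (36 + 1000%:R^-1 * 794)))) ^+ 2 <= (1 + 1000%:R^-1 * (0 + 1000%:R^-1 * (122 + 1000%:R^-1 * (77 + 1000%:R^-1 * 314)))) :> rat. Proof. lra. Qed.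
Lemma exp1_sq5 : (1 + 1000%:R^-1 * (0 + 1000%:R^-1 * (122 + 1000%:R^-1 * (77 + 1000%:R^-1 * 314)))) ^+ 2 <= (1 + 1000%:R^-1 * (0 + 1000%:R^-1 * (244 + 1000%:R^-1 * (169 + 1000%:R^-1 * 531)))) :> rat. Proof. lra. Qed.
Lemma exp1_sq6 : (1 + 1000%:R^-1 * (0 + 1000%:R^-1 * (244 + 1000%:R^-1 * (169 + 1000%:R^-1 * 531)))) ^+ 2 <= (1 + 1000%:R^-1 * (0 + 1000%:R^-1 * (488 + 1000%:R^-1 * (398 + 1000%:R^-1 * 681)))) :> rat. Proof. lra. Qed.
Lemma exp1_sq7 : (1 + 1000%:R^-1 * (0 + 1000%:R^-1 * (488 + 1000%:R^-1 * (398 + 1000%:R^-1 * 681)))) ^+ 2 <= (1 + 1000%:R^-1 * (0 + 1000%:R^-1 * (977 + 1000%:R^-1 * (35 + 1000%:R^-1 * 896)))) :> rat. Proof. lra. Qed.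
Lemma exp1_sq8 : (1 + 1000%:R^-1 * (0 + 1000%:R^-1 * (977 + 1000%:R^-1 * (35 + 1000%:R^-1 * 896)))) ^+ 2 <= (1 + 1000%:R^-1 * (1 + 1000%:R^-1 * (955 + 1000%:R^-1 * (26 + 1000%:R^-1 * 392)))) :> rat. Proof. lra. Qed.
Lemma exp1_sq9 : (1 + 1000%:R^-1 * (1 + 1000%:R^-1 * (955 + 1000%:R^-1 * (26 + 1000%:R^-1 * 392)))) ^+ 2 <= (1 + 1000%:R^-1 * (3 + 1000%:R^-1 * (913 + 1000%:R^-1 * (874 + 1000%:R^-1 * 913)))) :> rat. Proof. lra. Qed.
Lemma exp1_sq10 : (1 + 1000%:R^-1 * (3 + 1000%:R^-1 * (913 + 1000%:R^-1 * (874 + 1000%:R^-1 * 913)))) ^+ 2 <= (1 + 1000%:R^-1 * (7 + 1000%:R^-1 * (843 + 1000%:R^-1 * (68 + 1000%:R^-1 * 243)))) :> rat. Proof. lra. Qed.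
Lemma exp1_sq11 : (1 + 1000%:R^-1 * (7 + 1000%:R^-1 * (843 + 1000%:R^-1 * (68 + 1000%:R^-1 * 243)))) ^+ 2 <= (1 + 1000%:R^-1 * (15 + 1000%:R^-1 * (747 + 1000%:R^-1 * (650 + 1000%:R^-1 * 206)))) :> rat. Proof. lra. Qed.
Lemma exp1_sq12 : (1 + 1000%:R^-1 * (15 + 1000%:R^-1 * (747 + 1000%:R^-1 * (650 + 1000%:R^-1 * 206)))) ^+ 2 <= (1 + 1000%:R^-1 * (31 + 1000%:R^-1 * (743 + 1000%:R^-1 * (288 + 1000%:R^-1 * 900)))) :> rat. Proof. lra. Qed.
Lemma exp1_sq13 : (1 + 1000%:R^-1 * (31 + 1000%:R^-1 * (743 + 1000%:R^-1 * (288 + 1000%:R^-1 * 900)))) ^+ 2 <= (1 + 1000%:R^-1 * (64 + 1000%:R^-1 * (494 + 1000%:R^-1 * (214 + 1000%:R^-1 * 191)))) :> rat. Proof. lra. Qed.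
Lemma exp1_sq14 : (1 + 1000%:R^-1 * (64 + 1000%:R^-1 * (494 + 1000%:R^-1 * (214 + 1000%:R^-1 * 191)))) ^+ 2 <= (1 + 1000%:R^-1 * (133 + 1000%:R^-1 * (147 + 1000%:R^-1 * (932 + 1000%:R^-1 * 47)))) :> rat. Proof. lra. Qed.
Lemma exp1_sq15 : (1 + 1000%:R^-1 * (133 + 1000%:R^-1 * (147 + 1000%:R^-1 * (932 + 1000%:R^-1 * 47)))) ^+ 2 <= (1 + 1000%:R^-1 * (284 + 1000%:R^-1 * (24 + 1000%:R^-1 * (235 + 1000%:R^-1 * 903)))) :> rat. Proof. lra. Qed.
Lemma exp1_sq16 : (1 + 1000%:R^-1 * (284 + 1000%:R^-1 * (24 + 1000%:R^-1 * (235 + 1000%:R^-1 * 903)))) ^+ 2 <= (1 + 1000%:R^-1 * (648 + 1000%:R^-1 * (718 + 1000%:R^-1 * (238 + 1000%:R^-1 * 387)))) :> rat. Proof. lra. Qed.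
Lemma exp1_sq17 : (1 + 1000%:R^-1 * (648 + 1000%:R^-1 * (718 + 1000%:R^-1 * (238 + 1000%:R^-1 * 387)))) ^+ 2 <= (2 + 1000%:R^-1 * (718 + 1000%:R^-1 * (271 + 1000%:R^-1 * (829 + 1000%:R^-1 * 590)))) :> rat. Proof. lra. Qed.

Lemma final_ratio : 2%:R * (1 + 1000%:R^-1 * 1000%:R^-1) ^+ 3 * ((1 + 1000%:R^-1 * (0 + 1000%:R^-1 * (7 + 1000%:R^-1 * (629 + 1000%:R^-1 * 395)))) * (2 + 1000%:R^-1 * (718 + 1000%:R^-1 * (271 + 1000%:R^-1 * (829 + 1000%:R^-1 * 590))))) <= 5437%:R / 1000%:R :> rat.
Proof. lra. Qed.

Lemma cube_ge0 (t : rat) : 0 <= 2%:R * (1 + t * t) ^+ 3.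
Proof. by rewrite mulr_ge0 // exprn_ge0 // addr_ge0 // -expr2 sqr_ge0. Qed.

Lemma ratio_combine (u p q p' q' z : rat) : 0 <= u -> 0 <= p -> 0 <= q -> p <= p' -> q <= q' ->
  u * (p' * q') <= z -> u * (p * q) <= z.
Proof. by move=> u0 p0 q0 pp qq; apply: le_trans; apply: ler_wpM2l => //; apply: ler_pM. Qed.

Lemma ratio_reduce (a K k : nat) (z : rat) :
  (forall t y, t = k%:R^-1 -> y = (a%:R ^+ K)^-1 ->
    2%:R * (1 + t * t) ^+ 3 * ((1 + y) * (1 + y) ^+ (a ^ K)) <= z) ->
  2%:R * (1 + (k * k)%:R^-1) ^+ 3 * (1 + (a ^ K)%:R^-1) ^+ (a ^ K).+1 <= z.
Proof. by move=> H; rewrite (natrM _ k k) (natrX _ a K) (exprS _ (a ^ K)) (invfM k%:R k%:R); apply: H. Qed.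

Lemma approximation_ratio : exists J ee : nat, [/\ (0 < J)%N, (0 < ee)%N &
  2%:R * (1 + ee%:R^-1) ^+ 3 * (1 + J%:R^-1) ^+ J.+1 <= 5437%:R / 1000%:R :> rat].
Proof.
(* The constants are kept as variables with equations, so that the unary numbers 2^17 and 10^6 are
   never evaluated. *)
have [k Ek] : {k : nat | k = 1000%N} by exists 1000%N.
have [a Ea] : {a : nat | a = 2%N} by exists 2%N.
have [K EK] : {K : nat | K = 17%N} by exists 17%N.
exists (a ^ K)%N, (k * k)%N; split; [by rewrite Ea expn_gt0 | by rewrite Ek muln_gt0 | apply: ratio_reduce => t y Et Ey].
have k0 : k%:R != 0 :> rat by rewrite pnatr_eq0 Ek.
have a0 : a%:R != 0 :> rat by rewrite pnatr_eq0 Ea.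

have Hy : y * a%:R ^+ K = 1 by rewrite Ey mulVf // expf_neq0.
have y1 : 0 <= 1 + y by rewrite Ey addr_ge0 // invr_ge0 exprn_ge0 // ler0n.
have Hk : k%:R = 1000%:R :> rat := congr1 (fun i => i%:R) Ek.
have Ha : a%:R = 2%:R :> rat := congr1 (fun i => i%:R) Ea.
have T : t = 1000%:R^-1 := etrans Et (congr1 GRing.inv Hk).
 rewrite {}Ha EK in Hy; rewrite {}EK; clear k Ek Et Ey k0 a0 Hk.
have s0 : (1 + y) ^+ (a ^ 0) <= (1 + 1000%:R^-1 * (0 + 1000%:R^-1 * (7 + 1000%:R^-1 * (629 + 1000%:R^-1 * 395)))) by rewrite expn0 expr1; lra.
have s1 := pow2_bound Ea y1 s0 exp1_sq1.
have s2 := pow2_bound Ea y1 s1 exp1_sq2.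
have s3 := pow2_bound Ea y1 s2 exp1_sq3.
have s4 := pow2_bound Ea y1 s3 exp1_sq4.
have s5 := pow2_bound Ea y1 s4 exp1_sq5.
have s6 := pow2_bound Ea y1 s5 exp1_sq6.
have s7 := pow2_bound Ea y1 s6 exp1_sq7.
have s8 := pow2_bound Ea y1 s7 exp1_sq8.
have s9 := pow2_bound Ea y1 s8 exp1_sq9.
have s10 := pow2_bound Ea y1 s9 exp1_sq10.
have s11 := pow2_bound Ea y1 s10 exp1_sq11.
have s12 := pow2_bound Ea y1 s11 exp1_sq12.
have s13 := pow2_bound Ea y1 s12 exp1_sq13.
have s14 := pow2_bound Ea y1 s13 exp1_sq14.
have s15 := pow2_bound Ea y1 s14 exp1_sq15.
have s16 := pow2_bound Ea y1 s15 exp1_sq16.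
have s17 := pow2_bound Ea y1 s16 exp1_sq17.
have y3 : 1 + y <= (1 + 1000%:R^-1 * (0 + 1000%:R^-1 * (7 + 1000%:R^-1 * (629 + 1000%:R^-1 * 395)))) by move: s0; rewrite expn0 expr1.
have u0 := cube_ge0 t.
apply: ratio_combine u0 y1 (exprn_ge0 _ y1) y3 s17 _; rewrite T; exact: final_ratio.
Qed.


(** * Existence of an optimal colouring *)

Section Optimum.
Variable I : instance.
Implicit Types C : coloring I.

Lemma cost_mono C C' : (forall v, (C v <= C' v)%N) -> cost C <= cost C'.
Proof.
move=> H; rewrite /cost; have := groups_wf I; elim: (groups I) => [|g s IH] /=; first by rewrite !big_nil.
move=> /andP [/andP [_ g0] /IH {}IH]; rewrite !big_cons; apply: lerD => //.
apply: ler_wpM2l; first exact: ltW.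
by rewrite ler_nat; apply/bigmax_leqP => v Hv; apply: leq_trans (H v) _; rewrite /completion (bigD1 v) //= leq_maxl.
Qed.

(** Each colour is replaced by its rank among the colours in use. This preserves their order, does
    not increase any colour, and leaves none above the number of vertices. *)
Lemma compress C : feasible C -> exists C', [/\ feasible C', forall v, (C' v <= nvert I)%N & cost C' <= cost C].
Proof.
move=> [C0 Ce]; pose h k : nat := [exists u, C u == k].
pose C' : coloring I := [ffun v => \sum_(k < C v) h k.+1]%N.
have mono u v : (C u < C v)%N -> (C' u < C' v)%N.
  move=> uv; rewrite !ffunE -(big_mkord xpredT (fun k => h k.+1)) -(big_mkord xpredT (fun k => h k.+1)).
  rewrite [X in (_ < X)%N](big_cat_nat (leq0n _) (ltnW uv)) /= -[X in (X < _)%N]addn0 ltn_add2l.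
  have hv : h (C v) = 1%N by rewrite /h (_ : [exists u, _] = true) //; apply/existsP; exists v.
  case E: (C v) uv hv => [|c] // uv hv; rewrite big_nat_recr //= hv addn1 //.
exists C'; split.
- split=> [v|u v uv].
    have hv : h (C v) = 1%N by rewrite /h (_ : [exists u, _] = true) //; apply/existsP; exists v.
    by rewrite ffunE; have := C0 v; case E: (C v) hv => [|c] // hv _; rewrite big_ord_recr /= hv addn1.
  have := Ce u v uv; rewrite neq_ltn => /orP [] /mono H; first by rewrite neq_ltn H.
  by rewrite neq_ltn H orbT.
- move=> v; rewrite ffunE; apply: leq_trans (_ : \sum_(k < C v) \sum_(u < nvert I) (C u == k.+1 : nat) <= _)%N.
    apply: leq_sum => k _; rewrite /h; case: existsP => // -[u Hu]; by rewrite (bigD1 u) //= Hu.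
  rewrite exchange_big /=; apply: leq_trans (_ : \sum_(u < nvert I) 1 <= _)%N; last by rewrite sum1_card card_ord.
  apply: leq_sum => u _; case: (ltnP (C u).-1 (C v)) => Hu.
    rewrite (bigD1 (Ordinal Hu)) //= big1 ?addn0; first by case: (_ == _).
    move=> k Hk; apply/eqP; rewrite eqb0; apply: contra Hk => /eqP Hk; apply/eqP; apply: val_inj => /=.
    by rewrite Hk.
  rewrite big1 // => k _; apply/eqP; rewrite eqb0; apply/eqP => Hk.
  by move: Hu; rewrite Hk /= leqNgt ltn_ord.
apply: cost_mono => v; rewrite ffunE; apply: leq_trans (_ : \sum_(k < C v) 1 <= _)%N.
  by apply: leq_sum => k _; apply: leq_b1.
by rewrite sum1_card card_ord.
Qed.

(** By [compress] it suffices to minimise over the finitely many colourings with colours at most the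
    number of vertices; distinct colours for all vertices show that there is one. *)
Lemma optimal_exists : exists C, optimal C /\ forall v, (C v <= nvert I)%N.
Proof.
pose P (f : {ffun 'I_(nvert I) -> 'I_(nvert I).+1}) :=
  [forall v, (0 < f v)%N] && [forall u, forall v, edge u v ==> (f u != f v)].
pose col (f : {ffun 'I_(nvert I) -> 'I_(nvert I).+1}) : coloring I := [ffun v => f v : nat].
have PP f : reflect (feasible (col f)) (P f).
  apply: (iffP andP) => [[/forallP H1 /forallP H2]|[H1 H2]]; split.
  - by move=> v; rewrite ffunE.
  - by move=> u v uv; rewrite !ffunE; have /forallP /(_ v) /implyP := H2 u; apply.
  - by apply/forallP => v; have := H1 v; rewrite ffunE.
  - by apply/forallP => u; apply/forallP => v; apply/implyP => uv; have := H2 u v uv; rewrite !ffunE.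
pose f0 := [ffun v : 'I_(nvert I) => lift ord0 v].
have Pf0 : P f0.
  apply/PP; split=> [v|u v uv]; rewrite !ffunE //=; apply/eqP => /= E.
  have {}E : u = v by apply: val_inj; move: E; rewrite /bump /= => -[].
  by move: uv; rewrite E (@edge_irr I).
have [f /PP Hf Hmin] := @arg_minP _ rat _ f0 P (fun f => cost (col f)) Pf0.
exists (col f); split; last by move=> v; rewrite ffunE -ltnS.
split=> // C HC; have [C' [HC' bC' le]] := compress HC; apply: le_trans le.
pose f' := [ffun v => inord (C' v) : 'I_(nvert I).+1].
have E : col f' = C' by apply/ffunP => v; rewrite !ffunE inordK // ltnS.
by rewrite -E; apply: Hmin; apply/PP; rewrite E.
Qed.
End Optimum.

(** * Positions of the data in an encoded instance *)

Lemma nth_flatten_block (T : Type) (x : T) d (ss : seq (seq T)) i j : (forall k, (k < size ss)%N -> size (nth [::] ss k) = d) ->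
  (i < size ss)%N -> (j < d)%N -> nth x (flatten ss) (i * d + j) = nth x (nth [::] ss i) j.
Proof.
elim: ss i => // s ss IH [|i] Hs Hi Hj /=; have s0 := Hs 0%N isT; rewrite /= in s0.
  by rewrite mul0n add0n nth_cat s0 Hj.
rewrite nth_cat s0 mulSn -addnA ltnNge leq_addr /= addKn; apply: IH => // k Hk.
exact: (Hs k.+1).
Qed.

Lemma size_flatten_block (T : Type) d (ss : seq (seq T)) : (forall k, (k < size ss)%N -> size (nth [::] ss k) = d) ->
  size (flatten ss) = (size ss * d)%N.
Proof.
elim: ss => // s ss IH Hs /=; rewrite size_cat (Hs 0%N isT) IH ?mulSn // => k Hk; exact: (Hs k.+1).
Qed.

Section Layout.
Variable I : instance.
Let n := nvert I.
Let m := size (groups I).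
Let V := enum 'I_n.
Let gn (g : {set 'I_n} * rat) : seq nat :=
  [seq nat_of_bool (v \in g.1) | v <- V] ++ [:: `|numq g.2|%N; `|denq g.2|%N].
Let L := instance_nats I.

Let LE : L = n :: [seq nat_of_bool (edge u v) | u <- V, v <- V] ++ m :: flatten [seq gn g | g <- groups I].
Proof. by []. Qed.
Let sV : size V = n. Proof. by rewrite size_enum_ord. Qed.
Let nthV (x : 'I_n) : nth x V x = x. Proof. by rewrite nth_ord_enum. Qed.

Let ss := [seq [seq nat_of_bool (edge u v) | v <- V] | u <- V].
Let ss_size k : (k < size ss)%N -> size (nth [::] ss k) = n.
Proof.
rewrite size_map => Hk; have x0 : 'I_n by move: Hk; rewrite sV => Hk; exact: Ordinal Hk.
by rewrite (nth_map x0) // size_map.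
Qed.
Let gg := [seq gn g | g <- groups I].
Let gg_size k : (k < size gg)%N -> size (nth [::] gg k) = n.+2.
Proof.
by rewrite size_map => Hk; rewrite (nth_map (set0, 0)) // size_cat size_map sV addn2.
Qed.
Let size_ss : size (flatten ss) = (n * n)%N.
Proof. by rewrite (size_flatten_block ss_size) size_map sV. Qed.

Lemma size_instance : size L = ((n * n).+2 + m * n.+2)%N.
Proof.
rewrite LE /= size_cat /= -[X in (X + _)%N]/(size (flatten ss)) size_ss.
by rewrite -[X in size (flatten X)]/gg (size_flatten_block gg_size) size_map addnS.
Qed.

Lemma nth_nvert : nth 0%N L 0 = n. Proof. by []. Qed.

Lemma nth_edge (i j : 'I_n) : nth 0%N L (i * n + j).+1 = edge i j.
Proof.
rewrite LE /= nth_cat -[size _]/(size (flatten ss)) size_ss.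
have Hij : (i * n + j < n * n)%N.
  apply: leq_trans (_ : i.+1 * n <= _)%N; last by rewrite leq_mul2r ltn_ord orbT.
  by rewrite mulSn addnC ltn_add2r.
rewrite Hij -[X in nth _ X]/(flatten ss) (nth_flatten_block _ ss_size); [|by rewrite size_map sV ltn_ord|exact: ltn_ord].
by rewrite (nth_map i) ?sV // (nth_map j) ?sV // nthV nthV.
Qed.

Lemma nth_ngroups : nth 0%N L (n * n).+1 = m.
Proof.
by rewrite LE /= nth_cat -[size _]/(size (flatten ss)) size_ss ltnn subnn.
Qed.

Let nth_gn g k : (g < m)%N -> (k < n.+2)%N -> nth 0%N L ((n * n).+2 + (g * n.+2 + k)) = nth 0%N (gn (nth (set0, 0) (groups I) g)) k.
Proof.
move=> Hg Hk; rewrite LE addSn /= nth_cat -[size _]/(size (flatten ss)) size_ss.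
rewrite addSn ltnNge (leqW (leq_addr _ _)) /= -addnS addKn /=.
by rewrite -[X in flatten X]/gg (nth_flatten_block _ gg_size) ?size_map // (nth_map (set0, 0)).
Qed.

Lemma nth_member g (i : 'I_n) : (g < m)%N ->
  nth 0%N L ((n * n).+2 + (g * n.+2 + i)) = (i \in (nth (set0, 0) (groups I) g).1).
Proof.
move=> Hg; rewrite nth_gn //; last by rewrite ltnS ltnW // ltnS ltnW.
by rewrite /gn nth_cat size_map sV ltn_ord (nth_map i) ?sV // nthV.
Qed.
Lemma nth_num g : (g < m)%N -> nth 0%N L ((n * n).+2 + (g * n.+2 + n)) = `|numq (nth (set0, 0%R) (groups I) g).2|%N.
Proof. by move=> Hg; rewrite nth_gn // /gn nth_cat size_map sV ltnn subnn. Qed.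
Lemma nth_den g : (g < m)%N -> nth 0%N L ((n * n).+2 + (g * n.+2 + n.+1)) = `|denq (nth (set0, 0%R) (groups I) g).2|%N.
Proof. by move=> Hg; rewrite nth_gn // /gn nth_cat size_map sV ltnNge leqnSn /= subSnn. Qed.
End Layout.


(** * The complete algorithm and its correctness *)

Section Decode.
Variable L : seq int.
(** [read_nats] delivers the numbers in reverse order, so positions are counted from the end. *)
Definition num i := nth 0 L (size L - i.+1).
(** Conversion from binary to unary by counting. The length of the list is a safe cap, since a valid
    input has more entries than vertices. *)
Definition in_n := nsum (size L) (fun k => (k%:Z < num 0)%R : nat).
Definition in_E := mkseq (fun i => mkseq (fun j => (0 < num (i * in_n + j).+1)%R) in_n) in_n.
Definition in_m := nsum (size L) (fun k => (k%:Z < num (in_n * in_n).+1)%R : nat).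
Definition in_gm :=
  mkseq (fun g => mkseq (fun i => (0 < num ((in_n * in_n).+2 + (g * in_n.+2 + i)))%R) in_n) in_m.
Definition in_num := mkseq (fun g => num ((in_n * in_n).+2 + (g * in_n.+2 + in_n))) in_m.
Definition in_den := mkseq (fun g => num ((in_n * in_n).+2 + (g * in_n.+2 + in_n.+1))) in_m.
Definition solution ee J :=
  mkseq (nth 0%N (solve in_n in_E in_m in_gm in_num in_den ee J)) in_n.
End Decode.
Definition algorithm ee J (w : seq letter) := write_nats (solution (read_nats w) ee J).

Lemma PT_num {A} {EA : Enc A} (L : A -> seq int) (i : A -> nat) : PT L -> PT i -> PT (fun x => num (L x) (i x)).
Proof. by move=> HL Hi; rewrite /num; pt. Qed.

Ltac pt_user ::= first [ lazymatch goal with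
  | |- PT (fun x => num _ _) => apply PT_num
  end | pt3 ].
Lemma PT_in_n {A} {EA : Enc A} (L : A -> seq int) : PT L -> PT (fun x => in_n (L x)).
Proof. by move=> HL; rewrite /in_n; pt. Qed.
Ltac pt_user ::= first [ lazymatch goal with
  | |- PT (fun x => num _ _) => apply PT_num
  | |- PT (fun x => in_n _) => apply PT_in_n
  end | pt3 ].
Lemma PT_in_m {A} {EA : Enc A} (L : A -> seq int) : PT L -> PT (fun x => in_m (L x)).
Proof. by move=> HL; rewrite /in_m; pt. Qed.
Lemma PT_in_E {A} {EA : Enc A} (L : A -> seq int) : PT L -> PT (fun x => in_E (L x)).
Proof. by move=> HL; rewrite /in_E; pt. Qed.
Ltac pt_user ::= first [ lazymatch goal with
  | |- PT (fun x => num _ _) => apply PT_num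
  | |- PT (fun x => in_n _) => apply PT_in_n
  | |- PT (fun x => in_m _) => apply PT_in_m
  end | pt3 ].
Lemma PT_in_gm {A} {EA : Enc A} (L : A -> seq int) : PT L -> PT (fun x => in_gm (L x)).
Proof. by move=> HL; rewrite /in_gm; pt. Qed.
Lemma PT_in_num {A} {EA : Enc A} (L : A -> seq int) : PT L -> PT (fun x => in_num (L x)).
Proof. by move=> HL; rewrite /in_num; pt. Qed.
Lemma PT_in_den {A} {EA : Enc A} (L : A -> seq int) : PT L -> PT (fun x => in_den (L x)).
Proof. by move=> HL; rewrite /in_den; pt. Qed.

Lemma PT_solution ee J : PT (fun L => solution L ee J).
Proof.
have I := @PT_id (seq int) _.
rewrite /solution; apply (PT_mkseq (f := fun L i => nth 0%N (solve (in_n L) (in_E L) (in_m L) (in_gm L) (in_num L) (in_den L) ee J) i)).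
  exact: PT_in_n.
apply: PT_nth; last by pt.
by apply: PT_solve; [apply: PT_in_n|apply: PT_in_E|apply: PT_in_m|apply: PT_in_gm|apply: PT_in_num|apply: PT_in_den]; pt.
Qed.

Lemma PT_algorithm ee J : PT (algorithm ee J).
Proof. exact: (PT_write_nats (PT_comp (PT_solution ee J) PT_read_nats)). Qed.

Section Correct.
Variable I : instance.
Let n := nvert I.
Let m := size (groups I).
Let L := rev [seq Posz k | k <- instance_nats I].

Let sL : size L = ((n * n).+2 + m * n.+2)%N.
Proof. by rewrite size_rev size_map size_instance. Qed.

Let numE i : (i < (n * n).+2 + m * n.+2)%N -> num L i = Posz (nth 0%N (instance_nats I) i).
Proof.
move=> Hi; have Hs : size [seq Posz k | k <- instance_nats I] = ((n * n).+2 + m * n.+2)%N by rewrite -sL size_rev.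
rewrite /num /L nth_rev ?size_rev Hs; last by lia.
rewrite (_ : _ - _.+1 = i)%N; last by lia.
by rewrite (nth_map 0%N) // size_instance.
Qed.

Let count_below (k N : nat) : (k <= N)%N -> nsum N (fun t => (t%:Z < k%:Z)%R : nat) = k.
Proof.
move=> kN; have [] := @nsum_prefix N (fun t => (t%:Z < k%:Z)%R) _; first by move=> t; lia.
set l := nsum _ _ => H1 H2 H3; apply/eqP; rewrite eqn_leq; apply/andP; split.
  by case El: l H2 => [|l'] // /(_ l' (ltnSn l')).
by case: (ltnP l N) => [/H3|H]; [rewrite -leNgt | apply: leq_trans H].
Qed.

Let Hn : in_n L = n.
Proof.
rewrite /in_n numE // nth_nvert; apply: count_below; rewrite sL.
by have nn k : (k <= k * k)%N by [case: k => // k; rewrite leq_pmulr]; have := nn n; lia.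
Qed.

Let Hm : in_m L = m.
Proof.
rewrite /in_m Hn numE; last by lia.
by rewrite nth_ngroups; apply: count_below; rewrite sL; nia.
Qed.

Let in_range g k : (g < m)%N -> (k < n.+2)%N -> ((n * n).+2 + (g * n.+2 + k) < (n * n).+2 + m * n.+2)%N.
Proof.
move=> Hg Hk; rewrite ltn_add2l; apply: leq_trans (_ : g.+1 * n.+2 <= _)%N; last by rewrite leq_mul2r Hg orbT.
by rewrite mulSn addnC ltn_add2r.
Qed.

Let group g := nth (set0, 0) (groups I) g.

Let adjE (i j : 'I_n) : has_edge (in_E L) i j = edge i j.
Proof.
rewrite /has_edge /in_E Hn nth_mkseq // nth_mkseq // numE; last first.
  apply: leq_trans (_ : (n * n).+1 <= _)%N; last by lia.
  rewrite ltnS; apply: leq_trans (_ : i.+1 * n <= _)%N; last by rewrite leq_mul2r ltn_ord orbT.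
  by rewrite mulSn addnC ltn_add2r.
by rewrite nth_edge; case: (edge i j).
Qed.

Let ginE g (i : 'I_n) : (g < m)%N -> gin (in_gm L) g i = (i \in (group g).1).
Proof.
move=> Hg; rewrite /gin /in_gm Hn Hm nth_mkseq // nth_mkseq // numE.
  by rewrite nth_member //; case: (_ \in _).
by apply: in_range => //; rewrite ltnS ltnW // ltnS ltnW.
Qed.

Let group_wf g : (g < m)%N -> (group g).1 != set0 /\ 0 < (group g).2.
Proof. by move=> Hg; have /all_nthP /(_ g Hg) /andP := groups_wf I => /(_ (set0, 0)). Qed.

Let numE' g : (g < m)%N -> nth 0 (in_num L) g = numq (group g).2.
Proof.
move=> Hg; have [_ g0] := group_wf Hg; rewrite /in_num Hn Hm nth_mkseq // numE; last exact: in_range.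
by rewrite nth_num // gez0_abs // ltW // numq_gt0.
Qed.
Let denE' g : (g < m)%N -> nth 0 (in_den L) g = denq (group g).2.
Proof.
move=> Hg; rewrite /in_den Hn Hm nth_mkseq // numE; last exact: in_range.
by rewrite nth_den // gez0_abs // ltW // denq_gt0.
Qed.

Variables ee J : nat.
Hypotheses (ee_gt0 : (0 < ee)%N) (J_gt0 : (0 < J)%N).
Hypothesis perf : perfect (graph I).

Let col := solution L ee J.
Definition output_coloring : coloring I := [ffun v : 'I_(nvert I) => nth 0%N col v].

Let gE : good (@edge I). Proof. exact: (perfect_good perf). Qed.
Let gne g : (g < m)%N -> exists i : 'I_n, gin (in_gm L) g i.
Proof. by move=> Hg; have [/set0Pn [i Hi] _] := group_wf Hg; exists i; rewrite ginE. Qed.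
Let ab0 g : (g < m)%N -> 0 < nth 0 (in_num L) g /\ 0 < nth 0 (in_den L) g.
Proof.
by move=> Hg; have [_ g0] := group_wf Hg; rewrite numE' // denE' // numq_gt0 denq_gt0.
Qed.
Let sol := solve n (in_E L) m (in_gm L) (in_num L) (in_den L) ee J.
Let colE (v : 'I_n) : nth 0%N col v = nth 0%N sol v.
Proof. by rewrite /col /solution Hn Hm nth_mkseq. Qed.

Lemma output_feasible : feasible output_coloring.
Proof.
have [H1 H2] := solve_proper m (in_gm L) (in_num L) (in_den L) ee adjE (@edge_sym I) (@edge_irr I) gE J_gt0.
split=> [v|u v uv]; rewrite !ffunE !colE; last exact: H2.
by have /andP [] := H1 v.
Qed.

Let costE (C : coloring I) : cost C = \sum_(g < m) ((nth 0 (in_num L) g)%:~R / (nth 0 (in_den L) g)%:~R) * (\max_(i < n | gin (in_gm L) g i) C i)%:R.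
Proof.
rewrite /cost (big_nth (set0, 0)) big_mkord; apply: eq_bigr => g _.
rewrite numE' // denE' // divq_num_den; congr (_ * _%:R).
by apply: eq_bigl => i; rewrite ginE.
Qed.

Lemma output_cost (C : coloring I) : feasible C -> (forall v, (C v <= n)%N) ->
  cost output_coloring <= 2%:R * (1 + ee%:R^-1) ^+ 3 * (1 + J%:R^-1) ^+ J.+1 * cost C.
Proof.
move=> [C0 Ce] Cn; rewrite !costE.
have cb v : (0 < C v <= n)%N by rewrite C0 Cn.
have := solve_bound adjE (@edge_sym I) (@edge_irr I) gE J_gt0 ee_gt0 gne ab0 cb Ce.
rewrite -/sol; apply: le_trans; rewrite le_eqVlt; apply/orP; left; apply/eqP.
apply: eq_bigr => g _; congr (_ * _%:R); apply: eq_bigr => i _; by rewrite ffunE colE.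
Qed.

Lemma algorithmE : algorithm ee J (encode_instance I) = encode_coloring output_coloring.
Proof.
rewrite /algorithm write_natsE /encode_instance read_nats_encode -/L -/col /encode_coloring; congr encode_nats.
rewrite /col /solution Hn; apply: (@eq_from_nth _ 0%N); first by rewrite size_mkseq size_map -cardE card_ord.
move=> i; rewrite size_mkseq => Hi.
rewrite nth_mkseq // (nth_map (Ordinal Hi)) -?cardE ?card_ord // ffunE /col /solution Hn.
by rewrite (nth_ord_enum (Ordinal Hi) (Ordinal Hi)) nth_mkseq.
Qed.
End Correct.

Lemma cost_ge0 (I : instance) (C : coloring I) : 0 <= cost C.
Proof.
rewrite /cost; have := groups_wf I; elim: (groups I) => [|g s IH] /=; first by rewrite big_nil.
by move=> /andP [/andP [_ g0] /IH {}IH]; rewrite big_cons addr_ge0 // mulr_ge0 // ltW.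
Qed.

Theorem theorem21 :
  exists M : machine letter,
    approximation_algorithm (fun I => perfect (graph I)) 5.437%Q M.
Proof.
have [J [ee [J0 ee0 ratio]]] := approximation_ratio.
have [M [p Hp]] := PT_machine (PT_algorithm ee J).
(* The comparison colouring must use colours at most the number of vertices, as [output_cost]
   demands. *)
exists M, p => I perf; have [C [Copt Cn]] := optimal_exists I.
exists (output_coloring I ee J), C; split.
- by rewrite -algorithmE; exact: Hp.
- exact: output_feasible.
- exact: Copt.
have [Cf _] := Copt.
have -> : 5.437%Q = 5437%:R / 1000%:R by vm_compute.
apply: le_trans (output_cost ee0 J0 perf Cf Cn) _; apply: ler_wpM2r; last exact: ratio.
exact: cost_ge0.
Qed.
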